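(* Let $\Omega=(a,b)$ be a finite interval, $0<\alpha<1$ and $1<p<\infty$. Suppose that $\alpha p>1$. Then ${}^{\pm}\overline{W}_0^{\alpha,p}(\Omega)={}^{\pm}W_0^{\alpha,p}(\Omega)$ (for each choice of sign) and $\overline{W}_0^{\alpha,p}(\Omega)=W_0^{\alpha,p}(\Omega)$.
   Context: Fractional integrals on $(a,b)$, for $\sigma>0$: ${}^{-}I^{\sigma}f(x)=\frac{1}{\Gamma(\sigma)}\int_a^x\frac{f(y)}{(x-y)^{1-\sigma}}\,dy$ and ${}^{+}I^{\sigma}f(x)=\frac{1}{\Gamma(\sigma)}\int_x^b\frac{f(y)}{(y-x)^{1-\sigma}}\,dy$. For $0<\alpha<1$: ${}^{-}D^{\alpha}\varphi=\frac{d}{dx}\,{}^{-}I^{1-\alpha}\varphi$ and ${}^{+}D^{\alpha}\varphi=-\frac{d}{dx}\,{}^{+}I^{1-\alpha}\varphi$. Weak fractional derivatives ($0<\alpha<1$): for $u\in L^1(\Omega)$, $v\in L^1_{loc}(\Omega)$ is the left (resp. right) weak fractional derivative of $u$, written ${}^{-}\mathcal{D}^{\alpha}u=v$ (resp. ${}^{+}\mathcal{D}^{\alpha}u=v$), if $\int_\Omega v\varphi\,dx=\int_\Omega u\,{}^{+}D^{\alpha}\varphi\,dx$ (resp. with ${}^{-}D^{\alpha}\varphi$ on the right-hand side) for all $\varphi\in C_0^\infty(\Omega)$. ${}^{\pm}W^{\alpha,p}(\Omega)=\{u\in L^p(\Omega):{}^{\pm}\mathcal{D}^{\alpha}u\in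 L^p(\Omega)\}$ with norm $\big(\|u\|_{L^p}^p+\|{}^{\pm}\mathcal{D}^{\alpha}u\|_{L^p}^p\big)^{1/p}$. The symmetric space is $W^{\alpha,p}(\Omega)={}^{-}W^{\alpha,p}(\Omega)\cap{}^{+}W^{\alpha,p}(\Omega)$ with norm $\big(\|u\|_{{}^{-}W^{\alpha,p}}^p+\|u\|_{{}^{+}W^{\alpha,p}}^p\big)^{1/p}$. Traces: when $\alpha p>1$, every $u\in{}^{-}W^{\alpha,p}(\Omega)$ has a representative continuous on $[c,b]$ for every $c\in(a,b)$, and every $u\in{}^{+}W^{\alpha,p}(\Omega)$ has a representative continuous on $[a,c]$ for every $c\in(a,b)$; using these representatives, ${}^{-}Tu:=u(b)$ and ${}^{+}Tu:=u(a)$. Zero trace spaces: ${}^{\pm}W_0^{\alpha,p}(\Omega)=\{u\in{}^{\pm}W^{\alpha,p}(\Omega):{}^{\pm}Tu=0\}$ and $W_0^{\alpha,p}(\Omega)=\{u\in W^{\alpha,p}(\Omega):{}^{-}Tu=0\text{ and }{}^{+}Tu=0\}$. One-side supported smooth functions: ${}^{-}C_0^\infty(\Omega)=\{\varphi\in C^\infty(\Omega):\exists c\in(a,b),\ \varphi(x)=0\ \forall x>c\}$ and ${}^{+}C_0^\infty(\Omega)=\{\varphi\in C^\infty(\Omega):\exists c\in(a,b),\ \varphi(x)=0\ \forall x<c\}$. ${}^{\pm}\overline{W}_0^{\alpha,p}(\Omega)$ is the completion of ${}^{\pm}C_0^\infty(\Omega)$ (that is, of its elements with finite norm) in the norm of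 ${}^{\pm}W^{\alpha,p}(\Omega)$, and $\overline{W}_0^{\alpha,p}(\Omega)$ is the completion of $C_0^\infty(\Omega)$ in the norm of $W^{\alpha,p}(\Omega)$. *)

(* Defs.v *)
From HB Require Import structures.
From mathcomp Require Import all_boot all_order all_algebra.
From mathcomp Require Import all_classical all_reals all_analysis.

Set Implicit Arguments.
Unset Strict Implicit.
Unset Printing Implicit Defensive.
Import Order.TTheory GRing.Theory Num.Theory.
Import numFieldNormedType.Exports.
Local Open Scope classical_set_scope.
Local Open Scope ring_scope.

(* A function on the interval Omega = ]a, b[ is represented by a total function
   R -> R whose values outside Omega are irrelevant: every notion below depends
   only on the values on Omega.  Elements of L^p(Omega) are not quotiented by
   almost everywhere equality; instead, a Borel function that agrees almost
   everywhere on Omega with a member of one of the W spaces is a member too. *)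

(* Fminus is the left operator, written with a superscript - on the left,
   based on the integral from a; Fplus is the right one, based on b. *)
Inductive side := Fminus | Fplus.

Definition opp_side (s : side) : side :=
  match s with Fminus => Fplus | Fplus => Fminus end.

Definition Gamma (R : realType) (s : R) : R :=
  \int[lebesgue_measure]_(t in `]0%R, +oo[) (t `^ (s - 1) * expR (- t)).

Definition fracI (R : realType) (a b : R) (s : side) (sigma : R) (f : R -> R)
    (x : R) : R :=
  match s with
  | Fminus => (Gamma sigma)^-1 *
      \int[lebesgue_measure]_(y in `]a, x[) (f y / (x - y) `^ (1 - sigma))
  | Fplus => (Gamma sigma)^-1 *
      \int[lebesgue_measure]_(y in `]x, b[) (f y / (y - x) `^ (1 - sigma))
  end.

Definition fracD (R : realType) (a b : R) (s : side) (alpha : R) (f : R -> R)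
    (x : R) : R :=
  match s with
  | Fminus => derive1 (fracI a b Fminus (1 - alpha) f) x
  | Fplus => - derive1 (fracI a b Fplus (1 - alpha) f) x
  end.

Definition smooth_on (R : realType) (D : set R) (f : R -> R) : Prop :=
  forall (n : nat) (x : R), D x -> derivable (derive1n n f) x 1.

Definition Cc_smooth (R : realType) (a b : R) : set (R -> R) :=
  [set phi | smooth_on `]a, b[ phi /\
    exists K : set R, [/\ compact K, K `<=` `]a, b[ &
      forall x, x \in `]a, b[ -> ~ K x -> phi x = 0]].

Definition Cc_smooth_side (R : realType) (a b : R) (s : side) : set (R -> R) :=
  [set phi | smooth_on `]a, b[ phi /\
    exists2 c, c \in `]a, b[ &
      forall x, x \in `]a, b[ ->
        match s with Fminus => c < x | Fplus => x < c end -> phi x = 0].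

Definition LpOmega (R : realType) (a b p : R) : set (R -> R) :=
  [set u | u \_ `]a, b[ \in Lfun (@lebesgue_measure R) p%:E].

Definition LpNorm (R : realType) (a b p : R) (u : R -> R) : \bar R :=
  Lnorm (@lebesgue_measure R) p%:E (EFin \o (u \_ `]a, b[)).

Definition is_weak_fracD (R : realType) (a b : R) (s : side) (alpha : R)
    (u v : R -> R) : Prop :=
  [/\ (@lebesgue_measure R).-integrable `]a, b[ (EFin \o u),
      locally_integrable `]a, b[ v &
      forall phi, Cc_smooth a b phi ->
        \int[lebesgue_measure]_(x in `]a, b[) (v x * phi x) =
        \int[lebesgue_measure]_(x in `]a, b[)
          (u x * fracD a b (opp_side s) alpha phi x)].

(* A representative of the weak derivative, which is unique up to almost
   everywhere equality; the value is meaningless when there is none. *)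
Definition weak_fracD (R : realType) (a b : R) (s : side) (alpha : R)
    (u : R -> R) : R -> R :=
  xget (fun=> 0) [set v | is_weak_fracD a b s alpha u v].

Definition Wside (R : realType) (a b : R) (s : side) (alpha p : R) :
    set (R -> R) :=
  [set u | LpOmega a b p u /\
    exists2 v, is_weak_fracD a b s alpha u v & LpOmega a b p v].

Definition WsideNorm (R : realType) (a b : R) (s : side) (alpha p : R)
    (u : R -> R) : \bar R :=
  ((LpNorm a b p u `^ p + LpNorm a b p (weak_fracD a b s alpha u) `^ p)
    `^ p^-1)%E.

Definition Wsym (R : realType) (a b : R) (alpha p : R) : set (R -> R) :=
  Wside a b Fminus alpha p `&` Wside a b Fplus alpha p.

Definition WsymNorm (R : realType) (a b : R) (alpha p : R) (u : R -> R) :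
    \bar R :=
  ((WsideNorm a b Fminus alpha p u `^ p + WsideNorm a b Fplus alpha p u `^ p)
    `^ p^-1)%E.

(* The left trace is the value at b of the continuous representative, the
   right trace its value at a. *)
Definition has_trace (R : realType) (a b : R) (s : side) (u : R -> R) (t : R) :
    Prop :=
  exists2 v : R -> R, v = u %[ae (@lebesgue_measure R) in `]a, b[%classic] &
    match s with
    | Fminus => (forall c, c \in `]a, b[ -> {within `[c, b], continuous v}) /\
                v b = t
    | Fplus => (forall c, c \in `]a, b[ -> {within `[a, c], continuous v}) /\
               v a = t
    end.

Definition Wside0 (R : realType) (a b : R) (s : side) (alpha p : R) :
    set (R -> R) :=
  [set u | Wside a b s alpha p u /\ has_trace a b s u 0].

Definition Wsym0 (R : realType) (a b : R) (alpha p : R) : set (R -> R) :=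
  [set u | [/\ Wsym a b alpha p u, has_trace a b Fminus u 0 &
               has_trace a b Fplus u 0]].

(* V is the completion of A in the norm N: V contains A, A is N-dense in V,
   and V is N-complete. *)
Definition is_completion (R : realType) (N : (R -> R) -> \bar R)
    (A V : set (R -> R)) : Prop :=
  [/\ A `<=` V,
      forall u, V u -> exists2 phi : nat -> R -> R, (forall n, A (phi n)) &
        N (phi n \- u) @[n --> \oo] --> 0%E &
      forall w : nat -> R -> R, (forall n, V (w n)) ->
        (forall e : R, 0 < e -> exists n0 : nat, forall m n : nat,
          (n0 <= m)%N -> (n0 <= n)%N -> (N (w m \- w n)%R < e%:E)%E) ->
        exists2 u, V u & N (w n \- u) @[n --> \oo] --> 0%E].

(* Main.v *)
(* Write O = ]a, b[ and let J v be the left fractional integral of order alpha of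
   v. Abel's equation shows that v is the left weak derivative of u if and only
   if u = C (x - a)^(alpha - 1) + J v almost everywhere. Since alpha p > 1, J v is
   continuous with sup |J v| controlled by |v|_p, so the left trace is the value
   of this representation at b. The trace condition passes to L^p limits, which
   gives completeness, and right-sided statements follow by reflection.

   One-sided density: the condition u(b) = 0 allows v to be approximated by test
   functions whose representation still vanishes at b; a cutoff near b then
   perturbs u by the potential of a small function.

   Two-sided density: zero traces at both ends force C = 0, so u = J v on O. Let
   U be u extended by 0. Beyond b, the left derivative of U is the integral of u
   against the kernel (x - y)^(-1-alpha). It lies in L^p: bounding |u| by the
   right fractional integral of its right derivative w and integrating out y
   leaves the Hilbert-type kernel 1 / (x - z) against |w|, which is bounded on
   L^p for p > 1. Thus U = J V beyond b with V in L^p, and mollifying U after a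
   slight dilation about the midpoint gives test functions in O whose left
   derivatives are the mollified V, up to a power of the dilation factor. The
   same holds on the right by reflection, for the same test functions. *)
Require Import Defs.
From HB Require Import structures.
From mathcomp Require Import all_boot all_order all_algebra.
From mathcomp Require Import ring lra.
From mathcomp Require Import all_classical all_reals all_analysis measurable_realfun.
Import Order.TTheory GRing.Theory Num.Theory.
Import numFieldNormedType.Exports.
Local Open Scope classical_set_scope.
Local Open Scope ring_scope.
Set Implicit Arguments.
Unset Strict Implicit.
Unset Printing Implicit Defensive.

(** * Affine changes of variable, Fubini and convolution *)

(** The obstacle in the symmetric space is that one sequence must approximate both derivatives. The
    one-sided method approximates $v$ and reads the function off its representation, which gives no
    control of the right derivative; mollification treats both sides alike, provided the extension
    by zero keeps its derivative in $L^p$. Hölder continuity of $u$ with exponent $\alpha-1/p$ would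
    bound that derivative beyond $b$ only by $(x-b)^{-1/p}$, which just misses $L^p$; this is why
    the right derivative has to enter the estimate.

    The condition $\alpha p>1$ says that the kernel $t^{\alpha-1}$ lies in $L^{p/(p-1)}$ near 0.
    Norms are handled through their $p$-th powers: the triangle inequality becomes a factor $2^p$,
    and Hölder's inequality becomes Young's with a free parameter. Fractional integrals are
    convolutions on the whole line with truncated kernels, applied to functions set to zero outside
    the interval; at a point $x$ such a convolution sees only what lies before $x$. *)

Definition L1 (R : realType) (f : R -> R) : Prop :=
  (@lebesgue_measure R).-integrable setT (EFin \o f).

Definition conv (R : realType) (f g : R -> R) (x : R) : R :=
  \int[lebesgue_measure]_y (f y * g (x - y)).

Section affine.
Context {R : realType}.
Notation mu := (@lebesgue_measure R).

Lemma measurable_affine (c d : R) : measurable_fun setT (fun x : R => c * x + d).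
Proof.
by apply: measurable_funD => //; exact: measurable_funM.
Qed.

Definition affine_pushforward (c d : R) :
    {measure set (measurableTypeR R) -> \bar R} :=
  @measure_function_pushforward__canonical__measure_function_Measure _ _
    (measurableTypeR R) (measurableTypeR R) R mu _ (measurable_affine c d).

(** By uniqueness of Lebesgue measure it is enough to compare half-open intervals. A negative [c]
    turns []s, t]] into an interval closed on the left, hence two cases. *)
Lemma lebesgue_measure_affine (c d : R) (A : set R) : c != 0 -> measurable A ->
  mscale (NngNum (normr_ge0 c)) (affine_pushforward c d) A = mu A.
Proof.
move=> c0 mA.
apply/esym/lebesgue_measure_unique => //= _ [[s t]] _ <-.
rewrite /mscale /= /pushforward /=.
have [c_gt0|c_lt0|/esym/eqP] := ltgtP 0 c; last by rewrite (negbTE c0).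
  have -> : (fun x : R => c * x + d) @^-1` `]s, t] = `](s - d) / c, (t - d) / c]%classic.
    apply/seteqP; split => x /=; rewrite !in_itv/= => /andP[h1 h2]; apply/andP; split.
    - by rewrite ltr_pdivrMr// mulrC ltrBlDr.
    - by rewrite ler_pdivlMr// mulrC lerBrDr.
    - by move: h1; rewrite ltr_pdivrMr// mulrC ltrBlDr.
    - by move: h2; rewrite ler_pdivlMr// mulrC lerBrDr.
  rewrite !lebesgue_measure_itv/= !lte_fin ltr_pM2r ?invr_gt0// ltrD2r.
  case: ifP => st; last by rewrite mule0.
  rewrite -!EFinD -EFinM; congr (_%:E).
  by rewrite gtr0_norm//; field; rewrite gt_eqF.
have -> : (fun x : R => c * x + d) @^-1` `]s, t] = `[(t - d) / c, (s - d) / c[%classic.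
  apply/seteqP; split => x /=; rewrite !in_itv/= => /andP[h1 h2]; apply/andP; split.
  - by rewrite ler_ndivrMr// mulrC lerBrDr.
  - by rewrite ltr_ndivlMr// mulrC ltrBlDr.
  - by move: h2; rewrite ltr_ndivlMr// mulrC ltrBlDr.
  - by move: h1; rewrite ler_ndivrMr// mulrC lerBrDr.
rewrite !lebesgue_measure_itv/= !lte_fin ltr_nM2r ?invr_lt0// ltrD2r.
case: ifP => st; last by rewrite mule0.
rewrite -!EFinD -EFinM; congr (_%:E).
by rewrite ltr0_norm//; field; rewrite lt_eqF.
Qed.

Lemma ge0_integral_affine (f : R -> \bar R) (c d : R) : c != 0 ->
  measurable_fun [set: R] f -> (forall x, (0 <= f x)%E) ->
  (\int[mu]_x f (c * x + d)%R = (`|c|^-1)%:E * \int[mu]_x f x)%E.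
Proof.
move=> c0 mf f0.
transitivity ((`|c|^-1)%:E * \int[mscale (NngNum (normr_ge0 c)) (affine_pushforward c d)]_x f x)%E; last first.
  congr (_ * _)%E.
  apply: eq_measure_integral => A mA _.
  exact: (@lebesgue_measure_affine c d A c0 mA).
rewrite ge0_integral_mscale//=.
rewrite ge0_integral_pushforward//=.
rewrite preimage_setT muleA -EFinM mulVf ?mul1e//.
by rewrite normr_eq0.
exact: measurable_affine.
Qed.

Lemma L1_affine (f : R -> R) (c d : R) : c != 0 -> L1 f -> L1 (fun x => f (c * x + d)).
Proof.
move=> c0 /integrableP[mf foo].
have mf' : measurable_fun setT f by exact/measurable_EFinP.
apply/integrableP; split.
  by apply/measurable_EFinP; apply: (measurableT_comp mf'); exact: measurable_affine.
rewrite /= (@ge0_integral_affine (fun x => `|(f x)%:E|%E))//; last first.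
  by apply/measurableT_comp => //; exact/measurable_EFinP.
by rewrite lte_mul_pinfty// lee_fin invr_ge0.
Qed.

(** Positive and negative parts scale separately; when one of them has infinite integral, [fine]
    sends both sides to 0. *)
Lemma Rintegral_affine (f : R -> R) (c d : R) : c != 0 ->
  measurable_fun [set: R] f ->
  \int[mu]_x f (c * x + d) = `|c|^-1 * \int[mu]_x f x.
Proof.
move=> c0 /measurable_EFinP mf.
rewrite /Rintegral integralE [X in _ = _ * fine X]integralE.
have := @ge0_integral_affine (EFin \o f)^\+%E c d c0 (measurable_funepos mf) (@funepos_ge0 _ _ _).
have := @ge0_integral_affine (EFin \o f)^\-%E c d c0 (measurable_funeneg mf) (@funeneg_ge0 _ _ _).
have -> : (\int[mu]_x (fun x : R => (f (c * x + d))%:E)^\+ x)%E =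
  (\int[mu]_x (EFin \o f)^\+ (c * x + d)%R)%E.
  by apply: eq_integral => x _; rewrite !funeposE.
have -> : (\int[mu]_x (fun x : R => (f (c * x + d))%:E)^\- x)%E =
  (\int[mu]_x (EFin \o f)^\- (c * x + d)%R)%E.
  by apply: eq_integral => x _; rewrite !funenegE.
move=> -> ->; rewrite /comp.
have : (0 <= \int[mu]_x (fun x => (f x)%:E)^\+ x)%E by exact: integral_ge0.
have : (0 <= \int[mu]_x (fun x => (f x)%:E)^\- x)%E by exact: integral_ge0.
have k0 : (0 < (`|c|^-1)%:E)%E by rewrite lte_fin invr_gt0 normr_gt0.
case: (\int[mu]_x _)%E => [s||] // s0; case: (\int[mu]_x _)%E => [r||] // r0 /=.
- by rewrite mulrBr.
- by rewrite gt0_muley//= mulr0.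
- by rewrite gt0_muley//= mulr0.
- by rewrite gt0_muley//= mulr0.
Qed.

End affine.

Section L1.
Context {R : realType}.
Notation mu := (@lebesgue_measure R).
Notation RR := (measurableTypeR R * measurableTypeR R)%type.
Implicit Types f g h : R -> R.

Lemma aeS (P Q : R -> Prop) : (forall x, P x -> Q x) ->
  {ae mu, forall x, P x} -> {ae mu, forall x, Q x}.
Proof. by move=> PQ; apply: (@filterS _ _ (ae_filter_ringOfSetsType mu)). Qed.

Lemma aeS2 (P Q S : R -> Prop) : (forall x, P x -> Q x -> S x) ->
  {ae mu, forall x, P x} -> {ae mu, forall x, Q x} -> {ae mu, forall x, S x}.
Proof. by move=> PQ; apply: (@filterS2 _ _ (ae_filter_ringOfSetsType mu)). Qed.

Lemma L1_measurable f : L1 f -> measurable_fun setT f.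
Proof. by move=> /integrableP[/measurable_EFinP]. Qed.

Lemma L1_lty f : L1 f -> (\int[mu]_x `|f x|%:E < +oo)%E.
Proof. by move=> /integrableP[]. Qed.

Lemma L1_le f g : measurable_fun setT f -> (forall x, `|f x| <= g x) -> L1 g -> L1 f.
Proof.
move=> mf fg; apply: le_integrable => //; first exact/measurable_EFinP.
by move=> x _; rewrite lee_fin (le_trans (fg x))// ler_norm.
Qed.

Lemma L1D f g : L1 f -> L1 g -> L1 (fun x => f x + g x).
Proof. by move=> lf lg; exact: (integrableD measurableT lf lg). Qed.

Lemma L1B f g : L1 f -> L1 g -> L1 (fun x => f x - g x).
Proof. by move=> lf lg; exact: (integrableB measurableT lf lg). Qed.

Lemma L1Zl k f : L1 f -> L1 (fun x => k * f x).
Proof. by move=> lf; exact: (integrableZl measurableT k lf). Qed.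

Lemma L1_abs f : L1 f -> L1 (fun x => `|f x|).
Proof. exact: integrable_norm. Qed.

Lemma L1_mul f h C : L1 f -> measurable_fun setT h -> (forall x, `|h x| <= C) ->
  L1 (fun x => f x * h x).
Proof.
move=> lf mh hC; apply: (@L1_le _ (fun x => C * `|f x|)).
- by apply: measurable_funM => //; exact: L1_measurable.
- by move=> x; rewrite normrM mulrC ler_wpM2r.
- exact/L1Zl/L1_abs.
Qed.

Lemma L1_restrict (D : set R) f : measurable D ->
  mu.-integrable D (EFin \o f) <-> L1 (f \_ D).
Proof. by move=> mD; have := @integrable_mkcond _ _ _ mu D (EFin \o f) mD; rewrite restrict_EFin. Qed.

Lemma L1_patch (D : set R) f : measurable D -> L1 f -> L1 (f \_ D).
Proof.
by move=> mD lf; apply: (L1_restrict f mD).1; exact: (@integrableS _ _ _ mu setT D (EFin \o f) measurableT mD (@subsetT _ _) lf).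
Qed.

Lemma L1_bounded f (c d C : R) : measurable_fun setT f ->
  (forall x, `|f x| <= C) -> (forall x, ~ (c <= x <= d) -> f x = 0) -> L1 f.
Proof.
move=> mf fC f0; apply: (@L1_le _ (fun x => C * \1_(`[c, d]%classic) x)) => //.
  move=> x; rewrite indicE; case: (boolP (x \in _)) => xcd; first by rewrite mulr1.
  rewrite mulr0 f0 ?normr0// => h; move/negP: xcd; apply.
  by rewrite inE /= in_itv.
apply: L1Zl; exact: integrable_indic_itv.
Qed.

Lemma L1_fubini (F : RR -> R) :
  (mu \x mu)%E.-integrable setT (EFin \o F) ->
  L1 (fun x => \int[mu]_y F (x, y)).
Proof.
move=> iF; have := integrable_fubini_F iF; rewrite /fubini_F => iG.
apply/integrableP; split.
  apply/measurable_EFinP.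
  exact: (measurableT_comp (fine_measurable measurableT) (measurable_int _ iG)).
apply: (@le_lt_trans _ _ (\int[mu]_x `| \int[mu]_y (F (x, y))%:E |)%E); last first.
  by move/integrableP : iG => [].
apply: ge0_le_integral => //.
- apply: measurableT_comp => //; apply/measurable_EFinP.
  exact: (measurableT_comp (fine_measurable measurableT) (measurable_int _ iG)).
- by apply: measurableT_comp => //; exact: measurable_int iG.
- have E (z : \bar R) : (`|fine z|%:E <= `|z|)%E by case: z => [r||] //=; rewrite leey.
  by move=> x _; exact: E.
Qed.

Lemma ae_eq_Rintegral f g : measurable_fun setT f -> measurable_fun setT g ->
  {ae mu, forall x, f x = g x} -> \int[mu]_x f x = \int[mu]_x g x.
Proof.
move=> mf mg fg; rewrite /Rintegral; congr fine; apply: ae_eq_integral => //.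
- exact/measurable_EFinP.
- exact/measurable_EFinP.
- by apply: (aeS _ fg) => x /= -> _.
Qed.

Lemma integral2_le (F G : RR -> R) : measurable_fun setT F ->
  (forall z, `|F z| <= G z) ->
  (mu \x mu)%E.-integrable setT (EFin \o G) ->
  (mu \x mu)%E.-integrable setT (EFin \o F).
Proof.
move=> mF FG; apply: le_integrable => //; first exact/measurable_EFinP.
by move=> z _; rewrite lee_fin (le_trans (FG z))// ler_norm.
Qed.

Lemma integral2_swap (F : RR -> R) :
  (mu \x mu)%E.-integrable setT (EFin \o F) ->
  (mu \x mu)%E.-integrable setT (EFin \o (fun z => F (z.2, z.1))).
Proof.
move=> iF; have mF : measurable_fun setT F by apply/measurable_EFinP; exact: measurable_int iF.
have mF' : measurable_fun setT (fun z : RR => F (z.2, z.1)).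
  apply: (measurableT_comp mF).
  by apply/measurable_fun_pairP; split; [exact: measurable_snd|exact: measurable_fst].
apply/integrable12ltyP; first exact/measurable_EFinP.
by move/integrable21ltyP : iF; apply; exact/measurable_EFinP.
Qed.

(** The real-valued inner integral agrees with the extended one wherever the section is integrable,
    that is, almost everywhere; this is enough to transfer Fubini's theorem. *)
Lemma Rfubini (F : RR -> R) :
  (mu \x mu)%E.-integrable setT (EFin \o F) ->
  \int[mu]_x \int[mu]_y F (x, y) = \int[mu]_y \int[mu]_x F (x, y).
Proof.
move=> iF; rewrite {1 3}/Rintegral.
have E1 : (\int[mu]_x (\int[mu]_y F (x, y))%:E = \int[mu]_x \int[mu]_y (F (x, y))%:E)%E.
  apply: ae_eq_integral => //.
  - by apply/measurable_EFinP; exact: (L1_measurable (L1_fubini iF)).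
  - exact: (measurable_fubini_F iF).
  - apply: (aeS _ (ae_integrable1 iF)) => x ix _.
    by rewrite /Rintegral fineK//; exact: (integrable_fin_num measurableT ix).
have E2 : (\int[mu]_y (\int[mu]_x F (x, y))%:E = \int[mu]_y \int[mu]_x (F (x, y))%:E)%E.
  apply: ae_eq_integral => //.
  - by apply/measurable_EFinP; exact: (L1_measurable (L1_fubini (integral2_swap iF))).
  - exact: (measurable_fubini_G iF).
  - apply: (aeS _ (ae_integrable2 iF)) => x ix _.
    by rewrite /Rintegral fineK//; exact: (integrable_fin_num measurableT ix).
by rewrite E1 E2 (Fubini iF).
Qed.

End L1.

(** * Convolution on the line *)

Section convolution.
Context {R : realType}.
Notation mu := (@lebesgue_measure R).
Notation RR := (measurableTypeR R * measurableTypeR R)%type.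
Implicit Types f g h : R -> R.

Lemma measurable_conv_integrand f g : measurable_fun setT f -> measurable_fun setT g ->
  measurable_fun setT (fun z : RR => f z.2 * g (z.1 - z.2)).
Proof.
move=> mf mg; apply: measurable_funM.
  by apply: measurableT_comp => //; exact: measurable_snd.
apply: measurableT_comp => //.
by apply: measurable_funB; [exact: measurable_fst|exact: measurable_snd].
Qed.

Lemma Rintegral_shift f (d : R) : measurable_fun setT f ->
  \int[mu]_x f (x - d) = \int[mu]_x f x.
Proof.
move=> mf; have := Rintegral_affine (- d) (oner_neq0 R) mf.
by under eq_Rintegral do rewrite mul1r; rewrite normr1 invr1 mul1r.
Qed.

Lemma ge0_integral_shift (f : R -> \bar R) (d : R) : measurable_fun [set: R] f ->
  (forall x, (0 <= f x)%E) ->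
  (\int[mu]_x f (x - d)%R = \int[mu]_x f x)%E.
Proof.
move=> mf f0; have := ge0_integral_affine (- d) (oner_neq0 R) mf f0.
by under eq_integral do rewrite mul1r; rewrite normr1 invr1 mul1e.
Qed.

Lemma Rintegral_reflect f (d : R) : measurable_fun setT f ->
  \int[mu]_x f (d - x) = \int[mu]_x f x.
Proof.
move=> mf; have N1 : (-1 : R) != 0 by rewrite oppr_eq0 oner_neq0.
have := Rintegral_affine d N1 mf.
by under eq_Rintegral do rewrite mulN1r addrC; rewrite normrN1 invr1 mul1r.
Qed.

Lemma ge0_integral_reflect (f : R -> \bar R) (d : R) : measurable_fun [set: R] f ->
  (forall x, (0 <= f x)%E) ->
  (\int[mu]_x f (d - x)%R = \int[mu]_x f x)%E.
Proof.
move=> mf f0; have N1 : (-1 : R) != 0 by rewrite oppr_eq0 oner_neq0.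
have := ge0_integral_affine d N1 mf f0.
by under eq_integral do rewrite mulN1r addrC; rewrite normrN1 invr1 mul1e.
Qed.

Lemma L1_conv_integrand f g : L1 f -> L1 g ->
  (mu \x mu)%E.-integrable setT (EFin \o (fun z : RR => f z.2 * g (z.1 - z.2))).
Proof.
move=> lf lg; have mf := L1_measurable lf; have mg := L1_measurable lg.
apply/integrable21ltyP; first by apply/measurable_EFinP; exact: (measurable_conv_integrand mf mg).
rewrite [X in (X < _)%E](_ : _ = \int[mu]_y (`|f y|%:E * \int[mu]_x `|g x|%:E))%E; last first.
  apply: eq_integral => y _ /=.
  rewrite -(@ge0_integral_shift (fun x => `|g x|%:E) y)//; last first.
    exact/measurable_EFinP/measurableT_comp.
  rewrite -ge0_integralZl_EFin//; last first.
    apply/measurable_EFinP/measurableT_comp => //.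
    apply: measurableT_comp => //; exact: measurable_funB.
  by apply: eq_integral => x _; rewrite -EFinM normrM.
have := L1_lty lg; have : (0 <= \int[mu]_x `|g x|%:E)%E by exact: integral_ge0.
case: (\int[mu]_x `|g x|%:E)%E => // r r0 _.
rewrite ge0_integralZr//; [|exact/measurable_EFinP/measurableT_comp].
by rewrite lte_mul_pinfty//; [exact: integral_ge0| rewrite ge0_fin_numE ?integral_ge0//; exact: L1_lty|rewrite ltry].
Qed.

Lemma L1_conv f g : L1 f -> L1 g -> L1 (conv f g).
Proof. by move=> lf lg; have := L1_fubini (L1_conv_integrand lf lg). Qed.

Lemma conv_ae_L1 f g : L1 f -> L1 g ->
  {ae mu, forall x, L1 (fun y => f y * g (x - y))}.
Proof. by move=> lf lg; have := ae_integrable1 (L1_conv_integrand lf lg). Qed.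

Lemma convC f g x : measurable_fun setT f -> measurable_fun setT g ->
  conv f g x = conv g f x.
Proof.
move=> mf mg; rewrite /conv.
rewrite -(@Rintegral_reflect (fun y => f y * g (x - y)) x).
  by apply: eq_Rintegral => y _; rewrite opprB addrCA subrr addr0 mulrC.
apply: measurable_funM => //; apply: measurableT_comp => //.
exact: measurable_funB.
Qed.

(** Fubini at a fixed [x]: the triple product is integrable in both variables at every [x] where
    $(|f|*|g|)*|h|$ converges absolutely, hence at almost every [x]. *)
Lemma convA f g h : L1 f -> L1 g -> L1 h ->
  {ae mu, forall x, conv (conv f g) h x = conv f (conv g h) x}.
Proof.
move=> lf lg lh.
have mf := L1_measurable lf; have mg := L1_measurable lg.
have mh := L1_measurable lh.
apply: (aeS _ (conv_ae_L1 (L1_conv (L1_abs lf) (L1_abs lg)) (L1_abs lh))) => x lx.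
have mhx : measurable_fun setT (fun y : R => h (x - y)).
  by apply: measurableT_comp => //; exact: measurable_funB.
pose F (z : RR) := f z.2 * g (z.1 - z.2) * h (x - z.1).
have mF : measurable_fun setT F.
  apply: measurable_funM; first exact: measurable_conv_integrand.
  by apply: (measurableT_comp mhx); exact: measurable_fst.
have iF : (mu \x mu)%E.-integrable setT (EFin \o F).
  apply/integrable12ltyP; first exact/measurable_EFinP.
  apply: le_lt_trans (L1_lty lx).
  rewrite le_eqVlt; apply/orP; left; apply/eqP.
  apply: ae_eq_integral => //.
  - apply: (@measurable_fun_fubini_tonelli_F _ _ _ _ _ mu (fun z => `|(F z)%:E|%E)) => //.
    by apply/measurable_EFinP; exact: measurableT_comp.
  - apply/measurable_EFinP; apply: measurableT_comp => //; exact: L1_measurable lx.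
  - apply: (aeS _ (conv_ae_L1 (L1_abs lf) (L1_abs lg))) => y ly _ /=.
    rewrite ger0_norm; last first.
      by rewrite mulr_ge0// Rintegral_ge0// => z _; rewrite mulr_ge0.
    rewrite /conv EFinM /Rintegral fineK; last exact: (integrable_fin_num measurableT ly).
    rewrite muleC -ge0_integralZl_EFin//; last exact: (measurable_int mu ly).
    by apply: eq_integral => z _; rewrite -EFinM /F !normrM mulrC.
have E := Rfubini iF; rewrite /F /= in E.
rewrite {1}/conv -[LHS]/(\int[mu]_y (conv f g y * h (x - y))).
transitivity (\int[mu]_y \int[mu]_z (f z * g (y - z) * h (x - y))).
  apply: ae_eq_Rintegral.
  - apply: measurable_funM => //; exact: L1_measurable (L1_conv lf lg).
  - exact: L1_measurable (L1_fubini iF).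
  - apply: (aeS _ (conv_ae_L1 lf lg)) => y ly.
    by rewrite RintegralZr.
rewrite E; rewrite /conv.
apply: ae_eq_Rintegral.
- exact: L1_measurable (L1_fubini (integral2_swap iF)).
- apply: measurable_funM => //.
  apply: (measurableT_comp (L1_measurable (L1_conv lg lh))).
  exact: measurable_funB.
- apply: (aeS _ (ae_integrable2 iF)) => z lz.
  have -> : \int[mu]_y (g y * h (x - z - y)) = \int[mu]_y (g (y - z) * h (x - y)).
    rewrite -(@Rintegral_shift (fun y => g y * h (x - z - y)) z).
      by apply: eq_Rintegral => y _; congr (_ * h _); rewrite opprB addrA subrK.
    by apply: measurable_funM => //; apply: measurableT_comp => //; exact: measurable_funB.
  (* Integrability of the section without its factor [f z] is obtained by dividing [lz] by [f z]. *)
  have [fz|fz] := eqVneq (f z) 0.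
    rewrite fz mul0r.
    by under eq_Rintegral do rewrite !mul0r; rewrite Rintegral_cst// mul0r.
  rewrite -RintegralZl//; first by apply: eq_Rintegral => y _; rewrite mulrA.
  have := L1Zl (f z)^-1 lz; apply: eq_integrable => // y _ /=.
  by rewrite /F /= -!mulrA mulKf.
Qed.

(** The adjoint of a convolution, by Fubini. It carries fractional integrals over to test functions,
    and holds for any bounded [h]. *)
Lemma conv_swap f g h C : L1 f -> L1 g -> measurable_fun setT h ->
  (forall x, `|h x| <= C) ->
  \int[mu]_x (conv f g x * h x) = \int[mu]_y (f y * \int[mu]_x (g (x - y) * h x)).
Proof.
move=> lf lg mh hC.
have mf := L1_measurable lf; have mg := L1_measurable lg.
pose F (z : RR) := f z.2 * g (z.1 - z.2) * h z.1.
have mF : measurable_fun setT F.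
  apply: measurable_funM; first exact: measurable_conv_integrand.
  by apply: (measurableT_comp mh); exact: measurable_fst.
have iF : (mu \x mu)%E.-integrable setT (EFin \o F).
  apply: (@integral2_le _ _ (fun z : RR => C * `|f z.2 * g (z.1 - z.2)|)) => //.
    by move=> z; rewrite /F normrM mulrC ler_wpM2r.
  apply: (integrableZl measurableT C (integrable_norm _)).
  exact: L1_conv_integrand.
have := Rfubini iF; rewrite /F /= => E.
transitivity (\int[mu]_x (\int[mu]_y (f y * g (x - y) * h x))).
  apply: ae_eq_Rintegral.
  - apply: measurable_funM => //; exact: L1_measurable (L1_conv lf lg).
  - exact: L1_measurable (L1_fubini iF).
  - by apply: (aeS _ (conv_ae_L1 lf lg)) => x lx; rewrite -RintegralZr.
rewrite E; apply: eq_Rintegral => y _.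
rewrite -RintegralZl//; first by apply: eq_Rintegral => x _; rewrite mulrA.
apply: (L1_mul (C := C)) => //.
have := L1_affine (- y) (oner_neq0 R) lg.
by apply: eq_integrable => // x _ /=; rewrite mul1r.
Qed.

End convolution.

(** * Riemann-Liouville kernels and the Abel identity *)

Section ftc_left.
Context {R : realType}.
Notation mu := (@lebesgue_measure R).

(** [f] may be unbounded at [a], as $t^{s-1}$ is at 0: the fundamental theorem is applied on closed
    intervals shrinking away from [a], followed by monotone convergence. *)
Lemma ge0_FTC_left (F f : R -> R) (a b : R) : a < b ->
  (forall x, a < x -> x <= b -> is_derive x 1 F (f x)) ->
  (forall x, a < x -> x <= b -> {for x, continuous f}) ->
  (forall x, a < x -> x <= b -> 0 <= f x) ->
  F x @[x --> a^'+] --> F a ->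
  (\int[mu]_(x in `]a, b]) (f x)%:E = (F b - F a)%:E)%E.
Proof.
move=> ab dF cf f0 Fa.
(* The denominator [n.+2] keeps [e n] strictly below [b] from [n = 0] on. *)
pose e (n : nat) := a + (b - a) / n.+2%:R.
have ae n : a < e n by rewrite ltrDl divr_gt0// subr_gt0.
have eb n : e n < b.
  rewrite -ltrBrDl ltr_pdivrMr//; rewrite ltr_pMr ?subr_gt0// ltr1n//.
have cvge : e n @[n --> \oo] --> a.
  rewrite -[X in _ --> X]addr0; apply: cvgD; first exact: cvg_cst.
  rewrite -(mulr0 (b - a)); apply: cvgM; first exact: cvg_cst.
  by have := @cvg_harmonic R; rewrite -(cvg_shiftS (@harmonic R)).
have contF n : {within `[e n, b], continuous F}.
  apply: derivable_within_continuous => x; rewrite in_itv/= => /andP[ex xb].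
  by case: (dF x (lt_le_trans (ae n) ex) xb).
have contf n : {within `[e n, b], continuous f}.
  apply: continuous_in_subspaceT => x; rewrite inE/= in_itv/= => /andP[ex xb].
  exact: cf (lt_le_trans (ae n) ex) xb.
have intE n : (\int[mu]_(x in `[e n, b]) (f x)%:E = (F b - F (e n))%:E)%E.
  rewrite EFinB; apply: continuous_FTC2 => //.
    have [_ h1 h2] := (continuous_within_itvP _ (eb n)).1 (contF n).
    split=> // x; rewrite in_itv/= => /andP[ex xb].
    by case: (dF x (lt_trans (ae n) ex) (ltW xb)).
  move=> x; rewrite in_itv/= => /andP[ex xb].
  have D := dF x (lt_trans (ae n) ex) (ltW xb).
  by rewrite derive1E derive_val.
have U : \bigcup_n `[e n, b]%classic = `]a, b]%classic.
  apply/seteqP; split => x /=.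
    move=> [n _ /=]; rewrite !in_itv/= => /andP[ex ->]; rewrite andbT.
    exact: lt_le_trans ex.
  rewrite in_itv/= => /andP[ax xb].
  have : \forall n \near \oo, e n < x.
    by apply: (cvgr_lt a) => //.
  move=> [N _ /(_ N (leqnn _)) /= eN].
  by exists N => //=; rewrite in_itv/= xb (ltW eN).
have nd : nondecreasing_seq (fun n => `[e n, b]%classic).
  apply/nondecreasing_seqP => n; rewrite subsetEset => x /=.
  rewrite !in_itv/= => /andP[ex ->]; rewrite andbT (le_trans _ ex)//.
  rewrite lerD2l ler_pM2l ?subr_gt0// lef_pV2 ?posrE// ler_nat//.
have := @ge0_nondecreasing_set_cvg_integral _ (measurableTypeR R) R (fun n => `[e n, b]%classic)
  (EFin \o f) mu nd (fun=> measurable_itv _).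
rewrite U => /(_ _ _)/cvg_lim <- //.
- apply/cvg_lim => //; rewrite (_ : (fun _ => _) = (fun n => (F b - F (e n))%:E)); last first.
    by apply/funext => n; rewrite intE.
  apply: cvg_EFin; first exact: nearW.
  apply: cvgB; first exact: cvg_cst.
  exact: ((cvg_at_rightP F a (F a)).1 Fa e (conj ae cvge)).
- by move=> n; apply/measurable_EFinP; apply: subspace_continuous_measurable_fun.
- move=> n x /=; rewrite in_itv/= => /andP[ex xb]; rewrite lee_fin f0//.
  exact: lt_le_trans ex.
Qed.

End ftc_left.

(* Truncating the Riemann-Liouville kernel at [M] makes it integrable and changes
   nothing for functions supported on an interval of length at most [M]. *)
Definition rlker (R : realType) (s M t : R) : R :=
  if (0 < t) && (t < M) then t `^ (s - 1) else 0.

Section kernel.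
Context {R : realType}.
Notation mu := (@lebesgue_measure R).

Lemma rlker_ge0 (s M t : R) : 0 <= rlker s M t.
Proof. by rewrite /rlker; case: ifP => // _; exact: powR_ge0. Qed.

Lemma rlkerE (s M t : R) : 0 < t -> t < M -> rlker s M t = t `^ (s - 1).
Proof. by move=> t0 tM; rewrite /rlker t0 tM. Qed.

Lemma rlker_le0 (s M t : R) : t <= 0 -> rlker s M t = 0.
Proof. by rewrite leNgt => /negbTE t0; rewrite /rlker t0. Qed.

Lemma rlker_patch (s M : R) : rlker s M = (fun t => t `^ (s - 1)) \_ `]0, M[.
Proof.
by apply/funext => t; rewrite /rlker patchE mem_setE in_itv.
Qed.

Lemma measurable_rlker (s M : R) : measurable_fun setT (rlker s M).
Proof.
rewrite rlker_patch; apply/(measurable_restrictT _ _).1 => //.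
by apply: measurable_funTS; exact: measurable_powR.
Qed.

Lemma integral_powR (s M : R) : 0 < s -> 0 < M ->
  (\int[mu]_(t in `]0%R, M]) (t `^ (s - 1))%:E = (M `^ s / s)%:E)%E.
Proof.
move=> s0 M0.
have := @ge0_FTC_left R (fun t => s^-1 * t `^ s) (fun t => t `^ (s - 1)) 0 M M0.
rewrite powR0 ?gt_eqF// mulr0 subr0 mulrC; apply.
- move=> x x0 _; have D := is_derive1_powR s x0.
  have := is_deriveZ s^-1 D.
  by rewrite /GRing.scale/= mulrA mulVf ?gt_eqF// mul1r.
- move=> x x0 _; apply/differentiable_continuous/derivable1_diffP.
  by have [] := is_derive1_powR (s - 1) x0.
- by move=> x _ _; exact: powR_ge0.
- rewrite -{2}(mulr0 s^-1); apply: cvgM; first exact: cvg_cst.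
  exact: powR_cvg0.
Qed.

Lemma integral_rlker (s M : R) : 0 < s -> 0 < M ->
  (\int[mu]_t (rlker s M t)%:E = (M `^ s / s)%:E)%E.
Proof.
move=> s0 M0; rewrite -(integral_powR s0 M0) rlker_patch.
rewrite -integral_itv_bndo_bndc; last first.
  by apply/measurable_EFinP/measurable_funTS; exact: measurable_powR.
rewrite [RHS]integral_mkcond/=; apply: eq_integral => t _.
by rewrite restrict_EFin.
Qed.

Lemma L1_rlker (s M : R) : 0 < s -> L1 (rlker s M).
Proof.
move=> s0; have [M0|M0] := ltP 0 M; last first.
  rewrite (_ : rlker s M = cst 0); first exact: integrable0.
  apply/funext => t; rewrite /rlker; case: ifP => // /andP[t0 tM].
  by have := lt_trans t0 tM; rewrite ltNge M0.
apply/integrableP; split; first by apply/measurable_EFinP; exact: measurable_rlker.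
under eq_integral do rewrite gee0_abs ?lee_fin ?rlker_ge0//.
by rewrite integral_rlker// ltry.
Qed.

Lemma Rintegral_rlker (s M : R) : 0 < s -> 0 < M ->
  \int[mu]_t rlker s M t = M `^ s / s.
Proof. by move=> s0 M0; rewrite /Rintegral integral_rlker. Qed.

(** The Beta value $B(1-s,s)=\int_0^1 y^{-s}(1-y)^{s-1}\,dy$, kept as a convolution at the point
    1. *)
Definition betac (s : R) : R := conv (rlker (1 - s) 1) (rlker s 1) 1.

(** The two singularities are at 0 and 1: on each half of the unit interval one factor is at most 2
    and the other is an integrable kernel. *)
Lemma betac_integrable (s : R) : 0 < s -> s < 1 ->
  L1 (fun y => rlker (1 - s) 1 y * rlker s 1 (1 - y)).
Proof.
move=> s0 s1; have s1' : 0 < 1 - s by rewrite subr_gt0.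
have mF : measurable_fun setT (fun y : R => rlker (1 - s) 1 y * rlker s 1 (1 - y)).
  apply: measurable_funM; first exact: measurable_rlker.
  apply: (measurableT_comp (measurable_rlker _ _)); exact: measurable_funB.
have N1 : (-1 : R) != 0 by rewrite oppr_eq0 oner_neq0.
have l2 := L1_affine 1 N1 (L1_rlker 1 s0).
have := L1D (L1Zl 2 (L1_rlker 1 s1')) (L1Zl 2 l2).
apply: L1_le => // y; rewrite ger0_norm ?mulr_ge0 ?rlker_ge0//.
have -> : -1 * y + 1 = 1 - y by rewrite mulN1r addrC.
have [y0|y0] := leP y 0.
  by rewrite rlker_le0// mul0r addr_ge0// mulr_ge0// rlker_ge0.
have [y1|y1] := leP 1 y.
  rewrite [rlker s 1 (1 - y)]rlker_le0 ?subr_le0// mulr0.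
  by rewrite addr_ge0// mulr_ge0// rlker_ge0.
have bnd (t r : R) : 0 < r -> r < 1 -> 2^-1 <= t -> t `^ (r - 1) <= 2.
  move=> r0 r1 t2; have t0 : 0 < t by apply: lt_le_trans t2; rewrite invr_gt0.
  have -> : r - 1 = - (1 - r) by rewrite opprB.
  rewrite powRN -(invrK 2) lef_pV2 ?posrE ?powR_gt0 ?invr_gt0//.
  apply: (@le_trans _ _ (2^-1 `^ (1 - r))).
    apply: ger1_powR; first by apply/andP; split; [rewrite invr_gt0|rewrite invf_le1// ler1n].
    by rewrite gerBl ltW.
  apply: ge0_ler_powR => //; rewrite ?nnegrE ?subr_ge0 ?invr_ge0 //; exact: ltW.
have [y2|y2] := leP y 2^-1.
  apply: (@le_trans _ _ (2 * rlker (1 - s) 1 y)).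
    rewrite mulrC ler_wpM2r ?rlker_ge0// rlkerE ?subr_gt0//; last by rewrite gtrBl.
    by apply: bnd => //; lra.
  by rewrite lerDl mulr_ge0// rlker_ge0.
apply: (@le_trans _ _ (2 * rlker s 1 (1 - y))).
  rewrite ler_wpM2r ?rlker_ge0// rlkerE//.
  by apply: bnd; lra.
by rewrite lerDr mulr_ge0// rlker_ge0.
Qed.

(** Both exponents are negative, so the integrand is at least 1 on the unit interval. *)
Lemma betac_gt0 (s : R) : 0 < s -> s < 1 -> 0 < betac s.
Proof.
move=> s0 s1; apply: (@lt_le_trans _ _ 1) => //.
rewrite /betac /conv.
rewrite [X in X <= _](_ : 1 = \int[mu]_t rlker (1 : R) 1 t); last first.
  by rewrite Rintegral_rlker// powR1 divr1.
apply: le_Rintegral => //.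
- exact: (@L1_rlker 1 1 ltr01).
- exact: betac_integrable.
- move=> y _; have [y0|y0] := leP y 0.
    by rewrite rlker_le0// mulr_ge0 ?rlker_ge0.
  have [y1|y1] := leP 1 y.
    rewrite {1}/rlker y0 ltNge y1/= mulr_ge0 ?rlker_ge0//.
  rewrite !rlkerE ?subr_gt0 ?gtrBl// subrr powRr0.
  have h (t r : R) : 0 < t -> t < 1 -> r < 0 -> 1 <= t `^ r.
    move=> t0 t1 r0; rewrite -[leLHS](powRr0 t).
    by apply: ger_powR; [rewrite t0 ltW|exact: ltW].
  rewrite -[leLHS]mulr1 ler_pM//; apply: h; lra.
Qed.

(** The exponents $-s$ and $s-1$ add up to $-1$, so the substitution $y\mapsto xy$ cancels every
    power of [x]. The truncation at [M] is not felt because [x] is smaller. *)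
Lemma conv_rlker (s M x : R) : 0 < s -> s < 1 -> 0 < x -> x < M ->
  conv (rlker (1 - s) M) (rlker s M) x = betac s.
Proof.
move=> s0 s1 x0 xM.
have mF : measurable_fun setT (fun y : R => rlker (1 - s) M y * rlker s M (x - y)).
  apply: measurable_funM; first exact: measurable_rlker.
  apply: (measurableT_comp (measurable_rlker _ _)); exact: measurable_funB.
have H := Rintegral_affine 0 (lt0r_neq0 x0) mF.
have x1 : x^-1 != 0 by rewrite invr_neq0// gt_eqF.
apply: (mulfI x1).
transitivity (\int[mu]_y (rlker (1 - s) M (x * y + 0) * rlker s M (x - (x * y + 0)))).
  by rewrite H gtr0_norm.
rewrite /betac /conv -RintegralZl//; last exact: betac_integrable.
apply: eq_Rintegral => y _; rewrite addr0.
have -> : x - x * y = x * (1 - y) by rewrite mulrBr mulr1.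
have [y0|y0] := leP y 0.
  by rewrite rlker_le0 ?pmulr_rle0// [rlker _ 1 y]rlker_le0// !mul0r mulr0.
have [y1|y1] := leP 1 y.
  rewrite [rlker s M _]rlker_le0; last by rewrite pmulr_rle0// subr_le0.
  by rewrite [rlker s 1 _]rlker_le0 ?subr_le0// !mulr0.
rewrite !rlkerE ?subr_gt0 ?gtrBl ?mulr_gt0 ?subr_gt0//.
- rewrite !powRM ?(ltW x0) ?(ltW y0) ?subr_ge0 ?(ltW y1)//.
  rewrite mulrACA -powRD; last by apply/implyP => _; rewrite gt_eqF.
  by rewrite (_ : 1 - s - 1 + (s - 1) = -1) ?powR_inv1 ?ltW//; ring.
- by apply: le_lt_trans xM; rewrite ler_piMr ?ltW// gtrBl.
- by apply: le_lt_trans xM; rewrite ler_piMr ?ltW.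
Qed.

Lemma conv_rlker_le0 (s t M x : R) : x <= 0 -> conv (rlker s M) (rlker t M) x = 0.
Proof.
move=> x0; rewrite /conv (_ : (fun y => _) = cst 0) ?Rintegral_cst ?mul0r//.
apply/funext => y; have [y0|y0] := leP y 0; first by rewrite rlker_le0 ?mul0r.
by rewrite [rlker t M _]rlker_le0 ?mulr0//; lra.
Qed.

(** Integrability has to come before the lower bound, since [Rintegral] sends an infinite integral
    to 0. The lower bound $e^{-1}$ comes from the unit interval, where $t^{s-1}\ge 1$. *)
Lemma Gamma_gt0 (s : R) : 0 < s -> s < 1 -> 0 < Gamma s.
Proof.
move=> s0 s1; rewrite /Gamma Rintegral_mkcond.
set f := (X in Rintegral _ _ X).
have mf : measurable_fun setT f.
  apply/(measurable_restrictT _ _).1 => //; apply: measurable_funM.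
    by apply: measurable_funTS; exact: measurable_powR.
  apply: measurable_funTS; apply: continuous_measurable_fun => x.
  by apply: continuous_comp; [exact: continuousN|exact: continuous_expR].
have fE t : 0 < t -> f t = t `^ (s - 1) * expR (- t).
  by move=> t0; rewrite /f patchE mem_set//= in_itv/= t0.
have f0 t : t <= 0 -> f t = 0.
  by move=> t0; rewrite /f patchE memNset//= in_itv/= andbT ltNge t0.
have lf : L1 f.
  have le : L1 (exponential_pdf (1 : R)) by exact: integrable_exponential_pdf.
  have := L1D (L1_rlker 1 s0) (L1D (@L1_rlker 1 2 ltr01) le).
  apply: L1_le => // t; have e0 := exponential_pdf_ge0 (@ler01 R) t.
  have [t0|t0] := leP t 0; first by rewrite f0// normr0 !addr_ge0 ?rlker_ge0.
  rewrite fE// ger0_norm; last by rewrite mulr_ge0 ?powR_ge0 ?expR_ge0.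
  have [t1|t1] := ltP t 1.
    rewrite rlkerE// -[leLHS]addr0 lerD ?addr_ge0 ?rlker_ge0//.
    by rewrite ler_piMr ?powR_ge0// -expR0 ler_expR oppr_le0 ltW.
  rewrite ler_wpDl ?rlker_ge0// ler_wpDl ?rlker_ge0//.
  have -> : exponential_pdf 1 t = expR (- t).
    by rewrite exponential_pdfE ?(ltW t0)//= mul1r mulN1r.
  rewrite ler_piMl ?expR_ge0//.
  rewrite -[leRHS](powRr0 t); apply: ler_powR => //; lra.
apply: (@lt_le_trans _ _ (expR (-1))); first exact: expR_gt0.
have -> : expR (-1) = \int[mu]_t (expR (-1) * rlker (1 : R) 1 t).
  by rewrite RintegralZl ?Rintegral_rlker// ?powR1 ?divr1 ?mulr1//; exact: L1_rlker.
apply: le_Rintegral => //; first exact/L1Zl/L1_rlker.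
move=> t _; rewrite -[X in _ <= X]/(f t).
have [t0|t0] := leP t 0; first by rewrite rlker_le0// mulr0 f0.
have [t1|t1] := ltP t 1; last first.
  by rewrite {1}/rlker (ltNge t) t1 andbF mulr0 fE// mulr_ge0 ?powR_ge0 ?expR_ge0.
rewrite rlkerE// subrr powRr0 fE// mulrC ler_pM ?expR_ge0//.
  rewrite -[leLHS](powRr0 t); apply: ger_powR; [by rewrite t0 ltW|lra].
by rewrite ler_expR; lra.
Qed.

End kernel.

(** Differentiability [n] times, with the successive derivatives as witnesses rather than values of
    [derive1n]. Sums, products and affine substitutions are then handled by plain induction;
    [smooth_onP] returns to [smooth_on]. *)
Fixpoint Cn (R : realType) (D : set R) (n : nat) (f : R -> R) : Prop :=
  if n is m.+1 then
    exists2 g, (forall x, D x -> is_derive x 1 f (g x)) & Cn D m g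
  else True.

(** * Smooth functions and test functions *)

Section smooth.
Context {R : realType}.
Notation mu := (@lebesgue_measure R).
Implicit Types (D : set R) (f g h : R -> R) (n : nat).

Lemma near_eq_on D f g x : open D -> D x -> (forall y, D y -> f y = g y) ->
  {near x, f =1 g}.
Proof.
by move=> oD Dx fg; apply: filterS (open_nbhs_nbhs (conj oD Dx)) => y; exact: fg.
Qed.

Lemma is_derive_on D f g x df : open D -> D x -> (forall y, D y -> f y = g y) ->
  is_derive x 1 f df -> is_derive x 1 g df.
Proof.
by move=> oD Dx fg; apply: near_eq_is_derive; exact: (near_eq_on oD Dx fg).
Qed.

Lemma Cn_on D n f g : open D -> (forall x, D x -> f x = g x) -> Cn D n f -> Cn D n g.
Proof.
move=> oD; case: n => //= n fg [h df ch]; exists h => // x Dx.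
exact: (is_derive_on oD Dx fg (df x Dx)).
Qed.

Lemma CnW D n f : Cn D n.+1 f -> Cn D n f.
Proof.
by elim: n f => //= n ih f [g df cg]; exists g => //; exact: ih.
Qed.

Lemma Cn_sub D D' n f : D' `<=` D -> Cn D n f -> Cn D' n f.
Proof.
move=> DD; elim: n f => //= n ih f [g df cg]; exists g; last exact: ih.
by move=> x /DD; exact: df.
Qed.

Lemma CnD D n f g : Cn D n f -> Cn D n g -> Cn D n (fun x => f x + g x).
Proof.
elim: n f g => //= n ih f g [f' df cf] [g' dg cg].
exists (fun x => f' x + g' x); last exact: ih.
by move=> x Dx; exact: (is_deriveD (df x Dx) (dg x Dx)).
Qed.

Lemma CnZ D n k f : Cn D n f -> Cn D n (fun x => k * f x).
Proof.
elim: n f => //= n ih f [f' df cf].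
exists (fun x => k * f' x); last exact: ih.
by move=> x Dx; exact: (is_deriveZ k (df x Dx)).
Qed.

Lemma CnM D n f g : Cn D n f -> Cn D n g -> Cn D n (fun x => f x * g x).
Proof.
elim: n f g => // n ih f g Cf Cg.
have /= [f' df cf] := Cf; have /= [g' dg cg] := Cg.
exists (fun x => f x * g' x + g x * f' x); last first.
  by apply: CnD; apply: ih => //; exact: CnW.
by move=> x Dx; exact: (is_deriveM (df x Dx) (dg x Dx)).
Qed.

Lemma Cn_cst D n (k : R) : Cn D n (fun=> k).
Proof.
elim: n k => //= n ih k; exists (fun=> 0) => // x _.
exact: is_derive_cst.
Qed.

Lemma is_derive_affine (c d x : R) : is_derive x 1 (fun y : R => c * y + d) c.
Proof.
have := is_deriveD (is_deriveZ c (is_derive_id x 1)) (is_derive_cst d x 1).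
by rewrite /GRing.scale/= mulr1 addr0.
Qed.

Lemma Cn_affine D D' n f (c d : R) : (forall x, D x -> D' (c * x + d)) ->
  Cn D' n f -> Cn D n (fun x => f (c * x + d)).
Proof.
move=> DD; elim: n f => //= n ih f [f' df cf].
exists (fun x => c * f' (c * x + d)); last exact/CnZ/ih.
move=> x Dx.
have := @is_derive1_comp R f (fun y => c * y + d) x _ _ (df _ (DD x Dx)) (is_derive_affine c d x).
by rewrite mulrC.
Qed.

Lemma Cn_continuous D n f x : Cn D n.+1 f -> D x -> {for x, continuous f}.
Proof.
move=> /= [g df _] Dx; apply/differentiable_continuous/derivable1_diffP.
by case: (df x Dx).
Qed.

Lemma derive1Sn f n : derive1n n.+1 f = derive1n n (derive1 f).
Proof. by rewrite /derive1n iterSr. Qed.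

Lemma derive1n_on D n f g : open D -> (forall x, D x -> f x = g x) ->
  forall x, D x -> derive1n n f x = derive1n n g x.
Proof.
move=> oD fg; elim: n => [|n ih] x Dx; first exact: fg.
rewrite !derive1nS !derive1E; apply: near_eq_derive.
exact: (near_eq_on oD Dx ih).
Qed.

Lemma smooth_onP D f : open D -> (smooth_on D f <-> forall n, Cn D n f).
Proof.
move=> oD; split.
  move=> sf n; elim: n f sf => //= n ih f sf.
  exists (derive1 f).
    move=> x Dx; have := sf 0%N x Dx; rewrite derive1n0 => df.
    by rewrite derive1E; exact: derivableP.
  by apply: ih => k x Dx; rewrite -derive1Sn; exact: sf.
move=> cf n; move: (cf n.+1); elim: n f {cf} => [|n ih] f.
  by move=> [g df _] x Dx; rewrite derive1n0; case: (df x Dx).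
move=> [g df cg] x Dx; rewrite derive1Sn.
apply: (@near_eq_derivable _ _ _ (derive1n n g)).
  apply: (near_eq_on oD Dx) => y Dy.
  apply: (derive1n_on n oD _ Dy) => z Dz.
  by have D1 := df z Dz; rewrite derive1E derive_val.
exact: ih.
Qed.

Lemma Cn_powR D n (k a r : R) : (forall x, D x -> a < x) ->
  Cn D n (fun x => k * (x - a) `^ r).
Proof.
move=> Da; elim: n k r => //= n ih k r.
exists (fun x => k * r * (x - a) `^ (r - 1)); last exact: ih.
move=> x Dx; have xa : 0 < x - a by rewrite subr_gt0; exact: Da.
have da : is_derive x 1 (fun y : R => y - a) 1.
  have := is_derive_affine 1 (- a) x.
  by rewrite (_ : (fun y => _) = (fun y => y - a))//; apply/funext => y; rewrite mul1r.
have := is_deriveZ k (@is_derive1_comp R (fun y : R => y `^ r) (fun y => y - a) x _ _ (is_derive1_powR r xa) da).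
by rewrite /GRing.scale/= mulr1 mulrA.
Qed.

(** Serves to differentiate [flat] at 0, where its two definitions meet. *)
Lemma is_derive_quad f (x0 C : R) : (forall t : R, `|f (x0 + t)| <= C * t ^+ 2) ->
  is_derive x0 1 f 0.
Proof.
move=> fC; have f0 : f x0 = 0.
  by apply/normr0_eq0/le_anti; rewrite normr_ge0 andbT; have := fC 0; rewrite addr0 expr0n mulr0.
suff cv : h^-1 *: ((f \o shift x0) h%:A - f x0) @[h --> 0^'] --> (0 : R).
  split; first by apply/cvg_ex; exists 0.
  exact/cvg_lim.
apply/cvgrPdist_le => e e0; near=> h.
have h0 : h != 0 by near: h; exact: nbhs_dnbhs_neq.
rewrite f0 subr0 sub0r normrN /= normrM [_%:A]mulr1 normfV addrC.
have n0 : 0 < `|h| by rewrite normr_gt0.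
rewrite ler_pdivrMl// (le_trans (fC h))//.
rewrite -real_normK ?num_real// expr2 mulrA mulrC ler_wpM2l//.
apply: (@le_trans _ _ (`|C| * `|h|)); first by rewrite ler_wpM2r// ler_norm.
apply: (@le_trans _ _ ((`|C| + 1) * `|h|)); first by rewrite ler_wpM2r// lerDl.
rewrite mulrC -ler_pdivlMr ?ltr_wpDl//.
near: h; apply: dnbhs0_le; rewrite divr_gt0// ltr_wpDl//.
Unshelve. all: end_near. Qed.

(** The power $x^{-m}$ in front of $e^{-1/x}$ makes the family closed under differentiation, so
    smoothness of all members follows by one induction. *)
Definition flat (m : nat) (x : R) : R := if 0 < x then x ^- m * expR (- x^-1) else 0.

Lemma flat_ge0 m x : 0 <= flat m x.
Proof.
rewrite /flat; case: ifP => // x0; rewrite mulr_ge0 ?expR_ge0// invr_ge0 exprn_ge0// ltW//.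
Qed.

Lemma flatS m x : 0 < x -> flat m x = x * flat m.+1 x.
Proof.
by move=> x0; rewrite /flat x0 exprS invfM !mulrA divff ?mul1r// gt_eqF.
Qed.

(** With $y=1/x$ this is $y^m\le m!\,e^y$, one term of the exponential series. *)
Lemma flat_bound m x : flat m x <= m`!%:R.
Proof.
rewrite /flat; case: ifPn => x0; last by rewrite ler0n.
rewrite -exprVn expRN ler_pdivrMr ?expR_gt0// mulrC -ler_pdivrMr ?ltr0n ?fact_gt0//.
case: m => [|m]; first by rewrite expr0 divr1 -expR0 ler_expR invr_ge0 ltW.
apply: le_trans (expR_ge1Dxn m _); last by rewrite invr_ge0 ltW.
by rewrite lerDr.
Qed.

Lemma is_derive_flat (m : nat) (x : R) :
  is_derive x 1 (flat m) (flat m.+2 x - m%:R * flat m.+1 x).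
Proof.
have [x0|x0|x0] := ltgtP x 0.
- rewrite {2 3}/flat !ltNge (ltW x0)/= mulr0 subr0.
  apply: (@is_derive_on [set y | y < 0] (fun=> 0)) => //.
  by move=> y /= y0; rewrite /flat ltNge (ltW y0).
- apply: (@is_derive_on [set y | 0 < y] (fun y : R => (y ^+ m)^-1 * expR (- y^-1))) => //.
    by move=> y /= y0; rewrite /flat y0.
  have xn0 : x != 0 by rewrite gt_eqF.
  have xm0 : x ^+ m != 0 by rewrite expf_neq0.
  have dX : is_derive x 1 (fun y : R => y ^+ m) (m%:R * x ^+ m.-1).
    have := is_deriveX m (is_derive_id x 1).
    by rewrite exprfctE /GRing.scale/= mulr1.
  have d1 := @is_deriveV R (fun y : R => y ^+ m) x _ 1 xm0 dX.
  have d2 := is_deriveN (@is_deriveV R id x _ 1 xn0 (is_derive_id x 1)).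
  have d3 := @is_derive1_comp R expR (fun y => - y^-1) x _ _ (is_derive_expR (- x^-1)) d2.
  refine (is_derive_eq (is_deriveM d1 d3) _).
  have e0 : expR x^-1 != 0 by rewrite gt_eqF ?expR_gt0.
  rewrite /flat x0 /GRing.scale/= expRN.
  case: m xm0 {d1 dX} => [|m] xm0.
    by rewrite mulr0n expr0; field; rewrite xn0 e0.
  rewrite -pred_Sn -mulr_natl !exprS.
  have xm : x ^+ m != 0 by rewrite expf_neq0.
  by field; rewrite xn0 e0 xm.
(* At 0, the relation $\mathrm{flat}_m(h)=h^2\,\mathrm{flat}_{m+2}(h)$ and [flat_bound] give a
   quadratic bound. *)
- rewrite x0 {2 3}/flat ltxx mulr0 subr0.
  apply: (@is_derive_quad _ _ m.+2`!%:R) => h; rewrite add0r.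
  rewrite ger0_norm ?flat_ge0//.
  have [h0|h0] := leP h 0.
    by rewrite {1}/flat ltNge h0/= mulr_ge0// ?ler0n// sqr_ge0.
  rewrite flatS// flatS// mulrA -expr2 mulrC ler_wpM2r ?sqr_ge0// flat_bound//.
Qed.

Lemma Cn_flat D n m : Cn D n (flat m).
Proof.
elim: n m => //= n ih m; exists (fun x => flat m.+2 x - m%:R * flat m.+1 x).
  by move=> x _; exact: is_derive_flat.
have := CnD (ih m.+2) (CnZ (- m%:R) (ih m.+1)).
by congr Cn; apply/funext => x; rewrite mulNr.
Qed.

(** Test functions are smooth on the whole line and carry explicit bounds for their support, so that
    the distance to the end points can be tracked. For [d < c] the function is zero. *)
Definition is_test (c d : R) (f : R -> R) : Prop :=
  [/\ forall n, Cn setT n f, forall x, x < c -> f x = 0 &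
      forall x, d < x -> f x = 0].

Lemma Cn_derive1 f : (forall n, Cn setT n f) ->
  (forall x : R, is_derive x 1 f (derive1 f x)) /\ (forall n, Cn setT n (derive1 f)).
Proof.
move=> cf; split.
  move=> x; have [g df _] := cf 1%N; rewrite derive1E; apply: derivableP.
  by case: (df x I).
move=> n; have [g df cg] := cf n.+1.
suff -> : derive1 f = g by [].
by apply/funext => x; have D := df x I; rewrite derive1E derive_val.
Qed.

Lemma test_derive c d f : is_test c d f ->
  (forall x : R, is_derive x 1 f (derive1 f x)) /\ is_test c d (derive1 f).
Proof.
move=> [cf fc fd]; have [df cf'] := Cn_derive1 cf; split=> //; split=> //.
- move=> x xc; have D : is_derive x 1 f 0.
    apply: (@is_derive_on [set y | y < c] (fun=> 0) f x 0 (@open_lt R c) xc).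
      by move=> y /fc ->.
  by rewrite derive1E derive_val.
- move=> x xd; have D : is_derive x 1 f 0.
    apply: (@is_derive_on [set y | d < y] (fun=> 0) f x 0 (@open_gt R d) xd).
      by move=> y /fd ->.
  by rewrite derive1E derive_val.
Qed.

Lemma test_continuous c d f : is_test c d f -> continuous f.
Proof. by move=> [cf _ _] x; exact: (Cn_continuous (cf 1%N)). Qed.

Lemma test_measurable c d f : is_test c d f -> measurable_fun setT f.
Proof. by move=> tf; apply: continuous_measurable_fun; exact: test_continuous tf. Qed.

Lemma test_bounded c d f : is_test c d f -> exists C, forall x, `|f x| <= C.
Proof.
move=> tf; have [cf fc fd] := tf; have [cd|dc] := leP c d; last first.
  exists 0 => x; have [xc|cx] := ltP x c; first by rewrite fc ?normr0.
  by rewrite fd ?normr0// (lt_le_trans dc).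
have cn : {within `[c, d], continuous (fun x => `|f x|)}.
  apply: continuous_subspaceT => x; apply: continuous_comp.
    exact: test_continuous tf _.
  exact: norm_continuous.
have [x0 _ hx0] := EVT_max cd cn.
exists `|f x0| => x; have [xc|cx] := ltP x c; first by rewrite fc ?normr0.
have [xd|dx] := leP x d; first by apply: hx0; rewrite in_itv/= cx xd.
by rewrite fd ?normr0.
Qed.

Lemma test_L1 c d f : is_test c d f -> L1 f.
Proof.
move=> tf; have [C fC] := test_bounded tf; have [cf fc fd] := tf.
apply: (@L1_bounded R f c d C) => //; first exact: test_measurable tf.
move=> x /negP; rewrite negb_and -!ltNge => /orP[/fc//|/fd//].
Qed.

(** Differentiation under the integral sign: the smooth factor takes the derivative, and [C * |k y|]
    dominates. The kernel [k] may be singular. *)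
Lemma is_derive_conv (k phi psi : R -> R) (C : R) : L1 k ->
  (forall x : R, is_derive x 1 phi (psi x)) ->
  measurable_fun setT phi ->
  (forall x, `|phi x| <= C) -> (forall x, `|psi x| <= C) ->
  forall x : R, is_derive x 1 (conv k phi) (conv k psi x).
Proof.
move=> lk dphi mphi phiC psiC x.
pose f (z y : R) := k y * phi (z - y).
have dz (z y : R) : is_derive z 1 (f ^~ y) (k y * psi (z - y)).
  have da : is_derive z 1 (fun t : R => t - y) 1.
    have := is_derive_affine 1 (- y) z.
    by rewrite (_ : (fun y0 => _) = (fun t => t - y))//; apply/funext => t; rewrite mul1r.
  have := is_deriveZ (k y) (@is_derive1_comp R phi (fun t => t - y) z _ _ (dphi _) da).
  by rewrite /GRing.scale/= mulr1.
have ux : `]x - 1, x + 1[%classic x by rewrite /= in_itv/= ltrDl ltrBlDr ltrDl ltr01.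
have intf z : `]x - 1, x + 1[%classic z -> mu.-integrable setT (EFin \o f z).
  move=> _; apply: (L1_mul (C := C)) => //.
  by apply: (measurableT_comp mphi); exact: measurable_funB.
have derf z y : `]x - 1, x + 1[%classic z -> setT y -> derivable (f ^~ y) z 1.
  by move=> _ _; case: (dz z y).
have C0 : 0 <= C by apply: le_trans (phiC 0).
have G0 y : 0 <= C * `|k y| by rewrite mulr_ge0.
have iG : mu.-integrable setT (EFin \o (fun y => C * `|k y|)) by exact: L1Zl (L1_abs lk).
have p1E z y : partial1of2 f z y = k y * psi (z - y).
  by rewrite /partial1of2 derive1E; have D := dz z y; rewrite derive_val.
have Gub z y : `]x - 1, x + 1[%classic z -> setT y -> `|partial1of2 f z y| <= C * `|k y|.
  by move=> _ _; rewrite p1E normrM mulrC ler_wpM2r.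
have D1 := derivable_under_integral measurableT ux intf derf G0 iG Gub.
have D2 := differentiation_under_integral measurableT ux intf derf G0 iG Gub.
have -> : conv k psi x = 'D_1 (conv k phi) x.
  rewrite -derive1E [RHS]D2 /conv.
  by apply: eq_Rintegral => y _; rewrite p1E.
exact: derivableP.
Qed.

Lemma Cn_conv n (k f : R -> R) c d : L1 k -> is_test c d f -> Cn setT n (conv k f).
Proof.
move=> lk; elim: n f => //= n ih f tf.
have [df tf'] := test_derive tf; exists (conv k (derive1 f)); last exact: ih.
move=> x _; have [C1 h1] := test_bounded tf; have [C2 h2] := test_bounded tf'.
apply: (@is_derive_conv k f (derive1 f) (Num.max C1 C2)) => //.
- exact: test_measurable tf.
- by move=> y; rewrite le_max h1.
- by move=> y; rewrite le_max h2 orbT.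
Qed.

Lemma is_derive_primitive f (x : R) : L1 f -> {for x, continuous f} ->
  is_derive x 1 (fun x => \int[mu]_(t in `]-oo, x]) f t) (f x).
Proof.
move=> lf cf.
have lf' : mu.-integrable `]-oo, (x + 1)] (EFin \o f).
  exact: (@integrableS _ _ _ mu setT _ (EFin \o f) measurableT (measurable_itv _) (@subsetT _ _) lf).
have x1 : x < x + 1 by rewrite ltrDl.
have [|D1 D2] := continuous_FTC1 x1 lf' _ cf; first by rewrite ltNyr.
by rewrite -D2 derive1E; exact: derivableP.
Qed.

End smooth.

Section dominated.
Context {R : realType}.
Notation mu := (@lebesgue_measure R).

Lemma Rdominated_cvg (f_ : nat -> R -> R) (f g : R -> R) :
  (forall n, measurable_fun setT (f_ n)) -> measurable_fun setT f ->
  {ae mu, forall x, f_ n x @[n --> \oo] --> f x} ->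
  L1 g -> (forall n x, `|f_ n x| <= g x) ->
  \int[mu]_x f_ n x @[n --> \oo] --> \int[mu]_x f x.
Proof.
move=> mf_ mf ff lg fg.
have mF_ n : measurable_fun setT (EFin \o f_ n) by exact/measurable_EFinP.
have mF : measurable_fun setT (EFin \o f) by exact/measurable_EFinP.
have fF : {ae mu, forall x, setT x -> (EFin \o f_ n) x @[n --> \oo] --> (EFin \o f) x}.
  by apply: (aeS _ ff) => x fx _; apply: cvg_EFin => //; exact: nearW.
have Fg : {ae mu, forall x n, setT x -> (`|(EFin \o f_ n) x| <= (EFin \o g) x)%E}.
  by apply: aeW => x n _; rewrite lee_fin.
have [iF _ D] := @dominated_convergence _ (measurableTypeR R) R mu setT measurableT (fun n => EFin \o f_ n) (EFin \o f) (EFin \o g) mF_ mF fF lg Fg.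
apply: fine_cvg; rewrite fineK; first exact: D.
exact: (integrable_fin_num measurableT iF).
Qed.

End dominated.

(** * Bump functions and a smooth step *)

Section bump.
Context {R : realType}.
Notation mu := (@lebesgue_measure R).

(** As [k] grows these functions tend to the indicator of []c, d[] while staying below 1. *)
Lemma test_flat (k c d : R) : 0 < k ->
  is_test c d (fun x => flat 0 (k * (x - c)) * flat 0 (k * (d - x))).
Proof.
move=> k0; split.
- move=> n; apply: CnM.
    have := @Cn_affine R setT setT n _ k (- (k * c)) (fun _ _ => I) (@Cn_flat R setT n 0).
    by congr Cn; apply/funext => x; rewrite mulrBr.
  have := @Cn_affine R setT setT n _ (- k) (k * d) (fun _ _ => I) (@Cn_flat R setT n 0).
  by congr Cn; apply/funext => x; rewrite mulrBr addrC mulNr.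
- by move=> x xc; rewrite {1}/flat ltNge (ltW _) ?mul0r// pmulr_rlt0// subr_lt0.
- by move=> x xd; rewrite {2}/flat ltNge (ltW _) ?mulr0// pmulr_rlt0// subr_lt0.
Qed.

Lemma flat0_le1 (x : R) : flat 0 x <= 1.
Proof. by have := flat_bound 0 x. Qed.

Definition bump0 (x : R) : R := flat 0 (1 + x) * flat 0 (1 - x).

Lemma test_bump0 : is_test (-1) 1 bump0.
Proof.
have := @test_flat 1 (-1) 1 ltr01; congr is_test.
by apply/funext => x; rewrite !mul1r opprK addrC.
Qed.

Lemma bump0_ge0 x : 0 <= bump0 x.
Proof. by rewrite mulr_ge0 ?flat_ge0. Qed.

Lemma bump0N x : bump0 (- x) = bump0 x.
Proof. by rewrite /bump0 opprK mulrC. Qed.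

Lemma bump0_int_gt0 : 0 < \int[mu]_x bump0 x.
Proof.
(* For $0<x<1/2$ both $1+x$ and $1-x$ are at least $1/2$, so the exponents $-1/(1\pm x)$ add up to
   at least $-4$. *)
apply: (@lt_le_trans _ _ (\int[mu]_x (expR (-4) * rlker (1 : R) (2^-1) x))).
  rewrite RintegralZl//; last exact: L1_rlker.
  rewrite Rintegral_rlker ?invr_gt0//.
apply: le_Rintegral => //; first exact/L1Zl/L1_rlker.
  exact: test_L1 test_bump0.
move=> x _; rewrite /rlker; case: ifPn => [/andP[x0 x1]|_]; last first.
  by rewrite mulr0 bump0_ge0.
rewrite subrr powRr0 mulr1 /bump0 /flat !ifT; [|lra..].
rewrite !expr0 !invr1 !mul1r -expRD ler_expR.
have h (y : R) : 2^-1 <= y -> y^-1 <= 2.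
  by move=> y2; rewrite -[leRHS]invrK lef_pV2 ?posrE ?invr_gt0//; apply: lt_le_trans y2; rewrite invr_gt0.
have h1 : (1 + x)^-1 <= 2 by apply: h; lra.
have h2 : (1 - x)^-1 <= 2 by apply: h; lra.
lra.
Qed.

Definition bump (x : R) : R := (\int[mu]_x bump0 x)^-1 * bump0 x.

Lemma test_bump : is_test (-1) 1 bump.
Proof.
have [h1 h2 h3] := test_bump0; split.
- by move=> n; exact: CnZ.
- by move=> x xc; rewrite /bump h2// mulr0.
- by move=> x xc; rewrite /bump h3// mulr0.
Qed.

Lemma bump_ge0 x : 0 <= bump x.
Proof. by rewrite mulr_ge0 ?bump0_ge0// invr_ge0 ltW// bump0_int_gt0. Qed.

Lemma bumpN x : bump (- x) = bump x.
Proof. by rewrite /bump bump0N. Qed.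

Lemma bump_int : \int[mu]_x bump x = 1.
Proof.
rewrite RintegralZl//; last exact: test_L1 test_bump0.
by rewrite mulVf// gt_eqF// bump0_int_gt0.
Qed.

Lemma primitive_test (c d x : R) f : is_test c d f ->
  is_derive x 1 (fun x : R => \int[mu]_(t in `]-oo, x]) f t) (f x).
Proof.
move=> tf; apply: is_derive_primitive; first exact: test_L1 tf.
exact: (test_continuous tf).
Qed.

Lemma primitive_test_lt (c d x : R) f : is_test c d f -> x < c ->
  \int[mu]_(t in `]-oo, x]) f t = 0.
Proof.
move=> [_ fc _] xc; rewrite (@eq_Rintegral _ _ _ _ _ (cst 0)) ?Rintegral_cst ?mul0r//.
by move=> t; rewrite inE/= in_itv/= => tx; rewrite fc// (le_lt_trans tx).
Qed.

Lemma primitive_test_ge (c d x : R) f : is_test c d f -> d <= x ->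
  \int[mu]_(t in `]-oo, x]) f t = \int[mu]_t f t.
Proof.
move=> [_ _ fd] dx; rewrite Rintegral_mkcond; apply: eq_Rintegral => t _.
rewrite patchE; case: ifPn => //; rewrite notin_setE/= in_itv/= => /negP.
by rewrite -ltNge => xt; rewrite fd// (le_lt_trans dx).
Qed.

Definition step (x : R) : R := \int[mu]_(t in `]-oo, x]) bump t.

Lemma is_derive_step (x : R) : is_derive x 1 step (bump x).
Proof. exact: primitive_test test_bump. Qed.

Lemma step_eq0 x : x < -1 -> step x = 0.
Proof. exact: primitive_test_lt test_bump. Qed.

Lemma step_eq1 x : 1 <= x -> step x = 1.
Proof. by move=> x1; rewrite /step (primitive_test_ge test_bump x1) bump_int. Qed.

Lemma step_ge0 x : 0 <= step x.
Proof. by apply: Rintegral_ge0 => t _; exact: bump_ge0. Qed.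

Lemma step_le1 x : step x <= 1.
Proof.
rewrite -bump_int /step [leLHS]Rintegral_mkcond; apply: le_Rintegral => //.
- by apply: L1_patch => //; exact: test_L1 test_bump.
- exact: test_L1 test_bump.
- by move=> t _; rewrite patchE; case: ifP => // _; exact: bump_ge0.
Qed.

Lemma Cn_step n : Cn setT n step.
Proof.
case: n => //= n; exists bump; first by move=> x _; exact: is_derive_step.
by case: test_bump.
Qed.

End bump.

(** * The fundamental lemma of the calculus of variations *)

Section fundamental_lemma.
Context {R : realType}.
Notation mu := (@lebesgue_measure R).

Lemma cvg_flat0 (u : R) : 0 < u -> flat 0 (n.+1%:R * u) @[n --> \oo] --> (1 : R).
Proof.
move=> u0; rewrite (_ : (fun n => _) = (fun n => expR (- (n.+1%:R^-1 * u^-1)))); last first.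
  by apply/funext => n; rewrite /flat mulr_gt0// expr0 invr1 mul1r invfM.
rewrite -[X in _ --> X]expR0; apply: continuous_cvg; first exact: continuous_expR.
rewrite -[X in _ --> X]oppr0; apply: cvgN.
rewrite -[X in _ --> X](mul0r u^-1); apply: cvgM; [exact: cvg_harmonic|exact: cvg_cst].
Qed.

(** Dominated convergence along the test functions of [test_flat] with [k] going to infinity, which
    tend to the indicator of the interval. *)
Lemma integral_eq0_of_tests (w : R -> R) (s t : R) : L1 w ->
  (forall phi, is_test s t phi -> \int[mu]_x (w x * phi x) = 0) ->
  \int[mu]_(x in `]s, t[) w x = 0.
Proof.
move=> lw wphi.
pose phi (n : nat) x := flat 0 (n.+1%:R * (x - s)) * flat 0 (n.+1%:R * (t - x)).
have tphi n : is_test s t (phi n) by exact: test_flat.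
have phi1 n x : `|phi n x| <= 1.
  rewrite ger0_norm ?mulr_ge0 ?flat_ge0// -[leRHS]mulr1.
  by rewrite ler_pM ?flat_ge0 ?flat0_le1.
have mw := L1_measurable lw.
have cvphi x : phi n x @[n --> \oo] --> (\1_(`]s, t[%classic) x : R).
  rewrite indicE; case: (boolP (x \in _)) => [|/negP xst].
    rewrite inE/= in_itv/= => /andP[sx xt].
    rewrite -[X in _ --> X]mulr1; apply: cvgM; apply: cvg_flat0; rewrite subr_gt0//.
  rewrite (_ : (fun n => phi n x) = cst 0); first exact: cvg_cst.
  apply/funext => n; have [xs|sx] := leP x s.
    by rewrite /phi {1}/flat ltNge pmulr_rle0// subr_le0 xs mul0r.
  have [xt|xt] := ltP x t; first by exfalso; apply: xst; rewrite inE/= in_itv/= sx.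
  by rewrite /phi {2}/flat ltNge pmulr_rle0// subr_le0 xt mulr0.
have mI : measurable_fun setT (fun x => w x * \1_(`]s, t[%classic) x).
  by apply: measurable_funM => //; exact: measurable_indic.
have mw_ n : measurable_fun setT (fun x => w x * phi n x).
  by apply: measurable_funM => //; exact: test_measurable (tphi n).
have cw : {ae mu, forall x, w x * phi n x @[n --> \oo] --> w x * \1_(`]s, t[%classic) x}.
  by apply: aeW => x; apply: cvgM; [exact: cvg_cst|exact: cvphi].
have bw n x : `|w x * phi n x| <= `|w x|.
  by rewrite normrM -[leRHS]mulr1 ler_wpM2l.
have D := Rdominated_cvg mw_ mI cw (L1_abs lw) bw.
rewrite Rintegral_mkcond.
have -> : \int[mu]_x (w \_ `]s, t[) x = \int[mu]_x (w x * \1_(`]s, t[%classic) x).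
  by apply: eq_Rintegral => x _; rewrite patchE indicE; case: ifP => _; rewrite ?mulr1 ?mulr0.
apply/esym; move: D => /cvg_lim <- //; apply/esym/cvg_lim => //.
rewrite (_ : (fun n => _) = cst 0); first exact: cvg_cst.
by apply/funext => n; exact: wphi.
Qed.

Lemma primitive_eq (w : R -> R) (x y : R) : L1 w -> x <= y ->
  \int[mu]_(t in `]x, y[) w t = 0 ->
  \int[mu]_(t in `]-oo, x]) w t = \int[mu]_(t in `]-oo, y]) w t.
Proof.
move=> lw xy w0.
have li (i : interval R) : mu.-integrable [set` i] (EFin \o w).
  exact: (@integrableS _ _ _ mu setT _ (EFin \o w) measurableT (measurable_itv _) (@subsetT _ _) lw).
apply/esym/eqP; rewrite -subr_eq0 Rintegral_itvB//.
by rewrite -Rintegral_itv_bndo_bndc ?w0//.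
Qed.

(** On a compact subinterval the integrals of [v] over all smaller intervals vanish, so its
    primitive is locally constant; Lebesgue's differentiation theorem then gives [v x = 0] at every
    Lebesgue point. *)
Lemma ae_eq0_of_tests (v : R -> R) (a b : R) :
  (forall c d, a < c -> d < b -> mu.-integrable `[c, d] (EFin \o v)) ->
  (forall c d phi, a < c -> d < b -> is_test c d phi ->
    \int[mu]_(x in `]a, b[) (v x * phi x) = 0) ->
  {ae mu, forall x, a < x < b -> v x = 0}.
Proof.
move=> iv vphi.
have main c d : a < c -> d < b -> {ae mu, forall x, c < x < d -> v x = 0}.
  move=> ac db; pose w := v \_ `[c, d].
  have lw : L1 w by apply: (L1_restrict _ _).1 => //; exact: iv.
  have wphi s t phi : c < s -> t < d -> is_test s t phi -> \int[mu]_x (w x * phi x) = 0.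
    move=> cs td tphi.
    have as_ := lt_trans ac cs; have tb := lt_trans td db.
    rewrite -(vphi _ _ _ as_ tb tphi) [RHS]Rintegral_mkcond.
    apply: eq_Rintegral => x _; rewrite /w !patchE.
    have [_ p1 p2] := tphi.
    have [xs|sx] := ltP x s; first by rewrite p1// !mulr0; case: ifP.
    have [tx|xt] := ltP t x; first by rewrite p2// !mulr0; case: ifP.
    rewrite !mem_set//= in_itv/=.
      by rewrite (lt_le_trans as_)//= (le_lt_trans xt).
    by rewrite (le_trans (ltW cs))//= (le_trans xt)// ltW.
  have w0 s t : c < s -> t < d -> \int[mu]_(x in `]s, t[) w x = 0.
    by move=> cs td; apply: integral_eq0_of_tests => // phi; exact: wphi.
  have lloc : locally_integrable setT w.
    by apply: integrable_locally => //; exact: iv.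
  apply: (aeS _ (lebesgue_differentiation lloc)) => x lx /andP[cx xd].
  have lw' : mu.-integrable `]-oo, d] (EFin \o w).
    exact: (@integrableS _ _ _ mu setT _ (EFin \o w) measurableT (measurable_itv _) (@subsetT _ _) lw).
  have [|D1 D2] := FTC1_lebesgue_pt xd lw' _ lx; first by rewrite ltNyr.
  have : is_derive x 1 (fun x : R => \int[mu]_(t in `]-oo, x]) w t) 0.
    apply: (@is_derive_on R [set y | c < y < d] (fun=> \int[mu]_(t in `]-oo, x]) w t)) => //.
    - rewrite (_ : [set _ | _] = `]c, d[%classic); first exact: itv_open.
      by apply/seteqP; split => z /=; rewrite in_itv.
    - by rewrite /= cx xd.
    - move=> y /andP[cy yd].
      have [xy|/ltW yx] := leP x y.
        by apply: primitive_eq => //; apply: w0.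
      by apply/esym; apply: primitive_eq => //; apply: w0.
  move=> D3; have : w x = 0 by rewrite -D2 derive1E derive_val.
  by rewrite /w patchE mem_set//= in_itv/= !ltW.
(* Exhaustion of []a, b[] by countably many compact subintervals; a countable union of null sets is
   null. *)
apply: (aeS (P := fun x => forall n : nat, a + n.+1%:R^-1 < x < b - n.+1%:R^-1 -> v x = 0)).
  move=> x vx /andP[ax xb].
  have : \forall n \near \oo, n.+1%:R^-1 < Num.min (x - a) (b - x).
    by apply: (cvgr_lt (0 : R)); [exact: cvg_harmonic|rewrite lt_min !subr_gt0 ax xb].
  move=> [N _ /(_ N (leqnn _)) /=]; rewrite lt_min => /andP[h1 h2].
  by apply: (vx N); rewrite -ltrBrDl h1/= ltrBrDr -ltrBrDl.
apply/ae_foralln => n; apply: main.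
  by rewrite ltrDl invr_gt0.
by rewrite gtrBl invr_gt0.
Qed.

End fundamental_lemma.

(** * Weak fractional derivatives and the Abel equation *)

Section weak.
Context {R : realType}.
Notation mu := (@lebesgue_measure R).
Implicit Types (a b c d : R) (u v phi f h : R -> R).

Lemma L1_restrict_oo a b f : L1 f -> L1 (f \_ `]a, b[).
Proof. by apply: L1_patch. Qed.

Lemma test_restrict a b c d phi : a < c -> d < b -> is_test c d phi ->
  phi \_ `]a, b[ = phi.
Proof.
move=> ac db [_ pc pd]; apply/funext => x; rewrite patchE; case: ifPn => //.
rewrite notin_setE/= in_itv/= => /negP; rewrite negb_and -!leNgt => /orP[xa|bx].
  by rewrite pc// (le_lt_trans xa).
by rewrite pd// (lt_le_trans db).
Qed.

Lemma test_Cc_smooth a b c d phi : a < c -> d < b -> is_test c d phi ->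
  Cc_smooth a b phi.
Proof.
move=> ac db tphi; have [cphi pc pd] := tphi; split.
  apply/smooth_onP; first exact: itv_open.
  by move=> n; apply: Cn_sub (cphi n).
exists `[c, d]%classic; split.
- exact: segment_compact.
- move=> x /=; rewrite !in_itv/= => /andP[cx xd].
  by rewrite (lt_le_trans ac)//= (le_lt_trans xd).
- move=> x _; rewrite /= in_itv/= => /negP; rewrite negb_and -!ltNge.
  by move=> /orP[/pc//|/pd//].
Qed.

(** The compact set is replaced by the interval from its minimum to its maximum, or by the midpoint
    if it is empty. The extension by zero is smooth because []a, b[] and the complement of [[c, d]]
    are open and cover the line. *)
Lemma Cc_smooth_test a b phi : a < b -> Cc_smooth a b phi ->
  exists c d, [/\ a < c, d < b & is_test c d (phi \_ `]a, b[)].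
Proof.
move=> ab [sphi [K [cK KO K0]]].
have [c [d [ac db Kcd]]] : exists c d, [/\ a < c, d < b & K `<=` `[c, d]].
  have [->|/set0P K1] := eqVneq K set0.
    exists ((a + b) / 2), ((a + b) / 2); split => //; lra.
  have cid : {within K, continuous (id : R -> R)}.
    by apply: continuous_subspaceT => x; exact: cvg_id.
  have [c /set_mem Kc cmin] := compact_EVT_min K1 cK cid.
  have [d /set_mem Kd dmax] := compact_EVT_max K1 cK cid.
  exists c, d; split.
  - by have := KO _ Kc; rewrite /= in_itv/= => /andP[].
  - by have := KO _ Kd; rewrite /= in_itv/= => /andP[].
  - by move=> x Kx; rewrite /= in_itv/= cmin ?dmax// inE.
exists c, d; split => //.
have z x : ~ `[c, d]%classic x -> x \in `]a, b[ -> phi x = 0.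
  by move=> ncd xab; apply: K0 => // /Kcd.
split.
- apply/smooth_onP; first exact: openT.
  have Cin : smooth_on `]a, b[ (phi \_ `]a, b[).
    apply/smooth_onP; first exact: itv_open.
    move=> n; apply: (@Cn_on R _ n phi); first exact: itv_open.
      by move=> x xab; rewrite patchE mem_set.
    by move: n; apply/smooth_onP => //; exact: itv_open.
  have oD : open [set x | x < c \/ d < x].
    by apply: openU; [exact: open_lt|exact: open_gt].
  have Cout : smooth_on [set x | x < c \/ d < x] (phi \_ `]a, b[).
    apply/smooth_onP => // n; apply: (@Cn_on R _ n (fun=> 0)) => //; last exact: Cn_cst.
    move=> x xcd; rewrite patchE; case: ifPn => // /set_mem xab.
    rewrite z// /= in_itv/= => /andP[cx xd].
    by case: xcd => ?; lra.
  move=> n x _; have [xab|xab] := pselect (`]a, b[%classic x); first exact: Cin.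
  apply: Cout; move: xab; rewrite /= in_itv/= => /negP; rewrite negb_and -!leNgt.
  by move=> /orP[xa|bx]; [left|right]; lra.
- move=> x xc; rewrite patchE; case: ifPn => // /set_mem xab.
  by rewrite z// /= in_itv/= leNgt xc.
- move=> x dx; rewrite patchE; case: ifPn => // /set_mem xab.
  by rewrite z// /= in_itv/= (leNgt x) dx andbF.
Qed.

Lemma test_FTC c d phi x y : is_test c d phi -> x < y ->
  \int[mu]_(t in `]x, y[) derive1 phi t = phi y - phi x.
Proof.
move=> tphi xy; have [dphi tphi'] := test_derive tphi.
have lphi' : mu.-integrable `]x, y[ (EFin \o derive1 phi).
  exact: (@integrableS _ _ _ mu setT _ (EFin \o derive1 phi) measurableT (measurable_itv _) (@subsetT _ _) (test_L1 tphi')).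
have lphi2 : mu.-integrable `[x, y[ (EFin \o derive1 phi).
  exact: (@integrableS _ _ _ mu setT _ (EFin \o derive1 phi) measurableT (measurable_itv _) (@subsetT _ _) (test_L1 tphi')).
rewrite Rintegral_itv_obnd_cbnd// Rintegral_itv_bndo_bndc//.
rewrite /Rintegral (@continuous_FTC2 _ _ phi)//.
- by apply: continuous_subspaceT; exact: test_continuous tphi'.
- have cphi := test_continuous tphi; split.
  + by move=> z _; case: (dphi z).
  + by apply: cvg_at_right_filter; exact: cphi.
  + by apply: cvg_at_left_filter; exact: cphi.
Qed.

Lemma conv_rlker1 f (M x : R) : conv f (rlker 1 M) x = \int[mu]_(y in `](x - M), x[) f y.
Proof.
rewrite Rintegral_mkcond; apply: eq_Rintegral => y _.
rewrite /rlker patchE mem_setE in_itv/= subr_gt0 ltrBlDr -ltrBlDl [_ && _]andbC.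
by case: ifP => _; rewrite ?mulr0// subrr powRr0 mulr1.
Qed.

(** Integration by parts: [rlker 1 M] is the indicator of []0, M[], so on []a, b[], which is shorter
    than [M], convolution with it is the primitive from [a]. [conv_swap] puts this primitive on
    [phi']. *)
Lemma integral_test_primitive a b c d v phi (M : R) :
  L1 v -> (forall x, ~ (a < x < b) -> v x = 0) ->
  a < c -> d < b -> b - a < M -> 0 < M -> is_test c d phi ->
  \int[mu]_x (v x * phi x) = - \int[mu]_x (conv v (rlker 1 M) x * derive1 phi x).
Proof.
move=> lv v0 ac db baM M0 tphi.
have [dphi tphi'] := test_derive tphi; have [C phiC] := test_bounded tphi'.
rewrite (conv_swap lv (L1_rlker M ltr01) (test_measurable tphi') phiC).
have lvp : L1 (fun x => v x * phi x).
  have [C2 h2] := test_bounded tphi.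
  exact: (L1_mul lv (test_measurable tphi) h2).
transitivity (- \int[mu]_y (-1 * (v y * phi y))).
  by rewrite RintegralZl// mulN1r opprK.
congr (- _); apply: eq_Rintegral => y _.
have [yab|/negP yab] := boolP (a < y < b); last by rewrite v0// !mul0r mulr0.
have -> : \int[mu]_x (rlker 1 M (x - y) * derive1 phi x) =
  \int[mu]_(x in `]y, (y + M)[) derive1 phi x.
  rewrite [RHS]Rintegral_mkcond; apply: eq_Rintegral => x _.
  rewrite /rlker patchE mem_setE in_itv/= subr_gt0 ltrBlDl.
  by case: ifP => _; rewrite ?mul0r// subrr powRr0 mul1r.
have [_ _ pd] := tphi.
move: yab => /andP[ay yb].
rewrite (test_FTC tphi); last by rewrite ltrDl.
(* Since $M>b-a$ and $y>a$, the point $y+M$ lies beyond the support of [phi]. *)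
by rewrite (pd (y + M)); [rewrite sub0r mulN1r mulrN|lra].
Qed.

Lemma test_derive_int0 c d phi : is_test c d phi -> \int[mu]_x derive1 phi x = 0.
Proof.
move=> tphi; have [_ tphi'] := test_derive tphi; have [_ pc pd] := tphi.
(* [min] and [max] because [is_test] does not order [c] and [d]. *)
pose x := Num.min c d - 1; pose y := Num.max c d + 1.
have xc : x < c by rewrite ltrBlDr gt_min !ltrDl ltr01.
have yd : d < y by rewrite -ltrBlDr lt_max orbC ltrBlDr ltrDl ltr01.
have cd : Num.min c d <= Num.max c d by rewrite ge_min le_max lexx.
have xd : x <= d by rewrite lerBlDr; apply: (@le_trans _ _ d); rewrite ?ge_min ?lexx ?orbT// lerDl.
have xy : x < y by rewrite (le_lt_trans xd).
transitivity (\int[mu]_(t in `]x, y[) derive1 phi t); last first.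
  by rewrite (test_FTC tphi)// (pc x)// (pd y)// subrr.
have [_ pc' pd'] := tphi'.
rewrite [RHS]Rintegral_mkcond; apply: eq_Rintegral => t _.
rewrite patchE; case: ifPn => //; rewrite notin_setE/= in_itv/= => /negP.
rewrite negb_and -!leNgt => /orP[tx|yt].
  by rewrite pc'// (le_lt_trans tx).
by rewrite pd'// (lt_le_trans yd).
Qed.

Lemma test_widen c d c' d' phi : c' <= c -> d <= d' -> is_test c d phi -> is_test c' d' phi.
Proof.
move=> cc dd [p pc pd]; split=> // x h; first by rewrite pc// (lt_le_trans h).
by rewrite pd// (le_lt_trans dd).
Qed.

Lemma testB c d k f g : is_test c d f -> is_test c d g ->
  is_test c d (fun x => f x - k * g x).
Proof.
move=> [f1 f2 f3] [g1 g2 g3]; split.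
- move=> n; have := CnD (f1 n) (CnZ (- k) (g1 n)).
  by congr Cn; apply/funext => x; rewrite mulNr.
- by move=> x xc; rewrite f2// g2// mulr0 subrr.
- by move=> x xd; rewrite f3// g3// mulr0 subrr.
Qed.

(** A primitive of a test function is constant to the right of its support, with value the integral;
    zero mean makes it a test function again. *)
Lemma test_primitive c d f : is_test c d f -> \int[mu]_x f x = 0 ->
  exists2 F, is_test c d F & derive1 F = f.
Proof.
move=> tf f0; pose F (x : R) := \int[mu]_(t in `]-oo, x]) f t.
have dF (x : R) : is_derive x 1 F (f x) by exact: primitive_test tf.
exists F; last by apply/funext => x; have D := dF x; rewrite derive1E derive_val.
have [cf _ _] := tf; split.
- by case=> //= n; exists f.
- by move=> x; exact: primitive_test_lt tf.
- by move=> x xd; rewrite /F (primitive_test_ge tf)// ltW.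
Qed.

Lemma exists_unit_test a b : a < b -> exists c d eta,
  [/\ a < c, d < b, is_test c d eta & \int[mu]_x eta x = 1].
Proof.
(* The rescaled bump is centred at the midpoint and has half-width $1/k=(b-a)/4$. *)
move=> ab; pose k := 4 / (b - a); pose m := (a + b) / 2.
have ba : 0 < b - a by rewrite subr_gt0.
have k0 : 0 < k by rewrite divr_gt0.
have ki : k^-1 = (b - a) / 4 by rewrite invf_div.
have [cb b1 b2] := @test_bump R.
exists (m - k^-1), (m + k^-1), (fun x => k * bump (k * x + (- (k * m)))); split.
- by rewrite ki /m; lra.
- by rewrite ki /m; lra.
- split.
  + move=> n; apply: CnZ; apply: (@Cn_affine R setT setT) => //.
  + move=> x xm; rewrite b1 ?mulr0// -mulrBr mulrC -ltr_pdivlMr// mulN1r.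
    by rewrite ltrBlDr addrC.
  + move=> x xm; rewrite b2 ?mulr0// -mulrBr mulrC -ltr_pdivrMr// mul1r.
    by rewrite ltrBrDr addrC.
- have lb := test_L1 (@test_bump R).
  rewrite RintegralZl//; last exact: (L1_affine _ (lt0r_neq0 k0) lb).
  rewrite (Rintegral_affine _ (lt0r_neq0 k0) (L1_measurable lb)) bump_int.
  by rewrite gtr0_norm// mulr1 divff// gt_eqF.
Qed.

(* du Bois-Reymond: testing against [phi - (int phi) eta], which is the
   derivative of a test function, reduces the claim to [ae_eq0_of_tests]. *)
Lemma ae_cst_of_derive_tests a b h : a < b -> L1 h ->
  (forall c d phi, a < c -> d < b -> is_test c d phi ->
    \int[mu]_x (h x * derive1 phi x) = 0) ->
  exists C, {ae mu, forall x, a < x < b -> h x = C}.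
Proof.
move=> ab lh hphi.
have [c0 [d0 [eta [ac0 d0b teta eta1]]]] := exists_unit_test ab.
pose C := \int[mu]_x (h x * eta x).
exists C; have [Ce he] := test_bounded teta.
have lheta : L1 (fun x => h x * eta x) by exact: (L1_mul lh (test_measurable teta) he).
have lab : mu.-integrable `]a, b[ (EFin \o (cst C : R -> R)).
  apply: (L1_restrict _ (measurable_itv _)).2; apply: (@L1_bounded R _ a b `|C|).
  - by apply/(measurable_restrictT _ _).1.
  - by move=> x; rewrite patchE; case: ifP; rewrite ?normr0.
  - move=> x xab; rewrite patchE memNset//= in_itv/= => /andP[ax xb].
    by apply: xab; rewrite !ltW.
have lhC (i : set R) : measurable i -> i `<=` `]a, b[ ->
    mu.-integrable i (EFin \o (fun x => h x - C)).
  move=> mi iab; apply: (@integrableB _ _ _ mu i mi (EFin \o h) (EFin \o cst C)).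
    exact: (@integrableS _ _ _ mu setT _ (EFin \o h) measurableT mi (@subsetT _ _) lh).
  exact: (@integrableS _ _ _ mu `]a, b[%classic _ _ (measurable_itv _) mi iab lab).
suff: {ae mu, forall x, a < x < b -> h x - C = 0}.
  by apply: aeS => x hx /hx /eqP; rewrite subr_eq0 => /eqP.
apply: ae_eq0_of_tests.
  move=> c d ac db; apply: lhC => // x /=; rewrite !in_itv/= => /andP[cx xd].
  by rewrite (lt_le_trans ac)//= (le_lt_trans xd).
move=> c d phi ac db tphi.
have [Cp hp] := test_bounded tphi.
have lhp : L1 (fun x => h x * phi x) by exact: (L1_mul lh (test_measurable tphi) hp).
pose th := \int[mu]_x phi x.
pose c1 := Num.min c c0; pose d1 := Num.max d d0.
have ac1 : a < c1 by rewrite lt_min ac.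
have d1b : d1 < b by rewrite gt_max db.
have tphi1 : is_test c1 d1 phi by apply: test_widen tphi; rewrite ?ge_min ?le_max ?lexx.
have teta1 : is_test c1 d1 eta by apply: test_widen teta; rewrite ?ge_min ?le_max ?lexx ?orbT.
have tg := testB th tphi1 teta1.
have g0 : \int[mu]_x (phi x - th * eta x) = 0.
  rewrite RintegralB//; [|exact: test_L1 tphi|exact/L1Zl/(test_L1 teta)].
  by rewrite RintegralZl ?eta1 ?mulr1 ?subrr//; exact: test_L1 teta.
have [F tF F'] := test_primitive tg g0.
have := hphi _ _ _ ac1 d1b tF; rewrite F'.
under eq_Rintegral do rewrite mulrBr mulrCA.
rewrite RintegralB//; last exact: L1Zl.
rewrite RintegralZl// => /eqP; rewrite subr_eq0 => /eqP E.
rewrite Rintegral_mkcond.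
transitivity (\int[mu]_x (h x * phi x - C * phi x)).
  apply: eq_Rintegral => x _; rewrite patchE; case: ifPn => [_|]; first by rewrite mulrBl.
  rewrite notin_setE/= in_itv/= => /negP; rewrite negb_and -!leNgt.
  have [_ pc pd] := tphi.
  by move=> /orP[xa|bx]; [rewrite pc ?mulr0 ?subrr// (le_lt_trans xa)|rewrite pd ?mulr0 ?subrr// (lt_le_trans db)].
rewrite RintegralB//; last exact/L1Zl/(test_L1 tphi).
rewrite RintegralZl//; last exact: test_L1 tphi.
by rewrite E mulrC subrr.
Qed.

Lemma eq_conv_lt f g k (b0 x : R) : (forall t, t <= 0 -> k t = 0) ->
  (forall y, y < b0 -> f y = g y) -> x <= b0 -> conv f k x = conv g k x.
Proof.
move=> k0 fg xb; apply: eq_Rintegral => y _.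
have [xy|yx] := leP x y; first by rewrite k0 ?mulr0// subr_le0.
by rewrite fg// (lt_le_trans yx).
Qed.

Lemma ae_eq_conv_lt f g k (b0 x : R) : L1 f -> L1 g -> L1 k ->
  (forall t, t <= 0 -> k t = 0) ->
  {ae mu, forall y, y < b0 -> f y = g y} -> x <= b0 -> conv f k x = conv g k x.
Proof.
move=> lf lg lk k0 fg xb.
have mk : measurable_fun setT (fun y : R => k (x - y)).
  by apply: (measurableT_comp (L1_measurable lk)); exact: measurable_funB.
apply: ae_eq_Rintegral.
- by apply: measurable_funM => //; exact: L1_measurable.
- by apply: measurable_funM => //; exact: L1_measurable.
apply: (aeS _ fg) => y fgy.
have [xy|yx] := leP x y; first by rewrite k0 ?mulr0// subr_le0.
by rewrite fgy// (lt_le_trans yx).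
Qed.

Lemma convDl f1 f2 k x : L1 (fun y => f1 y * k (x - y)) -> L1 (fun y => f2 y * k (x - y)) ->
  conv (fun y => f1 y + f2 y) k x = conv f1 k x + conv f2 k x.
Proof.
move=> l1 l2; rewrite /conv -RintegralD//.
by apply: eq_Rintegral => y _; rewrite mulrDl.
Qed.

Lemma convZl r f k x : L1 (fun y => f y * k (x - y)) ->
  conv (fun y => r * f y) k x = r * conv f k x.
Proof.
move=> l1; rewrite /conv -RintegralZl//.
by apply: eq_Rintegral => y _; rewrite mulrA.
Qed.

Lemma conv_rlkerE (s M x : R) : 0 < s -> s < 1 -> x < M ->
  conv (rlker (1 - s) M) (rlker s M) x = betac s * rlker 1 M x.
Proof.
move=> s0 s1 xM; have [x0|x0] := leP x 0.
  by rewrite conv_rlker_le0// rlker_le0// mulr0.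
by rewrite conv_rlker// rlkerE// subrr powRr0 mulr1.
Qed.

(** By associativity. Only $y>a$ contributes, so for $x<a+M$ the argument $x-y$ stays below [M],
    where $k_1*k_2$ is the multiple [B] of the indicator. *)
Lemma conv_conv_cst f k1 k2 M a B : L1 f -> L1 k1 -> L1 k2 ->
  (forall y, y <= a -> f y = 0) ->
  (forall x, x < M -> conv k1 k2 x = B * rlker 1 M x) ->
  {ae mu, forall x, x < a + M -> conv (conv f k1) k2 x = B * conv f (rlker 1 M) x}.
Proof.
move=> lf lk1 lk2 f0 kB.
apply: (aeS2 _ (convA lf lk1 lk2) (conv_ae_L1 lf (L1_rlker M ltr01))) => x -> l1 xaM.
rewrite /conv -RintegralZl//; apply: eq_Rintegral => y _.
have [ya|ay] := leP y a; first by rewrite f0// !mul0r mulr0.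
by rewrite -/(conv _ _ _) kB 1?mulrCA//; lra.
Qed.

(* The Abel kernels [t^(s-1)] and [t^(-s)] convolve to a constant on the
   half-line, so composing the two convolutions is a primitive. *)
Lemma abel f s M a : 0 < s -> s < 1 -> L1 f -> (forall y, y <= a -> f y = 0) ->
  {ae mu, forall x, x < a + M ->
    conv (conv f (rlker (1 - s) M)) (rlker s M) x = betac s * conv f (rlker 1 M) x}.
Proof.
move=> s0 s1 lf f0; apply: conv_conv_cst => //.
- by apply: L1_rlker; rewrite subr_gt0.
- exact: L1_rlker.
- by move=> x; exact: conv_rlkerE.
Qed.

Lemma abel_sym f s M a : 0 < s -> s < 1 -> L1 f -> (forall y, y <= a -> f y = 0) ->
  {ae mu, forall x, x < a + M ->
    conv (conv f (rlker s M)) (rlker (1 - s) M) x = betac s * conv f (rlker 1 M) x}.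
Proof.
move=> s0 s1 lf f0; apply: conv_conv_cst => //.
- exact: L1_rlker.
- by apply: L1_rlker; rewrite subr_gt0.
- move=> x xM; rewrite convC; [exact: conv_rlkerE|exact: measurable_rlker..].
Qed.

(** A vanishing primitive gives vanishing integrals against all test functions, by
    [integral_test_primitive]. *)
Lemma ae_eq0_of_conv1 f M a b : a < b -> b - a < M -> L1 f ->
  {ae mu, forall x, a < x < b -> conv (f \_ `]a, b[) (rlker 1 M) x = 0} ->
  {ae mu, forall x, a < x < b -> f x = 0}.
Proof.
move=> ab baM lf f0; have M0 : 0 < M by lra.
have lf' := L1_restrict_oo a b lf.
apply: ae_eq0_of_tests.
  move=> c d _ _.
  exact: (@integrableS _ _ _ mu setT _ (EFin \o f) measurableT (measurable_itv _) (@subsetT _ _) lf).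
move=> c d phi ac db tphi; rewrite Rintegral_mkcond.
transitivity (\int[mu]_x ((f \_ `]a, b[) x * phi x)).
  by apply: eq_Rintegral => x _; rewrite !patchE; case: ifP; rewrite ?mul0r.
rewrite (integral_test_primitive lf' _ ac db baM M0 tphi); last first.
  by move=> x xab; rewrite patchE memNset//= in_itv.
have [_ tphi'] := test_derive tphi; have [_ pc pd] := tphi'.
apply/eqP; rewrite oppr_eq0; apply/eqP.
transitivity (\int[mu]_x (0 : R)); last by rewrite Rintegral_cst// mul0r.
apply: ae_eq_Rintegral => //.
  apply: measurable_funM; last exact: test_measurable tphi'.
  exact: L1_measurable (L1_conv lf' (L1_rlker M ltr01)).
apply: (aeS _ f0) => x fx.
have [xc|cx] := ltP x c; first by rewrite pc ?mulr0.
have [dx|xd] := ltP d x; first by rewrite pd ?mulr0.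
by rewrite fx ?mul0r// (lt_le_trans ac)//= (le_lt_trans xd).
Qed.

(** Uniqueness for Abel's equation: a second convolution, with the complementary kernel, turns the
    hypothesis into the vanishing of the primitive of [f]. *)
Lemma abel_inj f s M a b : 0 < s -> s < 1 -> a < b -> b - a < M -> L1 f ->
  (forall y, y <= a -> f y = 0) ->
  {ae mu, forall x, a < x < b -> conv f (rlker (1 - s) M) x = 0} ->
  {ae mu, forall x, a < x < b -> f x = 0}.
Proof.
move=> s0 s1 ab baM lf fa f0.
have s1' : 0 < 1 - s by rewrite subr_gt0.
have lg := L1_restrict_oo a b lf.
have ga y : y <= a -> (f \_ `]a, b[) y = 0.
  by move=> ya; rewrite patchE memNset//= in_itv/= ltNge ya.
have fg y : y < b -> (f \_ `]a, b[) y = f y.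
  move=> yb; have [ya|ay] := leP y a; first by rewrite ga// fa.
  by rewrite patchE mem_set//= in_itv/= ay.
have kl (s' : R) t : t <= 0 -> rlker s' M t = 0 by exact: rlker_le0.
have cE x : x <= b -> conv (f \_ `]a, b[) (rlker (1 - s) M) x = conv f (rlker (1 - s) M) x.
  exact: (eq_conv_lt (kl _) fg).
apply: (ae_eq0_of_conv1 ab baM lf).
(* The hypothesis is known only before [b], but so is everything that a convolution sees at a point
   [x <= b]. *)
apply: (aeS _ (abel M s0 s1 lg ga)) => x /[swap] /andP[ax xb] h.
apply: (mulfI (lt0r_neq0 (betac_gt0 s0 s1))); rewrite mulr0 -h; last by lra.
transitivity (conv (fun=> 0) (rlker s M) x); last first.
  rewrite /conv (_ : (fun y => _) = cst 0) ?Rintegral_cst ?mul0r//.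
  by apply/funext => y; rewrite mul0r.
apply: (@ae_eq_conv_lt _ _ _ b) => //.
- exact: L1_conv lg (L1_rlker M s1').
- exact: integrable0.
- exact: L1_rlker.
- exact: kl.
- apply: (aeS _ f0) => y fy yb; rewrite cE ?ltW//.
  have [ya|ay] := leP y a; last by rewrite fy// ay.
  rewrite /conv (_ : (fun y0 => _) = cst 0) ?Rintegral_cst ?mul0r//.
  apply/funext => z; have [za|az] := leP z a; first by rewrite fa// mul0r.
  by rewrite rlker_le0 ?mulr0// subr_le0 (le_trans ya)// ltW.
- exact: ltW.
Qed.

Lemma L1_reflect0 (k : R -> R) : L1 k -> L1 (fun t => k (- t)).
Proof.
move=> lk; have N1 : (-1 : R) != 0 by rewrite oppr_eq0 oner_neq0.
have := L1_affine 0 N1 lk; apply: eq_integrable => // x _ /=.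
by rewrite mulN1r addr0.
Qed.

(** On []a, b[] the right fractional integral is the convolution with the reflected kernel, since
    the truncation at $M>b-a$ is not felt there; the derivative can therefore be taken on the test
    function. *)
Lemma is_derive_fracI_plus a b alpha M c d phi x : 0 < alpha -> alpha < 1 ->
  b - a < M -> a < c -> d < b -> is_test c d (phi \_ `]a, b[) -> a < x -> x < b ->
  is_derive x 1 (fracI a b Fplus (1 - alpha) phi) ((Gamma (1 - alpha))^-1 *
     \int[mu]_y (rlker (1 - alpha) M (y - x) * derive1 (phi \_ `]a, b[) y)).
Proof.
move=> a0 a1 baM ac db tphi ax xb; set psi := phi \_ _.
have a1' : 0 < 1 - alpha by rewrite subr_gt0.
pose k t := rlker (1 - alpha) M (- t).
have lk : L1 k by exact: L1_reflect0 (L1_rlker M a1').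
have mk := L1_measurable lk.
have [dpsi tpsi'] := test_derive tphi.
have [C hC] := test_bounded tphi; have [C' hC'] := test_bounded tpsi'.
have D : is_derive x 1 (conv k psi) (conv k (derive1 psi) x).
  apply: (@is_derive_conv R k psi (derive1 psi) (Num.max C C')) => //.
  - exact: test_measurable tphi.
  - by move=> y; rewrite le_max hC.
  - by move=> y; rewrite le_max hC' orbT.
have fE y : `]a, b[%classic y -> (Gamma (1 - alpha))^-1 * conv k psi y = fracI a b Fplus (1 - alpha) phi y.
  rewrite /= in_itv/= => /andP[ay yb]; rewrite /fracI; congr (_ * _).
  rewrite convC//; last exact: test_measurable tphi.
  rewrite [RHS]Rintegral_mkcond; apply: eq_Rintegral => z _.
  rewrite /k opprB patchE mem_setE in_itv/=.
  have [zy|yz] := leP z y; first by rewrite rlker_le0 ?mulr0// subr_le0.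
  rewrite /psi patchE mem_setE in_itv/= (lt_trans ay yz)/=.
  case: ifPn => zb; last by rewrite mul0r.
  rewrite rlkerE ?subr_gt0//; last by lra.
  by rewrite -powRN opprB.
have D2 := is_deriveZ (Gamma (1 - alpha))^-1 D.
have xab : `]a, b[%classic x by rewrite /= in_itv/= ax.
have oO : open `]a, b[%classic by exact: itv_open.
have D3 := is_derive_on oO xab fE D2.
apply: (is_derive_eq D3); apply: (congr1 (fun z => (Gamma (1 - alpha))^-1 * z)).
rewrite convC//; last exact: test_measurable tpsi'.
by apply: eq_Rintegral => y _; rewrite /k opprB mulrC.
Qed.

Lemma fracD_plus_test a b alpha M c d phi x : 0 < alpha -> alpha < 1 ->
  b - a < M -> a < c -> d < b -> is_test c d (phi \_ `]a, b[) -> a < x -> x < b ->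
  fracD a b Fplus alpha phi x =
  - ((Gamma (1 - alpha))^-1 *
     \int[mu]_y (rlker (1 - alpha) M (y - x) * derive1 (phi \_ `]a, b[) y)).
Proof.
move=> a0 a1 baM ac db tphi ax xb; rewrite /fracD; congr (- _).
have [_ D] := is_derive_fracI_plus a0 a1 baM ac db tphi ax xb.
by rewrite derive1E; exact: D.
Qed.

Lemma conv_bounded k f C x : L1 k -> measurable_fun setT f -> (forall y, `|f y| <= C) ->
  `|conv k f x| <= C * \int[mu]_y `|k y|.
Proof.
move=> lk mf fC.
have mfx : measurable_fun setT (fun y : R => f (x - y)).
  by apply: (measurableT_comp mf); exact: measurable_funB.
have l1 := L1_mul lk mfx (fun y => fC (x - y)).
apply: (le_trans (le_normr_Rintegral measurableT l1)).
rewrite -RintegralZl//; last exact: L1_abs.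
apply: le_Rintegral => //; [exact: L1_abs|exact/L1Zl/L1_abs|].
by move=> y _; rewrite normrM mulrC ler_wpM2r.
Qed.

(** Fractional integration by parts: the adjoint of the right fractional integral is the left one,
    so the kernel moves from [phi'] to [u]. *)
Lemma integral_mul_fracD_plus a b alpha M c d u phi : 0 < alpha -> alpha < 1 ->
  b - a < M -> a < c -> d < b -> is_test c d (phi \_ `]a, b[) -> L1 (u \_ `]a, b[) ->
  \int[mu]_(x in `]a, b[) (u x * fracD a b Fplus alpha phi x) =
  - ((Gamma (1 - alpha))^-1 * \int[mu]_x (conv (u \_ `]a, b[) (rlker (1 - alpha) M) x *
     derive1 (phi \_ `]a, b[) x)).
Proof.
move=> a0 a1 baM ac db tphi lu; set psi := phi \_ _; set G := (Gamma _)^-1.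
have a1' : 0 < 1 - alpha by rewrite subr_gt0.
have [dpsi tpsi'] := test_derive tphi.
have [C' hC'] := test_bounded tpsi'.
have lk := L1_rlker M a1'.
have mpsi := test_measurable tpsi'.
rewrite (conv_swap lu lk mpsi hC').
pose k t := rlker (1 - alpha) M (- t).
have lk' : L1 k by exact: L1_reflect0.
have innerE y : \int[mu]_x (rlker (1 - alpha) M (x - y) * derive1 psi x) = conv k (derive1 psi) y.
  rewrite convC//; last exact: L1_measurable lk'.
  by apply: eq_Rintegral => x _; rewrite /k opprB mulrC.
have lui : L1 (fun y => (u \_ `]a, b[) y * \int[mu]_x (rlker (1 - alpha) M (x - y) * derive1 psi x)).
  apply: (L1_mul (C := C' * \int[mu]_y `|k y|)) => //.
    apply: (eq_measurable_fun (conv k (derive1 psi))) => [y _|]; first by rewrite innerE.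
    exact: L1_measurable (L1_conv lk' (test_L1 tpsi')).
  by move=> y; rewrite innerE; exact: conv_bounded.
rewrite -mulNr -RintegralZl// Rintegral_mkcond; apply: eq_Rintegral => y _.
rewrite !patchE; case: ifPn => [yO|_]; last by rewrite mul0r mulr0.
have /andP[ay yb] : a < y < b by move: yO; rewrite inE/= in_itv.
rewrite (fracD_plus_test a0 a1 baM ac db tphi ay yb) -/G -/psi.
by rewrite mulNr mulrN mulrCA.
Qed.

(** Both sides of the weak identity are written against [phi']. The identity thus says that the left
    integral of [u] of order $1-\alpha$ and the primitive of [v] have the same distributional
    derivative. *)
Lemma weak_minus_testP a b alpha M u v : a < b -> 0 < alpha -> alpha < 1 -> b - a < M ->
  L1 (u \_ `]a, b[) -> L1 (v \_ `]a, b[) ->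
  is_weak_fracD a b Fminus alpha u v <->
  (forall c d phi, a < c -> d < b -> is_test c d phi ->
    \int[mu]_x (((Gamma (1 - alpha))^-1 * conv (u \_ `]a, b[) (rlker (1 - alpha) M) x
       - conv (v \_ `]a, b[) (rlker 1 M) x) * derive1 phi x) = 0).
Proof.
move=> ab a0 a1 baM lu lv; set G := (Gamma _)^-1.
have M0 : 0 < M by lra.
have a1' : 0 < 1 - alpha by rewrite subr_gt0.
have lcu := L1_conv lu (L1_rlker M a1'); have lcv := L1_conv lv (@L1_rlker R 1 M ltr01).
have key c d phi : a < c -> d < b -> is_test c d (phi \_ `]a, b[) ->
  \int[mu]_x ((G * conv (u \_ `]a, b[) (rlker (1 - alpha) M) x
       - conv (v \_ `]a, b[) (rlker 1 M) x) * derive1 (phi \_ `]a, b[) x) =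
  \int[mu]_(x in `]a, b[) (v x * phi x) -
  \int[mu]_(x in `]a, b[) (u x * fracD a b Fplus alpha phi x).
  move=> ac db tphi; have [_ tpsi'] := test_derive tphi.
  have [C' hC'] := test_bounded tpsi'; have mpsi := test_measurable tpsi'.
  rewrite (integral_mul_fracD_plus a0 a1 baM ac db tphi lu) opprK.
  have -> : \int[mu]_(x in `]a, b[) (v x * phi x) =
      \int[mu]_x ((v \_ `]a, b[) x * (phi \_ `]a, b[) x).
    rewrite Rintegral_mkcond; apply: eq_Rintegral => x _.
    by rewrite !patchE; case: ifP => _; rewrite ?mulr0.
  rewrite (integral_test_primitive lv _ ac db baM M0 tphi); last first.
    by move=> x xab; rewrite patchE memNset//= in_itv.
  have lcup := L1_mul lcu mpsi hC'; have lcvp := L1_mul lcv mpsi hC'.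
  rewrite [RHS]addrC -[X in _ = X + _](@RintegralZl _ _ _ mu setT _ G measurableT lcup).
  rewrite -(@RintegralB _ _ _ mu setT _ _ measurableT (L1Zl G lcup) lcvp).
  by apply: eq_Rintegral => x _; rewrite mulrBl mulrA.
split.
  move=> [_ _ H] c d phi ac db tphi.
  have E := test_restrict ac db tphi; rewrite -E in tphi *.
  rewrite (key c d)// -[X in _ - X]H ?subrr//.
  by rewrite E in tphi; apply: test_Cc_smooth tphi.
move=> H; split.
- exact: (L1_restrict _ (measurable_itv _)).2.
- split.
  + have := L1_measurable lv.
    by move/(measurable_restrictT _ (measurable_itv _)).2.
  + exact: itv_open.
  + move=> K Kab cK; have mK := compact_measurable cK.
    have : mu.-integrable K (EFin \o v).
      apply: (@integrableS _ _ _ mu `]a, b[%classic K (EFin \o v) (measurable_itv _) mK Kab).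
      exact: (L1_restrict _ (measurable_itv _)).2.
    by move/integrableP => [].
- move=> phi /(Cc_smooth_test ab)[c [d [ac db tphi]]].
  by apply/eqP; rewrite -subr_eq0 -(key c d)// (H c d).
Qed.

(* By the Beta-Gamma identity this is [1 / Gamma alpha]; only the fact that it
   inverts the Abel convolution matters. *)
Definition rlconst (alpha : R) : R := Gamma (1 - alpha) / betac alpha.

(** The left fractional integral of order $\alpha$, as a function on the line. Truncation at
    [2 * (b - a)] leaves it untouched up to and including the point [b], so a trace there is a plain
    value. *)
Definition rlJ a b (alpha : R) v (x : R) : R :=
  rlconst alpha * conv (v \_ `]a, b[) (rlker alpha (2 * (b - a))) x.

Lemma rlconst_gt0 (alpha : R) : 0 < alpha -> alpha < 1 -> 0 < rlconst alpha.
Proof.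
move=> a0 a1; rewrite divr_gt0 ?betac_gt0// Gamma_gt0 ?subr_gt0//.
by rewrite gtrBl.
Qed.

Section rep.
Context a b (alpha : R) (ab : a < b) (a0 : 0 < alpha) (a1 : alpha < 1).
Local Notation M := (2 * (b - a)).
Local Notation G := ((Gamma (1 - alpha))^-1).
Local Notation O := (`]a, b[%classic).

Let baM : b - a < M. Proof. by rewrite mulr_natl mulr2n ltrDl subr_gt0. Qed.
Let a1' : 0 < 1 - alpha. Proof. by rewrite subr_gt0. Qed.
Let G0 : 0 < G. Proof. by rewrite invr_gt0 Gamma_gt0// gtrBl. Qed.
Let B0 : 0 < betac alpha. Proof. exact: betac_gt0. Qed.
Let GJ : G * (rlconst alpha * betac alpha) = 1.
Proof.
by rewrite /rlconst mulfVK ?gt_eqF// mulVf// gt_eqF// Gamma_gt0// gtrBl.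
Qed.

Lemma rlJ_le0 v x : x <= a -> rlJ a b alpha v x = 0.
Proof.
move=> xa; rewrite /rlJ /conv (_ : (fun y => _) = cst 0) ?Rintegral_cst ?mul0r ?mulr0//.
apply/funext => y; rewrite patchE; case: ifPn => [/set_mem|_]; last by rewrite mul0r.
by rewrite /= in_itv/= => /andP[ay _]; rewrite rlker_le0 ?mulr0// subr_le0 (le_trans xa)// ltW.
Qed.

(** The fractional integral of order $1-\alpha$ turns the singular term into a constant, by
    [conv_rlker], and the potential into the primitive of [v], by [abel_sym] and [GJ]. *)
Lemma conv_rep_ae C v : L1 (v \_ O) ->
  {ae mu, forall x, a < x < b ->
    G * conv (fun y => C * rlker alpha M (y - a) + rlJ a b alpha v y) (rlker (1 - alpha) M) x =
    G * C * betac alpha + conv (v \_ O) (rlker 1 M) x}.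
Proof.
move=> lv.
have lk1 := L1_rlker M a1'; have lk := L1_rlker M a0.
have va y : y <= a -> (v \_ O) y = 0.
  by move=> ya; rewrite patchE memNset//= in_itv/= ltNge ya.
have lka : L1 (fun y => rlker alpha M (y - a)).
  have := L1_affine (- a) (oner_neq0 R) lk.
  by apply: eq_integrable => // x _ /=; rewrite mul1r.
have lJ : L1 (rlJ a b alpha v) by apply: L1Zl; exact: L1_conv.
have lJ0 := L1_conv lv lk.
apply: (aeS2 _ (abel_sym M a0 a1 lv va)
  (aeS2 (fun x p q => conj p q) (conv_ae_L1 lka lk1) (conv_ae_L1 lJ0 lk1))) => x hx [l1 l2] /andP[ax xb].
have e1 : L1 (fun y => C * rlker alpha M (y - a) * rlker (1 - alpha) M (x - y)).
  by have := L1Zl C l1; apply: eq_integrable => // y _ /=; rewrite mulrA.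
have e2 : L1 (fun y => rlJ a b alpha v y * rlker (1 - alpha) M (x - y)).
  by have := L1Zl (rlconst alpha) l2; apply: eq_integrable => // y _ /=; rewrite mulrA.
have xM : x < a + M by rewrite -ltrBlDl (lt_trans _ baM)// ltrD2r.
have eJ : conv (fun y => rlJ a b alpha v y) (rlker (1 - alpha) M) x =
    rlconst alpha * (betac alpha * conv (v \_ O) (rlker 1 M) x).
  by rewrite -(hx xM); exact: (convZl (rlconst alpha) l2).
rewrite (convDl e1 e2) (convZl C l1) eJ.
have -> : conv (fun y => rlker alpha M (y - a)) (rlker (1 - alpha) M) x = betac alpha.
  have xa0 : 0 < x - a by rewrite subr_gt0.
  have xaM : x - a < M by rewrite (lt_trans _ baM)// ltrD2r.
  rewrite -(conv_rlker a0 a1 xa0 xaM).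
  rewrite [RHS](convC _ (measurable_rlker _ _) (measurable_rlker _ _)).
  rewrite /conv -(@Rintegral_shift R (fun y => rlker alpha M y * rlker (1 - alpha) M (x - a - y)) a).
    by apply: eq_Rintegral => y _; congr (_ * rlker _ _ _); rewrite opprB addrA subrK.
  apply: measurable_funM; first exact: measurable_rlker.
  by apply: (measurableT_comp (measurable_rlker _ _)); exact: measurable_funB.
move: GJ; move: (conv _ (rlker 1 M) x) (betac alpha) (rlconst alpha) G => V B r g E.
by rewrite mulrDr; congr (_ + _); [rewrite mulrA|rewrite (mulrA r) (mulrA g) E mul1r].
Qed.

Lemma L1_rlJ v : L1 (v \_ O) -> L1 (rlJ a b alpha v).
Proof. by move=> lv; apply: L1Zl; apply: L1_conv => //; exact: L1_rlker. Qed.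

Lemma rlker_shift_powR x : a < x -> x < b -> rlker alpha M (x - a) = (x - a) `^ (alpha - 1).
Proof. by move=> ax xb; apply: rlkerE; [rewrite subr_gt0|lra]. Qed.

(* u = C (x - a)^(alpha - 1) + J v is the general solution of the Abel
   equation G K u = const + int v to which the weak equation reduces. *)
Lemma weak_minusP u v : L1 (u \_ O) -> L1 (v \_ O) ->
  is_weak_fracD a b Fminus alpha u v <->
  exists C, {ae mu, forall x, a < x < b ->
    u x = C * (x - a) `^ (alpha - 1) + rlJ a b alpha v x}.
Proof.
move=> lu lv; rewrite (weak_minus_testP ab a0 a1 baM lu lv).
have lk1 := L1_rlker M a1'; have lk := L1_rlker M a0.
have lka : L1 (fun y => rlker alpha M (y - a)).
  have := L1_affine (- a) (oner_neq0 R) lk.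
  by apply: eq_integrable => // x _ /=; rewrite mul1r.
have lJ := L1_rlJ lv.
have lr C : L1 (fun y => C * rlker alpha M (y - a) + rlJ a b alpha v y).
  by apply: L1D => //; exact: L1Zl.
have ua y : y <= a -> (u \_ O) y = 0.
  by move=> ya; rewrite patchE memNset//= in_itv/= ltNge ya.
have ra C y : y <= a -> C * rlker alpha M (y - a) + rlJ a b alpha v y = 0.
  by move=> ya; rewrite rlJ_le0// rlker_le0 ?subr_le0// mulr0 addr0.
have kl (s' : R) t : t <= 0 -> rlker s' M t = 0 by exact: rlker_le0.
split.
  have lh : L1 (fun x => G * conv (u \_ O) (rlker (1 - alpha) M) x - conv (v \_ O) (rlker 1 M) x).
    by apply: L1B; [apply: L1Zl; exact: L1_conv|apply: L1_conv => //; exact: L1_rlker].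
  move=> /(ae_cst_of_derive_tests ab lh)[C0 hC0].
  (* Chosen so that the constant produced by [conv_rep_ae] is the [C0] of the du Bois-Reymond
     lemma. *)
  pose C := C0 / (G * betac alpha); exists C.
  have CE : G * C * betac alpha = C0.
    by rewrite mulrAC mulrC /C mulfVK// mulf_neq0 ?gt_eqF.
  have lur : L1 (fun x => (u \_ O) x - (C * rlker alpha M (x - a) + rlJ a b alpha v x)).
    exact: L1B.
  have : {ae mu, forall x, a < x < b ->
      (u \_ O) x - (C * rlker alpha M (x - a) + rlJ a b alpha v x) = 0}.
    (* The difference between [u] and the candidate has zero fractional integral on []a, b[]. *)
    apply: (@abel_inj _ alpha M a b) => //.
      by move=> y ya; rewrite ua// ra// subrr.
    apply: (aeS2 _ (aeS2 (fun x p q => conj p q) hC0 (conv_rep_ae C lv))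
      (aeS2 (fun x p q => conj p q) (conv_ae_L1 lu lk1) (conv_ae_L1 (lr C) lk1))).
    move=> x [h1 h2] [l1 l2] xab; apply: (mulfI (lt0r_neq0 G0)); rewrite mulr0.
    have -> : conv (fun x => (u \_ O) x - (C * rlker alpha M (x - a) + rlJ a b alpha v x))
        (rlker (1 - alpha) M) x = conv (u \_ O) (rlker (1 - alpha) M) x -
        conv (fun y => C * rlker alpha M (y - a) + rlJ a b alpha v y) (rlker (1 - alpha) M) x.
      by rewrite /conv -RintegralB//; apply: eq_Rintegral => y _; rewrite mulrBl.
    rewrite mulrBr (h2 xab) CE -(h1 xab); set A := G * _; set V := conv _ (rlker 1 M) x.
    by rewrite subrK subrr.
  apply: aeS => x /[swap] xab /(_ xab) /eqP; rewrite subr_eq0 => /eqP.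
  have /andP[ax xb] := xab.
  by rewrite patchE mem_set ?rlker_shift_powR//= in_itv.
move=> [C hC] c d phi ac db tphi.
have [_ tphi'] := test_derive tphi; have [C' hC'] := test_bounded tphi'.
have mphi' := test_measurable tphi'.
(* Conversely the two terms differ by a constant, which integrates to 0 against the derivative of a
   test function. *)
transitivity (\int[mu]_x (G * C * betac alpha * derive1 phi x)); last first.
  by rewrite RintegralZl ?(test_derive_int0 tphi) ?mulr0//; exact: test_L1 tphi'.
apply: ae_eq_Rintegral.
- apply: measurable_funM => //; apply: L1_measurable; apply: L1B.
    by apply: L1Zl; exact: L1_conv.
  by apply: L1_conv => //; exact: L1_rlker.
- exact: measurable_funM.
apply: (aeS _ (conv_rep_ae C lv)) => x hx.
have [_ pc pd] := tphi'.
have [xc|cx] := ltP x c; first by rewrite pc ?mulr0.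
have [dx|xd] := ltP d x; first by rewrite pd ?mulr0.
have xab : a < x < b by rewrite (lt_le_trans ac)//= (le_lt_trans xd).
congr (_ * _); have -> : conv (u \_ O) (rlker (1 - alpha) M) x =
  conv (fun y => C * rlker alpha M (y - a) + rlJ a b alpha v y) (rlker (1 - alpha) M) x.
  apply: (ae_eq_conv_lt lu (lr C) lk1 (kl _)); last by have /andP[_ /ltW] := xab; apply.
  apply: (aeS _ hC) => y hy yb.
  have [ya|ay] := leP y a; first by rewrite ua// ra.
  have yab : a < y < b by rewrite ay.
  have yO : O y by rewrite /= in_itv.
  by rewrite patchE (mem_set yO) (hy yab) rlker_shift_powR.
by rewrite hx// addrK.
Qed.

End rep.

Lemma weak_fracD_unique a b (s : side) (alpha : R) u v1 v2 :
  is_weak_fracD a b s alpha u v1 -> is_weak_fracD a b s alpha u v2 ->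
  {ae mu, forall x, a < x < b -> v1 x = v2 x}.
Proof.
move=> [_ [m1 _ l1] h1] [_ [m2 _ l2] h2].
have iv v : measurable_fun `]a, b[ v ->
    (forall K, K `<=` `]a, b[%classic -> compact K -> (\int[mu]_(x in K) `|v x|%:E < +oo)%E) ->
    forall c d, a < c -> d < b -> mu.-integrable `[c, d] (EFin \o v).
  move=> mv lv c d ac db.
  have cdab : `[c, d]%classic `<=` `]a, b[%classic.
    move=> x /=; rewrite !in_itv/= => /andP[cx xd].
    by rewrite (lt_le_trans ac)//= (le_lt_trans xd).
  apply/integrableP; split; last by apply: lv => //; exact: segment_compact.
  by apply/measurable_EFinP; apply: measurable_funS mv.
have i1 := iv _ m1 l1; have i2 := iv _ m2 l2.
suff : {ae mu, forall x, a < x < b -> v1 x - v2 x = 0}.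
  by apply: aeS => x hx /hx /eqP; rewrite subr_eq0 => /eqP.
have lp v phi c d : (forall c d, a < c -> d < b -> mu.-integrable `[c, d] (EFin \o v)) ->
    a < c -> d < b -> is_test c d phi -> L1 ((fun x => v x * phi x) \_ `]a, b[).
  move=> i ac db tphi; have [C hC] := test_bounded tphi.
  have lv : L1 (v \_ `[c, d]) by apply: (L1_restrict _ (measurable_itv _)).1; exact: i.
  have := L1_mul lv (test_measurable tphi) hC; apply: eq_integrable => // x _ /=.
  rewrite !patchE; have [_ pc pd] := tphi; congr (_%:E).
  have [xc|cx] := ltP x c; first by rewrite pc// !mulr0; case: ifP.
  have [dx|xd] := ltP d x; first by rewrite pd// !mulr0; case: ifP.
  rewrite !mem_set//= in_itv/= ?cx//.
  by rewrite (lt_le_trans ac)//= (le_lt_trans xd).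
apply: ae_eq0_of_tests.
  move=> c d ac db; exact: (@integrableB _ _ _ mu _ (measurable_itv _) _ _ (i1 c d ac db) (i2 c d ac db)).
move=> c d phi ac db tphi.
have Cphi : Cc_smooth a b phi by exact: test_Cc_smooth tphi.
under eq_Rintegral do rewrite mulrBl.
rewrite RintegralB//.
- by rewrite (h1 _ Cphi) (h2 _ Cphi) subrr.
- by apply: (L1_restrict _ (measurable_itv _)).2; exact: lp tphi.
- by apply: (L1_restrict _ (measurable_itv _)).2; exact: lp tphi.
Qed.

End weak.

(** * The spaces L^p *)

Definition Lp (R : realType) (p : R) (f : R -> R) : Prop :=
  measurable_fun setT f /\ L1 (fun x => `|f x| `^ p).

(** The $p$-th power of the norm. Convergence to 0 and Cauchy conditions are the same for it, and no
    root or Minkowski inequality is involved. *)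
Definition Np (R : realType) (p : R) (f : R -> R) : R :=
  \int[lebesgue_measure]_x (`|f x| `^ p).

Section Lp.
Context {R : realType} (p : R) (p1 : 1 < p).
Notation mu := (@lebesgue_measure R).
Implicit Types (a b c d : R) (u v f g h : R -> R).

Let p0 : 0 < p. Proof. exact: lt_trans p1. Qed.
Let p0' : 0 <= p. Proof. exact: ltW. Qed.
Let pN0 : p != 0. Proof. exact: lt0r_neq0. Qed.

Lemma Np_ge0 f : 0 <= Np p f.
Proof. by apply: Rintegral_ge0 => x _; exact: powR_ge0. Qed.

Lemma measurable_powR_abs f : measurable_fun setT f ->
  measurable_fun setT (fun x : R => `|f x| `^ p).
Proof.
move=> mf; apply: (@measurableT_comp _ _ _ _ _ _ (fun y : R => y `^ p)).
  exact: measurable_powR.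
exact: (measurableT_comp (@normr_measurable R setT) mf).
Qed.

Lemma Lp_le f g : measurable_fun setT f -> (forall x, `|f x| <= `|g x|) ->
  Lp p g -> Lp p f.
Proof.
move=> mf fg [mg lg]; split => //; apply: (L1_le _ _ lg).
  exact: measurable_powR_abs.
by move=> x; rewrite ger0_norm ?powR_ge0// ge0_ler_powR// nnegrE.
Qed.

Lemma Np_le f g : Lp p f -> Lp p g -> (forall x, `|f x| <= `|g x|) ->
  Np p f <= Np p g.
Proof.
move=> [_ lf] [_ lg] fg; apply: le_Rintegral => // x _.
by rewrite ge0_ler_powR// nnegrE.
Qed.

Lemma ae_Np f g : measurable_fun setT f -> measurable_fun setT g ->
  {ae mu, forall x, f x = g x} -> Np p f = Np p g.
Proof.
move=> mf mg fg; apply: ae_eq_Rintegral.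
- exact: measurable_powR_abs.
- exact: measurable_powR_abs.
- by apply: (aeS _ fg) => x ->.
Qed.

Lemma L1_ae f g : L1 f -> measurable_fun setT g ->
  {ae mu, forall x, f x = g x} -> L1 g.
Proof.
move=> lf mg fg; have mf := L1_measurable lf.
apply/integrableP; split; first exact/measurable_EFinP.
have <- : (\int[mu]_x `|(EFin \o f) x| = \int[mu]_x `|(EFin \o g) x|)%E.
  apply: ae_eq_integral => //.
  - by apply: measurableT_comp => //; exact/measurable_EFinP.
  - by apply: measurableT_comp => //; exact/measurable_EFinP.
  - by apply: (aeS _ fg) => x /= ->.
by have /integrableP[] := lf.
Qed.

Lemma ae_Lp f g : Lp p f -> measurable_fun setT g ->
  {ae mu, forall x, f x = g x} -> Lp p g.
Proof.
move=> [mf lf] mg fg; split => //; apply: (L1_ae lf).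
  exact: measurable_powR_abs.
by apply: (aeS _ fg) => x ->.
Qed.

Lemma powRD_le (x y : R) : 0 <= x -> 0 <= y ->
  (x + y) `^ p <= 2 `^ p * (x `^ p + y `^ p).
Proof.
move=> x0 y0; apply: (@le_trans _ _ ((2 * Num.max x y) `^ p)).
  rewrite ge0_ler_powR ?nnegrE ?addr_ge0//.
    by rewrite mulr_ge0// le_max x0.
  by rewrite mulr_natl mulr2n lerD// le_max lexx// orbT.
rewrite powRM ?le_max ?x0// ler_wpM2l ?powR_ge0//.
by have [xy|xy] := leP x y; rewrite ?lerDl ?lerDr powR_ge0.
Qed.

Lemma LpNpD f g : Lp p f -> Lp p g ->
  Lp p (fun x => f x + g x) /\
  Np p (fun x => f x + g x) <= 2 `^ p * (Np p f + Np p g).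
Proof.
move=> [mf lf] [mg lg].
have mfg : measurable_fun setT (fun x => f x + g x) by exact: measurable_funD.
have le x : `|f x + g x| `^ p <= 2 `^ p * (`|f x| `^ p + `|g x| `^ p).
  apply: (le_trans _ (powRD_le (normr_ge0 _) (normr_ge0 _))).
  by rewrite ge0_ler_powR ?nnegrE ?addr_ge0// ler_normD.
have ll : L1 (fun x => 2 `^ p * (`|f x| `^ p + `|g x| `^ p)) by apply: L1Zl; exact: L1D.
have l : L1 (fun x => `|f x + g x| `^ p).
  apply: (L1_le _ _ ll); first exact: measurable_powR_abs.
  by move=> x; rewrite ger0_norm ?powR_ge0.
split => //; rewrite /Np -RintegralD// -RintegralZl//; last exact: L1D.
by apply: le_Rintegral.
Qed.

Lemma LpD f g : Lp p f -> Lp p g -> Lp p (fun x => f x + g x).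
Proof. by move=> lf lg; have [] := LpNpD lf lg. Qed.

Lemma NpD f g : Lp p f -> Lp p g ->
  Np p (fun x => f x + g x) <= 2 `^ p * (Np p f + Np p g).
Proof. by move=> lf lg; have [] := LpNpD lf lg. Qed.

Lemma LpZ k f : Lp p f -> Lp p (fun x => k * f x).
Proof.
move=> [mf lf]; split; first exact: measurable_funM.
have := L1Zl (`|k| `^ p) lf; apply: eq_integrable => // x _ /=.
by rewrite normrM powRM.
Qed.

Lemma NpZ k f : Lp p f -> Np p (fun x => k * f x) = `|k| `^ p * Np p f.
Proof.
move=> [mf lf]; rewrite /Np -RintegralZl//; apply: eq_Rintegral => x _.
by rewrite normrM powRM.
Qed.

Lemma NpN f : Np p (fun x => - f x) = Np p f.
Proof. by apply: eq_Rintegral => x _; rewrite normrN. Qed.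

Lemma LpN f : Lp p f -> Lp p (fun x => - f x).
Proof.
move=> [mf lf]; split; first exact: measurableT_comp.
by apply: eq_integrable lf => // x _ /=; rewrite normrN.
Qed.

Lemma LpB f g : Lp p f -> Lp p g -> Lp p (fun x => f x - g x).
Proof. by move=> lf lg; apply: LpD => //; exact: LpN. Qed.

Lemma NpB f g : Lp p f -> Lp p g ->
  Np p (fun x => f x - g x) <= 2 `^ p * (Np p f + Np p g).
Proof. by move=> lf lg; rewrite -(NpN g); apply: NpD => //; exact: LpN. Qed.

Lemma NpBC f g : Np p (fun x => f x - g x) = Np p (fun x => g x - f x).
Proof. by rewrite -NpN; apply: eq_Rintegral => x _; rewrite opprB. Qed.

Lemma Lp_patch (D : set R) f : measurable D -> Lp p f -> Lp p (f \_ D).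
Proof.
move=> mD lf; apply: (Lp_le _ _ lf) => [|x].
  by have [mf _] := lf; apply/(measurable_restrictT _ mD); exact: measurable_funS mf.
by rewrite patchE; case: ifP => //; rewrite normr0.
Qed.

Lemma Np_patch (D : set R) f : measurable D -> Lp p f -> Np p (f \_ D) <= Np p f.
Proof.
move=> mD lf; apply: Np_le => //; first exact: Lp_patch.
by move=> x; rewrite patchE; case: ifP => //; rewrite normr0.
Qed.

Lemma Lp_bounded f c d C : measurable_fun setT f -> (forall x, `|f x| <= C) ->
  (forall x, ~ (c <= x <= d) -> f x = 0) -> Lp p f.
Proof.
move=> mf fC f0; split => //; apply: (@L1_bounded _ _ c d (C `^ p)).
- exact: measurable_powR_abs.
- move=> x; rewrite ger0_norm ?powR_ge0// ge0_ler_powR// nnegrE//.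
  exact: le_trans (fC x).
- by move=> x /f0 ->; rewrite normr0 powR0.
Qed.

Lemma test_Lp c d f : is_test c d f -> Lp p f.
Proof.
move=> tf; have [C hC] := test_bounded tf; apply: (Lp_bounded (test_measurable tf) hC).
have [_ fc fd] := tf.
move=> x /negP; rewrite negb_and -!ltNge => /orP[]; [exact: fc|exact: fd].
Qed.

(** Where $|x|>e$ one has $|x|^{p-1}\ge e^{p-1}$. With [e = 1] it yields $L^p\subset L^1$ on a
    bounded interval. *)
Lemma abs_le_powR (e x : R) : 0 < e -> `|x| <= e + e `^ (1 - p) * `|x| `^ p.
Proof.
move=> e0; have [xe|ex] := leP `|x| e.
  by rewrite (le_trans xe)// lerDl mulr_ge0 ?powR_ge0.
have x0 : 0 < `|x| by exact: lt_trans ex.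
apply: (@le_trans _ _ (e `^ (1 - p) * `|x| `^ p)); last by rewrite lerDr ltW.
have -> : `|x| `^ p = `|x| * `|x| `^ (p - 1).
  by rewrite -{2}(powRr1 (ltW x0)) -powRD ?(gt_eqF x0) ?implybT// addrC subrK.
rewrite mulrCA; apply: ler_peMr; first exact: ltW.
rewrite -opprB powRN mulrC ler_pdivlMr ?powR_gt0// mul1r.
apply: ge0_ler_powR; rewrite ?nnegrE ?subr_ge0 //; exact: ltW.
Qed.

Lemma Lp_L1 a b f : Lp p (f \_ `]a, b[) -> L1 (f \_ `]a, b[).
Proof.
move=> [mf lf]; apply: (@L1_le _ _ (fun x => \1_(`]a, b[%classic) x + `|(f \_ `]a, b[) x| `^ p)) => //.
  move=> x; have := abs_le_powR ((f \_ `]a, b[) x) ltr01; rewrite powR1 mul1r.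
  rewrite indicE; case: (boolP (x \in _)) => //= xab _.
  by rewrite patchE (negbTE xab) normr0 add0r powR_ge0.
apply: L1D => //; apply: (@L1_bounded _ _ a b 1); first exact: measurable_indic.
  by move=> x; rewrite indicE; case: (_ \in _); rewrite ?normr1 ?normr0.
move=> x nab; rewrite indicE memNset//= in_itv/= => /andP[ax xb].
by apply: nab; rewrite !ltW.
Qed.

Lemma LpOmegaP a b u : LpOmega a b p u <-> Lp p (u \_ `]a, b[).
Proof.
rewrite /LpOmega /Lfun /=; split.
  move=> /andP[/= /set_mem mf /set_mem fin]; rewrite /finLfun /finite_norm /= in fin.
  change (measurable_fun setT (u \_ `]a, b[)) in mf.
  split => //; apply/integrableP; split.
    by apply/measurable_EFinP; exact: measurable_powR_abs.
  have := poweR_lty p fin; rewrite poweR_Lnorm//; congr (_ < _)%E.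
  by apply: eq_integral => x _ /=; rewrite (ger0_norm (powR_ge0 _ _)).
move=> [mf lf]; apply/andP; split; apply/mem_set => //=.
have h : ('N[mu]_p%:E[EFin \o u \_ `]a, b[] `^ p < +oo)%E.
  rewrite poweR_Lnorm//; have /integrableP[_] := lf; congr (_ < _)%E.
  by apply: eq_integral => x _ /=; rewrite (ger0_norm (powR_ge0 _ _)).
exact: lty_poweRy pN0 h.
Qed.

Lemma LpNorm_powR a b u : Lp p (u \_ `]a, b[) ->
  (LpNorm a b p u `^ p)%E = (Np p (u \_ `]a, b[))%:E.
Proof.
move=> [_ lu]; rewrite /LpNorm poweR_Lnorm// /Np /Rintegral fineK//.
  by apply: integrable_fin_num.
Qed.

Lemma L1_reflect f d : L1 f -> L1 (fun x => f (d - x)).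
Proof.
move=> lf; have N1 : (-1 : R) != 0 by rewrite oppr_eq0 oner_neq0.
have := L1_affine d N1 lf; apply: eq_integrable => // x _ /=.
by rewrite mulN1r addrC.
Qed.

Lemma Lp_reflect f d : Lp p f -> Lp p (fun x => f (d - x)).
Proof.
move=> [mf lf]; split; last exact: (L1_reflect d lf).
by apply: (measurableT_comp mf); exact: measurable_funB.
Qed.

Lemma Np_reflect f d : measurable_fun setT f -> Np p (fun x => f (d - x)) = Np p f.
Proof.
move=> mf; rewrite /Np -[RHS](@Rintegral_reflect R (fun x => `|f x| `^ p) d)//.
exact: measurable_powR_abs.
Qed.

End Lp.

Section powR_cvg.
Context {R : realType}.
Implicit Types (r l : R).

Lemma powR_VK r x : 0 < r -> 0 <= x -> (x `^ r^-1) `^ r = x.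
Proof. by move=> r0 x0; rewrite -powRrM mulVf ?gt_eqF// powRr1. Qed.

Lemma powR_KV r x : 0 < r -> 0 <= x -> (x `^ r) `^ r^-1 = x.
Proof. by move=> r0 x0; rewrite -powRrM mulfV ?gt_eqF// powRr1. Qed.

Lemma powR_exprn r x n : 0 <= x -> (x ^+ n) `^ r = (x `^ r) ^+ n.
Proof.
move=> x0; elim: n => [|n ih]; first by rewrite !expr0 powR1.
by rewrite !exprS powRM ?exprn_ge0// ih.
Qed.

Lemma cvg_powR0 r (u : nat -> R) : 0 < r -> (forall n, 0 <= u n) ->
  u n @[n --> \oo] --> 0 -> u n `^ r @[n --> \oo] --> 0.
Proof.
move=> r0 u0 /cvgrPdist_lt cu; apply/cvgrPdist_lt => e e0.
have e0' : 0 < e `^ r^-1 by exact: powR_gt0.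
have := cu _ e0'; apply: filterS => n; rewrite !sub0r !normrN ger0_norm// => h.
rewrite ger0_norm ?powR_ge0// -[X in _ < X](@powR_VK r)//; last exact: ltW.
by rewrite gt0_ltr_powR// nnegrE// ltW.
Qed.

Lemma cvg_powR_abs r (u : nat -> R) l : 0 < r ->
  u n @[n --> \oo] --> l -> `|u n| `^ r @[n --> \oo] --> `|l| `^ r.
Proof.
move=> r0 cu; have cua : `|u n| @[n --> \oo] --> `|l| by exact: cvg_norm.
have [l0|l0] := eqVneq l 0.
  rewrite l0 normr0 powR0 ?gt_eqF//; apply: cvg_powR0 => //.
  by rewrite l0 normr0 in cua.
have la : 0 < `|l| by rewrite normr_gt0.
have [D _] := is_derive1_powR r la.
have C : {for `|l|, continuous (fun x : R => x `^ r)}.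
  by apply: differentiable_continuous; exact/derivable1_diffP.
apply: (@cvg_comp _ _ _ (fun n => `|u n|) (fun x : R => x `^ r) _ _ _ cua).
exact: C.
Qed.

(* The telescoping series of differences converges absolutely by comparison
   with a geometric series. *)
Lemma cvg_geometric_diff (u : nat -> R) (C : R) :
  (forall n, `|u n.+1 - u n| <= C * 2^-1 ^+ n) -> cvgn u.
Proof.
move=> hu; pose d n := u n.+1 - u n.
have cd : cvgn (series d).
  apply: normed_cvg; apply: (@series_le_cvg _ _ (geometric C 2^-1)).
  - by move=> n; exact: normr_ge0.
  - by move=> n; apply: le_trans (hu n).
  - by move=> n; exact: hu.
  - by apply: is_cvg_geometric_series; rewrite ger0_norm// invf_lt1// ltr1n.
have -> : u = (fun n => u 0%N + series d n).
  apply/funext => n; rewrite seriesEnat/= telescope_sumr// addrC subrK//.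
by apply: is_cvgD => //; exact: is_cvg_cst.
Qed.

End powR_cvg.

(** * Completeness of L^p *)

Section Lp_complete.
Context {R : realType} (p : R) (p1 : 1 < p).
Notation mu := (@lebesgue_measure R).
Implicit Types (u v f g h : R -> R) (w : nat -> R -> R).

Let p0 : 0 < p. Proof. exact: lt_trans p1. Qed.

Lemma limn_einf_le (u : nat -> \bar R) (C : \bar R) : (forall n, (u n <= C)%E) ->
  (limn_einf u <= C)%E.
Proof.
move=> uC; rewrite limn_einf_lim; apply: lime_le; first exact: is_cvg_einfs.
apply: nearW => n; apply: (le_trans _ (uC n)).
by apply: ereal_inf_lbound; exists n => /=.
Qed.

(** Fatou's lemma for the $p$-th powers; it gives membership of the limit and the bound together. *)
Lemma Np_fatou w f (C : R) : (forall n, Lp p (w n)) -> measurable_fun setT f ->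
  {ae mu, forall x, w n x @[n --> \oo] --> f x} ->
  (forall n, Np p (w n) <= C) -> Lp p f /\ Np p f <= C.
Proof.
move=> lw mf cw hC.
have mfp := measurable_powR_abs p mf.
pose F n (x : R) := (`|w n x| `^ p)%:E.
have mF n : measurable_fun [set: R] (F n).
  by apply/measurable_EFinP; apply: measurable_powR_abs; have [] := lw n.
have IE n : (\int[mu]_x F n x)%E = (Np p (w n))%:E.
  by rewrite /Np /Rintegral fineK//; apply: integrable_fin_num => //; have [] := lw n.
have le : (\int[mu]_x (`|f x| `^ p)%:E <= C%:E)%E.
  rewrite (_ : (\int[mu]_x (`|f x| `^ p)%:E)%E = (\int[mu]_x limn_einf (F^~ x))%E); last first.
    apply: ae_eq_integral => //.
    - exact/measurable_EFinP.
    - have mN n : measurable_fun [set: R] (fun x => - F n x)%E by exact: measurableT_comp.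
      by have := measurable_fun_limn_esup mN; exact: measurableT_comp.
    - apply: (aeS _ cw) => x hx _; apply/esym.
      have cF : F n x @[n --> \oo] --> (`|f x| `^ p)%:E.
        by apply: cvg_EFin; [exact: nearW|exact: cvg_powR_abs].
      by rewrite is_cvg_limn_einfE; [exact/cvg_lim|apply/cvg_ex; eexists; exact: cF].
  apply: (le_trans (@fatou _ _ _ mu _ measurableT _ mF _)).
    by move=> n x _; rewrite lee_fin powR_ge0.
  by apply: limn_einf_le => n; rewrite IE lee_fin.
have ge0 : (0 <= \int[mu]_x (`|f x| `^ p)%:E)%E.
  by apply: integral_ge0 => x _; rewrite lee_fin powR_ge0.
have lf : L1 (fun x => `|f x| `^ p).
  apply/integrableP; split; first exact/measurable_EFinP.
  rewrite (_ : (\int[mu]_x _)%E = (\int[mu]_x (`|f x| `^ p)%:E)%E).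
    by apply: (le_lt_trans le); rewrite ltry.
  by apply: eq_integral => x _ /=; rewrite (ger0_norm (powR_ge0 _ _)).
split; first by split.
by rewrite -lee_fin /Np /Rintegral fineK//; exact: integrable_fin_num.
Qed.

(** With weights $2^{pk}$ the series of $|w_{k+1}-w_k|^p$ still has finite integral, so its sum $S$
    is finite almost everywhere; each term then gives $|w_{k+1}-w_k|\le S^{1/p}2^{-k}$. The rate in
    the hypothesis is chosen for this. *)
Lemma Lp_series_cvg w : (forall n, Lp p (w n)) ->
  (forall k, Np p (fun x => w k.+1 x - w k x) <= (2 `^ p)^-1 ^+ k * 2^-1 ^+ k) ->
  {ae mu, forall x, cvgn (w ^~ x)}.
Proof.
move=> lw hw; pose d k x := w k.+1 x - w k x.
have ld k : Lp p (d k) by exact: LpB.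
pose F k (x : R) := ((2 `^ p) ^+ k * `|d k x| `^ p)%:E.
have lF k : L1 (fun x => (2 `^ p) ^+ k * `|d k x| `^ p) by apply: L1Zl; have [] := ld k.
have q0 k : 0 < (2 `^ p) ^+ k by rewrite exprn_gt0// powR_gt0.
have mF k : measurable_fun [set: R] (F k) by apply/measurable_EFinP; exact: L1_measurable.
have F0 k x : (0 <= F k x)%E by rewrite lee_fin mulr_ge0 ?powR_ge0// ltW.
have IF k : (\int[mu]_x F k x <= (2^-1 ^+ k)%:E)%E.
  have -> : (\int[mu]_x F k x)%E = ((2 `^ p) ^+ k * Np p (d k))%:E.
    rewrite /Np -RintegralZl//; last by have [] := ld k.
    rewrite /Rintegral fineK//; exact: (integrable_fin_num _ (lF k)).
  rewrite lee_fin -ler_pdivlMl//; apply: (le_trans (hw k)).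
  by rewrite exprVn.
have sF : (\int[mu]_x \sum_(0 <= k <oo) F k x < +oo)%E.
  rewrite integral_nneseries//.
  apply: (@le_lt_trans _ _ (\sum_(0 <= k <oo) (2^-1 ^+ k)%:E)%E).
    by apply: lee_nneseries => // k _ _; exact: integral_ge0.
  have := @cvg_geometric_eseries_half R 2 0.
  move=> h; rewrite (_ : limn _ = limn (eseries (fun k => (2 / (2 ^ (k + 1))%:R)%:E))).
    by rewrite (cvg_lim _ h)// ltry.
  congr (limn _); apply/funext => n; rewrite eseriesEnat; apply: eq_bigr => k _.
  by rewrite addn1 expnS natrM invfM mulrA divff ?mul1r// natrX exprVn.
have iF : mu.-integrable setT (fun x => \sum_(0 <= k <oo) F k x)%E.
  apply/integrableP; split.
    exact: (@ge0_emeasurable_sum _ (measurableTypeR R) R setT F xpredT (fun k x _ _ => F0 k x) (fun k _ => mF k)).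
  rewrite (_ : (\int[mu]_x _)%E = (\int[mu]_x (\sum_(0 <= k <oo) F k x))%E)//.
  by apply: eq_integral => x _; rewrite gee0_abs//; exact: nneseries_ge0.
apply: (aeS _ (integrable_ae measurableT iF)) => x /(_ I) fx.
pose S := fine (\sum_(0 <= k <oo) F k x)%E.
have hS k : (2 `^ p) ^+ k * `|d k x| `^ p <= S.
  rewrite -lee_fin /S fineK//.
  apply: (@le_trans _ _ (\sum_(0 <= i < k.+1) F i x)%E); last exact: nneseries_lim_ge.
  by rewrite big_nat_recr//= leeDr// sume_ge0.
have S0 : 0 <= S by apply: le_trans (hS 0%N); rewrite mulr_ge0 ?powR_ge0// ltW.
apply: (@cvg_geometric_diff _ _ (S `^ p^-1)) => k.
have h2 : (2 ^+ k * `|d k x|) `^ p <= S.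
  apply: le_trans (hS k); rewrite powRM// ?exprn_ge0//.
  by rewrite powR_exprn.
rewrite exprVn ler_pdivlMr ?exprn_gt0// mulrC.
rewrite -(powR_KV p0 (_ : 0 <= 2 ^+ k * `|d k x|)) ?mulr_ge0 ?exprn_ge0//.
by apply: ge0_ler_powR; rewrite ?nnegrE ?powR_ge0// invr_ge0 ltW.
Qed.

(** Riesz-Fischer: a fast subsequence converges almost everywhere, and Fatou's lemma on the
    differences with its limit gives convergence of the whole sequence. *)
Lemma Lp_complete w : (forall n, Lp p (w n)) ->
  (forall e : R, 0 < e -> exists n0, forall m n, (n0 <= m)%N -> (n0 <= n)%N ->
    Np p (fun x => w m x - w n x) < e) ->
  exists2 u, Lp p u & Np p (fun x => w n x - u x) @[n --> \oo] --> 0.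
Proof.
move=> lw cw.
have q0 : 0 < 2 `^ p by exact: powR_gt0.
pose e k := (2 `^ p)^-1 ^+ k * 2^-1 ^+ k.
have e0 k : 0 < e k by rewrite mulr_gt0// exprn_gt0// invr_gt0.
have [K hK] : {K : nat -> nat | forall k m n, (K k <= m)%N -> (K k <= n)%N ->
    Np p (fun x => w m x - w n x) < e k}.
  exists (fun k => projT1 (cid (cw _ (e0 k)))) => k; exact: projT2 (cid (cw _ (e0 k))).
(* A strictly increasing choice of indices with [K k <= s k]. *)
pose s := fix s n := if n is k.+1 then maxn (s k).+1 (K k.+1) else K 0%N.
have sK k : (K k <= s k)%N by case: k => //= k; exact: leq_maxr.
have sS k : (s k < s k.+1)%N by rewrite /= leq_maxl.
have sle m n : (m <= n)%N -> (s m <= s n)%N.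
  by apply: (homo_leq (@leqnn) (fun a b c => @leq_trans a b c)) => k; exact: ltnW.
have skk k : (k <= s k)%N by elim: k => // k ih; exact: leq_ltn_trans (sS k).
have sc : {ae mu, forall x, cvgn (fun k => w (s k) x)}.
  apply: (@Lp_series_cvg (fun k => w (s k))) => // k.
  apply: ltW; apply: hK => //; apply: leq_trans (sK k) _; exact/ltnW.
(* The upper limit is measurable without any exceptional set; it is the limit wherever there is
   one. *)
pose u x := fine (limn_esup (fun k => (w (s k) x)%:E)).
have mw k : measurable_fun setT (w k) by have [] := lw k.
have mu_ : measurable_fun setT u.
  apply: measurableT_comp; first exact: fine_measurable.
  by apply: measurable_fun_limn_esup => k; exact/measurable_EFinP.
have cu : {ae mu, forall x, w (s k) x @[k --> \oo] --> u x}.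
  apply: (aeS _ sc) => x /cvg_ex[l hl]; suff -> : u x = l by [].
  have hl' : (w (s k) x)%:E @[k --> \oo] --> l%:E by apply: cvg_EFin => //; exact: nearW.
  rewrite /u is_cvg_limn_esupE; last by apply/cvg_ex; exists l%:E.
  by rewrite (cvg_lim _ hl').
have key (eps : R) : 0 < eps -> exists n0, forall n, (n0 <= n)%N ->
    Lp p (fun x => w n x - u x) /\ Np p (fun x => w n x - u x) <= eps.
  move=> /cw[n0 hn0]; exists n0 => n n0n.
  (* The shift by [n0] puts every index of the subsequence past the Cauchy threshold. *)
  apply: (@Np_fatou (fun k x => w n x - w (s (k + n0)%N) x)).
  - by move=> k; exact: LpB.
  - by apply: measurable_funB.
  - apply: (aeS _ cu) => x hx; apply: cvgB; first exact: cvg_cst.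
    by move: hx; rewrite -(cvg_shiftn n0).
  - move=> k; apply: ltW; apply: hn0 => //; apply: leq_trans (skk _).
    exact: leq_addl.
exists u.
  have [n0 h] := key _ ltr01; have [l _] := h _ (leqnn n0).
  have := LpB p1 (lw n0) l; congr (Lp _ _); apply/funext => x.
  by rewrite opprB addrC subrK.
apply/cvgrPdist_le => eps eps0; have [n0 h] := key _ eps0.
exists n0 => // n /= n0n; rewrite sub0r normrN ger0_norm ?Np_ge0//.
by have [] := h n n0n.
Qed.

End Lp_complete.

(** * Reflection *)

Section reflection.
Context {R : realType} (a b alpha : R).
Hypotheses (ab : a < b) (a0 : 0 < alpha) (a1 : alpha < 1).
Notation mu := (@lebesgue_measure R).
Implicit Types (u v f phi : R -> R).

Definition refl_itv (f : R -> R) (x : R) : R := f (a + b - x).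

Lemma refl_itvK f : refl_itv (refl_itv f) = f.
Proof. by apply/funext => x; rewrite /refl_itv subKr. Qed.

Lemma refl_itv_in x : (a + b - x \in `]a, b[) = (x \in `]a, b[).
Proof. by rewrite !in_itv/= ltrBrDl ltrBlDr (addrC x) ltrD2l addrC ltrD2l andbC. Qed.

Lemma refl_itv_patch f : refl_itv f \_ `]a, b[ = refl_itv (f \_ `]a, b[).
Proof.
by apply/funext => x; rewrite /refl_itv !patchE !mem_setE refl_itv_in.
Qed.

Lemma L1_refl_itv f : L1 f -> L1 (refl_itv f).
Proof. exact: L1_reflect. Qed.

Lemma Cc_smooth_restrict c d phi : a < c -> d < b -> is_test c d (phi \_ `]a, b[) ->
  Cc_smooth a b phi.
Proof.
move=> ac db tphi; have [sphi [K [cK KO K0]]] := test_Cc_smooth ac db tphi.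
have pE x : `]a, b[%classic x -> (phi \_ `]a, b[) x = phi x.
  by move=> xab; rewrite patchE mem_set.
split.
  have oO : open `]a, b[%classic by exact: itv_open.
  have h := (smooth_onP _ oO).1 sphi.
  by apply/(smooth_onP _ oO) => n; exact: Cn_on oO pE (h n).
by exists K; split => // x xab nK; rewrite -pE//; exact: K0.
Qed.

Lemma test_refl c d phi : is_test c d phi ->
  is_test (a + b - d) (a + b - c) (refl_itv phi).
Proof.
have e x : a + b - x = -1 * x + (a + b) by rewrite mulN1r addrC.
move=> [cp pc pd]; split.
- move=> n; rewrite /refl_itv; have := @Cn_affine R setT setT n phi (-1) (a + b) (fun _ _ => I) (cp n).
  by apply: Cn_on => [|x _]; [exact: openT|rewrite e].
- by move=> x xd; apply: pd; lra.
- by move=> x xd; apply: pc; lra.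
Qed.

Lemma Cc_smooth_refl phi : Cc_smooth a b phi -> Cc_smooth a b (refl_itv phi).
Proof.
move=> /(Cc_smooth_test ab)[c [d [ac db tphi]]].
have := test_refl tphi; rewrite -refl_itv_patch.
apply: Cc_smooth_restrict; first by rewrite ltrBrDl addrC ltrD2l.
by rewrite ltrBlDr addrC ltrD2l.
Qed.

Lemma Rintegral_refl f : measurable_fun setT (f \_ `]a, b[) ->
  \int[mu]_(x in `]a, b[) f x = \int[mu]_(x in `]a, b[) refl_itv f x.
Proof.
move=> mf; rewrite Rintegral_mkcond [RHS]Rintegral_mkcond refl_itv_patch.
by rewrite /refl_itv (Rintegral_reflect (a + b) mf).
Qed.

Lemma fracI_minus_refl (s : R) phi x : measurable_fun setT (phi \_ `]a, b[) -> a < x -> x < b ->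
  fracI a b Fminus s phi x = fracI a b Fplus s (refl_itv phi) (a + b - x).
Proof.
move=> mphi ax xb; rewrite /fracI; apply: (congr1 (fun z => (Gamma s)^-1 * z)).
rewrite Rintegral_mkcond [RHS]Rintegral_mkcond.
set g := (X in \int[mu]_(_ in _) X _ = _).
have mg : measurable_fun setT g.
  rewrite (_ : g = (fun y => (phi \_ `]a, b[) y / (x - y) `^ (1 - s)) \_ `]a, x[); last first.
    apply/funext => y; rewrite /g !patchE; case: ifPn => //.
    rewrite inE/= in_itv/= => /andP[ay yx]; rewrite mem_set//= in_itv/= ay/=.
    exact: lt_trans xb.
  apply/(measurable_restrictT _ (measurable_itv _)); apply: measurable_funTS.
  apply: measurable_funM => //.
  rewrite (_ : (fun y : R => _) = (fun y => (x - y) `^ (- (1 - s)))); last first.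
    by apply/funext => y; rewrite powRN.
  apply: (@measurableT_comp _ _ _ _ _ _ (fun y : R => y `^ (- (1 - s)))).
    exact: measurable_powR.
  exact: measurable_funB.
rewrite -(Rintegral_reflect (a + b) mg); apply: eq_Rintegral => y _.
rewrite /g !patchE !mem_setE !in_itv/= /refl_itv.
have -> : (a < a + b - y) && (a + b - y < x) = (a + b - x < y) && (y < b).
  by apply/idP/idP => /andP[h1 h2]; apply/andP; split; lra.
by have -> : x - (a + b - y) = y - (a + b - x) by lra.
Qed.

Lemma fracD_minus_refl phi x : Cc_smooth a b phi -> a < x -> x < b ->
  fracD a b Fminus alpha phi x = fracD a b Fplus alpha (refl_itv phi) (a + b - x).
Proof.
move=> Cphi ax xb; have [c [d [ac db tphi]]] := Cc_smooth_test ab Cphi.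
have mphi := test_measurable tphi.
have [c' [d' [ac' db' tphi']]] := Cc_smooth_test ab (Cc_smooth_refl Cphi).
have bM : b - a < (b - a) + 1 by rewrite ltrDl.
have /andP[ax' xb'] : (a < a + b - x) && (a + b - x < b).
  by have := refl_itv_in x; rewrite !in_itv/= ax xb.
have D := is_derive_fracI_plus a0 a1 bM ac' db' tphi' ax' xb'.
rewrite /fracD [in RHS]derive1E.
set g := fracI a b Fplus (1 - alpha) (refl_itv phi) in D *.
set D' := (X in is_derive _ _ _ X) in D.
have [_ ->] := D.
have A : is_derive x 1 (fun y : R => a + b - y) (-1).
  by have := is_derive_affine (-1) (a + b) x; congr (is_derive _ _ _ _); apply/funext => y; rewrite mulN1r addrC.
have D2 : is_derive x 1 (g \o (fun y : R => a + b - y)) (D' * -1).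
  exact: (is_derive1_comp (g := fun y : R => a + b - y)).
have oO : open `]a, b[%classic by exact: itv_open.
have xab : `]a, b[%classic x by rewrite /= in_itv/= ax.
have gE y : `]a, b[%classic y ->
    (g \o (fun y : R => a + b - y)) y = fracI a b Fminus (1 - alpha) phi y.
  move=> yab; have /andP[ay yb] : a < y < b by move: yab; rewrite /= in_itv.
  by rewrite (fracI_minus_refl _ mphi ay yb).
have [_ D3] := is_derive_on oO xab gE D2.
by rewrite derive1E D3 mulrN1.
Qed.

Lemma measurable_mul_fracD u phi : Cc_smooth a b phi -> L1 (u \_ `]a, b[) ->
  measurable_fun setT ((fun x => u x * fracD a b Fplus alpha phi x) \_ `]a, b[).
Proof.
move=> Cphi lu; have [c [d [ac db tphi]]] := Cc_smooth_test ab Cphi.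
have bM : b - a < (b - a) + 1 by rewrite ltrDl.
have [_ tphi'] := test_derive tphi.
have a1' : 0 < 1 - alpha by rewrite subr_gt0.
pose k t := rlker (1 - alpha) (b - a + 1) (- t).
have lk : L1 k by exact: L1_reflect0 (L1_rlker _ a1').
pose h := conv k (derive1 (phi \_ `]a, b[)).
have mh : measurable_fun setT h by exact: L1_measurable (L1_conv lk (test_L1 tphi')).
have mu_ := L1_measurable lu.
rewrite (_ : _ \_ _ = fun x => (u \_ `]a, b[) x * (- (Gamma (1 - alpha))^-1 * h x)).
  by apply: measurable_funM => //; exact: measurable_funM.
apply/funext => x; rewrite !patchE; case: ifPn; last by rewrite mul0r.
rewrite inE => xab; have /andP[ax xb] : a < x < b by move: xab; rewrite /= in_itv.
rewrite (fracD_plus_test a0 a1 bM ac db tphi ax xb) mulNr /h convC.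
- by congr (_ * - (_ * _)); apply: eq_Rintegral => y _; rewrite /k opprB mulrC.
- exact: L1_measurable lk.
- exact: test_measurable tphi'.
Qed.

(** The substitution $x\mapsto a+b-x$ in both integrals of the weak identity; test functions are
    reflected as well and [fracD_minus_refl] exchanges the two fractional derivatives. *)
Lemma weak_refl u v : L1 (u \_ `]a, b[) -> L1 (v \_ `]a, b[) ->
  is_weak_fracD a b Fplus alpha u v <->
  is_weak_fracD a b Fminus alpha (refl_itv u) (refl_itv v).
Proof.
move=> lu lv.
have K1 phi : Cc_smooth a b phi ->
    \int[mu]_(x in `]a, b[) (v x * phi x) =
    \int[mu]_(x in `]a, b[) (refl_itv v x * refl_itv phi x).
  move=> Cphi; have [c [d [_ _ tphi]]] := Cc_smooth_test ab Cphi.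
  rewrite Rintegral_refl//.
  rewrite (_ : _ \_ _ = fun x => (v \_ `]a, b[) x * (phi \_ `]a, b[) x).
    by apply: measurable_funM; [exact: L1_measurable|exact: test_measurable tphi].
  by apply/funext => x; rewrite !patchE; case: ifP; rewrite ?mul0r.
have K2 phi : Cc_smooth a b phi ->
    \int[mu]_(x in `]a, b[) (u x * fracD a b Fminus alpha phi x) =
    \int[mu]_(x in `]a, b[) (refl_itv u x * fracD a b Fplus alpha (refl_itv phi) x).
  move=> Cphi; have Cphi' := Cc_smooth_refl Cphi.
  rewrite [RHS]Rintegral_refl.
    apply: eq_Rintegral => x; rewrite inE => xab.
    have /andP[ax xb] : a < x < b by move: xab; rewrite /= in_itv.
    by rewrite (fracD_minus_refl Cphi ax xb) /refl_itv subKr.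
  by apply: measurable_mul_fracD => //; rewrite refl_itv_patch; exact: L1_refl_itv.
have ou f : L1 (f \_ `]a, b[) -> mu.-integrable `]a, b[ (EFin \o f).
  by move=> lf; apply/(L1_restrict _ (measurable_itv _)).
have lo f : L1 (f \_ `]a, b[) -> locally_integrable `]a, b[ f.
  by move=> /ou lf; apply: open_integrable_locally => //; exact: itv_open.
have lr f : L1 (f \_ `]a, b[) -> L1 (refl_itv f \_ `]a, b[).
  by rewrite refl_itv_patch; exact: L1_refl_itv.
split=> -[_ _ h]; split; [exact/ou/lr|exact/lo/lr| |exact/ou|exact/lo|].
- move=> phi Cphi; have Cphi' := Cc_smooth_refl Cphi.
  by rewrite -[phi]refl_itvK -K1// -K2//; exact: h.
- move=> phi Cphi; rewrite K1// K2//; apply: h; exact: Cc_smooth_refl.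
Qed.

End reflection.

(** * Mollification *)

Definition molk (R : realType) (N z : R) : R := N * bump (N * z).

(* Mollification at scale [1 / N] composed with the dilation of ratio [lam]
   about [m]: the dilation makes room for the support to spread. *)
Definition moll (R : realType) (N lam m : R) (f : R -> R) (x : R) : R :=
  conv f (molk N) (m + lam * (x - m)).

Section mollifier.
Context {R : realType}.
Notation mu := (@lebesgue_measure R).
Implicit Types (f g : R -> R) (N lam m c d x y : R).

Lemma test_molk N : 0 < N -> is_test (- N^-1) N^-1 (molk N).
Proof.
move=> N0; have [cb b1 b2] := @test_bump R; split.
- move=> n; apply: CnZ; have := @Cn_affine R setT setT n bump N 0 (fun _ _ => I) (cb n).
  by apply: Cn_on => [|x _]; [exact: openT|rewrite addr0].
- move=> x xN; rewrite /molk b1 ?mulr0//.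
  by rewrite -ltr_pdivlMl// mulrN1.
- move=> x xN; rewrite /molk b2 ?mulr0//.
  by rewrite -ltr_pdivrMl// mulr1.
Qed.

Lemma molk_ge0 N z : 0 <= N -> 0 <= molk N z.
Proof. by move=> N0; rewrite mulr_ge0// bump_ge0. Qed.

Lemma molkN N z : molk N (- z) = molk N z.
Proof. by rewrite /molk mulrN bumpN. Qed.

Lemma molk_int N : 0 < N -> \int[mu]_z molk N z = 1.
Proof.
move=> N0; have mb : measurable_fun setT (@bump R) := test_measurable (@test_bump R).
have lb : L1 (fun z => bump (N * z + 0)) by exact: L1_affine (lt0r_neq0 N0) (test_L1 (@test_bump R)).
rewrite /molk RintegralZl//; last by apply: eq_integrable lb => // x _ /=; rewrite addr0.
rewrite (_ : \int[mu]_x bump (N * x) = \int[mu]_x bump (N * x + 0)).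
  by rewrite Rintegral_affine ?gt_eqF// bump_int mulr1 gtr0_norm// divff// gt_eqF.
by apply: eq_Rintegral => x _; rewrite addr0.
Qed.

Lemma molk_int_shift N y : 0 < N -> \int[mu]_z molk N (y - z) = 1.
Proof.
by move=> N0; rewrite (Rintegral_reflect _ (test_measurable (test_molk N0))) molk_int.
Qed.

Lemma bump_bound : exists2 C : R, 0 < C & forall N z, 0 <= N -> molk N z <= N * C.
Proof.
have [C hC] := test_bounded (@test_bump R).
have C0 : 0 <= C by exact: le_trans (hC 0).
exists (C + 1); first by rewrite ltr_wpDl.
move=> N z N0; rewrite ler_wpM2l//.
by rewrite (le_trans (ler_norm _))// (le_trans (hC _))// lerDl.
Qed.

Lemma L1_mul_molk f N y : 0 < N -> L1 f -> L1 (fun z => f z * molk N (y - z)).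
Proof.
move=> N0 lf; have [C hC] := test_bounded (test_molk N0).
apply: (L1_mul lf _ (fun z => hC (y - z))).
by apply: (measurableT_comp (test_measurable (test_molk N0))); exact: measurable_funB.
Qed.

Lemma L1_molk N y : 0 < N -> L1 (fun z => molk N (y - z)).
Proof.
move=> N0; have N1 : (-1 : R) != 0 by rewrite oppr_eq0 oner_neq0.
have := L1_affine y N1 (test_L1 (test_molk N0)); apply: eq_integrable => // x _ /=.
by rewrite mulN1r addrC.
Qed.

Lemma conv_molk_bounded f K N y : 0 < N -> measurable_fun setT f -> (forall x, `|f x| <= K) ->
  `|conv f (molk N) y| <= K.
Proof.
move=> N0 mf fK; have tm := test_molk N0.
rewrite convC//; last exact: test_measurable tm.
apply: (le_trans (conv_bounded y (test_L1 tm) mf fK)).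
under eq_Rintegral do rewrite ger0_norm ?molk_ge0 ?ltW//.
by rewrite molk_int// mulr1.
Qed.

Lemma conv_molk_supp f c d N y : 0 < N -> (forall x, ~ (c <= x <= d) -> f x = 0) ->
  ~ (c - N^-1 <= y <= d + N^-1) -> conv f (molk N) y = 0.
Proof.
move=> N0 f0 hy; have [_ m1 m2] := test_molk N0.
transitivity (\int[mu]_(z in setT) (0 : R)); last by rewrite Rintegral_cst// mul0r.
apply: eq_Rintegral => z _.
have [/andP[cz zd]|/negP/f0 ->] := boolP (c <= z <= d); last by rewrite mul0r.
have [h|h] := ltP (y - z) (- N^-1); first by rewrite m1// mulr0.
have [h'|h'] := ltP N^-1 (y - z); first by rewrite m2// mulr0.
by case: hy; rewrite lerBlDr; apply/andP; split; lra.
Qed.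

(* Jensen's inequality for [t `^ p], from Young's inequality
   [t s^(p-1) <= t^p / p + (1 - 1/p) s^p]. *)
Lemma powR_jensen p (rho F : R -> R) : 1 < p -> L1 rho -> (forall z, 0 <= rho z) ->
  \int[mu]_z rho z = 1 -> (forall z, 0 <= F z) ->
  L1 (fun z => F z * rho z) -> L1 (fun z => F z `^ p * rho z) ->
  (\int[mu]_z (F z * rho z)) `^ p <= \int[mu]_z (F z `^ p * rho z).
Proof.
move=> p1 lr r0 r1 F0 l1 l2; have p0 : 0 < p by exact: lt_trans p1.
set I := \int[mu]_z (F z `^ p * rho z); set s := \int[mu]_z (F z * rho z).
have s0 : 0 <= s by apply: Rintegral_ge0 => z _; rewrite mulr_ge0.
have [s_eq0|sN0] := eqVneq s 0.
  rewrite s_eq0 powR0 ?gt_eqF//; apply: Rintegral_ge0 => z _.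
  by rewrite mulr_ge0// powR_ge0.
have sgt0 : 0 < s by rewrite lt_neqAle eq_sym sN0.
have sp : s * s `^ (p - 1) = s `^ p.
  by rewrite -{1}(powRr1 s0) -powRD ?sN0 ?implybT// addrC subrK.
have young (t : R) : 0 <= t -> t * s `^ (p - 1) <= t `^ p / p + (1 - p^-1) * s `^ p.
  move=> t0; have q0 : 0 < p / (p - 1) by rewrite divr_gt0// subr_gt0.
  have pm : p - 1 != 0 by rewrite gt_eqF// subr_gt0.
  have qe : (p / (p - 1))^-1 = 1 - p^-1 by rewrite invf_div mulrBl divff ?gt_eqF// mul1r.
  have := conjugate_powR t0 (powR_ge0 s (p - 1)) p0 q0.
  rewrite qe addrC subrK => /(_ erefl); rewrite -powRrM.
  have -> : (p - 1) * (p / (p - 1)) = p by rewrite mulrC divfK.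
  by rewrite [_ * (1 - _)]mulrC.
have : s `^ p <= I / p + (1 - p^-1) * s `^ p.
  have E1 : s * s `^ (p - 1) = \int[mu]_z (F z * rho z * s `^ (p - 1)).
    by rewrite RintegralZr.
  have E2 : I / p = \int[mu]_z (F z `^ p * rho z / p) by rewrite RintegralZr.
  have E3 : (1 - p^-1) * s `^ p = \int[mu]_z ((1 - p^-1) * s `^ p * rho z).
    by rewrite RintegralZl ?r1 ?mulr1.
  rewrite -{1}sp E1 E2 [X in _ <= _ + X]E3 -RintegralD//; first last.
  - exact: L1Zl.
  - by have := L1Zl p^-1 l2; apply: eq_integrable => // z _ /=; rewrite mulrC.
  apply: le_Rintegral => //.
  - by have := L1Zl (s `^ (p - 1)) l1; apply: eq_integrable => // z _ /=; rewrite mulrC.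
  - apply: L1D; last exact: L1Zl.
    by have := L1Zl p^-1 l2; apply: eq_integrable => // z _ /=; rewrite mulrC.
  move=> z _; have := ler_wpM2r (r0 z) (young _ (F0 z)).
  by rewrite mulrDl mulrAC [_ / p * _]mulrAC.
rewrite mulrBl mul1r addrCA lerDl subr_ge0 [p^-1 * _]mulrC.
by rewrite ler_pM2r ?invr_gt0.
Qed.

Lemma conv_molk_jensen p f N y : 1 < p -> 0 < N -> L1 f -> L1 (fun x => `|f x| `^ p) ->
  `|conv f (molk N) y| `^ p <= conv (fun x => `|f x| `^ p) (molk N) y.
Proof.
move=> p1 N0 lf lfp; have lfa := L1_abs lf.
have r0 z : 0 <= molk N z by exact/molk_ge0/ltW.
have j := @powR_jensen p (fun z => molk N (y - z)) (fun z => `|f z|) p1 (L1_molk y N0)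
  (fun z => r0 (y - z)) (molk_int_shift y N0) (fun z => normr_ge0 (f z))
  (L1_mul_molk y N0 lfa) (L1_mul_molk y N0 lfp).
apply: (le_trans _ j).
have sle : `|conv f (molk N) y| <= \int[mu]_z (`|f z| * molk N (y - z)).
  apply: (le_trans (le_normr_Rintegral measurableT (L1_mul_molk y N0 lf))).
  rewrite le_eqVlt; apply/orP; left; apply/eqP; apply: eq_Rintegral => z _.
  by rewrite normrM (ger0_norm (r0 _)).
apply: ge0_ler_powR; rewrite ?nnegrE //; first by rewrite ltW// (lt_trans _ p1).
by rewrite (le_trans _ sle).
Qed.

(** Jensen's inequality at each point, then integration: by [conv_swap] against the constant 1 the
    mollifier integrates out to 1. *)
Lemma Lp_Np_conv_molk p f N : 1 < p -> 0 < N -> L1 f -> Lp p f ->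
  Lp p (conv f (molk N)) /\ Np p (conv f (molk N)) <= Np p f.
Proof.
move=> p1 N0 lf [mf lfp]; have tm := test_molk N0; have lm := test_L1 tm.
have lc := L1_conv lf lm; have mc := L1_measurable lc.
have lcp := L1_conv lfp lm.
have le y := conv_molk_jensen y p1 N0 lf lfp.
have l : L1 (fun y => `|conv f (molk N) y| `^ p).
  apply: (L1_le _ _ lcp); first exact: measurable_powR_abs.
  by move=> y; rewrite ger0_norm ?powR_ge0.
split=> //; apply: (le_trans (le_Rintegral measurableT l lcp (fun y _ => le y))).
have := @conv_swap R (fun x => `|f x| `^ p) (molk N) (fun=> 1) 1 lfp lm (measurable_cst _).
under eq_Rintegral do rewrite mulr1.
move=> ->; last by move=> x; rewrite normr1.
rewrite le_eqVlt; apply/orP; left; apply/eqP; apply: eq_Rintegral => y _.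
under eq_Rintegral do rewrite mulr1.
by rewrite (Rintegral_shift y (test_measurable tm)) molk_int// mulr1.
Qed.

Lemma Np_affine p f c d : c != 0 -> measurable_fun setT f ->
  Np p (fun x => f (c * x + d)) = `|c|^-1 * Np p f.
Proof.
move=> c0 mf; rewrite /Np (@Rintegral_affine R (fun x => `|f x| `^ p))//.
exact: measurable_powR_abs.
Qed.

Lemma Lp_affine p f c d : c != 0 -> Lp p f -> Lp p (fun x => f (c * x + d)).
Proof.
move=> c0 [mf lf]; split; last exact: (L1_affine d c0 lf).
exact: (measurableT_comp mf (measurable_affine c d)).
Qed.

Lemma mollE N lam m f x : moll N lam m f x = conv f (molk N) (lam * x + (m - lam * m)).
Proof. by rewrite /moll mulrBr; apply: (congr1 (conv f (molk N))); rewrite addrCA. Qed.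

Lemma Lp_Np_moll p f N lam m : 1 < p -> 0 < N -> 0 < lam -> L1 f -> Lp p f ->
  Lp p (moll N lam m f) /\ Np p (moll N lam m f) <= lam^-1 * Np p f.
Proof.
move=> p1 N0 l0 lf lpf; have [l h] := Lp_Np_conv_molk p1 N0 lf lpf.
have ln0 : lam != 0 by rewrite gt_eqF.
rewrite (_ : moll N lam m f = fun x => conv f (molk N) (lam * x + (m - lam * m))); last first.
  by apply/funext => x; exact: mollE.
split; first exact: (Lp_affine _ ln0 l).
rewrite Np_affine//; last by case: l.
by rewrite gtr0_norm// ler_wpM2l// invr_ge0 ltW.
Qed.

(** A ball of radius [r] has measure [2 * r]; the average is therefore taken below [e / 2]. *)
Lemma lebesgue_pt_avg f x (e : R) : lebesgue_pt f x -> 0 < e ->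
  exists2 dlt, 0 < dlt & forall r, 0 < r -> r < dlt ->
    (\int[mu]_(y in ball x r) `|f y - f x|%:E <= (e * r)%:E)%E.
Proof.
move=> lx e0; have e20 : (0 < (e / 2)%:E)%E by rewrite lte_fin divr_gt0.
have : \forall r \near (0 : R)^'+, (davg f x r < (e / 2)%:E)%E.
  have : nbhs (0%R%:E : \bar R) [set y | (y < (e / 2)%:E)%E].
    by apply: (@nbhs_open_ereal_lt _ 0 (fun=> e / 2)); rewrite divr_gt0.
  by move=> /lx.
move=> /nbhs_ballP[dlt /= dlt0 hd]; exists dlt => // r r0 rd.
have bd : ball 0 dlt r by rewrite /ball/= sub0r normrN gtr0_norm.
have := hd _ bd r0; rewrite /davg /iavg lebesgue_measure_ball ?(ltW r0)//.
have r2 : 0 < r *+ 2 by rewrite pmulrn_lgt0.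
rewrite inver (gt_eqF r2) lte_pdivrMl//= => /ltW; rewrite -EFinM.
have -> : r *+ 2 * (e / 2) = e * r by rewrite mulr2n; field.
by [].
Qed.

(** The dilation displaces [x] by $O(1/N)$, which is no more than the order of the width of the
    mollifier. The kernel thus lives in a ball about [x] of radius $O(1/N)$ with values $O(N)$, as
    the Lebesgue point property requires. *)
Lemma moll_cvg_pt f x m (A : R) (lam : nat -> R) : L1 f -> lebesgue_pt f x ->
  (forall n, `|lam n - 1| <= A / n.+1%:R) ->
  moll n.+1%:R (lam n) m f x @[n --> \oo] --> f x.
Proof.
move=> lf lx hlam; have [Cb Cb0 hCb] := bump_bound.
have A0 : 0 <= A by have := le_trans (normr_ge0 _) (hlam 0%N); rewrite divr1.
(* [A * |x - m|] accounts for the displacement; the 2 exceeds the half-width 1 of the bump and keeps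
   the ball strictly larger than the support. *)
pose B := A * `|x - m| + 2; have B0 : 0 < B by rewrite ltr_wpDl// mulr_ge0.
apply/cvgrPdist_le => e e0.
have e'0 : 0 < e / (Cb * B) by rewrite divr_gt0// mulr_gt0.
have [dlt dlt0 hd] := lebesgue_pt_avg lx e'0.
have [n0 hn0] : exists n0, forall n, (n0 <= n)%N -> B / n.+1%:R < dlt.
  exists (Num.truncn (B / dlt)) => n hn.
  rewrite ltr_pdivrMr ?ltr0n// mulrC -ltr_pdivrMr//.
  by apply: (lt_le_trans (truncnS_gt _)); rewrite ler_nat.
exists n0 => // n /= /hn0 rd; set N : R := n.+1%:R in rd *; have N0 : 0 < N by rewrite ltr0n.
have r0 : 0 < B / N by rewrite divr_gt0.
set y := m + lam n * (x - m).
have yx : `|y - x| <= A * `|x - m| / N.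
  have -> : y - x = (lam n - 1) * (x - m) by rewrite /y; ring.
  by rewrite normrM mulrAC ler_wpM2r// hlam.
have lin (q1 q2 q3 q4 : R) : q1 + (q4 + q4) <= q2 + q3 -> q2 <= q1 -> 0 < q4 -> q4 < q3.
  by move=> *; lra.
have supp (z : R) : ~ ball x (B / N) z -> molk N (y - z) = 0.
  move=> nb; have [_ m1 m2] := test_molk N0.
  have : N^-1 < `|y - z|.
    have h1 : B / N <= `|x - z| by rewrite leNgt; apply/negP.
    have h2 : `|x - z| <= `|y - x| + `|y - z|.
      by rewrite -[`|y - x|]distrC (le_trans _ (ler_normD _ _))// addrA subrK.
    have h3 : B / N = A * `|x - m| / N + 2 / N by rewrite /B mulrDl.
    have h4 : 0 < N^-1 by rewrite invr_gt0.
    have h5 : 2 / N = N^-1 + N^-1 by rewrite mulr_natl mulr2n.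
    rewrite h5 in h3; move: (le_trans h1 h2) yx h4; rewrite h3.
    exact: lin.
  have [h0|h0] := leP 0 (y - z); first by rewrite (ger0_norm h0); exact: m2.
  by rewrite (ltr0_norm h0) => h; apply: m1; rewrite ltrNr.
have lxc : L1 (fun z => (f z - f x) * molk N (y - z)).
  have := L1B (L1_mul_molk y N0 lf) (L1Zl (f x) (L1_molk y N0)).
  by apply: eq_integrable => // z _ /=; rewrite mulrBl.
have -> : f x - moll N (lam n) m f x = - \int[mu]_z ((f z - f x) * molk N (y - z)).
  under eq_Rintegral do rewrite mulrBl.
  rewrite RintegralB//; [|exact: L1_mul_molk|by apply: L1Zl; exact: L1_molk].
  rewrite RintegralZl//; last exact: L1_molk.
  by rewrite molk_int_shift// mulr1 opprB.
rewrite normrN; apply: (le_trans (le_normr_Rintegral measurableT lxc)).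
have mfx : measurable_fun setT (fun z => `|f z - f x|).
  apply: measurableT_comp => //; apply: measurable_funB => //; exact: L1_measurable.
rewrite -lee_fin /Rintegral fineK; last first.
  by apply: integrable_fin_num => //; exact: L1_abs lxc.
apply: (@le_trans _ _ (\int[mu]_(z in ball x (B / N)) ((N * Cb)%:E * `|f z - f x|%:E))%E).
  rewrite [leRHS]integral_mkcond; apply: ge0_le_integral => //.
  - by apply/measurable_EFinP; exact: L1_measurable (L1_abs lxc).
  - apply/(measurable_restrictT _ (measurable_ball _ _)).
    apply: emeasurable_funM => //; apply/measurable_EFinP; exact: measurable_funTS.
  - move=> z _; rewrite patchE normrM; case: ifPn => [_|].
      rewrite -EFinM lee_fin mulrC ler_wpM2r// ger0_norm ?molk_ge0 ?(ltW N0)//.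
      by apply: hCb; exact: ltW.
    by rewrite notin_setE => /supp ->; rewrite normr0 mulr0.
rewrite ge0_integralZl//; first last.
- by rewrite lee_fin mulr_ge0// ltW.
- by apply/measurable_EFinP; exact: measurable_funTS.
- exact: measurable_ball.
apply: (@le_trans _ _ ((N * Cb)%:E * (e / (Cb * B) * (B / N))%:E)%E).
  rewrite lee_wpmul2l ?lee_fin ?mulr_ge0 ?(ltW N0) ?(ltW Cb0)//.
  exact: hd.
rewrite -EFinM lee_fin le_eqVlt; apply/orP; left; apply/eqP.
by field; rewrite !gt_eqF.
Qed.

Lemma conv_mollB f g N y : 0 < N -> L1 f -> L1 g ->
  conv (fun x => f x - g x) (molk N) y = conv f (molk N) y - conv g (molk N) y.
Proof.
move=> N0 lf lg; rewrite /conv -RintegralB//; [|exact: L1_mul_molk|exact: L1_mul_molk].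
by apply: eq_Rintegral => z _; rewrite mulrBl.
Qed.

Lemma supp_patch f c d : (forall x, ~ (c <= x <= d) -> f x = 0) ->
  f \_ `](c - 1), (d + 1)[ = f.
Proof.
move=> f0; apply/funext => x; rewrite patchE; case: ifPn => //.
rewrite notin_setE/= in_itv/= => h; rewrite f0// => /andP[h1 h2]; apply: h.
by apply/andP; split; lra.
Qed.

Lemma Lp_supp_L1 p f c d : 1 < p -> Lp p f -> (forall x, ~ (c <= x <= d) -> f x = 0) -> L1 f.
Proof.
move=> p1 lf f0; rewrite -(supp_patch f0); apply: (Lp_L1 p1).
by rewrite supp_patch.
Qed.

Lemma Np_cvg0P p (w : nat -> R -> R) : Np p (w n) @[n --> \oo] --> 0 <->
  forall e, 0 < e -> exists n0, forall n, (n0 <= n)%N -> Np p (w n) < e.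
Proof.
have E n : `|0 - Np p (w n)| = Np p (w n) by rewrite sub0r normrN ger0_norm// Np_ge0.
split=> [/cvgrPdist_lt cw e e0|h].
  by have [n0 _ hn] := cw _ e0; exists n0 => n /hn /=; rewrite E.
apply/cvgrPdist_lt => e e0; have [n0 hn] := h _ e0.
by exists n0 => // n /= /hn; rewrite E.
Qed.

(** Dominated convergence: the differences are bounded by [2 * K] and, since the dilation ratios are
    at least $1/2$, they all vanish outside one fixed interval. *)
Lemma moll_cvg_bounded p f c d (K : R) m (A : R) (lam : nat -> R) : 1 < p ->
  measurable_fun setT f -> (forall x, `|f x| <= K) ->
  (forall x, ~ (c <= x <= d) -> f x = 0) ->
  (forall n, `|lam n - 1| <= A / n.+1%:R) -> (forall n, 2^-1 <= lam n) ->
  Np p (fun x => moll n.+1%:R (lam n) m f x - f x) @[n --> \oo] --> 0.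
Proof.
move=> p1 mf fK f0 hlam lam2; have p0 : 0 < p by exact: lt_trans p1.
have lf : L1 f by exact: L1_bounded mf fK f0.
have lpf : Lp p f by apply: (Lp_bounded p1 mf fK f0).
have K0 : 0 <= K by exact: le_trans (fK 0).
have lam0 n : 0 < lam n by apply: lt_le_trans (lam2 n); rewrite invr_gt0.
have N0 n : 0 < n.+1%:R :> R by rewrite ltr0n.
have lpm n : Lp p (moll n.+1%:R (lam n) m f).
  by have [] := Lp_Np_moll m p1 (N0 n) (lam0 n) lf lpf.
suff : Np p (fun x => moll n.+1%:R (lam n) m f x - f x) @[n --> \oo] --> \int[mu]_x (0 : R).
  by rewrite Rintegral_cst// mul0r.
(* [S] bounds the distance from [m] to the support of [f] widened by 1, the largest scale of
   mollification; undoing a ratio of at least $1/2$ at most doubles it. *)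
have [S [S1 cS dS]] : exists S : R, [/\ 1 <= S, - S <= c - 1 - m & d + 1 - m <= S].
  exists (`|c| + `|d| + `|m| + 1); split; first by rewrite lerDr !addr_ge0.
    have := ler_norm (- c); have := ler_norm m; have := normr_ge0 d.
    by rewrite normrN; lra.
  have := ler_norm d; have := ler_norm (- m); have := normr_ge0 c.
  by rewrite normrN; lra.
pose g x := (2 * K) `^ p * \1_(`[m - 2 * S, m + 2 * S]%classic) x.
have out n x : ~ (m - 2 * S <= x <= m + 2 * S) -> moll n.+1%:R (lam n) m f x - f x = 0.
  move=> hx.
  have -> : f x = 0 by apply: f0 => /andP[h1 h2]; apply: hx; apply/andP; split; lra.
  rewrite subr0 /moll (conv_molk_supp (N0 n) f0)// => /andP[h1 h2]; apply: hx.
  have n1 : n.+1%:R^-1 <= 1 :> R by rewrite invf_le1// ler1n.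
  have h3 : - S <= lam n * (x - m).
    by move: (n.+1%:R^-1) (lam n * (x - m)) h1 h2 n1 => I q h1 h2 n1; lra.
  have h4 : lam n * (x - m) <= S.
    by move: (n.+1%:R^-1) (lam n * (x - m)) h1 h2 n1 => I q h1 h2 n1; lra.
  have l2 := lam2 n; apply/andP; split.
    rewrite leNgt; apply/negP => h5; move: h3; rewrite leNgt => /negP; apply.
    have : lam n * (x - m) < lam n * (- (2 * S)) by rewrite ltr_pM2l//; lra.
    have : 2^-1 * (2 * S) <= lam n * (2 * S) by rewrite ler_wpM2r//; lra.
    by rewrite mulKf// mulrN; lra.
  rewrite leNgt; apply/negP => h5; move: h4; rewrite leNgt => /negP; apply.
  have : lam n * (2 * S) < lam n * (x - m) by rewrite ltr_pM2l//; lra.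
  have : 2^-1 * (2 * S) <= lam n * (2 * S) by rewrite ler_wpM2r//; lra.
  by rewrite mulKf//; lra.
apply: (@Rdominated_cvg _ _ _ g).
- by move=> n; apply: measurable_powR_abs; have [] := LpB p1 (lpm n) lpf.
- exact: measurable_cst.
- have loc : locally_integrable setT f.
    by apply: open_integrable_locally => //; exact: openT.
  apply: (aeS _ (lebesgue_differentiation loc)) => x lx.
  have := moll_cvg_pt m lf lx hlam => h.
  apply: cvg_powR0 => //.
  rewrite -(normr0 R) -(subrr (f x)); apply: cvg_norm; apply: cvgB => //.
  exact: cvg_cst.
- apply: L1Zl; apply: (@L1_bounded _ _ (m - 2 * S) (m + 2 * S) 1).
  + exact: measurable_indic.
  + by move=> x; rewrite indicE; case: (_ \in _); rewrite ?normr1 ?normr0.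
  + by move=> x hx; rewrite indicE memNset//= in_itv.
- move=> n x; rewrite ger0_norm ?powR_ge0// /g indicE mem_setE in_itv/=.
  case: (boolP (_ <= x <= _)) => [_|/negP hx]; last first.
    by rewrite out// normr0 powR0 ?gt_eqF// mulr0.
  rewrite mulr1; apply: ge0_ler_powR; rewrite ?nnegrE ?(ltW p0)//.
    by rewrite mulr_ge0.
  rewrite (le_trans (ler_normB _ _))// mulr_natl mulr2n lerD//.
  exact: conv_molk_bounded.
Qed.

Lemma Np_truncation p f : 1 < p -> Lp p f ->
  Np p (fun x => f x - (f \_ [set y | `|f y| <= n%:R]) x) @[n --> \oo] --> 0 /\
  forall n : nat, measurable [set y | `|f y| <= n%:R].
Proof.
move=> p1 lpf; have [mf lf] := lpf; have p0 : 0 < p by exact: lt_trans p1.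
have mS n : measurable [set y | `|f y| <= n%:R].
  have mfa : measurable_fun setT (fun x => `|f x|) by exact: measurableT_comp.
  have := mfa measurableT _ (measurable_itv `]-oo, n%:R]).
  by rewrite setTI; congr measurable; apply/seteqP; split => x /=; rewrite in_itv.
split=> //; suff : Np p (fun x => f x - (f \_ [set y | `|f y| <= n%:R]) x) @[n --> \oo] --> \int[mu]_x (0 : R).
  by rewrite Rintegral_cst// mul0r.
apply: (@Rdominated_cvg _ _ _ (fun x => `|f x| `^ p)) => //.
- move=> n; apply: measurable_powR_abs.
  by have [] := LpB p1 lpf (Lp_patch p1 (mS n) lpf).
- apply: aeW => x; apply: cvg_near_cst; near=> n.
  rewrite patchE mem_set ?subrr ?normr0 ?powR0 ?gt_eqF//=.
  near: n; exists (Num.truncn `|f x|).+1 => // n /= hn.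
  by rewrite ltW// (lt_le_trans (truncnS_gt _))// ler_nat.
- move=> n x; rewrite ger0_norm ?powR_ge0// patchE; case: ifP => _.
    by rewrite subrr normr0 powR0 ?gt_eqF// powR_ge0.
  by rewrite subr0.
Unshelve. all: by end_near. Qed.

(** [f] is split into a bounded truncation and a remainder of small norm. Mollified dilations are
    uniformly bounded on $L^p$, by [Lp_Np_moll], so the remainder stays small. *)
Lemma moll_cvg p f c d m (A : R) (lam : nat -> R) : 1 < p -> Lp p f ->
  (forall x, ~ (c <= x <= d) -> f x = 0) ->
  (forall n, `|lam n - 1| <= A / n.+1%:R) -> (forall n, 2^-1 <= lam n) ->
  Np p (fun x => moll n.+1%:R (lam n) m f x - f x) @[n --> \oo] --> 0.
Proof.
have lin (q r s : R) : q <= 2 * r -> r < s -> q + r <= (2 + 1) * s by move=> *; lra.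
move=> p1 lpf f0 hlam lam2; have [mf _] := lpf.
have lam0 n : 0 < lam n by apply: lt_le_trans (lam2 n); rewrite invr_gt0.
have N0 n : 0 < n.+1%:R :> R by rewrite ltr0n.
have lf := Lp_supp_L1 p1 lpf f0.
have P0 : 0 < 2 `^ p :> R by exact: powR_gt0.
have [ct mS] := Np_truncation p1 lpf.
apply/Np_cvg0P => e e0.
(* Solves $2^p(\delta+2^p(2+1)\delta)=e$, the total of the two quasi-triangle inequalities below. *)
pose dl := e / (2 `^ p * (2 `^ p * (2 + 1)) + 2 `^ p).
have D0 : 0 < 2 `^ p * (2 `^ p * (2 + 1)) + 2 `^ p :> R.
  by rewrite addr_gt0// mulr_gt0// mulr_gt0.
have dl0 : 0 < dl by rewrite divr_gt0.
have [n1 /(_ n1 (leqnn _)) hg] := (Np_cvg0P _ _).1 ct _ dl0.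
pose h := f \_ [set y | `|f y| <= n1%:R]; pose g x := f x - h x.
have lph : Lp p h by exact: Lp_patch.
have h0 x : ~ (c <= x <= d) -> h x = 0.
  by rewrite /h patchE; case: ifP => // _; exact: f0.
have lh := Lp_supp_L1 p1 lph h0.
have hK x : `|h x| <= n1%:R by rewrite /h patchE; case: ifPn => [/set_mem//|_]; rewrite normr0.
have lpg : Lp p g by exact: LpB.
have lg : L1 g by exact: L1B.
have [mh _] := lph.
have := moll_cvg_bounded m p1 mh hK h0 hlam lam2.
move=> /Np_cvg0P /(_ _ dl0)[n2 hn2]; exists n2 => n /hn2 hn.
have [l1 l2] := Lp_Np_moll m p1 (N0 n) (lam0 n) lg lpg.
have [l3 _] := Lp_Np_moll m p1 (N0 n) (lam0 n) lh lph.
have -> : (fun x => moll n.+1%:R (lam n) m f x - f x) =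
    (fun x => (moll n.+1%:R (lam n) m h x - h x) + (moll n.+1%:R (lam n) m g x - g x)).
  by apply/funext => x; rewrite {3}/moll conv_mollB// -!/(moll _ _ _ _ _) /g; ring.
apply: (le_lt_trans (NpD p1 (LpB p1 l3 lph) (LpB p1 l1 lpg))).
have hg2 := NpB p1 l1 lpg.
have l4 : (lam n)^-1 <= 2 by rewrite -[leRHS]invrK lef_pV2 ?posrE.
have hg3 : Np p (moll n.+1%:R (lam n) m g) <= 2 * Np p g.
  by apply: (le_trans l2); rewrite ler_wpM2r// Np_ge0.
have hg4 : Np p (fun x => moll n.+1%:R (lam n) m g x - g x) <= 2 `^ p * (2 + 1) * dl.
  apply: (le_trans hg2); rewrite -mulrA ler_wpM2l ?(ltW P0)//.
  exact: lin hg3 hg.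
have -> : e = 2 `^ p * (dl + 2 `^ p * (2 + 1) * dl).
  by rewrite /dl; field; rewrite gt_eqF.
by rewrite ltr_pM2l// ltr_leD.
Qed.

End mollifier.

(** * Young's inequality with a parameter *)

Section young.
Context {R : realType} (p : R) (p1 : 1 < p).
Notation mu := (@lebesgue_measure R).
Implicit Types (f g : R -> R) (e : R).

Let p0 : 0 < p. Proof. exact: lt_trans p1. Qed.
Let q := p / (p - 1).

Lemma young_eps (e x y : R) : 0 < e ->
  `|x * y| <= (e^-1) `^ p * `|x| `^ p + e `^ q * `|y| `^ q.
Proof.
move=> e0; have q0 : 0 < q by rewrite divr_gt0// subr_gt0.
have pm : p - 1 != 0 by rewrite gt_eqF// subr_gt0.
have pq : p^-1 + q^-1 = 1 by rewrite /q invf_div mulrBl divff ?gt_eqF// mul1r addrC subrK.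
have e0' : 0 <= e^-1 by rewrite invr_ge0 ltW.
have := @conjugate_powR R (e^-1 * `|x|) (e * `|y|) p q.
rewrite !mulr_ge0 ?(ltW e0)// => /(_ isT isT p0 q0 pq).
rewrite mulrACA mulVf ?gt_eqF// mul1r -normrM => h; apply: (le_trans h).
rewrite !powRM ?(ltW e0)// lerD//.
  by rewrite ler_piMr ?mulr_ge0 ?powR_ge0// invf_le1// ltW.
rewrite ler_piMr ?mulr_ge0 ?powR_ge0// -pq lerDr invr_ge0 ltW//.
Qed.

(** Stands in for Hölder's inequality: a small [e] weakens the contribution of [g], after which a
    small [Np p f] takes care of the other term. *)
Lemma young_int f g e : 0 < e -> Lp p f -> measurable_fun setT g ->
  L1 (fun x => `|g x| `^ q) ->
  L1 (fun x => f x * g x) /\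
  `|\int[mu]_x (f x * g x)| <=
    (e^-1) `^ p * Np p f + e `^ q * \int[mu]_x (`|g x| `^ q).
Proof.
move=> e0 [mf lf] mg lg.
have ll : L1 (fun x => (e^-1) `^ p * `|f x| `^ p + e `^ q * `|g x| `^ q).
  by apply: L1D; exact: L1Zl.
have l : L1 (fun x => f x * g x).
  by apply: (L1_le _ _ ll); [exact: measurable_funM|move=> x; exact: young_eps].
split=> //; apply: (le_trans (le_normr_Rintegral measurableT l)).
rewrite /Np -RintegralZl// -RintegralZl// -RintegralD//; [|exact: L1Zl|exact: L1Zl].
by apply: le_Rintegral => //; [exact: L1_abs|move=> x _; exact: young_eps].
Qed.

End young.

(** * Density of test functions in L^p *)

Section test_density.
Context {R : realType} (a b p : R) (ab : a < b) (p1 : 1 < p).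
Local Notation O := (`]a, b[%classic).

Lemma moll_test (N lam m c d : R) (f : R -> R) : 0 < N -> 0 < lam -> L1 f ->
  (forall x, ~ (c <= x <= d) -> f x = 0) ->
  is_test (m + (c - N^-1 - m) / lam) (m + (d + N^-1 - m) / lam) (moll N lam m f).
Proof.
move=> N0 l0 lf f0; split.
- move=> n; have C := Cn_conv n lf (test_molk N0).
  have := @Cn_affine R setT setT n (conv f (molk N)) lam (m - lam * m) (fun _ _ => I) C.
  by apply: Cn_on => [|x _]; [exact: openT|rewrite -mollE].
- move=> x; rewrite -ltrBlDl ltr_pdivlMr// => h; rewrite /moll (conv_molk_supp N0 f0)//.
  by move=> /andP[h1 h2]; move: h1; rewrite leNgt => /negP; apply; rewrite -ltrBrDl mulrC.
- move=> x; rewrite -ltrBrDl ltr_pdivrMr// => h; rewrite /moll (conv_molk_supp N0 f0)//.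
  by move=> /andP[h1 h2]; move: h2; rewrite leNgt => /negP; apply; rewrite -ltrBlDl mulrC.
Qed.

(* Ratio of the dilation at scale [1 / (n + 1)]: the support of the mollified
   function stays away from the end points. *)
Definition lamn (n : nat) : R := 1 + 4 / (b - a) / n.+1%:R.

Local Notation mid := ((a + b) / 2).

Let ba : 0 < b - a. Proof. by rewrite subr_gt0. Qed.

Lemma lamn_ge1 n : 1 < lamn n.
Proof. by rewrite /lamn ltrDl !divr_gt0. Qed.

Lemma lamn_gt0 n : 0 < lamn n.
Proof. exact: lt_trans (lamn_ge1 n). Qed.

Lemma lamn_ge n : 2^-1 <= lamn n.
Proof. by rewrite (le_trans _ (ltW (lamn_ge1 n)))// invf_le1// ler1n. Qed.

Lemma lamnB n : `|lamn n - 1| <= 4 / (b - a) / n.+1%:R.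
Proof. by rewrite /lamn addrAC subrr add0r ger0_norm// ltW// !divr_gt0. Qed.

Lemma moll_test_in n (f : R -> R) : L1 f -> (forall x, ~ (a <= x <= b) -> f x = 0) ->
  exists c d, [/\ a < c, d < b & is_test c d (moll n.+1%:R (lamn n) mid f)].
Proof.
move=> lf f0; have N0 : 0 < n.+1%:R :> R by rewrite ltr0n.
have l0 := lamn_gt0 n; have i0 : 0 < n.+1%:R^-1 :> R by rewrite invr_gt0.
exists (mid + (a - n.+1%:R^-1 - mid) / lamn n), (mid + (b + n.+1%:R^-1 - mid) / lamn n).
(* The 4 in [lamn] gives the dilated half-length a surplus of $2/(n+1)$, of which mollification
   spends $1/(n+1)$. *)
have key : (b - a) / 2 + n.+1%:R^-1 < lamn n * ((b - a) / 2).
  have -> : lamn n * ((b - a) / 2) = (b - a) / 2 + n.+1%:R^-1 + n.+1%:R^-1.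
    by rewrite /lamn; field; rewrite !gt_eqF.
  by rewrite ltrDl.
have T := moll_test mid N0 l0 lf f0.
move: (lamn n) (n.+1%:R^-1) l0 i0 key T => l i l0 i0 key T.
have h1 : a - i - mid = - ((b - a) / 2 + i) by field.
have h2 : b + i - mid = (b - a) / 2 + i by field.
split.
- rewrite -ltrBlDl h1 mulNr ltrNr ltr_pdivrMr//.
  by have -> : - (a - mid) * l = l * ((b - a) / 2) by field.
- rewrite -ltrBrDl h2 ltr_pdivrMr//.
  by have -> : (b - mid) * l = l * ((b - a) / 2) by field.
- exact: T.
Qed.

Lemma test_dense v : Lp p (v \_ O) -> forall e, 0 < e -> exists c d w,
  [/\ a < c, d < b, is_test c d w & Np p (fun x => w x - (v \_ O) x) < e].
Proof.
move=> lv e e0; have v0 x : ~ (a <= x <= b) -> (v \_ O) x = 0.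
  move=> h; rewrite patchE memNset//= in_itv/= => /andP[h1 h2].
  by apply: h; rewrite !ltW.
have := moll_cvg mid p1 lv v0 lamnB lamn_ge => /Np_cvg0P/(_ _ e0)[n /(_ n (leqnn n)) hn].
have [c [d [ac db t]]] := moll_test_in n (Lp_L1 p1 lv) v0.
by exists c, d, (moll n.+1%:R (lamn n) mid (v \_ O)).
Qed.

End test_density.

Lemma dist3_lt (R : realFieldType) (x y z t e : R) :
  `|x - y| < e / 3 -> `|y - z| < e / 3 -> `|t - z| < e / 3 -> `|x - t| < e.
Proof. by rewrite !ltr_norml => /andP[h1 h2] /andP[h3 h4] /andP[h5 h6]; apply/andP; split; lra. Qed.

(** * Potentials of L^p functions *)

Section potential.
Context {R : realType} (a b alpha p : R).
Hypotheses (ab : a < b) (a0 : 0 < alpha) (a1 : alpha < 1) (p1 : 1 < p) (ap : 1 < alpha * p).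
Notation mu := (@lebesgue_measure R).
Local Notation O := (`]a, b[%classic).
Local Notation M := (2 * (b - a)).
Local Notation J := (rlJ a b alpha).
Implicit Types (u v w : R -> R).

Let p0 : 0 < p. Proof. exact: lt_trans p1. Qed.

(** With $q=p/(p-1)$ one has $(\alpha-1)q+1=(\alpha p-1)/(p-1)$, positive exactly when $\alpha
    p>1$. *)
Lemma L1_rlker_powR : L1 (fun t => `|rlker alpha M t| `^ (p / (p - 1))).
Proof.
have q0 : 0 < p / (p - 1) by rewrite divr_gt0// subr_gt0.
have s0 : 0 < (alpha - 1) * (p / (p - 1)) + 1.
  have -> : (alpha - 1) * (p / (p - 1)) + 1 = (alpha * p - 1) / (p - 1).
    by field; rewrite gt_eqF// subr_gt0.
  by rewrite divr_gt0// subr_gt0.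
have := L1_rlker M s0; apply: eq_integrable => // t _ /=.
rewrite ger0_norm ?rlker_ge0// /rlker; case: ifP => _; last by rewrite powR0// gt_eqF.
by rewrite -powRrM addrK.
Qed.

Lemma rlJ_young e v : 0 < e -> Lp p (v \_ O) -> forall x,
  L1 (fun y => (v \_ O) y * rlker alpha M (x - y)) /\
  `|J v x| <= rlconst alpha * ((e^-1) `^ p * Np p (v \_ O) +
     e `^ (p / (p - 1)) * \int[mu]_t (`|rlker alpha M t| `^ (p / (p - 1)))).
Proof.
move=> e0 lv x; have mk := measurable_rlker alpha M.
have mk' : measurable_fun setT (fun y : R => rlker alpha M (x - y)).
  by apply: (measurableT_comp mk); exact: measurable_funB.
have lk' : L1 (fun y => `|rlker alpha M (x - y)| `^ (p / (p - 1))).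
  exact: (L1_reflect x L1_rlker_powR).
have [l1 l2] := young_int p1 e0 lv mk' lk'.
split; first exact: l1.
have c0 := rlconst_gt0 a0 a1.
have <- := Rintegral_reflect x (measurable_powR_abs (p / (p - 1)) mk).
rewrite /rlJ normrM (gtr0_norm c0); apply: ler_wpM2l; first exact: ltW.
exact: l2.
Qed.

Lemma rlJB u v x : Lp p (u \_ O) -> Lp p (v \_ O) ->
  J (fun y => u y - v y) x = J u x - J v x.
Proof.
move=> lu lv; have [l1 _] := rlJ_young ltr01 lu x; have [l2 _] := rlJ_young ltr01 lv x.
rewrite /rlJ -mulrBr; congr (_ * _); rewrite /conv -RintegralB//.
apply: eq_Rintegral => y _; rewrite -mulrBl; congr (_ * _).
by rewrite !patchE; case: ifP => //; rewrite subr0.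
Qed.

Lemma rlJZ k v x : Lp p (v \_ O) -> J (fun y => k * v y) x = k * J v x.
Proof.
move=> lv; have [l _] := rlJ_young ltr01 lv x.
rewrite /rlJ mulrCA; congr (_ * _); rewrite /conv -RintegralZl//.
apply: eq_Rintegral => y _; rewrite mulrA; congr (_ * _).
by rewrite !patchE; case: ifP => //; rewrite mulr0.
Qed.

(** Uniform smallness of potentials, from Young's inequality: the parameter is fixed by the kernel
    term, and then [dl] by the term in [v]. *)
Lemma rlJ_small (e : R) : 0 < e -> exists2 dl, 0 < dl &
  forall v, Lp p (v \_ O) -> Np p (v \_ O) < dl -> forall x, `|J v x| < e.
Proof.
move=> e0; set K := \int[mu]_t (`|rlker alpha M t| `^ (p / (p - 1))).
have K0 : 0 <= K by apply: Rintegral_ge0 => t _; exact: powR_ge0.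
have c0 := rlconst_gt0 a0 a1; set c := rlconst alpha in c0.
have q0 : 0 < p / (p - 1) by rewrite divr_gt0// subr_gt0.
(* Makes the kernel term at most [e / 2]; [K + 1] in place of [K] keeps the denominator positive. *)
pose r := (e / 2 / (c * (K + 1))) `^ (p / (p - 1))^-1.
have D0 : 0 < c * (K + 1) by rewrite mulr_gt0// ltr_wpDl.
have r0 : 0 < r by rewrite powR_gt0// !divr_gt0.
have rq : r `^ (p / (p - 1)) = e / 2 / (c * (K + 1)).
  by rewrite /r powR_VK// ltW// !divr_gt0.
have P0 : 0 < (r^-1) `^ p by rewrite powR_gt0// invr_gt0.
exists (e / 2 / (c * r^-1 `^ p)); first by rewrite !divr_gt0// mulr_gt0.
move=> v lv hv x; have [_ h] := rlJ_young r0 lv x; apply: (le_lt_trans h).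
rewrite -/K -/c rq mulrDr [ltRHS](_ : e = e / 2 + e / 2); last by field.
apply: ltr_leD.
  by rewrite mulrA mulrC -ltr_pdivlMr// mulr_gt0.
rewrite mulrA (_ : c * (e / 2 / (c * (K + 1))) = e / 2 / (K + 1)); last first.
  by field; rewrite !gt_eqF ?ltr_wpDl.
rewrite -mulrA ler_piMr ?divr_ge0 ?(ltW e0)// mulrC ler_pdivrMr ?ltr_wpDl// mul1r.
by rewrite lerDl.
Qed.

Lemma test_conv_continuous (c d : R) w : is_test c d w -> continuous (conv w (rlker alpha M)).
Proof.
move=> tw x; have lk := L1_rlker M a0.
have -> : conv w (rlker alpha M) = conv (rlker alpha M) w.
  by apply/funext => y; apply: convC; [exact: test_measurable tw|exact: measurable_rlker].
exact: (Cn_continuous (Cn_conv 1 lk tw)).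
Qed.

Lemma rlJ_test (c d : R) w : a < c -> d < b -> is_test c d w ->
  J w = fun x => rlconst alpha * conv w (rlker alpha M) x.
Proof. by move=> ac db tw; rewrite /rlJ (test_restrict ac db tw). Qed.

(** A uniform limit of potentials of test functions, which are continuous. *)
Lemma rlJ_continuous v : Lp p (v \_ O) -> continuous (J v).
Proof.
move=> lv x; apply/cvgrPdist_lt => e e0.
have e30 : 0 < e / 3 by rewrite divr_gt0.
have [dl dl0 hJ] := rlJ_small e30.
have [c [d [w [ac db tw hw]]]] := test_dense ab p1 lv dl0.
have lw : Lp p (w \_ O) by rewrite (test_restrict ac db tw); exact: test_Lp tw.
have hd y : `|J v y - J w y| < e / 3.
  rewrite -(rlJB y lv lw); apply: hJ.
    rewrite (_ : _ \_ _ = fun y => (v \_ O) y - (w \_ O) y); first exact: LpB.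
    by apply/funext => z; rewrite !patchE; case: ifP => //; rewrite subr0.
  rewrite (_ : _ \_ _ = fun y => (v \_ O) y - (w \_ O) y).
    by rewrite NpBC (test_restrict ac db tw).
  by apply/funext => z; rewrite !patchE; case: ifP => //; rewrite subr0.
have cJ : {for x, continuous (J w)}.
  rewrite (rlJ_test ac db tw); apply: cvgM; first exact: cvg_cst.
  exact: (test_conv_continuous tw).
move/cvgrPdist_lt : cJ => /(_ _ e30); apply: filterS => y hy.
exact: dist3_lt (hd x) hy (hd y).
Qed.

End potential.

Section ae_limits.
Context {R : realType}.
Notation mu := (@lebesgue_measure R).
Implicit Types (f g : R -> R) (a b x y l : R).

Lemma ae_exists_in x y (P : R -> Prop) : x < y -> {ae mu, forall z, P z} ->
  exists z, x < z < y /\ P z.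
Proof.
move=> xy [N [mN N0 hN]]; apply: contrapT => nex.
have sub : `]x, y[%classic `<=` N.
  move=> z; rewrite /= in_itv/= => zxy; apply: hN => /= Pz; apply: nex; by exists z.
have : (mu `]x, y[ <= mu N)%E by apply: le_measure => //; rewrite inE.
rewrite N0 lebesgue_measure_itv/= lte_fin xy lee_fin => h.
by move: xy; rewrite -subr_gt0 ltNge h.
Qed.

Lemma ae_eq_lim_right a b f g l l' : a < b -> {ae mu, forall x, a < x < b -> f x = g x} ->
  f x @[x --> a^'+] --> l -> g x @[x --> a^'+] --> l' -> l = l'.
Proof.
move=> ab fg fl gl; apply/eqP; rewrite -subr_eq0; apply/negPn/negP => ll.
have d0 : 0 < `|l - l'| by rewrite normr_gt0.
have /cvgrPdist_lt/(_ _ d0) : (fun x => f x - g x) x @[x --> a^'+] --> l - l' by exact: cvgB.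
move=> /nbhs_ballP[e /= e0 he].
have [|z [/andP[az zb] h]] := @ae_exists_in a (Num.min b (a + e)) _ _ fg.
  by rewrite lt_min ab ltrDl.
move: zb; rewrite lt_min => /andP[zb ze].
have := he z; rewrite /ball/= ltr0_norm ?subr_lt0// opprB ltrBlDl => /(_ ze az).
by rewrite h ?az// subrr subr0 ltxx.
Qed.

Lemma ae_eq_lim_left a b f g l l' : a < b -> {ae mu, forall x, a < x < b -> f x = g x} ->
  f x @[x --> b^'-] --> l -> g x @[x --> b^'-] --> l' -> l = l'.
Proof.
move=> ab fg fl gl; apply/eqP; rewrite -subr_eq0; apply/negPn/negP => ll.
have d0 : 0 < `|l - l'| by rewrite normr_gt0.
have /cvgrPdist_lt/(_ _ d0) : (fun x => f x - g x) x @[x --> b^'-] --> l - l' by exact: cvgB.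
move=> /nbhs_ballP[e /= e0 he].
have [|z [/andP[az zb] h]] := @ae_exists_in (Num.max a (b - e)) b _ _ fg.
  by rewrite gt_max ab ltrBlDr ltrDl.
move: az; rewrite gt_max => /andP[az ze].
have := he z; rewrite /ball/= gtr0_norm ?subr_gt0// ltrBlDr addrC -ltrBlDr => /(_ ze zb).
by rewrite h ?az// subrr subr0 ltxx.
Qed.

Lemma ae_reflect (P : R -> Prop) d : {ae mu, forall x, P x} -> {ae mu, forall x, P (d - x)}.
Proof.
move=> [N [mN N0 hN]].
have md : measurable_fun setT (fun x : R => d - x) by exact: measurable_funB.
exists ((fun x => d - x) @^-1` N); split.
- by rewrite -[X in measurable X]setTI; exact: md.
- have N1 : (-1 : R) != 0 by rewrite oppr_eq0 oner_neq0.
  have h := @ge0_integral_reflect R (EFin \o \1_N) d.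
  have mi : measurable_fun [set: R] (EFin \o (\1_N : R -> R)).
    by apply/measurable_EFinP; exact: measurable_indic.
  have {}h := h mi (fun x => _).
  rewrite -[RHS]N0 -[X in _ = mu X]setIT -(integral_indic mu measurableT mN) -h.
    rewrite -[in LHS](setIT (_ @^-1` _)) -integral_indic//.
    by rewrite -[X in measurable X]setTI; exact: md.
  by move=> x; rewrite /= lee_fin indicE.
- by move=> x /= nP; apply: (hN (d - x)).
Qed.

End ae_limits.

(** * Pairs of a function and its weak derivative *)

Section weak_pairs.
Context {R : realType} (a b alpha p : R).
Hypotheses (ab : a < b) (a0 : 0 < alpha) (a1 : alpha < 1) (p1 : 1 < p).
Notation mu := (@lebesgue_measure R).
Local Notation O := (`]a, b[%classic).
Local Notation J := (rlJ a b alpha).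
Local Notation refl := (refl_itv a b).
Implicit Types (u v w f g : R -> R) (s : side).

Let p0 : 0 < p. Proof. exact: lt_trans p1. Qed.

(** The derivative is carried along explicitly, so that algebra and limits do not go through the
    representative chosen by [weak_fracD]. *)
Definition weak_pair s u v :=
  [/\ Lp p (u \_ O), Lp p (v \_ O) & is_weak_fracD a b s alpha u v].

Lemma patchB f g (D : set R) : (f \- g) \_ D = (fun x => (f \_ D) x - (g \_ D) x).
Proof. by apply/funext => x; rewrite !patchE; case: ifP => //=; rewrite subr0. Qed.

Lemma Wside_pair s u : Wside a b s alpha p u <-> exists v, weak_pair s u v.
Proof.
split=> [[/(LpOmegaP p1) lu [v h /(LpOmegaP p1) lv]]|[v [/(LpOmegaP p1) lu /(LpOmegaP p1) lv h]]].
  by exists v.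
by split=> //; exists v.
Qed.

Lemma refl_Lp f : Lp p (f \_ O) -> Lp p (refl f \_ O).
Proof. by rewrite refl_itv_patch; exact: Lp_reflect. Qed.

Lemma refl_LpE f : Lp p (refl f \_ O) <-> Lp p (f \_ O).
Proof. by split=> [/refl_Lp|/refl_Lp//]; rewrite refl_itvK. Qed.

Lemma refl_Np f : Lp p (f \_ O) -> Np p (refl f \_ O) = Np p (f \_ O).
Proof. by move=> [mf _]; rewrite refl_itv_patch; exact: Np_reflect. Qed.

Lemma weak_pair_refl u v : weak_pair Fplus u v <-> weak_pair Fminus (refl u) (refl v).
Proof.
split=> [[lu lv h]|[/refl_LpE lu /refl_LpE lv h]].
  split; [exact: refl_Lp|exact: refl_Lp|].
  by apply/(weak_refl ab a0 a1) => //; exact: (Lp_L1 p1).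
by split=> //; apply/(weak_refl ab a0 a1) => //; exact: (Lp_L1 p1).
Qed.

Lemma weak_pair_minusP u v : weak_pair Fminus u v <->
  [/\ Lp p (u \_ O), Lp p (v \_ O) & exists C, {ae mu, forall x, a < x < b ->
    u x = C * (x - a) `^ (alpha - 1) + J v x}].
Proof.
split=> -[lu lv h]; split=> //.
  by apply/(weak_minusP ab a0 a1) => //; exact: (Lp_L1 p1).
by apply/(weak_minusP ab a0 a1) => //; exact: (Lp_L1 p1).
Qed.

(** Only almost everywhere: this uses convergence of the convolutions by Fubini, not the pointwise
    Young bound. *)
Lemma rlJB1 u v : Lp p (u \_ O) -> Lp p (v \_ O) ->
  {ae mu, forall x, J (u \- v) x = J u x - J v x}.
Proof.
move=> lu lv; have lk := L1_rlker (2 * (b - a)) a0.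
have h1 := conv_ae_L1 (Lp_L1 p1 lu) lk; have h2 := conv_ae_L1 (Lp_L1 p1 lv) lk.
apply: (aeS2 _ h1 h2) => x l1 l2.
rewrite /rlJ -mulrBr; congr (_ * _); rewrite /conv -RintegralB//.
by apply: eq_Rintegral => y _; rewrite -mulrBl patchB.
Qed.

Lemma weak_pairB_minus u1 v1 u2 v2 : weak_pair Fminus u1 v1 -> weak_pair Fminus u2 v2 ->
  weak_pair Fminus (u1 \- u2) (v1 \- v2).
Proof.
move=> /weak_pair_minusP[lu1 lv1 [C1 h1]] /weak_pair_minusP[lu2 lv2 [C2 h2]].
apply/weak_pair_minusP; split; [by rewrite patchB; exact: LpB|by rewrite patchB; exact: LpB|].
exists (C1 - C2); apply: (aeS2 _ (rlJB1 lv1 lv2) (aeS2 (fun x p q => conj p q) h1 h2)).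
by move=> x -> [e1 e2] xab; rewrite /= e1// e2//; ring.
Qed.

Lemma weak_pairB s u1 v1 u2 v2 : weak_pair s u1 v1 -> weak_pair s u2 v2 ->
  weak_pair s (u1 \- u2) (v1 \- v2).
Proof.
case: s; first exact: weak_pairB_minus.
move=> /weak_pair_refl h1 /weak_pair_refl h2; apply/weak_pair_refl.
exact: (weak_pairB_minus h1 h2).
Qed.

(** Weak derivatives are unique almost everywhere, so the representative picked by [xget] has the
    same [Np] as [v]. *)
Lemma weak_pair_norm s u v : weak_pair s u v ->
  WsideNorm a b s alpha p u = ((Np p (u \_ O) + Np p (v \_ O)) `^ p^-1)%:E.
Proof.
move=> [lu lv h]; rewrite /WsideNorm (LpNorm_powR p1 lu).
set v' := weak_fracD a b s alpha u.
have h' : is_weak_fracD a b s alpha u v'.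
  exact: (@xgetPex _ (fun=> 0) [set v | is_weak_fracD a b s alpha u v] (ex_intro _ v h)).
have vv : {ae mu, forall x, (v \_ O) x = (v' \_ O) x}.
  apply: (aeS _ (weak_fracD_unique h h')) => x e; rewrite !patchE; case: ifPn => //.
  by rewrite inE/= in_itv/= => /e.
have mv' : measurable_fun setT (v' \_ O).
  by apply/(measurable_restrictT _ (measurable_itv _)); have [_ []] := h'.
have lv' := ae_Lp lv mv' vv.
by rewrite (LpNorm_powR p1 lv') -EFinD/= -(ae_Np p _ _ vv)//; have [] := lv.
Qed.

Lemma weak_pair_norm_lt s u v (e : R) : weak_pair s u v -> 0 < e ->
  (WsideNorm a b s alpha p u < e%:E)%E ->
  Np p (u \_ O) < e `^ p /\ Np p (v \_ O) < e `^ p.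
Proof.
move=> h e0; rewrite (weak_pair_norm h) lte_fin => hlt.
have N1 := Np_ge0 p (u \_ O); have N2 := Np_ge0 p (v \_ O).
have S0 := addr_ge0 N1 N2.
have : Np p (u \_ O) + Np p (v \_ O) < e `^ p.
  rewrite -(powR_VK p0 S0); apply: gt0_ltr_powR => //; rewrite nnegrE ?powR_ge0//.
  exact: ltW.
move: N1 N2; move: (Np _ _) (Np _ _) => n1 n2 {S0 hlt} N1 N2 hS.
by split; apply: le_lt_trans hS; lra.
Qed.

Lemma cvg0D (f g : nat -> R) : f n @[n --> \oo] --> 0 -> g n @[n --> \oo] --> 0 ->
  f n + g n @[n --> \oo] --> 0.
Proof. by move=> cf cg; rewrite -[X in _ --> X]addr0; exact: cvgD. Qed.

Lemma cvg_norm_powR (S : nat -> R) : (forall n, 0 <= S n) -> S n @[n --> \oo] --> 0 ->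
  ((S n `^ p^-1)%:E @[n --> \oo] --> 0)%E.
Proof.
move=> S0 cS; apply: cvg_EFin; first exact: nearW.
by apply: cvg_powR0 => //; rewrite invr_gt0.
Qed.

Lemma weak_pair_cvg s (u v : nat -> R -> R) u0 v0 :
  (forall n, weak_pair s (u n) (v n)) -> weak_pair s u0 v0 ->
  Np p (fun x => (u n \_ O) x - (u0 \_ O) x) @[n --> \oo] --> 0 ->
  Np p (fun x => (v n \_ O) x - (v0 \_ O) x) @[n --> \oo] --> 0 ->
  WsideNorm a b s alpha p (u n \- u0) @[n --> \oo] --> 0%E.
Proof.
move=> hn h0 cu cv.
have -> : (fun n => WsideNorm a b s alpha p (u n \- u0)) = (fun n =>
    ((Np p (fun x => (u n \_ O) x - (u0 \_ O) x) +
      Np p (fun x => (v n \_ O) x - (v0 \_ O) x)) `^ p^-1)%:E).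
  by apply/funext => n; rewrite (weak_pair_norm (weak_pairB (hn n) h0)) !patchB.
apply: cvg_norm_powR => [n|]; first by rewrite addr_ge0 ?Np_ge0.
exact: (cvg0D cu cv).
Qed.

Lemma WsymNorm_pair u v w : weak_pair Fminus u v -> weak_pair Fplus u w ->
  WsymNorm a b alpha p u = ((Np p (u \_ O) + Np p (v \_ O) +
    (Np p (u \_ O) + Np p (w \_ O))) `^ p^-1)%:E.
Proof.
move=> h1 h2; rewrite /WsymNorm (weak_pair_norm h1) (weak_pair_norm h2) /=.
have N1 := Np_ge0 p (u \_ O); have N2 := Np_ge0 p (v \_ O); have N3 := Np_ge0 p (w \_ O).
have e1 := powR_VK p0 (addr_ge0 N1 N2); have e2 := powR_VK p0 (addr_ge0 N1 N3).
by apply: (congr1 (fun x => (x `^ p^-1)%:E)); exact: (congr2 +%R e1 e2).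
Qed.

Lemma Wsym_pair_norm_lt u v w (e : R) : weak_pair Fminus u v -> weak_pair Fplus u w -> 0 < e ->
  (WsymNorm a b alpha p u < e%:E)%E ->
  [/\ Np p (u \_ O) < e `^ p, Np p (v \_ O) < e `^ p & Np p (w \_ O) < e `^ p].
Proof.
move=> h1 h2 e0; rewrite (WsymNorm_pair h1 h2) lte_fin => hlt.
have N1 := Np_ge0 p (u \_ O); have N2 := Np_ge0 p (v \_ O); have N3 := Np_ge0 p (w \_ O).
have S0 := addr_ge0 (addr_ge0 N1 N2) (addr_ge0 N1 N3).
have : Np p (u \_ O) + Np p (v \_ O) + (Np p (u \_ O) + Np p (w \_ O)) < e `^ p.
  rewrite -(powR_VK p0 S0); apply: gt0_ltr_powR => //; rewrite nnegrE ?powR_ge0//.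
  exact: ltW.
move: N1 N2 N3; move: (Np _ _) (Np _ _) (Np _ _) => n1 n2 n3 {S0 hlt} N1 N2 N3 hS.
by split; apply: le_lt_trans hS; lra.
Qed.

Lemma Wsym_pair_cvg (u v w : nat -> R -> R) u0 v0 w0 :
  (forall n, weak_pair Fminus (u n) (v n)) -> (forall n, weak_pair Fplus (u n) (w n)) ->
  weak_pair Fminus u0 v0 -> weak_pair Fplus u0 w0 ->
  Np p (fun x => (u n \_ O) x - (u0 \_ O) x) @[n --> \oo] --> 0 ->
  Np p (fun x => (v n \_ O) x - (v0 \_ O) x) @[n --> \oo] --> 0 ->
  Np p (fun x => (w n \_ O) x - (w0 \_ O) x) @[n --> \oo] --> 0 ->
  WsymNorm a b alpha p (u n \- u0) @[n --> \oo] --> 0%E.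
Proof.
move=> hn kn h0 k0 cu cv cw.
have -> : (fun n => WsymNorm a b alpha p (u n \- u0)) = (fun n =>
    ((Np p (fun x => (u n \_ O) x - (u0 \_ O) x) +
      Np p (fun x => (v n \_ O) x - (v0 \_ O) x) +
     (Np p (fun x => (u n \_ O) x - (u0 \_ O) x) +
      Np p (fun x => (w n \_ O) x - (w0 \_ O) x))) `^ p^-1)%:E).
  apply/funext => n.
  by rewrite (WsymNorm_pair (weak_pairB (hn n) h0) (weak_pairB (kn n) k0)) !patchB.
apply: cvg_norm_powR => [n|]; first by rewrite !addr_ge0 ?Np_ge0.
exact: (cvg0D (cvg0D cu cv) (cvg0D cu cw)).
Qed.

Lemma ae_refl f g : f = g %[ae mu in `]a, b[%classic] -> refl f = refl g %[ae mu in `]a, b[%classic].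
Proof.
move=> h; have := ae_reflect (a + b) h; apply: aeS => x hx xab; apply: hx.
by rewrite /= refl_itv_in.
Qed.

Lemma refl_within (c d : R) f : {within `[c, d], continuous f} ->
  {within `[a + b - d, a + b - c], continuous (refl f)}.
Proof.
move=> cf; apply/subspace_continuousP => x; rewrite /= in_itv/= => /andP[xd xc].
have xi : `[c, d]%classic (a + b - x) by rewrite /= in_itv/=; apply/andP; split; lra.
move/subspace_continuousP : cf => /(_ _ xi) /cvgrPdist_lt cf.
apply/cvgrPdist_lt => e e0; have := cf _ e0.
move=> /nbhs_ballP[r /= r0 hr]; apply/nbhs_ballP; exists r => //= y xy yi.
apply: hr; last by move: yi; rewrite /= !in_itv/= => /andP[y1 y2]; apply/andP; split; lra.
rewrite /ball/= in xy *; rewrite (_ : a + b - x - (a + b - y) = - (x - y)) ?normrN//.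
by ring.
Qed.

Lemma has_trace_refl u t : has_trace a b Fplus u t <-> has_trace a b Fminus (refl u) t.
Proof.
split=> -[v vu [cv vt]].
  exists (refl v); first exact: ae_refl.
  split=> [c cab|]; last by rewrite /refl_itv addrK.
  have := refl_within (cv (a + b - c) _); rewrite refl_itv_in => /(_ cab).
  by rewrite subKr -[a + b - a]addrAC subrr add0r.
exists (refl v); first by rewrite -[u](refl_itvK a b); exact: ae_refl.
split=> [c cab|]; last by rewrite /refl_itv -addrAC subrr add0r.
have := refl_within (cv (a + b - c) _); rewrite refl_itv_in => /(_ cab).
by rewrite subKr addrK.
Qed.

End weak_pairs.

(** * Sequences of witnesses *)

Lemma choice_pairs (T S : Type) (P : nat -> T -> S -> Prop) :
  (forall n, exists x y, P n x y) -> exists F G, forall n, P n (F n) (G n).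
Proof.
move=> h; pose f n := projT1 (cid (h n)).
pose g n := projT1 (cid (projT2 (cid (h n)))).
by exists f, g => n; exact: (projT2 (cid (projT2 (cid (h n))))).
Qed.

(** * Traces and one-sided completeness *)

Section minus_space.
Context {R : realType} (a b alpha p : R).
Hypotheses (ab : a < b) (a0 : 0 < alpha) (a1 : alpha < 1) (p1 : 1 < p) (ap : 1 < alpha * p).
Notation mu := (@lebesgue_measure R).
Local Notation O := (`]a, b[%classic).
Local Notation J := (rlJ a b alpha).
Local Notation wpair := (weak_pair a b alpha p Fminus).
Implicit Types (u v w f g : R -> R).

Let p0 : 0 < p. Proof. exact: lt_trans p1. Qed.

Definition rl_rep (C : R) v x := C * (x - a) `^ (alpha - 1) + J v x.

Lemma rl_powR_continuous (C x : R) : a < x -> {for x, continuous (fun y => C * (y - a) `^ (alpha - 1))}.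
Proof.
move=> ax.
exact: (Cn_continuous (@Cn_powR R [set y | a < y] 1 C a (alpha - 1) (fun y h => h)) ax).
Qed.

Lemma rl_rep_continuous C v x : Lp p (v \_ O) -> a < x -> {for x, continuous (rl_rep C v)}.
Proof.
move=> lv ax; apply: cvgD; first exact: rl_powR_continuous.
exact: (rlJ_continuous ab a0 a1 p1 ap lv).
Qed.

Lemma itv_mid : a < (a + b) / 2 /\ (a + b) / 2 < b.
Proof. by rewrite !midf_lt. Qed.

(** Any representative continuous up to [b] agrees with [rl_rep C v] almost everywhere near [b], so
    both have the same limit there. *)
Lemma trace_minusP C u v t : Lp p (v \_ O) ->
  {ae mu, forall x, a < x < b -> u x = rl_rep C v x} ->
  has_trace a b Fminus u t <-> t = rl_rep C v b.
Proof.
move=> lv uU; have [am mb] := itv_mid.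
split=> [[w wu [cw wt]]|->].
  have mab : (a + b) / 2 \in `]a, b[ by rewrite in_itv/= am.
  have /(continuous_within_itvP _ mb)[_ _ lim] := cw _ mab.
  rewrite -wt; apply: (ae_eq_lim_left ab _ lim (g := rl_rep C v)).
    by apply: (aeS2 _ wu uU) => x h1 h2 xab; rewrite h1 ?h2.
  by apply: cvg_at_left_filter; exact: rl_rep_continuous.
exists (rl_rep C v).
  by apply: (aeS _ uU) => x h; rewrite /= in_itv/= => /h ->.
split=> // c; rewrite in_itv/= => /andP[ac cb].
apply: continuous_in_subspaceT => x; rewrite inE/= in_itv/= => /andP[cx _].
by apply: rl_rep_continuous => //; exact: lt_le_trans cx.
Qed.

Lemma Wside0_minusP u : Wside0 a b Fminus alpha p u <->
  exists v C, [/\ Lp p (u \_ O), Lp p (v \_ O),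
    {ae mu, forall x, a < x < b -> u x = rl_rep C v x} & rl_rep C v b = 0].
Proof.
split=> [[/(Wside_pair _ _ _ p1)[v /(weak_pair_minusP ab a0 a1 p1)[lu lv [C h]]] tr]|].
  by exists v, C; split=> //; apply/esym/(trace_minusP _ lv h).
move=> [v [C [lu lv h tr]]]; split.
  by apply/(Wside_pair _ _ _ p1); exists v; apply/(weak_pair_minusP ab a0 a1 p1); split=> //; exists C.
by apply/(trace_minusP _ lv h).
Qed.

Lemma Np_eq0_ae f : Lp p f -> Np p f = 0 -> {ae mu, forall x, f x = 0}.
Proof.
move=> [mf lf] N0; have mfp := measurable_powR_abs p mf.
have mE : measurable_fun [set: R] (fun x => (`|f x| `^ p)%:E) by exact/measurable_EFinP.
have := (@ae_eq_integral_abs _ _ _ mu _ measurableT _ mE).1.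
have -> : (\int[mu]_x `|(`|f x| `^ p)%:E|)%E = 0%E.
  rewrite -[RHS]/(0%:E) -N0 /Np /Rintegral fineK; last first.
    exact: (integrable_fin_num measurableT lf).
  by apply: eq_integral => x _ /=; rewrite (ger0_norm (powR_ge0 _ _)).
move=> /(_ erefl); apply: aeS => x /(_ I) /= [h].
by apply: normr0_eq0; rewrite -(powR_KV p0 (normr_ge0 (f x))) h powR0// invr_neq0// gt_eqF.
Qed.

(** Identifies an almost everywhere limit with an $L^p$ limit: Fatou's lemma on the tails bounds the
    norm of [g] by every positive number. *)
Lemma Lp_lim_ae0 (w : nat -> R -> R) g : (forall n, Lp p (w n)) -> measurable_fun setT g ->
  {ae mu, forall x, w n x @[n --> \oo] --> g x} -> Np p (w n) @[n --> \oo] --> 0 ->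
  {ae mu, forall x, g x = 0}.
Proof.
move=> lw mg cw /Np_cvg0P cN.
have key e : 0 < e -> Lp p g /\ Np p g <= e.
  move=> /cN[n0 h]; apply: (@Np_fatou _ _ p1 (fun n => w (n + n0)%N)) => //.
    by apply: (aeS _ cw) => x; rewrite -(cvg_shiftn n0).
  by move=> n; apply/ltW/h; exact: leq_addl.
apply: Np_eq0_ae; first by have [] := key _ ltr01.
apply/eqP; rewrite eq_le Np_ge0 andbT; apply/ler_addgt0Pr => e e0.
by rewrite add0r; have [] := key _ e0.
Qed.

Lemma Lp_complete_itv (w : nat -> R -> R) : (forall n, Lp p (w n \_ O)) ->
  (forall e : R, 0 < e -> exists n0, forall m n, (n0 <= m)%N -> (n0 <= n)%N ->
    Np p (fun x => (w m \_ O) x - (w n \_ O) x) < e) ->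
  exists2 u, Lp p (u \_ O) &
    Np p (fun x => (w n \_ O) x - (u \_ O) x) @[n --> \oo] --> 0.
Proof.
move=> lw /(Lp_complete p1 lw)[u lu /Np_cvg0P cu]; exists u; first exact: Lp_patch.
apply/Np_cvg0P => e e0; have [n0 h] := cu _ e0; exists n0 => n /h; apply: le_lt_trans.
have -> : (fun x => (w n \_ O) x - (u \_ O) x) = (fun x => (w n \_ O) x - u x) \_ O.
  by apply/funext => x; rewrite !patchE; case: ifP => //; rewrite subr0.
by apply: Np_patch => //; exact: LpB.
Qed.

Lemma rlJ_cvg (v : nat -> R -> R) v0 : (forall n, Lp p (v n \_ O)) -> Lp p (v0 \_ O) ->
  Np p (fun x => (v n \_ O) x - (v0 \_ O) x) @[n --> \oo] --> 0 ->
  forall x, J (v n) x @[n --> \oo] --> J v0 x.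
Proof.
move=> lv lv0 /Np_cvg0P cv x; apply/cvgrPdist_lt => e e0.
have [dl dl0 h] := rlJ_small a b a0 a1 p1 ap e0.
have [n0 hn] := cv _ dl0; exists n0 => // n /= /hn hlt.
rewrite distrC -(rlJB a0 a1 p1 ap x (lv n) lv0); apply: h.
  by rewrite (patchB (v n) v0); exact: LpB.
by rewrite (patchB (v n) v0).
Qed.

(* The trace condition recovers the coefficient of the singular part from the
   derivative, which makes the representation pass to the limit. *)
Lemma rl_rep_limit (u v : nat -> R -> R) (C : nat -> R) u0 v0 :
  (forall n, Lp p (u n \_ O)) -> (forall n, Lp p (v n \_ O)) ->
  (forall n, {ae mu, forall x, a < x < b -> u n x = rl_rep (C n) (v n) x}) ->
  (forall n, rl_rep (C n) (v n) b = 0) ->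
  Lp p (u0 \_ O) -> Lp p (v0 \_ O) ->
  Np p (fun x => (u n \_ O) x - (u0 \_ O) x) @[n --> \oo] --> 0 ->
  Np p (fun x => (v n \_ O) x - (v0 \_ O) x) @[n --> \oo] --> 0 ->
  exists C0, {ae mu, forall x, a < x < b -> u0 x = rl_rep C0 v0 x} /\ rl_rep C0 v0 b = 0.
Proof.
move=> lu lv rep tr lu0 lv0 cu cv.
have K0 : 0 < (b - a) `^ (alpha - 1) by rewrite powR_gt0// subr_gt0.
set K := (b - a) `^ (alpha - 1) in K0.
have CE n : C n = - J (v n) b / K.
  by have := tr n; rewrite /rl_rep -/K => /eqP; rewrite addr_eq0 => /eqP <-; rewrite mulfK// gt_eqF.
pose C0 := - J v0 b / K; exists C0; split; last first.
  by rewrite /rl_rep /C0 -/K divfK ?gt_eqF// addNr.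
have cJ := rlJ_cvg lv lv0 cv.
have cC : C n @[n --> \oo] --> C0.
  rewrite (_ : C = fun n => - J (v n) b / K); last by apply/funext.
  by apply: cvgMr_tmp; apply: cvgN; exact: cJ.
have cU x : rl_rep (C n) (v n) x @[n --> \oo] --> rl_rep C0 v0 x.
  by apply: cvgD; [exact: cvgMr_tmp|exact: cJ].
have mU : measurable_fun setT (rl_rep C0 v0 \_ O).
  apply/(measurable_restrictT _ (measurable_itv _)).
  apply: open_continuous_measurable_fun; first exact: itv_open.
  move=> x; rewrite inE/= in_itv/= => /andP[ax _]; exact: rl_rep_continuous.
have h : {ae mu, forall x, (rl_rep C0 v0 \_ O) x - (u0 \_ O) x = 0}.
  apply: (Lp_lim_ae0 _ _ _ cu).
  - by move=> n; exact: LpB.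
  - by apply: measurable_funB => //; have [] := lu0.
  - have : {ae mu, forall x, forall n, a < x < b -> u n x = rl_rep (C n) (v n) x}.
      by apply/ae_foralln.
    apply: aeS => x hx; apply: cvgB; last exact: cvg_cst.
    rewrite patchE; case: ifPn => [|/negbTE xab].
      rewrite inE/= in_itv/= => xab.
      rewrite (_ : (fun n => (u n \_ O) x) = fun n => rl_rep (C n) (v n) x)//.
      apply/funext => n; rewrite patchE mem_set/= ?in_itv//; exact: hx.
    rewrite (_ : (fun n => (u n \_ O) x) = fun n => 0); first exact: cvg_cst.
    by apply/funext => n; rewrite patchE xab.
apply: (aeS _ h) => x + xab; rewrite !patchE mem_set/= ?in_itv//.
by move/eqP; rewrite subr_eq0 => /eqP.
Qed.

Lemma Wside0_minus_complete (w : nat -> R -> R) :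
  (forall n, Wside0 a b Fminus alpha p (w n)) ->
  (forall e : R, 0 < e -> exists n0 : nat, forall m n : nat,
    (n0 <= m)%N -> (n0 <= n)%N ->
    (WsideNorm a b Fminus alpha p (w m \- w n)%R < e%:E)%E) ->
  exists2 u, Wside0 a b Fminus alpha p u &
    WsideNorm a b Fminus alpha p (w n \- u) @[n --> \oo] --> 0%E.
Proof.
move=> hw cw.
have [v [C h]] := choice_pairs (fun n => (Wside0_minusP (w n)).1 (hw n)).
have lw n : Lp p (w n \_ O) by have [] := h n.
have lv n : Lp p (v n \_ O) by have [] := h n.
have hp n : wpair (w n) (v n).
  by apply/(weak_pair_minusP ab a0 a1 p1); have [l1 l2 l3 _] := h n; split => //; exists (C n).
have cauchy e : 0 < e -> exists n0, forall m n, (n0 <= m)%N -> (n0 <= n)%N ->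
    Np p (fun x => (w m \_ O) x - (w n \_ O) x) < e /\
    Np p (fun x => (v m \_ O) x - (v n \_ O) x) < e.
  move=> e0; have e0' : 0 < e `^ p^-1 by exact: powR_gt0.
  have [n0 hn] := cw _ e0'; exists n0 => m n n0m n0n.
  have := weak_pair_norm_lt p1 (weak_pairB ab a0 a1 p1 (hp m) (hp n)) e0' (hn _ _ n0m n0n).
  by rewrite !patchB (powR_VK p0 (ltW e0)).
have [u0 lu0 cu] : exists2 u, Lp p (u \_ O) &
    Np p (fun x => (w n \_ O) x - (u \_ O) x) @[n --> \oo] --> 0.
  apply: Lp_complete_itv => // e /cauchy[n0 hn]; exists n0 => m n h1 h2.
  by have [] := hn m n h1 h2.
have [v0 lv0 cv] : exists2 u, Lp p (u \_ O) &
    Np p (fun x => (v n \_ O) x - (u \_ O) x) @[n --> \oo] --> 0.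
  apply: Lp_complete_itv => // e /cauchy[n0 hn]; exists n0 => m n h1 h2.
  by have [] := hn m n h1 h2.
have [C0 [hC0 tr0]] : exists C0,
    {ae mu, forall x, a < x < b -> u0 x = rl_rep C0 v0 x} /\ rl_rep C0 v0 b = 0.
  have rep n : {ae mu, forall x, a < x < b -> w n x = rl_rep (C n) (v n) x} by have [] := h n.
  have tr n : rl_rep (C n) (v n) b = 0 by have [] := h n.
  exact: (rl_rep_limit lw lv rep tr lu0 lv0 cu cv).
exists u0; first by apply/Wside0_minusP; exists v0, C0.
apply: (weak_pair_cvg ab a0 a1 p1 hp _ cu cv).
by apply/(weak_pair_minusP ab a0 a1 p1); split => //; exists C0.
Qed.

Lemma Cc_smooth_side_minus_sub : Cc_smooth_side a b Fminus `&` Wside a b Fminus alpha p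
  `<=` Wside0 a b Fminus alpha p.
Proof.
move=> u [[su [c cab uc]] Wu]; split=> //.
have [ac cb] : a < c /\ c < b by move: cab; rewrite in_itv/= => /andP[].
have oO : open O by exact: itv_open.
(* The values of [u] at [b] and beyond are arbitrary. This representative is zero from [b] on, hence
   on all of $x>c$, which makes it continuous at [b]. *)
pose w x := if x < b then u x else 0.
exists w.
  apply: aeW => x; rewrite /= in_itv/= => /andP[_ xb]; by rewrite /w xb.
split; last by rewrite /w ltxx.
move=> c'; rewrite in_itv/= => /andP[ac' c'b].
apply: continuous_in_subspaceT => x; rewrite inE/= in_itv/= => /andP[c'x xb].
have ax : a < x by exact: lt_le_trans c'x.
have [xlb|bx] := ltP x b.
  have xO : O x by rewrite /= in_itv/= ax.
  have C1 := (smooth_onP _ oO).1 su 1%N.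
  have wE y : O y -> u y = w y by rewrite /= in_itv/= /w => /andP[_ ->].
  exact: (Cn_continuous (Cn_on oO wE C1) xO).
have w0 : forall y, [set y | c < y] y -> 0 = w y.
  move=> y /= cy; rewrite /w; case: ifP => // yb.
  by rewrite uc// in_itv/= yb andbT (lt_trans ac).
have oc : open [set y | c < y] by exact: open_gt.
have cx : [set y | c < y] x by exact: lt_le_trans bx.
exact: (Cn_continuous (Cn_on oc w0 (@Cn_cst R _ 1 0)) cx).
Qed.

End minus_space.

(** * One-sided density *)

Section minus_density.
Context {R : realType} (a b alpha p : R).
Hypotheses (ab : a < b) (a0 : 0 < alpha) (a1 : alpha < 1) (p1 : 1 < p) (ap : 1 < alpha * p).
Notation mu := (@lebesgue_measure R).
Local Notation O := (`]a, b[%classic).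
Local Notation M := (2 * (b - a)).
Local Notation G := ((Gamma (1 - alpha))^-1).
Local Notation J := (rlJ a b alpha).
Local Notation U := (rl_rep a b alpha).
Implicit Types (u v w f g : R -> R).

Let p0 : 0 < p. Proof. exact: lt_trans p1. Qed.
Let ba : 0 < b - a. Proof. by rewrite subr_gt0. Qed.
Let a1' : 0 < 1 - alpha. Proof. by rewrite subr_gt0. Qed.
Let baM : b - a < M. Proof. by rewrite ltr_pMl// ltr1n. Qed.

Lemma Np_bounded_itv f (B : R) : measurable_fun setT (f \_ O) -> 0 <= B ->
  (forall x, a < x -> x < b -> `|f x| <= B) ->
  Lp p (f \_ O) /\ Np p (f \_ O) <= B `^ p * (b - a).
Proof.
move=> mf B0 fB.
have fB' x : `|(f \_ O) x| <= B.
  by rewrite patchE; case: ifPn => [|_]; [rewrite inE/= in_itv/= => /andP[]; exact: fB|rewrite normr0].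
have f0 x : ~ (a <= x <= b) -> (f \_ O) x = 0.
  move=> h; rewrite patchE memNset//= in_itv/= => /andP[h1 h2].
  by apply: h; rewrite !ltW.
have lf : Lp p (f \_ O) := Lp_bounded p1 mf fB' f0.
split => //; have -> : B `^ p * (b - a) = \int[mu]_x ((fun=> B `^ p) \_ O) x.
  rewrite -Rintegral_mkcond Rintegral_cst ?measurable_itv//.
  by rewrite [X in fine X]lebesgue_measure_itv/= lte_fin ab.
apply: le_Rintegral => //; first by case: lf.
  apply: (@L1_bounded _ _ a b (B `^ p)).
  - by apply/(measurable_restrictT _ (measurable_itv _)); exact: measurable_cst.
  - by move=> x; rewrite patchE; case: ifP => _; rewrite ?normr0 ?powR_ge0// ger0_norm ?powR_ge0.
  - move=> x h; rewrite patchE memNset//= in_itv/= => /andP[h1 h2].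
    by apply: h; rewrite !ltW.
move=> x _; rewrite [leRHS]patchE; case: ifPn => xab.
  by apply: ge0_ler_powR; rewrite ?nnegrE ?(ltW p0).
by rewrite patchE (negbTE xab) normr0 powR0// gt_eqF.
Qed.

Lemma measurable_itv_cont f : (forall x, a < x -> {for x, continuous f}) ->
  measurable_fun setT (f \_ O).
Proof.
move=> cf; apply/(measurable_restrictT _ (measurable_itv _)).
apply: open_continuous_measurable_fun; first exact: itv_open.
by move=> x; rewrite inE/= in_itv/= => /andP[ax _]; exact: cf.
Qed.

Lemma C1_FTC (e g : R -> R) (c x : R) : a < c -> c < x ->
  (forall y : R, a < y -> is_derive y 1 e (g y)) ->
  (forall y, a < y -> {for y, continuous g}) ->
  \int[mu]_(t in `]c, x[) g t = e x - e c.
Proof.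
move=> ac cx de cg.
have ce y : a < y -> {for y, continuous e}.
  by move=> ay; have [dy _] := de _ ay; apply: differentiable_continuous; exact/derivable1_diffP.
have cg' : {within `[c, x], continuous g}.
  apply: continuous_in_subspaceT => y; rewrite inE/= in_itv/= => /andP[cy _].
  by apply: cg; exact: lt_le_trans cy.
have ig : mu.-integrable `[c, x] (EFin \o g).
  by apply: continuous_compact_integrable => //; exact: segment_compact.
have ig1 : mu.-integrable `[c, x[ (EFin \o g).
  apply: (@integrableS _ _ _ mu `[c, x] _ (EFin \o g) (measurable_itv _) (measurable_itv _) _ ig).
  by move=> y /=; rewrite !in_itv/= => /andP[-> /ltW].
have ig2 : mu.-integrable `]c, x[ (EFin \o g).
  apply: (@integrableS _ _ _ mu `[c, x] _ (EFin \o g) (measurable_itv _) (measurable_itv _) _ ig).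
  by move=> y /=; rewrite !in_itv/= => /andP[/ltW -> /ltW].
rewrite Rintegral_itv_obnd_cbnd// Rintegral_itv_bndo_bndc//.
rewrite /Rintegral (@continuous_FTC2 _ _ e)//.
- split.
  + move=> z; rewrite in_itv/= => /andP[cz _].
    by case: (de z (lt_trans ac cz)).
  + by apply: cvg_at_right_filter; exact: ce.
  + by apply: cvg_at_left_filter; apply: ce; exact: lt_trans cx.
- move=> z; rewrite in_itv/= => /andP[cz _]; rewrite derive1E.
  by case: (de z (lt_trans ac cz)).
Qed.

Lemma conv_eq0 f k x : (forall y, y <= a -> f y = 0) -> (forall t, t <= 0 -> k t = 0) ->
  x <= a -> conv f k x = 0.
Proof.
move=> f0 k0 xa; rewrite (_ : conv f k x = \int[mu]_(z in setT) (0 : R)).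
  by rewrite Rintegral_cst ?mul0r.
apply: eq_Rintegral => z _; have [za|az] := leP z a; first by rewrite f0 ?mul0r.
by rewrite k0 ?mulr0// subr_le0 (le_trans xa)// ltW.
Qed.

(** For [g] the derivative of a function vanishing near [a], this is the left fractional derivative
    of that function, with the differentiation inside the integral. *)
Definition rlK g x : R := G * conv (g \_ O) (rlker (1 - alpha) M) x.

(* A C^1 function supported near [b] is the potential of the Riemann-Liouville
   derivative [G * conv e' (t ^ (- alpha))], small when the support is. *)
Lemma small_potential (e g : R -> R) (c0 L : R) : a < c0 -> c0 < b ->
  (forall x : R, a < x -> is_derive x 1 e (g x)) ->
  (forall x, a < x -> {for x, continuous g}) ->
  (forall x, a < x -> x <= c0 -> e x = 0) -> (forall x, a < x -> x <= c0 -> g x = 0) ->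
  0 <= L -> (forall x, a < x -> x < b -> `|g x| <= L) ->
  [/\ measurable_fun setT (rlK g),
    {ae mu, forall x, a < x < b -> e x = J (rlK g) x} &
    forall x, x < b -> `|rlK g x| <= G * (L * ((b - c0) `^ (1 - alpha) / (1 - alpha)))].
Proof.
move=> ac cb de cg e0 g0 L0 gL.
have mg := measurable_itv_cont cg.
have lk1 := L1_rlker M a1'; have lk := L1_rlker M a0.
have gL' x : `|(g \_ O) x| <= L.
  by rewrite patchE; case: ifPn => [|_]; [rewrite inE/= in_itv/= => /andP[]; exact: gL|rewrite normr0].
have gz y : y <= a -> (g \_ O) y = 0.
  by move=> ya; rewrite patchE memNset//= in_itv/= ltNge ya.
have gz2 y : y <= c0 -> (g \_ O) y = 0.
  move=> yc; have [ya|ay] := leP y a; first exact: gz.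
  by rewrite patchE; case: ifP => // _; exact: g0.
have lg : L1 (g \_ O).
  apply: (@L1_bounded _ _ a b L) => // x h.
  by rewrite patchE memNset//= in_itv/= => /andP[h1 h2]; apply: h; rewrite !ltW.
have lc := L1_conv lg lk1.
have G0 : 0 < G by rewrite invr_gt0 Gamma_gt0// ltrBlDr ltrDl.
have B0 := betac_gt0 a0 a1.
split.
- by apply: measurable_funM => //; exact: L1_measurable.
- apply: (aeS2 _ (abel M a0 a1 lg gz) (conv_ae_L1 lc lk)) => x hx l1 /andP[ax xb].
  have -> : J (rlK g) x = rlconst alpha * conv (rlK g) (rlker alpha M) x.
    rewrite /rlJ; congr (_ * _); apply: (@eq_conv_lt R _ _ _ b) => //; last exact: ltW.
      by move=> t t0; exact: rlker_le0.
    move=> y yb; have [ya|ay] := leP y a; last first.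
      by rewrite patchE mem_set//= in_itv/= ay.
    rewrite patchE memNset/= ?in_itv/= ?ltNge ?ya//.
    by rewrite /rlK (conv_eq0 gz _ ya) ?mulr0// => t t0; exact: rlker_le0.
  rewrite /rlK (convZl _ l1) hx; last first.
    by rewrite -ltrBlDl; apply: lt_trans baM; rewrite ltrD2r.
  have -> : conv (g \_ O) (rlker 1 M) x = e x.
    rewrite conv_rlker1; have [xc|cx] := leP x c0.
      rewrite e0// (_ : \int[mu]_(y in _) _ = \int[mu]_(y in `](x - M), x[) (0 : R)).
        by rewrite Rintegral_cst ?mul0r//; exact: measurable_itv.
      apply: eq_Rintegral => y; rewrite inE/= in_itv/= => /andP[_ yx].
      by rewrite gz2// (le_trans (ltW yx)).
    rewrite -[RHS]subr0 -(e0 c0 ac (lexx _)) -(C1_FTC ac cx de cg).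
    rewrite Rintegral_mkcond [RHS]Rintegral_mkcond; apply: eq_Rintegral => y _.
    rewrite patchE [RHS]patchE !mem_setE !in_itv/=.
    have [yx|xy] := ltP y x; rewrite ?andbF// !andbT.
    have [cy|yc] := ltP c0 y; last by rewrite gz2//; case: ifP.
    have xMy : x - M < y.
      apply: lt_trans (lt_trans ac cy); rewrite ltrBlDr -ltrBlDl; apply: lt_trans baM.
      by rewrite ltrD2r.
    by rewrite xMy patchE mem_set//= in_itv/= (lt_trans ac cy) (lt_trans yx).
  rewrite /rlconst; move: (e x) (betac alpha) B0 (Gamma (1 - alpha)) G0 => E B B0 Ga.
  by rewrite invr_gt0 => G0; field; rewrite !gt_eqF.
- move=> x xb; rewrite /rlK normrM gtr0_norm// ler_wpM2l ?(ltW G0)//.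
  have bc0 : 0 < b - c0 by rewrite subr_gt0.
  have bcM : b - c0 < M by apply: lt_trans baM; rewrite ltrD2l ltrN2.
  (* [g] vanishes up to [c0], so only lags below [b - c0] occur and the kernel may be truncated
     there; its mass supplies the small factor. *)
  have -> : conv (g \_ O) (rlker (1 - alpha) M) x = conv (g \_ O) (rlker (1 - alpha) (b - c0)) x.
    apply: eq_Rintegral => y _; have [yc|cy] := leP y c0; first by rewrite gz2// !mul0r.
    congr (_ * _); have [xy|yx] := leP x y; first by rewrite !rlker_le0// subr_le0.
    have h1 : 0 < x - y by rewrite subr_gt0.
    have h2 : x - y < b - c0 by rewrite ltrB.
    by rewrite !rlkerE// (lt_trans h2).
  have mk' := measurable_rlker (1 - alpha) (b - c0).
  rewrite convC//; apply: (le_trans (conv_bounded x (L1_rlker (b - c0) a1') mg gL')).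
  rewrite -(Rintegral_rlker a1' bc0) ler_wpM2l// le_eqVlt; apply/orP; left; apply/eqP.
  by apply: eq_Rintegral => y _; rewrite ger0_norm ?rlker_ge0.
Qed.

Lemma testZ c d k f : is_test c d f -> is_test c d (fun x => k * f x).
Proof.
move=> [cf fc fd]; split; first by move=> n; exact: CnZ.
  by move=> x /fc ->; rewrite mulr0.
by move=> x /fd ->; rewrite mulr0.
Qed.

(** A test function whose potential has a prescribed value at [b], used to restore a trace. A
    nonnegative bump has a positive potential, since the kernel is at least $(b-a)^{\alpha-1}$ at
    all lags involved; it is then normalised. *)
Lemma exists_rlJ_test : exists c d h, [/\ a < c, d < b, is_test c d h & J h b = 1].
Proof.
pose N := 4 / (b - a); have N0 : 0 < N by rewrite divr_gt0.
have NV : N^-1 = (b - a) / 4 by rewrite invf_div.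
pose m := (a + b) / 2; pose h x := molk N (x - m).
have [ct t1 t2] := test_molk N0.
pose c := m - (b - a) / 4; pose d := m + (b - a) / 4.
have th : is_test c d h.
  split.
  - move=> n; have := @Cn_affine R setT setT n (molk N) 1 (- m) (fun _ _ => I) (ct n).
    by apply: Cn_on => [|x _]; [exact: openT|rewrite mul1r].
  - by move=> x xc; apply: t1; rewrite NV ltrBlDr; apply: (lt_le_trans xc); rewrite /c addrC.
  - by move=> x xd; apply: t2; rewrite NV ltrBrDr; apply: le_lt_trans xd; rewrite /d addrC.
have ac : a < c by have := ba; rewrite /c /m; lra.
have db : d < b by have := ba; rewrite /d /m; lra.
have h0 x : 0 <= h x by exact/molk_ge0/ltW.
have Jh : 0 < J h b.
  rewrite (rlJ_test _ ac db th) mulr_gt0 ?rlconst_gt0//.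
  have K0 : 0 < (b - a) `^ (alpha - 1) by rewrite powR_gt0.
  apply: (@lt_le_trans _ _ ((b - a) `^ (alpha - 1) * \int[mu]_y h y)).
    rewrite mulr_gt0// (Rintegral_shift m (test_measurable (test_molk N0))) molk_int//.
  have lh : Lp p (h \_ O) by rewrite (test_restrict ac db th); exact: test_Lp th.
  have [l _] := rlJ_young a0 a1 p1 ap ltr01 lh b; rewrite (test_restrict ac db th) in l.
  rewrite -RintegralZl//; last exact: test_L1 th.
  apply: le_Rintegral => //; first by apply: L1Zl; exact: test_L1 th.
  move=> y _; have [_ hc hd] := th.
  have [yc|cy] := ltP y c; first by rewrite hc// mulr0 mul0r.
  have [dy|yd] := ltP d y; first by rewrite hd// mulr0 mul0r.
  rewrite mulrC ler_wpM2l//.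
  have yb : 0 < b - y by rewrite subr_gt0 (le_lt_trans yd).
  have yba : b - y < b - a by rewrite ltrD2l ltrN2 (lt_le_trans ac).
  rewrite rlkerE//; last exact: lt_trans baM.
  rewrite -[alpha - 1]opprB !powRN lef_pV2 ?posrE ?powR_gt0//.
  by apply: ge0_ler_powR; rewrite ?nnegrE ?ltW.
exists c, d, (fun x => (J h b)^-1 * h x); split=> //; first exact: testZ.
have lh : Lp p (h \_ O) by rewrite (test_restrict ac db th); exact: test_Lp th.
by rewrite (rlJZ a0 a1 p1 ap _ _ lh) mulVf// gt_eqF.
Qed.

(** A test function [w1] close to [v] spoils the value at [b] by the small number [t]; subtracting
    [t * h], with [J h b = 1], restores it at small cost in $L^p$. *)
Lemma approx_test C v (e : R) : Lp p (v \_ O) -> U C v b = 0 -> 0 < e ->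
  exists c d w, [/\ a < c, d < b, is_test c d w, U C w b = 0 &
    Np p (fun x => (w \_ O) x - (v \_ O) x) < e /\ forall x, `|J w x - J v x| < e].
Proof.
move=> lv Uv e0; have [c1 [d1 [h [ac1 db1 th Jh]]]] := exists_rlJ_test.
have lh : Lp p (h \_ O) by rewrite (test_restrict ac1 db1 th); exact: test_Lp th.
have P0 : 0 < 2 `^ p :> R by exact: powR_gt0.
have Nh := Np_ge0 p (h \_ O); set H := Np p (h \_ O) in Nh.
have H1 : 0 < H + 1 by rewrite ltr_wpDl.
have [dl1 dl10 hJ1] := rlJ_small a b a0 a1 p1 ap e0.
pose e' := Num.min e dl1; have e'0 : 0 < e' by rewrite lt_min e0.
(* Makes $2^p t_0^p(H+1)=e'/2$, the share of the correction [t * h]. The other half of [e'] goes to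
   [w1], and [e' <= dl1] makes the potentials uniformly close. *)
pose t0 := (e' / (2 * 2 `^ p * (H + 1))) `^ p^-1.
have D0 : 0 < e' / (2 * 2 `^ p * (H + 1)) by rewrite divr_gt0// !mulr_gt0.
have t00 : 0 < t0 by exact: powR_gt0.
have t0p : t0 `^ p = e' / (2 * 2 `^ p * (H + 1)) := powR_VK p0 (ltW D0).
have [dl2 dl20 hJ2] := rlJ_small a b a0 a1 p1 ap t00.
have e1 : 0 < Num.min dl2 (e' / (2 * 2 `^ p)).
  by rewrite lt_min dl20 divr_gt0 ?mulr_gt0.
have [c2 [d2 [w1 [ac2 db2 tw1]]]] := test_dense ab p1 lv e1.
move=> hmin; have [hw1 hw2] := andP (etrans (esym (lt_min _ _ _)) hmin).
have w1E := test_restrict ac2 db2 tw1.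
have lw1 : Lp p (w1 \_ O) by rewrite w1E; exact: test_Lp tw1.
pose t := J w1 b - J v b.
have ht : `|t| < t0.
  rewrite /t -(rlJB a0 a1 p1 ap b lw1 lv); apply: hJ2; rewrite (patchB w1 v) ?w1E//.
  by apply: LpB => //; rewrite -w1E.
pose w x := w1 x - t * h x.
exists (Num.min c1 c2), (Num.max d1 d2), w.
have tw : is_test (Num.min c1 c2) (Num.max d1 d2) w.
  apply: testB.
    by apply: (test_widen _ _ tw1); rewrite ?ge_min ?le_max lexx orbT.
  by apply: (test_widen _ _ th); rewrite ?ge_min ?le_max lexx.
have ac : a < Num.min c1 c2 by rewrite lt_min ac1.
have db : Num.max d1 d2 < b by rewrite gt_max db1.
have lw : Lp p (w \_ O) by rewrite (test_restrict ac db tw); exact: test_Lp tw.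
have lth : Lp p ((fun x => t * h x) \_ O).
  rewrite (_ : _ \_ _ = fun x => t * (h \_ O) x); first exact: LpZ.
  by apply/funext => x; rewrite !patchE; case: ifP => //; rewrite mulr0.
have Jw : J w b = J w1 b - t by rewrite (rlJB a0 a1 p1 ap b lw1 lth) (rlJZ a0 a1 p1 ap _ _ lh) Jh mulr1.
have hN : Np p (fun x => (w \_ O) x - (v \_ O) x) < e'.
  have -> : (fun x => (w \_ O) x - (v \_ O) x) =
      (fun x => ((w1 \_ O) x - (v \_ O) x) - t * (h \_ O) x).
    apply/funext => x; rewrite !patchE /w; case: ifP => _; last by rewrite mulr0 !subr0.
    by rewrite addrAC.
  apply: (le_lt_trans (NpB p1 (LpB p1 lw1 lv) (LpZ t lh))).
  rewrite w1E NpZ//; set N1 := Np p _; rewrite -/N1 in hw2.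
  have h1 : 2 `^ p * N1 < e' / 2.
    rewrite mulrC -ltr_pdivlMr//; apply: (lt_le_trans hw2).
    by rewrite invfM mulrA.
  have h2 : 2 `^ p * (`|t| `^ p * Np p (h \_ O)) <= e' / 2.
    apply: (@le_trans _ _ (2 `^ p * (t0 `^ p * (H + 1)))).
      rewrite ler_wpM2l ?(ltW P0)// ler_pM ?powR_ge0//; last by rewrite lerDl.
      by apply: ge0_ler_powR; rewrite ?nnegrE ?(ltW p0) ?(ltW ht)// ltW.
    rewrite t0p le_eqVlt; apply/orP; left; apply/eqP; move: (2 `^ p) (H + 1) P0 H1 => P Q P0 Q0.
    by field; rewrite !gt_eqF.
  rewrite mulrDr [ltRHS](_ : e' = e' / 2 + e' / 2); last by field.
  exact: ltr_leD.
split=> //.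
  by move: Uv; rewrite /rl_rep Jw /t subKr.
split; first by apply: (lt_le_trans hN); rewrite /e' ge_min lexx.
move=> x; rewrite -(rlJB a0 a1 p1 ap x lw lv); apply: hJ1; rewrite (patchB w v).
  exact: LpB.
by apply: (lt_le_trans hN); rewrite /e' ge_min lexx orbT.
Qed.

(** Near [b] the representation is smooth and vanishes at [b], so it is at most $L(b-x)$. Cut off
    over a length [dl], with a slope of order $1/dl$, it has a derivative bounded independently of
    [dl]; by [small_potential] the removed part is the potential of a function of size
    $O(dl^{1-\alpha})$. *)
Lemma cutoff_approx C (c d : R) w (e : R) : a < c -> d < b -> is_test c d w -> U C w b = 0 ->
  0 < e -> exists phi K : R -> R, [/\ Cc_smooth_side a b Fminus phi, measurable_fun setT (K \_ O),
    measurable_fun setT (phi \_ O),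
    {ae mu, forall x, a < x < b -> phi x = U C w x - J K x} &
    forall x, a < x -> x < b -> `|phi x - U C w x| <= e /\ `|K x| <= e].
Proof.
move=> ac db tw Ub e0; have oA : open [set x | a < x] by exact: open_gt.
have lin1 (r s t : R) : t <= (s - r) / 4 -> 0 < s - r -> (r + s) / 2 < s - t.
  by move=> *; lra.
have lin2 (r : R) : 4 <= r -> 1 < r - 2 by move=> *; lra.
have lin3 (r : R) : r < 1 -> r - 2 < - 1 by move=> *; lra.
have lk := L1_rlker M a0.
have CU n : Cn [set x | a < x] n (U C w).
  have c1 : Cn [set x | a < x] n (fun x => C * (x - a) `^ (alpha - 1)) by exact: Cn_powR.
  have c2 : Cn [set x | a < x] n (J w).
    rewrite (rlJ_test alpha ac db tw); apply: CnZ.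
    have -> : conv w (rlker alpha M) = conv (rlker alpha M) w.
      by apply/funext => y; apply: convC; [exact: test_measurable tw|exact: measurable_rlker].
    by apply: Cn_sub (Cn_conv n lk tw); exact: subsetT.
  exact: CnD c1 c2.
have [g dU Cg] := CU 2%N.
have cg x : a < x -> {for x, continuous g}.
  by move=> ax; exact: (@Cn_continuous R [set x | a < x] 0 g x Cg ax).
have cU x : a < x -> {for x, continuous (U C w)}.
  by move=> ax; exact: (@Cn_continuous R [set x | a < x] 0 _ x (CU 1%N) ax).
have [am mb] := itv_mid ab; set m := (a + b) / 2 in am mb.
have [L L0 gL] : exists2 L, 0 <= L & forall x, m <= x -> x <= b -> `|g x| <= L.
  have cga : {within `[m, b], continuous (fun x => `|g x|)}.
    apply: continuous_in_subspaceT => y; rewrite inE/= in_itv/= => /andP[my _].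
    by apply: (@continuous_comp _ _ _ g); [apply: cg; exact: lt_le_trans my|exact: norm_continuous].
  have [y ymb hy] := EVT_max (ltW mb) cga.
  exists `|g y| => // x mx xb; apply: hy; by rewrite in_itv/= mx.
have UL x : m <= x -> x <= b -> `|U C w x| <= L * (b - x).
  move=> mx xb; have ax : a < x by exact: lt_le_trans mx.
  have [||y yxb E] := @MVT_segment R (U C w) g x b xb.
  - by move=> y; rewrite in_itv/= => /andP[xy _]; apply: dU; exact: lt_trans xy.
  - apply: continuous_in_subspaceT => y; rewrite inE/= in_itv/= => /andP[xy _].
    by apply: cU; exact: lt_le_trans xy.
  have : - U C w x = g y * (b - x) by rewrite -E Ub sub0r.
  move=> /(congr1 (fun z => `|z|)); rewrite normrN normrM => ->.
  rewrite [X in _ * X <= _]ger0_norm ?subr_ge0// ler_wpM2r ?subr_ge0//.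
  by move: yxb; rewrite in_itv/= => /andP[xy yb]; apply: gL => //; exact: le_trans xy.
have [Cb Cb0 hCb] := @bump_bound R.
have G0 : 0 < G by rewrite invr_gt0 Gamma_gt0// ltrBlDr ltrDl.
(* Bounds the derivative of the removed part: [L] from [g], and $4LC_b=(L\,dl)(NC_b)$ from the slope
   of the cutoff, with $N\,dl=4$. *)
pose L' := L + 4 * L * Cb.
have L'0 : 0 <= L' by rewrite addr_ge0// mulr_ge0 ?(ltW Cb0)// mulr_ge0.
pose D := G * (L' / (1 - alpha)) + 1.
have D0 : 0 < D by rewrite ltr_wpDl// mulr_ge0 ?(ltW G0)// divr_ge0// ltW.
(* Three requirements: the cutoff acts to the right of the midpoint, the uniform error $L\,dl$ is at
   most [e], and so is the bound on [K]. *)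
pose dl := Num.min ((b - a) / 4) (Num.min (e / (L + 1)) ((e / D) `^ (1 - alpha)^-1)).
have L1p : 0 < L + 1 by rewrite ltr_wpDl.
have dl0 : 0 < dl by rewrite !lt_min !divr_gt0// powR_gt0// divr_gt0.
have dl1 : dl <= (b - a) / 4 by rewrite /dl ge_min lexx.
have dl2 : L * dl <= e.
  apply: (@le_trans _ _ ((L + 1) * (e / (L + 1)))); last by rewrite mulrC divfK// gt_eqF.
  by rewrite ler_pM ?(ltW dl0)// ?lerDl// /dl !ge_min lexx orbT.
have dl3 : G * (L' * (dl `^ (1 - alpha) / (1 - alpha))) <= e.
  have h : dl `^ (1 - alpha) <= e / D.
    rewrite -[leRHS](powR_VK a1' (ltW (divr_gt0 e0 D0))); apply: ge0_ler_powR.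
    - exact: ltW.
    - by rewrite nnegrE ltW.
    - by rewrite nnegrE powR_ge0.
    - by rewrite /dl !ge_min lexx !orbT.
  apply: (@le_trans _ _ (D * (e / D))); last by rewrite mulrC divfK// gt_eqF.
  rewrite (_ : G * _ = G * (L' / (1 - alpha)) * dl `^ (1 - alpha)); last first.
    by rewrite -mulrA; congr (_ * _); rewrite mulrA mulrAC.
  apply: ler_pM; rewrite ?powR_ge0 ?lerDl//.
  by rewrite mulr_ge0 ?(ltW G0)// divr_ge0// ltW.
have {D0} [N [N0 NV N4]] : exists N : R, [/\ 0 < N, N * dl = 4 & dl = 4 / N].
  by exists (4 / dl); split; [rewrite divr_gt0|rewrite divfK// gt_eqF|rewrite invf_div mulrCA divff ?mulr1// ].
(* [z] decreases from 2 at [b - dl] to -2 at [b], so [chi] passes from 1 to 0 strictly inside this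
   interval. *)
pose z (x : R) : R := - N * x + (N * b - 2); pose chi (x : R) : R := step (z x).
have zE x : z x = N * (b - x) - 2 by rewrite /z mulrBr mulNr addrA [- _ + _]addrC.
have Cchi n : Cn [set x | a < x] n chi.
  apply: (@Cn_affine R _ setT n step (- N) (N * b - 2)) => //; exact: Cn_step.
have dchi (x : R) : is_derive x 1 chi (bump (z x) * - N).
  exact: (@is_derive1_comp R step z x _ _ (is_derive_step (z x)) (is_derive_affine (- N) (N * b - 2) x)).
pose E (x : R) : R := U C w x * (1 - chi x).
have CE : Cn [set x | a < x] 2 E.
  apply: CnM => //; have := CnD (@Cn_cst R [set x | a < x] 2 1) (CnZ (-1) (Cchi 2%N)).
  by apply: Cn_on => // x _; rewrite mulN1r.
have [gE dE CgE] := CE.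
have cgE x : a < x -> {for x, continuous gE}.
  by move=> ax; exact: (@Cn_continuous R [set x | a < x] 0 gE x CgE ax).
have gEE (x : R) : a < x -> gE x = g x * (1 - chi x) + U C w x * (N * bump (z x)).
  move=> ax; have [_ <-] := dE x ax.
  have d1 : is_derive x 1 (fun x : R => 1 - chi x) (0 - bump (z x) * - N).
    exact: (is_deriveB (is_derive_cst (1 : R) x 1) (dchi x)).
  have [_ ->] := is_deriveM (dU x ax) d1.
  have -> : 0 - bump (z x) * - N = N * bump (z x) by rewrite sub0r -mulrN opprK mulrC.
  by rewrite /GRing.scale/= addrC [g x * _]mulrC.
pose c0 := b - dl.
have c0b : c0 < b by rewrite ltrBlDr ltrDl.
have mc0 : m < c0 by exact: lin1.
have ac0 : a < c0 by exact: lt_trans mc0.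
have zc x : x <= c0 -> 1 < z x.
  move=> xc; have : N * dl <= N * (b - x) by rewrite ler_pM2l// lerBrDr addrC -lerBrDr.
  by rewrite NV zE; exact: lin2.
have chi1 x : x <= c0 -> chi x = 1 by move=> /zc /ltW h; exact: step_eq1.
have [_ _ bump1] := @test_bump R.
have E0 x : a < x -> x <= c0 -> E x = 0 by move=> _ xc; rewrite /E chi1// subrr mulr0.
have gE0 x : a < x -> x <= c0 -> gE x = 0.
  by move=> ax xc; rewrite gEE// chi1// subrr mulr0 add0r bump1 ?mulr0//; exact: zc.
have chi01 x : `|1 - chi x| <= 1.
  rewrite ger0_norm ?subr_ge0 ?step_le1//.
  by rewrite lerBlDr lerDl step_ge0.
have ULx x : c0 < x -> x < b -> `|U C w x| <= L * dl.
  move=> cx xb; apply: (le_trans (UL x _ (ltW xb))); first exact: ltW (lt_trans mc0 cx).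
  by rewrite ler_wpM2l// lerBlDr -lerBlDl ltW.
have gEL x : a < x -> x < b -> `|gE x| <= L'.
  move=> ax xb; have [xc|cx] := leP x c0; first by rewrite gE0// normr0.
  rewrite gEE//; apply: (le_trans (ler_normD _ _)); apply: lerD.
    rewrite normrM -[leRHS]mulr1; apply: ler_pM => //.
    by apply: gL; [exact: ltW (lt_trans mc0 cx)|exact: ltW].
  have bC : bump (z x) <= Cb by have := hCb 1 (z x) ler01; rewrite /molk !mul1r.
  have Nb0 : 0 <= N * bump (z x) := mulr_ge0 (ltW N0) (bump_ge0 (z x)).
  rewrite normrM [`|N * _|]ger0_norm//.
  apply: (@le_trans _ _ (L * dl * (N * Cb))).
    by apply: ler_pM => //; [exact: ULx|rewrite ler_pM2l].
  by rewrite mulrA -[L * dl * N]mulrA [dl * N]mulrC NV [L * 4]mulrC.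
have [mK aeK bK] := small_potential ac0 c0b dE cgE E0 gE0 L'0 gEL.
have Cphi n : Cn [set x | a < x] n (fun x => U C w x * chi x) by exact: CnM.
exists (fun x => U C w x * chi x), (rlK gE); split.
- split.
    apply/smooth_onP; first exact: itv_open.
    by move=> n; apply: Cn_sub (Cphi n) => x /=; rewrite in_itv/= => /andP[].
  (* At [b - dl / 4] the argument [z] equals -1; beyond it the cutoff vanishes. *)
  have hc : a < b - dl / 4.
    by apply: (lt_trans ac0); rewrite /c0 ltrD2l ltrN2 ltr_pdivrMr// ltr_pMr// ltr1n.
  exists (b - dl / 4); first by rewrite in_itv/= hc ltrBlDr ltrDl divr_gt0.
  move=> x _ cx; rewrite /chi step_eq0 ?mulr0//.
  have : N * (b - x) < N * (dl / 4) by rewrite ltr_pM2l// ltrBlDr -ltrBlDl.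
  by rewrite mulrA NV zE divff//; exact: lin3.
- by apply/(measurable_restrictT _ (measurable_itv _)); exact: measurable_funTS.
- apply: measurable_itv_cont => x ax.
  exact: (@Cn_continuous R [set x | a < x] 0 _ x (Cphi 1%N) ax).
- apply: (aeS _ aeK) => x h xab; rewrite -h// /E mulrBr mulr1 opprB addrC subrK.
  by [].
- move=> x ax xb; split; last first.
    apply: (le_trans (bK x xb)); rewrite (_ : b - c0 = dl)//.
    by rewrite /c0 opprB addrC subrK.
  rewrite (_ : _ - _ = - E x) ?normrN; last by rewrite /E mulrBr mulr1 opprB.
  have [xc|cx] := leP x c0; first by rewrite E0// normr0 ltW.
  apply: le_trans dl2; rewrite /E normrM -[leRHS]mulr1; apply: ler_pM => //.
  exact: ULx.
Qed.

End minus_density.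

Section one_sided.
Context {R : realType} (a b alpha p : R).
Hypotheses (ab : a < b) (a0 : 0 < alpha) (a1 : alpha < 1) (p1 : 1 < p) (ap : 1 < alpha * p).
Notation mu := (@lebesgue_measure R).
Local Notation O := (`]a, b[%classic).
Local Notation J := (rlJ a b alpha).
Local Notation U := (rl_rep a b alpha).
Local Notation wpair := (weak_pair a b alpha p).
Local Notation refl := (refl_itv a b).
Implicit Types (u v w f g : R -> R) (s : side).

Let ba : 0 < b - a. Proof. by rewrite subr_gt0. Qed.

Lemma powR_le_id (e : R) : 0 < e -> e <= 1 -> e `^ p <= e.
Proof.
move=> e0 e1; have -> : e `^ p = e * e `^ (p - 1).
  by rewrite -{2}(powRr1 (ltW e0)) -powRD ?(gt_eqF e0) ?implybT// addrC subrK.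
have h : e `^ (p - 1) <= 1 `^ (p - 1).
  apply: ge0_ler_powR; [by rewrite subr_ge0 ltW|by rewrite nnegrE ltW|by rewrite nnegrE|exact: e1].
by rewrite powR1 in h; apply: ler_piMr => //; exact: ltW.
Qed.

(** The cut-off function is the representation with the same [C] and with [w - K] in place of [w],
    so its weak derivative is [w - K]. Uniform smallness of the errors becomes smallness in $L^p$ on
    the bounded interval. *)
Lemma minus_dense_eps u C v : Lp p (u \_ O) -> Lp p (v \_ O) ->
  {ae mu, forall x, a < x < b -> u x = U C v x} -> U C v b = 0 ->
  forall e, 0 < e -> exists phi psi,
    [/\ Cc_smooth_side a b Fminus phi, wpair Fminus phi psi,
      Np p (fun x => (phi \_ O) x - (u \_ O) x) < e &
      Np p (fun x => (psi \_ O) x - (v \_ O) x) < e].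
Proof.
move=> lu lv hu tr eps eps0.
have P0 : 0 < 2 `^ p :> R by exact: powR_gt0.
pose D := 2 `^ p * (1 + (b - a)).
have D0 : 0 < D by rewrite mulr_gt0// addr_gt0.
(* Bounding [e] by 1 gives $e^p\le e$, so that all errors are linear in [e]. *)
pose e := Num.min 1 (eps / (D * 2)).
have e0 : 0 < e by rewrite lt_min ltr01 divr_gt0// mulr_gt0.
have e1 : e <= 1 by rewrite /e ge_min lexx.
have De : D * e < eps.
  apply: (@le_lt_trans _ _ (eps / 2)); last by rewrite ltr_pdivrMr// ltr_pMr// ltr1n.
  rewrite mulrC -ler_pdivlMr// (le_trans (_ : e <= eps / (D * 2)))//.
    by rewrite /e ge_min lexx orbT.
  by rewrite invfM mulrA mulrAC.
have ep := powR_le_id e0 e1.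
have [c [d [w [ac db tw Uw [hw1 hw2]]]]] := approx_test ab a0 a1 p1 ap lv tr e0.
have lw : Lp p (w \_ O) by rewrite (test_restrict ac db tw); exact: test_Lp tw.
have [phi [K [sphi mK mphi hphi bd]]] := cutoff_approx ab a0 a1 ac db tw Uw e0.
have mU f : Lp p (f \_ O) -> measurable_fun setT (U C f \_ O).
  move=> lf; apply: measurable_itv_cont => x ax; exact: (rl_rep_continuous ab a0 a1 p1 ap).
have e0' := ltW e0.
have e20 : 0 <= 2 * e by rewrite mulr_ge0.
have [lK NK] := Np_bounded_itv ab p1 mK e0' (fun x h1 h2 => (bd x h1 h2).2).
pose del x := phi x - U C v x.
have mdel : measurable_fun setT (del \_ O).
  rewrite (_ : _ \_ _ = fun x => (phi \_ O) x - (U C v \_ O) x).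
    by apply: measurable_funB => //; exact: mU.
  by apply/funext => x; rewrite !patchE; case: ifP => //; rewrite subr0.
have bdel x : a < x -> x < b -> `|del x| <= 2 * e.
  move=> ax xb; have [h1 _] := bd x ax xb.
  have -> : del x = (phi x - U C w x) + (J w x - J v x).
    by rewrite /del /rl_rep; ring.
  rewrite mulr_natl mulr2n (le_trans (ler_normD _ _))// lerD//.
  by apply: ltW; exact: hw2.
have [ldel Ndel] := Np_bounded_itv ab p1 mdel e20 bdel.
have udel : {ae mu, forall x, (u \_ O) x + (del \_ O) x = (phi \_ O) x}.
  apply: (aeS _ hu) => x h; rewrite !patchE; case: ifPn => [|_]; last by rewrite addr0.
  by rewrite inE/= in_itv/= => /h ->; rewrite /del addrC subrK.
have lphi : Lp p (phi \_ O) by apply: (ae_Lp (LpD p1 lu ldel) mphi udel).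
have rep : {ae mu, forall x, a < x < b -> phi x = U C (w \- K) x}.
  apply: (aeS _ hphi) => x h1 xab.
  by rewrite h1// /rl_rep (rlJB a0 a1 p1 ap x lw lK) addrA.
have lwK : Lp p ((w \- K) \_ O) by rewrite patchB; exact: LpB.
exists phi, (w \- K); split=> //.
- by apply/(weak_pair_minusP ab a0 a1 p1); split=> //; exists C.
- rewrite (ae_Np p _ _ (_ : {ae mu, forall x, (phi \_ O) x - (u \_ O) x = (del \_ O) x})).
  + apply: (le_lt_trans Ndel); apply: le_lt_trans De.
    rewrite powRM// /D -mulrA -mulrA; apply: ler_wpM2l; first exact: ltW.
    rewrite mulrDl mul1r [(b - a) * e]mulrC.
    apply: (@le_trans _ _ (e * (b - a))); last by rewrite lerDr.
    by apply: ler_wpM2r => //; exact: ltW.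
  + by apply: measurable_funB => //; have [] := lu.
  + exact: mdel.
  + by apply: (aeS _ udel) => x <-; rewrite addrC addKr.
- have -> : (fun x => ((w \- K) \_ O) x - (v \_ O) x) =
      (fun x => ((w \_ O) x - (v \_ O) x) - (K \_ O) x).
    by rewrite patchB; apply/funext => x; rewrite addrAC.
  apply: (le_lt_trans (NpB p1 (LpB p1 lw lv) lK)); apply: le_lt_trans De.
  rewrite /D -mulrA ler_wpM2l ?(ltW P0)// mulrDl mul1r lerD ?(ltW hw1)//.
  by apply: (le_trans NK); rewrite mulrC ler_wpM2l ?(ltW ba).
Qed.

Lemma Wside0_minus_dense u : Wside0 a b Fminus alpha p u ->
  exists2 phi : nat -> R -> R,
    (forall n, (Cc_smooth_side a b Fminus `&` Wside a b Fminus alpha p) (phi n)) &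
    WsideNorm a b Fminus alpha p (phi n \- u) @[n --> \oo] --> 0%E.
Proof.
move=> /(Wside0_minusP ab a0 a1 p1 ap)[v [C [lu lv hu tr]]].
have i0 n : 0 < n.+1%:R^-1 :> R by rewrite invr_gt0.
have [phi [psi h]] := choice_pairs (fun n => minus_dense_eps lu lv hu tr (i0 n)).
have cvgi (f : nat -> R) : (forall n, 0 <= f n) -> (forall n, f n < n.+1%:R^-1) ->
    f n @[n --> \oo] --> 0.
  move=> f0 fn; apply: (squeeze_cvgr _ (cvg_cst (0 : R)) (@cvg_harmonic R)).
  by apply: nearW => n; rewrite f0/= ltW.
exists phi.
  move=> n; have [s wp _ _] := h n; split=> //.
  by apply/(Wside_pair _ _ _ p1); exists (psi n).
have hn n : wpair Fminus (phi n) (psi n) by have [] := h n.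
apply: (weak_pair_cvg ab a0 a1 p1 hn (v0 := v)).
- by apply/(weak_pair_minusP ab a0 a1 p1); split=> //; exists C.
- by apply: cvgi => n; [exact: Np_ge0|have [_ _ h1 _] := h n; exact: h1].
- by apply: cvgi => n; [exact: Np_ge0|have [_ _ _ h1] := h n; exact: h1].
Qed.

Lemma Wside0_minus_completion : is_completion (WsideNorm a b Fminus alpha p)
  (Cc_smooth_side a b Fminus `&` Wside a b Fminus alpha p) (Wside0 a b Fminus alpha p).
Proof.
split; [exact: Cc_smooth_side_minus_sub|exact: Wside0_minus_dense|].
exact: Wside0_minus_complete.
Qed.

Lemma Wside_refl u : Wside a b Fplus alpha p u <-> Wside a b Fminus alpha p (refl u).
Proof.
split=> /(Wside_pair _ _ _ p1)[v h]; apply/(Wside_pair _ _ _ p1).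
  by exists (refl v); exact/(weak_pair_refl ab a0 a1 p1).
by exists (refl v); apply/(weak_pair_refl ab a0 a1 p1); rewrite refl_itvK.
Qed.

Lemma Wside0_refl u : Wside0 a b Fplus alpha p u <-> Wside0 a b Fminus alpha p (refl u).
Proof.
by split=> -[/Wside_refl h1 h2]; split=> //; apply/has_trace_refl.
Qed.

Lemma Cc_smooth_side_refl u : Cc_smooth_side a b Fplus u <->
  Cc_smooth_side a b Fminus (refl u).
Proof.
have oO : open O by exact: itv_open.
have cr n f : Cn O n f -> Cn O n (refl f).
  move=> cf; have := @Cn_affine R O O n f (-1) (a + b) _ cf.
  have H x : O x -> O (-1 * x + (a + b)).
    by move=> xO; rewrite mulN1r addrC /=; rewrite refl_itv_in.
  by move=> /(_ H); apply: Cn_on => // x _; rewrite /refl_itv mulN1r addrC.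
have sr f : smooth_on O f -> smooth_on O (refl f).
  by move=> /(smooth_onP _ oO) sf; apply/(smooth_onP _ oO) => n; exact: cr.
split=> -[su [c cab uc]].
  split; first exact: sr.
  exists (a + b - c); first by rewrite refl_itv_in.
  move=> x xab cx; apply: uc; first by rewrite refl_itv_in.
  by rewrite ltrBlDr -ltrBlDl.
split; first by rewrite -[u](refl_itvK a b); exact: sr.
exists (a + b - c); first by rewrite refl_itv_in.
move=> x xab xc; have := uc (a + b - x); rewrite refl_itv_in /refl_itv subKr; apply=> //.
by rewrite ltrBrDr -ltrBrDl.
Qed.

Lemma WsideNorm_refl u : Wside a b Fplus alpha p u ->
  WsideNorm a b Fplus alpha p u = WsideNorm a b Fminus alpha p (refl u).
Proof.
move=> /(Wside_pair _ _ _ p1)[v h]; have h' := (weak_pair_refl ab a0 a1 p1 u v).1 h.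
rewrite (weak_pair_norm p1 h) (weak_pair_norm p1 h').
by have [lu lv _] := h; rewrite !refl_Np.
Qed.

Lemma WsideB s u v : Wside a b s alpha p u -> Wside a b s alpha p v ->
  Wside a b s alpha p (u \- v).
Proof.
move=> /(Wside_pair _ _ _ p1)[u' hu] /(Wside_pair _ _ _ p1)[v' hv].
by apply/(Wside_pair _ _ _ p1); exists (u' \- v'); exact: weak_pairB.
Qed.

(** The right-sided case is transported by reflection. Norms are compared for members of the space
    only, since [WsideNorm] has a meaning only where the derivative exists. *)
Lemma Wside0_completion s : is_completion (WsideNorm a b s alpha p)
  (Cc_smooth_side a b s `&` Wside a b s alpha p) (Wside0 a b s alpha p).
Proof.
case: s; first exact: Wside0_minus_completion.
have [h1 h2 h3] := Wside0_minus_completion.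
have NB u v : Wside a b Fplus alpha p u -> Wside a b Fplus alpha p v ->
    WsideNorm a b Fplus alpha p (u \- v) = WsideNorm a b Fminus alpha p (refl u \- refl v).
  by move=> hu hv; rewrite WsideNorm_refl//; exact: WsideB.
split.
- move=> u [/Cc_smooth_side_refl su /Wside_refl Wu]; apply/Wside0_refl; exact: h1.
- move=> u /[dup] -[Wu _] /Wside0_refl /h2 [phi hphi cphi].
  have Wphi n : Wside a b Fplus alpha p (refl (phi n)).
    by apply/Wside_refl; rewrite refl_itvK; have [] := hphi n.
  exists (fun n => refl (phi n)).
    move=> n; split=> //; apply/Cc_smooth_side_refl; rewrite refl_itvK.
    by have [] := hphi n.
  rewrite (_ : (fun n => _) = fun n => WsideNorm a b Fminus alpha p (phi n \- refl u))//.
  by apply/funext => n; rewrite NB// refl_itvK.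
- move=> w hw cw; have Ww n : Wside a b Fplus alpha p (w n) by have [] := hw n.
  have [] := h3 (fun n => refl (w n)).
  + by move=> n; apply/Wside0_refl.
  + by move=> e /cw[n0 hn]; exists n0 => m n h4 h5; rewrite -NB//; exact: hn.
  move=> u hu cu; have Wu : Wside0 a b Fplus alpha p (refl u) by apply/Wside0_refl; rewrite refl_itvK.
  exists (refl u); first exact: Wu.
  rewrite (_ : (fun n => _) = fun n => WsideNorm a b Fminus alpha p (refl (w n) \- u))//.
  by apply/funext => n; rewrite NB// ?refl_itvK//; have [] := Wu.
Qed.

End one_sided.

(** * Hilbert's inequality *)

Section hilbert.
Context {R : realType}.
Notation mu := (@lebesgue_measure R).
Notation RR := (measurableTypeR R * measurableTypeR R)%type.
Implicit Types (f g h : R -> R).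

Lemma cvg_powRNy (r : R) : 0 < r -> x `^ (- r) @[x --> +oo] --> (0 : R).
Proof.
move=> r0; apply/cvgrPdist_lt => e e0; near=> x.
have x0 : 0 < x by near: x; exact: nbhs_pinfty_gt.
rewrite sub0r normrN ger0_norm ?powR_ge0// powRN.
rewrite -[ltRHS]invrK ltf_pV2 ?posrE ?powR_gt0 ?invr_gt0//.
have ei : 0 <= e^-1 by rewrite invr_ge0 ltW.
rewrite -[ltLHS](@powR_VK R r)//; apply: gt0_ltr_powR => //; rewrite ?nnegrE ?powR_ge0 ?(ltW x0)//.
Unshelve. all: by end_near. Qed.

Lemma integral_powR_y (r : R) : 0 < r ->
  (\int[mu]_(t in `[1%R, +oo[) (t `^ (- r - 1))%:E = (r^-1)%:E)%E.
Proof.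
move=> r0; have D (x : R) : 0 < x -> is_derive x 1 (fun t => - r^-1 * t `^ (- r)) (x `^ (- r - 1)).
  move=> x0; have := is_deriveZ (- r^-1) (is_derive1_powR (- r) x0).
  by rewrite /GRing.scale/= mulrA mulrNN mulVf ?gt_eqF// mul1r.
rewrite (@ge0_continuous_FTC2y R _ (fun t => - r^-1 * t `^ (- r)) 1 0)//.
- by rewrite powR1 mulr1 EFinN oppeK add0e.
- by move=> x _; exact: powR_ge0.
- apply: continuous_in_subspaceT => x; rewrite inE/= in_itv/= andbT => x1.
  apply/differentiable_continuous/derivable1_diffP.
  by have [] := is_derive1_powR (- r - 1) (lt_le_trans ltr01 x1).
- rewrite -(mulr0 (- r^-1)); apply: cvgM; first exact: cvg_cst.
  exact: cvg_powRNy.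
- by move=> x x1; have [] := D x (lt_trans ltr01 x1).
- have [d1 _] := D 1 ltr01; apply: cvg_at_right_filter.
  have C : {for (1 : R), continuous (fun t => - r^-1 * t `^ (- r))}.
    by apply: differentiable_continuous; exact/derivable1_diffP.
  exact: C.
- move=> x; rewrite in_itv/= andbT => x1; rewrite derive1E.
  by have [_ ->] := D x (lt_trans ltr01 x1).
Qed.

Lemma L1_powR_y (r : R) : 0 < r -> L1 ((fun t => t `^ (- r - 1)) \_ `[1, +oo[).
Proof.
move=> r0; apply/(L1_restrict _ (measurable_itv _)); apply/integrableP; split.
  by apply/measurable_EFinP/measurable_funTS; exact: measurable_powR.
rewrite (_ : (\int[mu]_(x in _) _)%E = (\int[mu]_(t in `[1%R, +oo[) (t `^ (- r - 1))%:E)%E).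
  by rewrite integral_powR_y// ltry.
by apply: eq_integral => x _ /=; rewrite (ger0_norm (powR_ge0 _ _)).
Qed.

Lemma integral2_of_bound (F : RR -> R) g : measurable_fun setT F -> L1 g ->
  (forall y, (\int[mu]_x `|F (x, y)|%:E <= (g y)%:E)%E) ->
  (mu \x mu)%E.-integrable setT (EFin \o F).
Proof.
move=> mF lg hF; apply/integrable21ltyP; first exact/measurable_EFinP.
have /integrableP[mg goo] := lg.
apply: le_lt_trans goo; apply: ge0_le_integral => //.
- by move=> y _; exact: integral_ge0.
- have mF' : measurable_fun setT (fun z : RR => `|F z|%:E).
    by apply/measurable_EFinP; exact: measurableT_comp.
  exact: (@measurable_fun_fubini_tonelli_G _ _ (measurableTypeR R) (measurableTypeR R) R mu
    (fun z => `|F z|%:E) mF' (fun z => normr_ge0 (F z))).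
- by apply: measurableT_comp.
- by move=> y _ /=; apply: (le_trans (hF y)); rewrite lee_fin ler_norm.
Qed.

(** The kernel $1/(x-z)$ in the coordinates $r=x-b$ and $s=b-z$, the distances to [b] from outside
    and from inside. *)
Definition hilbk (r s : R) : R := if 0 < s then (r + s)^-1 else 0.

(* The weight [t^(-1/p) / (1 + t)] of Schur's test for the Hilbert kernel. *)
Definition schurw (p t : R) : R := if 0 < t then t `^ (- p^-1) / (1 + t) else 0.

Lemma schurw_ge0 p t : 0 <= schurw p t.
Proof.
rewrite /schurw; case: ifPn => // t0; rewrite divr_ge0 ?powR_ge0//.
by rewrite addr_ge0// ltW.
Qed.

Lemma measurable_ite0 f : measurable_fun setT f ->
  measurable_fun setT (fun t : R => if 0 < t then f t else 0).
Proof.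
move=> mf; rewrite (_ : (fun t : R => _) = f \_ `]0, +oo[).
  by apply/(measurable_restrictT _ (measurable_itv _)); exact: measurable_funTS.
by apply/funext => t; rewrite patchE mem_setE in_itv/= andbT.
Qed.

Lemma measurable_hilbk (r : R) : 0 <= r -> measurable_fun setT (hilbk r).
Proof.
move=> r0; rewrite (_ : hilbk r = fun s => if 0 < s then (r + s) `^ (-1) else 0).
  apply: measurable_ite0; apply: (@measurableT_comp _ _ _ _ _ _ (fun y : R => y `^ (-1))).
    exact: measurable_powR.
  exact: measurable_funD.
apply/funext => s; rewrite /hilbk; case: ifP => // s0.
by rewrite powR_inv1// addr_ge0// ltW.
Qed.

Lemma hilbk_bound (r s : R) : 0 < r -> `|hilbk r s| <= r^-1.
Proof.
move=> r0; rewrite /hilbk; case: ifP => s0; last by rewrite normr0 invr_ge0 ltW.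
have rs : 0 < r + s by rewrite addr_gt0.
by rewrite ger0_norm ?invr_ge0 ?(ltW rs)// lef_pV2 ?posrE// lerDl ltW.
Qed.

Lemma measurable_schurw p : measurable_fun setT (schurw p).
Proof.
rewrite (_ : schurw p = fun t => t `^ (- p^-1) * hilbk 1 t).
  apply: measurable_funM; first exact: measurable_powR.
  exact: measurable_hilbk.
by apply/funext => t; rewrite /schurw /hilbk; case: ifP; rewrite ?mulr0.
Qed.

(** Comparable to $t^{-1/p}$ near 0 and to $t^{-1/p-1}$ at infinity; the first is integrable because
    $p>1$, the second because $1/p>0$. *)
Lemma L1_schurw p : 1 < p -> L1 (schurw p).
Proof.
move=> p1; have p0 : 0 < p by exact: lt_trans p1.
have pV : p^-1 < 1 by rewrite invf_lt1.
have l1 : L1 (rlker (1 - p^-1) 1) by apply: L1_rlker; rewrite subr_gt0.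
have pi0 : 0 < p^-1 by rewrite invr_gt0.
have l2 := L1_powR_y pi0.
apply: (L1_le _ _ (L1D l1 l2)); first exact: measurable_schurw.
move=> t; rewrite ger0_norm ?schurw_ge0// /schurw; case: ifPn => t0; last first.
  by rewrite addr_ge0 ?rlker_ge0// patchE; case: ifP => // _; exact: powR_ge0.
have t1 : 0 < 1 + t by rewrite addr_gt0.
rewrite patchE mem_setE in_itv/= andbT; have [ht|ht] := leP 1 t.
  rewrite -[leLHS]add0r lerD ?rlker_ge0// powRD ?(gt_eqF t0) ?implybT//.
  rewrite ler_wpM2l ?powR_ge0// powR_inv1 ?(ltW t0)// lef_pV2 ?posrE//.
  by rewrite lerDr.
rewrite addr0 rlkerE// addrAC subrr add0r ler_piMr ?powR_ge0//.
by rewrite invf_le1// lerDl ltW.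
Qed.

Lemma schurw_int_gt0 p : 1 < p -> 0 < \int[mu]_t schurw p t.
Proof.
move=> p1; have lw := L1_schurw p1.
have l1 : L1 (rlker 1 (1 : R)) by exact: L1_rlker.
have h : \int[mu]_t (2^-1 * rlker 1 1 t) = (2^-1 : R).
  by rewrite RintegralZl// Rintegral_rlker// powR1 divr1 mulr1.
apply: (@lt_le_trans _ _ 2^-1); first by rewrite invr_gt0.
rewrite -h; apply: le_Rintegral => //; first exact: L1Zl.
move=> t _; have [t0|t0] := leP t 0; first by rewrite rlker_le0// mulr0 schurw_ge0.
have [t1|t1] := leP 1 t.
  by rewrite /rlker t0 ltNge t1/= mulr0 schurw_ge0.
rewrite rlkerE// subrr powRr0 mulr1 /schurw t0 -[leLHS]mul1r.
apply: ler_pM; rewrite ?invr_ge0//.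
  rewrite powRN -[leLHS]invr1 lef_pV2 ?posrE ?powR_gt0//.
  have p0 : 0 < p by exact: lt_trans p1.
  have : t `^ p^-1 <= 1 `^ p^-1.
    by apply: ge0_ler_powR; rewrite ?nnegrE ?invr_ge0 ?(ltW p0) ?(ltW t0) ?(ltW t1).
  by rewrite powR1.
rewrite lef_pV2 ?posrE// ?addr_gt0//.
by rewrite -[leRHS]/(1 + 1) lerD2l ltW.
Qed.

(* Hilbert's inequality in L^p: scaling [s = r t] makes the kernel independent
   of [r], and Jensen's inequality applies with a fixed density. *)
Lemma hilbert_L1 p g : 1 < p -> L1 g -> Lp p g ->
  exists2 Q : R -> R, L1 Q &
    forall r, 0 < r -> (\int[mu]_s (`|g s| * hilbk r s)) `^ p <= Q r.
Proof.
move=> p1 lg [mg lgp]; have p0 : 0 < p by exact: lt_trans p1.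
have pi0 : 0 < p^-1 by rewrite invr_gt0.
set c := \int[mu]_t schurw p t; have c0 : 0 < c := schurw_int_gt0 p1.
have lw := L1_schurw p1; have mw := measurable_schurw p.
(* Integrating $|g(rt)|^p q(t)$ over [r] produces a factor $1/t$, which turns [q] back into the
   integrable weight [schurw]. *)
pose q t := t * schurw p t.
have mq : measurable_fun setT q by exact: measurable_funM.
have q0 t : 0 <= q t.
  have [t0|t0] := leP t 0; last by rewrite mulr_ge0 ?schurw_ge0// ltW.
  by rewrite /q /schurw ltNge t0 mulr0.
have mgp := measurable_powR_abs p mg.
pose F (z : RR) := `|g (z.1 * z.2)| `^ p * q z.2.
have mF : measurable_fun setT F.
  apply: measurable_funM.
    apply: (measurableT_comp mgp).
    by apply: measurable_funM; [exact: measurable_fst|exact: measurable_snd].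
  by apply: (measurableT_comp mq); exact: measurable_snd.
have iF : (mu \x mu)%E.-integrable setT (EFin \o F).
  apply: (integral2_of_bound mF (L1Zl (Np p g) lw)) => t.
  have [t0|t0] := leP t 0.
    rewrite (_ : (\int[mu]_x _)%E = 0%E) ?lee_fin ?mulr_ge0 ?Np_ge0 ?schurw_ge0//.
    rewrite integral0_eq// => x _.
    by rewrite /F/= /q /schurw ltNge t0 !mulr0 normr0.
  rewrite (_ : (\int[mu]_x _)%E = (q t)%:E * \int[mu]_x (`|g (t * x + 0)| `^ p)%:E)%E.
    rewrite (@ge0_integral_affine R (fun x => (`|g x| `^ p)%:E)) ?gt_eqF//; last exact/measurable_EFinP.
    have -> : (\int[mu]_x (`|g x| `^ p)%:E)%E = (Np p g)%:E.
      by rewrite /Np /Rintegral fineK//; exact: (integrable_fin_num measurableT lgp).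
    rewrite -!EFinM lee_fin gtr0_norm// /q mulrA [t * _]mulrC -(mulrA (schurw p t)).
    by rewrite mulfV ?gt_eqF// mulr1 mulrC.
  rewrite -ge0_integralZl_EFin//; last first.
    by apply/measurable_EFinP; apply: (measurableT_comp mgp); exact: measurable_affine.
  apply: eq_integral => x _; rewrite /F/= -EFinM addr0 (mulrC t).
  rewrite (ger0_norm (mulr_ge0 (powR_ge0 _ _) (q0 t))).
  by congr (_%:E); exact: mulrC.
pose Q0 r := \int[mu]_t F (r, t).
exists (fun r => c `^ p / c * Q0 r); first by apply: L1Zl; exact: (L1_fubini iF).
move=> r r0.
(* The factor $t^{1/p}$ undoes that of [schurw]: to the first power the product with [rho] is the
   Hilbert integrand, to the power [p] it is the integrand of [F], both up to $1/c$. *)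
pose Fr t := if 0 < t then `|g (r * t)| * t `^ p^-1 else 0.
have Fr0 t : 0 <= Fr t by rewrite /Fr; case: ifP => // _; rewrite mulr_ge0 ?powR_ge0.
pose rho t := c^-1 * schurw p t.
have lrho : L1 rho by exact: L1Zl.
have rho0 t : 0 <= rho t by rewrite mulr_ge0 ?schurw_ge0// invr_ge0 ltW.
have rho1 : \int[mu]_t rho t = 1 by rewrite /rho RintegralZl// mulVf// gt_eqF.
have FrE t : Fr t * rho t = c^-1 * (`|g (r * t)| * hilbk 1 t).
  rewrite /Fr /rho /schurw /hilbk; case: ifP => t0; last by rewrite !mulr0.
  rewrite powRN; move: (powR_gt0 p^-1 t0); move: (t `^ p^-1) (`|g (r * t)|) => y z y0.
  by field; rewrite !gt_eqF// addr_gt0.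
have FrpE t : Fr t `^ p * rho t = c^-1 * F (r, t).
  rewrite /Fr /rho /F /q /schurw /=; case: ifP => t0; last by rewrite !mulr0.
  rewrite powRM ?powR_ge0// powR_VK ?(ltW t0)//.
  by rewrite mulrCA !mulrA.
have lgr : L1 (fun t => `|g (r * t)|).
  have := L1_abs (L1_affine 0 (lt0r_neq0 r0) lg); apply: eq_integrable => // t _ /=.
  by rewrite addr0.
have mh : measurable_fun setT (hilbk 1) by exact: measurable_hilbk.
have h1 t : `|hilbk 1 t| <= 1 by rewrite (le_trans (hilbk_bound t ltr01))// invr1.
have lFr : L1 (fun t => Fr t * rho t).
  have := L1Zl c^-1 (L1_mul lgr mh h1); apply: eq_integrable => // t _ /=.
  by rewrite FrE.
have q1 t : `|q t| <= 1.
  rewrite ger0_norm// /q /schurw; case: ifP => t0; last by rewrite mulr0.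
  rewrite mulrA ler_pdivrMr ?mul1r ?addr_gt0//.
  have [t1|/ltW t1] := leP 1 t.
    apply: (@le_trans _ _ t); last by rewrite lerDr.
    rewrite ler_piMr ?(ltW t0)// powRN invf_le1 ?powR_gt0//.
    have := @ge0_ler_powR R p^-1 (ltW pi0) 1 t; rewrite !nnegrE powR1; apply=> //.
    exact: ltW.
  apply: (@le_trans _ _ 1); last by rewrite lerDl ltW.
  have -> : t * t `^ (- p^-1) = t `^ (1 - p^-1).
    by rewrite -{1}(powRr1 (ltW t0)) -powRD// (gt_eqF t0) implybT.
  have := @ge0_ler_powR R (1 - p^-1) _ t 1; rewrite !nnegrE powR1; apply=> //.
    by rewrite subr_ge0 invf_le1// ltW.
  exact: ltW.
have lFrp : L1 (fun t => Fr t `^ p * rho t).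
  have lgrp : L1 (fun t => `|g (r * t)| `^ p).
    have := L1_affine 0 (lt0r_neq0 r0) lgp; apply: eq_integrable => // t _ /=.
    by rewrite addr0.
  have := L1Zl c^-1 (L1_mul lgrp mq q1); apply: eq_integrable => // t _ /=.
  by rewrite FrpE.
have := powR_jensen p1 lrho rho0 rho1 Fr0 lFr lFrp.
have -> : \int[mu]_z (Fr z `^ p * rho z) = c^-1 * Q0 r.
  rewrite /Q0 -RintegralZl; first by apply: eq_Rintegral => t _; rewrite FrpE.
  - exact: measurableT.
  - by have := L1Zl c lFrp; apply: eq_integrable => // t _ /=; rewrite FrpE mulVKf// gt_eqF.
have -> : \int[mu]_z (Fr z * rho z) = c^-1 * \int[mu]_s (`|g s| * hilbk r s).
  have E : \int[mu]_s (`|g s| * hilbk r s) = \int[mu]_t (`|g (r * t)| * hilbk 1 t).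
    have mgh : measurable_fun setT (fun s => `|g s| * hilbk r s).
      apply: measurable_funM; first exact: measurableT_comp.
      by apply: measurable_hilbk; exact: ltW.
    have := Rintegral_affine 0 (lt0r_neq0 r0) mgh.
    rewrite gtr0_norm// => /(congr1 (fun x => r * x)); rewrite mulVKf ?gt_eqF// => <-.
    rewrite -RintegralZl//; last first.
      apply: (L1_affine 0 (lt0r_neq0 r0) (f := fun s => `|g s| * hilbk r s)).
      apply: (L1_mul (C := r^-1) (L1_abs lg)); first by apply: measurable_hilbk; exact: ltW.
      by move=> s; exact: hilbk_bound.
    apply: eq_Rintegral => t _; rewrite addr0 mulrCA; congr (_ * _).
    rewrite /hilbk pmulr_rgt0//; case: ifP => t0; last by rewrite mulr0.
    by field; rewrite !gt_eqF ?addr_gt0// ?mulr_gt0.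
  rewrite E -RintegralZl; first by apply: eq_Rintegral => t _; rewrite FrE.
  - exact: measurableT.
  - exact: (L1_mul lgr mh h1).
have I0 : 0 <= \int[mu]_s (`|g s| * hilbk r s).
  apply: Rintegral_ge0 => s _; rewrite mulr_ge0// /hilbk; case: ifP => // s0.
  by rewrite invr_ge0 addr_ge0// ltW.
rewrite powRM ?invr_ge0 ?(ltW c0)// => h.
have cp : 0 < c `^ p by exact: powR_gt0.
have -> : (\int[mu]_s (`|g s| * hilbk r s)) `^ p =
    c `^ p * (c^-1 `^ p * (\int[mu]_s (`|g s| * hilbk r s)) `^ p).
  by rewrite mulrA -powRM ?invr_ge0 ?(ltW c0)// mulfV ?gt_eqF// powR1 mul1r.
by rewrite -mulrA ler_wpM2l// ltW.
Qed.

End hilbert.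

(** Up to the factor $-\alpha$, the derivative of $t^{-\alpha}$. It is not integrable at 0, so it
    acts only at points away from the support of what it is convolved with. *)
Definition rlker2 (R : realType) (alpha t : R) : R :=
  if 0 < t then t `^ (- 1 - alpha) else 0.

Section kernel2.
Context {R : realType} (alpha : R) (a0 : 0 < alpha).
Notation mu := (@lebesgue_measure R).
Notation RR := (measurableTypeR R * measurableTypeR R)%type.
Implicit Types (f g : R -> R).

Lemma rlker2_ge0 t : 0 <= rlker2 alpha t.
Proof. by rewrite /rlker2; case: ifP => // _; exact: powR_ge0. Qed.

Lemma measurable_rlker2 : measurable_fun setT (rlker2 alpha).
Proof. by apply: measurable_ite0; exact: measurable_powR. Qed.

Lemma rlker2_le (r t : R) : 0 < r -> r <= t -> rlker2 alpha t <= r `^ (- 1 - alpha).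
Proof.
move=> r0 rt; have t0 : 0 < t by exact: lt_le_trans rt.
rewrite /rlker2 t0 -opprD !powRN lef_pV2 ?posrE ?powR_gt0//.
by apply: ge0_ler_powR; rewrite ?nnegrE ?addr_ge0 ?(ltW a0) ?(ltW r0) ?(ltW t0).
Qed.

(** Obtained from Tonelli on positive and negative parts, as [L1_conv] does not apply to the
    non-integrable kernel [rlker2]. *)
Lemma measurable_conv f g : measurable_fun setT f -> measurable_fun setT g ->
  measurable_fun setT (conv f g).
Proof.
move=> mf mg; pose E (z : RR) := (f z.2 * g (z.1 - z.2))%:E.
have mE : measurable_fun setT E.
  by apply/measurable_EFinP; exact: measurable_conv_integrand.
have mp : measurable_fun setT E^\+%E by exact: measurable_funepos.
have mn : measurable_fun setT E^\-%E by exact: measurable_funeneg.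
have m1 := @measurable_fun_fubini_tonelli_F _ _ (measurableTypeR R) (measurableTypeR R) R mu _ mp (fun z => funepos_ge0 E z).
have m2 := @measurable_fun_fubini_tonelli_F _ _ (measurableTypeR R) (measurableTypeR R) R mu _ mn (fun z => funeneg_ge0 E z).
have m := emeasurable_funB m1 m2.
have := measurableT_comp (fine_measurable measurableT) m; apply: eq_measurable_fun => x _ /=.
rewrite /conv /Rintegral [in RHS]integralE; congr (fine (_ - _)%E);
  by rewrite /fubini_F; apply: eq_integral => y _; rewrite /E ?funeposE ?funenegE.
Qed.

(** Replacing [g] by the maximum with [f] changes it on a null set only and makes the inequality
    hold everywhere. *)
Lemma ae_le_Rintegral f g : L1 f -> L1 g -> {ae mu, forall x, f x <= g x} ->
  \int[mu]_x f x <= \int[mu]_x g x.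
Proof.
move=> lf lg fg; have mf := L1_measurable lf; have mg := L1_measurable lg.
have mm : measurable_fun setT (fun x => Num.max (f x) (g x)) by exact: measurable_maxr.
have em : {ae mu, forall x, g x = Num.max (f x) (g x)}.
  by apply: aeS fg => x h; rewrite max_r.
rewrite (ae_eq_Rintegral mg mm em); apply: le_Rintegral => //; first exact: (L1_ae lg mm em).
by move=> x _; rewrite le_max lexx.
Qed.

(* [(s / (s + r)) ^ alpha / (alpha r)] is an antiderivative of
   [s ^ (alpha - 1) (s + r) ^ (- 1 - alpha)]. *)
Lemma rlker_rlker2_int (M r : R) : 0 < M -> 0 < r ->
  L1 (fun s => rlker alpha M s * rlker2 alpha (s + r)) /\
  \int[mu]_s (rlker alpha M s * rlker2 alpha (s + r)) <= (alpha * r)^-1.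
Proof.
move=> M0 r0; have ar0 : 0 < alpha * r by rewrite mulr_gt0.
have m2 : measurable_fun setT (fun s : R => rlker2 alpha (s + r)).
  by apply: (measurableT_comp measurable_rlker2); exact: measurable_funD.
have l : L1 (fun s => rlker alpha M s * rlker2 alpha (s + r)).
  pose h s := if 0 < s then rlker2 alpha (s + r) else 0.
  have mh : measurable_fun setT h by exact: measurable_ite0.
  have hb s : `|h s| <= r `^ (- 1 - alpha).
    rewrite /h; case: ifP => s0; last by rewrite normr0 powR_ge0.
    by rewrite ger0_norm ?rlker2_ge0// rlker2_le// lerDr ltW.
  have := L1_mul (L1_rlker M a0) mh hb; apply: eq_integrable => // s _ /=.
  rewrite /h; case: ifPn => //; rewrite -leNgt => s0.
  by rewrite rlker_le0// !mul0r.
split=> //.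
pose f (s : R) := s `^ (alpha - 1) * (s + r) `^ (- 1 - alpha).
pose F (s : R) := (alpha * r)^-1 * (s `^ alpha * (s + r) `^ (- alpha)).
have dsr (q s : R) : 0 < s + r ->
    is_derive s 1 (fun t : R => (t + r) `^ q) (q * (s + r) `^ (q - 1)).
  move=> sr; have da : is_derive s 1 (fun t : R => t + r) 1.
    by have := is_derive_affine 1 r s; congr (is_derive _ _ _ _); apply/funext => t; rewrite mul1r.
  have := @is_derive1_comp R (fun y : R => y `^ q) (fun t => t + r) s _ _ (is_derive1_powR q sr) da.
  by rewrite mulr1.
have powS (q s : R) : 0 < s -> s `^ q = s * s `^ (q - 1).
  by move=> s0; rewrite -{2}(powRr1 (ltW s0)) -powRD ?(gt_eqF s0) ?implybT// addrC subrK.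
have H1 (s : R) : 0 < s -> s <= M -> is_derive s 1 F (f s).
  move=> s0 _; have sr : 0 < s + r by rewrite addr_gt0.
  have D := is_deriveZ (alpha * r)^-1 (is_deriveM (is_derive1_powR alpha s0) (dsr (- alpha) s sr)).
  refine (is_derive_eq D _); rewrite /GRing.scale/= /f.
  rewrite (powS alpha s s0) (powS (- alpha) (s + r) sr) [- 1 - alpha]addrC.
  move: (s `^ (alpha - 1)) ((s + r) `^ (- alpha - 1)) => A B.
  by field; rewrite !gt_eqF.
have H2 (s : R) : 0 < s -> s <= M -> {for s, continuous f}.
  move=> s0 _; have sr : 0 < s + r by rewrite addr_gt0.
  apply: cvgM.
    have C : {for s, continuous (fun s : R => s `^ (alpha - 1))}.
      apply/differentiable_continuous/derivable1_diffP.
      by have [] := is_derive1_powR (alpha - 1) s0.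
    exact: C.
  have C : {for s, continuous (fun s : R => (s + r) `^ (- 1 - alpha))}.
    apply/differentiable_continuous/derivable1_diffP.
    by have [] := dsr (- 1 - alpha) s sr.
  exact: C.
have H3 (s : R) : 0 < s -> s <= M -> 0 <= f s by move=> _ _; rewrite /f mulr_ge0 ?powR_ge0.
have H4 : F x @[x --> 0^'+] --> F 0.
  rewrite /F powR0 ?gt_eqF// mul0r mulr0 -{2}(mulr0 (alpha * r)^-1).
  apply: cvgM; first exact: cvg_cst.
  suff : x `^ alpha * (x + r) `^ (- alpha) @[x --> (0 : R)^'+] --> 0 * (0 + r) `^ (- alpha).
    by rewrite mul0r.
  apply: cvgM; first exact: powR_cvg0.
  have r00 : 0 < 0 + r by rewrite add0r.
  have C : {for (0 : R), continuous (fun t : R => (t + r) `^ (- alpha))}.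
    apply/differentiable_continuous/derivable1_diffP.
    by have [] := dsr (- alpha) 0 r00.
  by apply: cvg_at_right_filter; exact: C.
have mf : measurable_fun setT f.
  apply: measurable_funM; first exact: measurable_powR.
  apply: (@measurableT_comp _ _ _ _ _ _ (fun y : R => y `^ (- 1 - alpha))).
    exact: measurable_powR.
  exact: measurable_funD.
have -> : \int[mu]_s (rlker alpha M s * rlker2 alpha (s + r)) = F M - F 0.
  rewrite /Rintegral (_ : (\int[mu]_x _)%E = (F M - F 0)%:E)//.
  rewrite -(ge0_FTC_left M0 H1 H2 H3 H4) -integral_itv_bndo_bndc; last first.
    exact/measurable_EFinP/measurable_funTS.
  rewrite [RHS]integral_mkcond/=; apply: eq_integral => t _.
  rewrite patchE mem_setE in_itv/= /rlker /rlker2.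
  have [t0|t0] := ltP 0 t; last by rewrite mul0r.
  by rewrite addr_gt0//=; case: ifP => _; rewrite ?mul0r.
rewrite /F powR0 ?gt_eqF// mul0r mulr0 subr0 ler_piMr ?invr_ge0 ?(ltW ar0)//.
have Mr : 0 < M + r by rewrite addr_gt0.
rewrite powRN ler_pdivrMr ?powR_gt0// mul1r; apply: ge0_ler_powR.
- exact: ltW.
- by rewrite nnegrE ltW.
- by rewrite nnegrE ltW.
- by rewrite lerDl ltW.
Qed.

End kernel2.

(** * Estimate of the derivative beyond the end point *)

Section extension_bound.
Context {R : realType} (a b alpha p : R).
Hypotheses (ab : a < b) (a0 : 0 < alpha) (a1 : alpha < 1) (p1 : 1 < p) (ap : 1 < alpha * p).
Notation mu := (@lebesgue_measure R).
Local Notation O := (`]a, b[%classic).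
Local Notation J := (rlJ a b alpha).
Local Notation M := (2 * (b - a)).
Local Notation refl := (refl_itv a b).
Local Notation K2 := (rlker2 alpha).
Implicit Types (u v w f g : R -> R).

Let ba : 0 < b - a. Proof. by rewrite subr_gt0. Qed.
Let M0 : 0 < M. Proof. by rewrite mulr_gt0. Qed.

(** The left potential of [v] is also the right potential of [w], right fractional integrals being
    written as reflected left ones. *)
Definition refl_rep v w := {ae mu, forall x, a < x < b -> refl (J v) x = J (refl w) x}.

Lemma rlJ_refl_bound w y : Lp p (w \_ O) ->
  `|J (refl w) (a + b - y)| <=
  rlconst alpha * conv (fun z => `|(w \_ O) z|) (fun t => rlker alpha M (- t)) y.
Proof.
move=> lw; have lrw := refl_Lp lw; have [l _] := rlJ_young a0 a1 p1 ap ltr01 lrw (a + b - y).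
rewrite /rlJ normrM gtr0_norm ?rlconst_gt0//; apply: ler_wpM2l; first by rewrite ltW ?rlconst_gt0.
apply: (le_trans (le_normr_Rintegral measurableT l)).
have mk := measurable_rlker alpha M.
have ml : measurable_fun setT (fun z => `|(refl w \_ O) z * rlker alpha M (a + b - y - z)|).
  exact: L1_measurable (L1_abs l).
rewrite -(Rintegral_reflect (a + b) ml) le_eqVlt; apply/orP; left; apply/eqP.
apply: eq_Rintegral => z _; rewrite refl_itv_patch /refl_itv subKr normrM.
congr (_ * _); rewrite ger0_norm ?rlker_ge0//; congr (rlker _ _ _).
by rewrite opprB !opprB; ring.
Qed.

Lemma L1_abs_patch w : Lp p (w \_ O) -> L1 (fun z => `|(w \_ O) z|).
Proof. by move=> lw; apply: L1_abs; exact: (Lp_L1 p1). Qed.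

(** For [x] beyond [b] the kernel, cut at [b], keeps a distance [x - b] from its singularity. By
    [patch_cut] the cut changes nothing against functions supported in []a, b[]. *)
Lemma rlker2_cut_bound (x y : R) : b < x ->
  `|(if y < b then K2 (x - y) else 0)| <= (x - b) `^ (- 1 - alpha).
Proof.
move=> bx; case: ifP => yb; last by rewrite normr0 powR_ge0.
rewrite ger0_norm ?rlker2_ge0//; apply: (rlker2_le a0); first by rewrite subr_gt0.
by rewrite lerD2l lerN2 ltW.
Qed.

Lemma measurable_rlker2_cut (x : R) :
  measurable_fun setT (fun y : R => if y < b then K2 (x - y) else 0).
Proof.
rewrite (_ : (fun y : R => _) = (fun y => K2 (x - y)) \_ `]-oo, b[).
  apply/(measurable_restrictT _ (measurable_itv _)); apply: measurable_funTS.
  by apply: (measurableT_comp (measurable_rlker2 _)); exact: measurable_funB.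
by apply/funext => y; rewrite patchE mem_setE in_itv.
Qed.

Lemma patch_cut v x y : (v \_ O) y * K2 (x - y) =
  (v \_ O) y * (if y < b then K2 (x - y) else 0).
Proof.
case: ifPn => //; rewrite -leNgt => yb.
by rewrite mulr0 patchE memNset ?mul0r//= in_itv/= [y < b]ltNge yb andbF.
Qed.

Lemma L1_rlker2_cut v x : b < x -> L1 (v \_ O) -> L1 (fun y => (v \_ O) y * K2 (x - y)).
Proof.
move=> bx lv; have := L1_mul lv (measurable_rlker2_cut x) (fun y => rlker2_cut_bound y bx).
by apply: eq_integrable => // y _ /=; rewrite patch_cut.
Qed.

Lemma conv_rlker2_bound v w x : Lp p (v \_ O) -> Lp p (w \_ O) -> refl_rep v w -> b < x ->
  `|conv (J v \_ O) K2 x| <=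
  rlconst alpha / alpha * \int[mu]_s (`|(w \_ O) (b - s)| * hilbk (x - b) s).
Proof.
move=> lv lw hr bx; have c0 := rlconst_gt0 a0 a1; set c := rlconst alpha in c0 *.
have xb0 : 0 < x - b by rewrite subr_gt0.
have lJ : L1 (J v \_ O).
  by apply: L1_restrict_oo; apply: (L1_rlJ a0); exact: (Lp_L1 p1).
pose om z := `|(w \_ O) z|; have lom : L1 om := L1_abs_patch lw.
pose kt t := rlker alpha M (- t).
have lkt : L1 kt by exact: L1_reflect0 (L1_rlker _ a0).
pose h (y : R) := if y < b then K2 (x - y) else 0.
have mh : measurable_fun setT h := measurable_rlker2_cut x.
have hb y : `|h y| <= (x - b) `^ (- 1 - alpha) := rlker2_cut_bound y bx.
have h0 y : 0 <= h y by rewrite /h; case: ifP => // _; exact: rlker2_ge0.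
(* Here the right representation enters: it bounds the potential by a right fractional integral of
   $|w|$, which decays towards [b]. *)
have aeb : {ae mu, forall y, `|(J v \_ O) y| <= c * conv om kt y}.
  have := ae_reflect (a + b) hr; apply: aeS => y hy; rewrite patchE; case: ifPn => [|_].
    rewrite inE => yO; have yO' : a < a + b - y < b.
      by have := refl_itv_in a b y; rewrite !in_itv/= => ->; move: yO; rewrite /= in_itv.
    have := hy yO'; rewrite {1}/refl_itv subKr => ->.
    exact: rlJ_refl_bound.
  rewrite normr0; apply: mulr_ge0; first exact: ltW.
  by apply: Rintegral_ge0 => z _; exact: (mulr_ge0 (normr_ge0 _) (rlker_ge0 _ _ _)).
have lJh := L1_mul (L1_abs lJ) mh hb.
have lch := L1_mul (L1Zl c (L1_conv lom lkt)) mh hb.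
have s1 : `|conv (J v \_ O) K2 x| <= \int[mu]_y (`|(J v \_ O) y| * h y).
  apply: (le_trans (le_normr_Rintegral measurableT (L1_rlker2_cut bx lJ))).
  rewrite le_eqVlt; apply/orP; left; apply/eqP; apply: eq_Rintegral => y _.
  by rewrite patch_cut normrM (ger0_norm (h0 y)).
have s2 : \int[mu]_y (`|(J v \_ O) y| * h y) <= \int[mu]_y (c * conv om kt y * h y).
  by apply: ae_le_Rintegral => //; apply: aeS aeb => y; exact: ler_wpM2r.
have s3 : \int[mu]_y (c * conv om kt y * h y) =
    c * \int[mu]_z (om z * \int[mu]_y (kt (y - z) * h y)).
  rewrite -(conv_swap lom lkt mh hb) -RintegralZl//.
    by apply: eq_Rintegral => y _; rewrite mulrA.
  exact: (L1_mul (L1_conv lom lkt) mh hb).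
pose g s := `|(w \_ O) (b - s)|.
have lg : L1 g by exact: (L1_reflect b lom).
have mhk : measurable_fun setT (hilbk (x - b)) by apply: measurable_hilbk; exact: ltW.
have lgh : L1 (fun s => g s * hilbk (x - b) s).
  exact: (L1_mul lg mhk (fun s => hilbk_bound s xb0)).
(* With $s=z-y$ the inner integral is that of [rlker_rlker2_int] at $r=x-z$, hence at most
   $1/(\alpha(x-z))$; and $x-z=(x-b)+(b-z)$. *)
have inner z : om z * \int[mu]_y (kt (y - z) * h y) <= alpha^-1 * (g (b - z) * hilbk (x - b) (b - z)).
  rewrite /g subKr; have [zO|zO] := boolP (z \in O); last first.
    by rewrite /om patchE (negbTE zO) normr0 !mul0r mulr0.
  have /andP[az zb] : a < z < b by move: zO; rewrite inE/= in_itv.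
  rewrite mulrCA; apply: ler_wpM2l; first exact: normr_ge0.
  have bz : 0 < b - z by rewrite subr_gt0.
  have xz : 0 < x - z by rewrite subr_gt0 (lt_trans zb).
  rewrite /hilbk bz addrA subrK -invfM.
  have [lk hk] := rlker_rlker2_int a0 M0 xz.
  apply: le_trans hk.
  have mkh : measurable_fun setT (fun y : R => kt (y - z) * h y).
    apply: measurable_funM => //; apply: (measurableT_comp (L1_measurable lkt)).
    exact: measurable_funB.
  have ktE s : kt (z - s - z) = rlker alpha M s by rewrite /kt; congr rlker; ring.
  rewrite -(Rintegral_reflect z mkh); apply: le_Rintegral => //.
    have lks : L1 (fun s => rlker alpha M s * h (z - s)).
      apply: (L1_mul (C := (x - b) `^ (- 1 - alpha)) (L1_rlker M a0)) => //.
      by apply: (measurableT_comp mh); exact: measurable_funB.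
    by apply: eq_integrable lks => // s _ /=; rewrite ktE.
  move=> s _; rewrite ktE; apply: ler_wpM2l; first exact: rlker_ge0.
  rewrite /h; case: ifP => _; last exact: rlker2_ge0.
  by rewrite opprB addrA [x + s]addrC -addrA.
apply: (le_trans s1); apply: (le_trans s2); rewrite s3 -mulrA; apply: ler_wpM2l; first exact: ltW.
have mgh : measurable_fun setT (fun s => g s * hilbk (x - b) s) by exact: L1_measurable lgh.
rewrite -(Rintegral_reflect b mgh) -RintegralZl//; last exact: (L1_reflect b lgh).
apply: le_Rintegral => //.
  have E z : \int[mu]_y (kt (y - z) * h y) = conv (rlker alpha M) h z.
    rewrite (convC _ (measurable_rlker _ _) mh); apply: eq_Rintegral => y _.
    by rewrite mulrC /kt opprB.
  have mc := measurable_conv (measurable_rlker alpha M) mh.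
  have := L1_mul lom mc (fun z => conv_bounded z (L1_rlker M a0) mh hb).
  apply: eq_integrable => [|z _]; first exact: measurableT.
  exact: (congr1 (fun t => (om z * t)%:E) (esym (E z))).
by apply: L1Zl; exact: (L1_reflect b lgh).
Qed.

End extension_bound.

(** * The extension by zero *)

Section extension.
Context {R : realType} (a b alpha p : R).
Hypotheses (ab : a < b) (a0 : 0 < alpha) (a1 : alpha < 1) (p1 : 1 < p) (ap : 1 < alpha * p).
Notation mu := (@lebesgue_measure R).
Notation RR := (measurableTypeR R * measurableTypeR R)%type.
Local Notation O := (`]a, b[%classic).
Local Notation J := (rlJ a b alpha).
Local Notation M := (2 * (b - a)).
Local Notation G := ((Gamma (1 - alpha))^-1).
Local Notation K2 := (rlker2 alpha).
Local Notation b' := (b + (b - a)).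
Local Notation O' := (`]a, (b + (b - a))[%classic).
Local Notation M' := (2 * (b + (b - a) - a)).
Local Notation k' := (rlker (1 - alpha) (2 * (b + (b - a) - a))).
Implicit Types (u v w f g : R -> R).

Let p0 : 0 < p. Proof. exact: lt_trans p1. Qed.
Let ba : 0 < b - a. Proof. by rewrite subr_gt0. Qed.
Let bb' : b < b'. Proof. by rewrite ltrDl. Qed.
Let ab' : a < b'. Proof. exact: lt_trans bb'. Qed.
Let a1' : 0 < 1 - alpha. Proof. by rewrite subr_gt0. Qed.
Let G0 : 0 < G. Proof. by rewrite invr_gt0 Gamma_gt0// gtrBl. Qed.
Let baM' : b' - a < M'. Proof. by rewrite ltr_pMl ?ltr1n// subr_gt0. Qed.

Lemma L1_EFin f : L1 f -> (\int[mu]_x (f x)%:E = (\int[mu]_x f x)%:E)%E.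
Proof. by move=> lf; rewrite /Rintegral fineK//; exact: (integrable_fin_num measurableT lf). Qed.

Lemma rlker_trunc (s M1 M2 t : R) : t < M1 -> t < M2 -> rlker s M1 t = rlker s M2 t.
Proof. by rewrite /rlker => -> ->. Qed.

Lemma conv_trunc f (s M1 M2 x : R) : (forall y, y <= a -> f y = 0) ->
  x - a <= M1 -> x - a <= M2 -> conv f (rlker s M1) x = conv f (rlker s M2) x.
Proof.
move=> f0 x1 x2; apply: eq_Rintegral => y _; have [ya|ay] := leP y a; first by rewrite f0// !mul0r.
by congr (_ * _); apply: rlker_trunc; [apply: lt_le_trans x1|apply: lt_le_trans x2]; rewrite ltrD2l ltrN2.
Qed.

Lemma patch_le0 f y : y <= a -> (f \_ O) y = 0.
Proof. by move=> ya; rewrite patchE memNset//= in_itv/= ltNge ya. Qed.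

Lemma patch_ge0 f y : b <= y -> (f \_ O) y = 0.
Proof. by move=> yb; rewrite patchE memNset//= in_itv/= [y < b]ltNge yb andbF. Qed.

Lemma patch_in f y : a < y -> y < b -> (f \_ O) y = f y.
Proof. by move=> ay yb; rewrite patchE mem_set//= in_itv/= ay. Qed.

Lemma ae_neq (c : R) : {ae mu, forall x, x <> c}.
Proof.
exists [set c]; split; [exact: measurable_set1|exact: lebesgue_measure_set1|].
by move=> x /= /contrapT ->.
Qed.

Lemma rlJ_patch_bounded v : Lp p (v \_ O) -> exists2 B, 0 <= B & forall y, `|(J v \_ O) y| <= B.
Proof.
move=> lv; have [l h] := rlJ_young a0 a1 p1 ap ltr01 lv 0; exists (rlconst alpha * ((1^-1) `^ p * Np p (v \_ O) +
     1 `^ (p / (p - 1)) * \int[mu]_t (`|rlker alpha M t| `^ (p / (p - 1))))).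
  exact: le_trans (normr_ge0 _) h.
move=> y; rewrite patchE; case: ifP => _; first by have [_] := rlJ_young a0 a1 p1 ap ltr01 lv y.
by rewrite normr0 (le_trans (normr_ge0 _) h).
Qed.

Lemma measurable_rlJ_patch v : Lp p (v \_ O) -> measurable_fun setT (J v \_ O).
Proof.
by move=> lv; apply: L1_measurable; apply: L1_restrict_oo; apply: (L1_rlJ a0); exact: (Lp_L1 p1).
Qed.

(** Since [J v] vanishes up to [a] and at [b], the extension by zero is [J v] composed with the
    minimum with [b]. *)
Lemma rlJ_patch_continuous v : Lp p (v \_ O) -> J v b = 0 -> continuous (J v \_ O).
Proof.
move=> lv Jb; have cJ := rlJ_continuous ab a0 a1 p1 ap lv.
have -> : J v \_ O = J v \o ((id : R -> R^o) \min (fun=> b)).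
  apply/funext => y /=; have [yb|by'] := ltP y b; last by rewrite patch_ge0.
  have [ya|ay] := leP y a; last by rewrite patch_in.
  rewrite (patch_le0 (J v) ya); apply/esym; exact: rlJ_le0.
move=> x; apply: continuous_comp; last exact: cJ.
by apply: continuous_min; [exact: cvg_id|exact: cvg_cst].
Qed.

(* Beyond [b] the Riemann-Liouville derivative of [J v], truncated at [b], has
   no jump term and is given by the differentiated kernel. *)
Definition rl_ext v (x : R) : R :=
  if b < x then - (alpha * G * conv (J v \_ O) K2 x) else (v \_ O) x.

Lemma rl_ext_lt v y : y <= b -> rl_ext v y = (v \_ O) y.
Proof. by move=> yb; rewrite /rl_ext ltNge yb. Qed.

Lemma rl_ext_patch_lt v y : y <= b -> (rl_ext v \_ O') y = (v \_ O) y.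
Proof.
move=> yb; rewrite patchE; case: ifPn => [_|]; first exact: rl_ext_lt.
rewrite notin_setE/= in_itv/= (le_lt_trans yb bb') andbT => /negP; rewrite -leNgt => ya.
by rewrite patch_le0.
Qed.

Lemma measurable_conv_rlker2 v : Lp p (v \_ O) -> measurable_fun setT (conv (J v \_ O) K2).
Proof.
move=> lv; apply: measurable_conv; first exact: measurable_rlJ_patch.
exact: measurable_rlker2.
Qed.

Lemma rl_ext_patch v : rl_ext v \_ O' =
  fun x => (v \_ O) x + ((fun x => - (alpha * G) * conv (J v \_ O) K2 x) \_ `]b, b'[) x.
Proof.
apply/funext => x; have [xb|bx] := leP x b.
  by rewrite rl_ext_patch_lt// [X in _ + X]patchE memNset ?addr0//= in_itv/= ltNge xb.
rewrite (patch_ge0 _ (ltW bx)) add0r !patchE !mem_setE !in_itv/= bx (lt_trans ab bx)/=.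
by case: ifP => // _; rewrite /rl_ext bx mulNr.
Qed.

(** Up to a constant factor, [conv_rlker2_bound] reduces the part beyond [b] to the Hilbert integral
    of $s\mapsto w(b-s)$ at $r=x-b$. *)
Lemma Lp_rl_ext v w : Lp p (v \_ O) -> Lp p (w \_ O) -> refl_rep a b alpha v w ->
  Lp p (rl_ext v \_ O').
Proof.
move=> lv lw hr; rewrite rl_ext_patch; apply: LpD => //.
have N1 : (-1 : R) != 0 by rewrite oppr_eq0 oner_neq0.
pose g (s : R) := (w \_ O) (b - s).
have lg : L1 g by apply: L1_reflect; exact: (Lp_L1 p1).
have lpg : Lp p g by exact: Lp_reflect.
have [Q lQ hQ] := hilbert_L1 p1 lg lpg.
have mc : measurable_fun setT ((fun x => - (alpha * G) * conv (J v \_ O) K2 x) \_ `]b, b'[).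
  apply/(measurable_restrictT _ (measurable_itv _)); apply: measurable_funTS.
  by apply: measurable_funM => //; exact: measurable_conv_rlker2.
split=> //.
pose C := alpha * G * (rlconst alpha / alpha).
have C0 : 0 <= C.
  apply: mulr_ge0; first by apply: mulr_ge0; exact: ltW.
  by apply: divr_ge0; [apply/ltW; exact: rlconst_gt0|exact: ltW].
have lQ' : L1 (fun x => C `^ p * `|Q (x - b)|).
  apply: L1Zl; apply: L1_abs; have := L1_affine (- b) (oner_neq0 R) lQ.
  by apply: eq_integrable => // x _ /=; rewrite mul1r.
apply: (L1_le (measurable_powR_abs p mc) _ lQ') => x.
rewrite ger0_norm ?powR_ge0// patchE; case: ifPn => [|_]; last first.
  by rewrite normr0 powR0 ?gt_eqF//; apply: mulr_ge0; [exact: powR_ge0|exact: normr_ge0].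
rewrite inE/= in_itv/= => /andP[bx _].
have xb0 : 0 < x - b by rewrite subr_gt0.
have I0 : 0 <= \int[mu]_s (`|g s| * hilbk (x - b) s).
  apply: Rintegral_ge0 => s _; apply: mulr_ge0; first exact: normr_ge0.
  rewrite /hilbk; case: ifP => // s0; rewrite invr_ge0; apply: addr_ge0; exact: ltW.
apply: le_trans (_ : (C * \int[mu]_s (`|g s| * hilbk (x - b) s)) `^ p <= _); last first.
  rewrite powRM//; apply: ler_wpM2l; first exact: powR_ge0.
  exact: le_trans (hQ _ xb0) (ler_norm _).
apply: ge0_ler_powR; [exact: ltW|by rewrite nnegrE|rewrite nnegrE; exact: mulr_ge0|].
have aG0 : 0 <= alpha * G by apply: mulr_ge0; exact: ltW.
rewrite normrM normrN (ger0_norm aG0) /C -[leRHS]mulrA; apply: ler_wpM2l => //.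
exact: (conv_rlker2_bound ab a0 a1 p1 ap lv lw hr bx).
Qed.

Lemma is_derive_powR_shift (q y t : R) : y < t ->
  is_derive t 1 (fun t : R => (t - y) `^ q) (q * (t - y) `^ (q - 1)).
Proof.
move=> yt; have da : is_derive t 1 (fun t : R => t - y) 1.
  by have := is_derive_affine 1 (- y) t; congr (is_derive _ _ _ _); apply/funext => s; rewrite mul1r.
have ty0 : 0 < t - y by rewrite subr_gt0.
have := @is_derive1_comp R (fun y : R => y `^ q) (fun t => t - y) t _ _ (is_derive1_powR q ty0) da.
by rewrite mulr1.
Qed.

Lemma rlker2_int (x y : R) : y < b -> b < x ->
  \int[mu]_(t in `]b, x[) K2 (t - y) = alpha^-1 * ((b - y) `^ (- alpha) - (x - y) `^ (- alpha)).
Proof.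
move=> yb bx.
pose e (t : R) := - alpha^-1 * (t - y) `^ (- alpha).
pose g (t : R) := (t - y) `^ (- 1 - alpha).
have -> : \int[mu]_(t in `]b, x[) K2 (t - y) = \int[mu]_(t in `]b, x[) g t.
  apply: eq_Rintegral => t; rewrite inE/= in_itv/= => /andP[bt _].
  by rewrite /rlker2 subr_gt0 (lt_trans yb bt).
have D1 t : y < t -> is_derive t 1 e (g t).
  move=> yt; have D := is_deriveZ (- alpha^-1) (is_derive_powR_shift (- alpha) yt).
  refine (is_derive_eq D _); rewrite /GRing.scale/= /g [- 1 - alpha]addrC.
  by rewrite mulrA mulrNN mulVf ?mul1r// gt_eqF.
have D2 t : y < t -> {for t, continuous g}.
  move=> yt; apply/differentiable_continuous/derivable1_diffP.
  by have [] := is_derive_powR_shift (- 1 - alpha) yt.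
have -> : \int[mu]_(t in `]b, x[) g t = e x - e b := C1_FTC yb bx D1 D2.
by rewrite /e; ring.
Qed.

(** Fubini: integrating the differentiated kernel over []b, x[] gives the difference of the kernels
    $(b-y)^{-\alpha}$ and $(x-y)^{-\alpha}$, up to $1/\alpha$. *)
Lemma rl_ext_increment v x : Lp p (v \_ O) -> b < x -> x < b' ->
  G * conv (J v \_ O) k' x - G * conv (J v \_ O) k' b = \int[mu]_t (rl_ext v \_ `]b, x[) t.
Proof.
move=> lv bx xb'; set ut := J v \_ O.
have mu' : measurable_fun setT ut := measurable_rlJ_patch lv.
have [B B0 hB] := rlJ_patch_bounded lv.
pose I (t : R) : R := \1_(`]b, x[%classic) t.
have mI : measurable_fun setT I by exact: measurable_indic.
have I01 t : 0 <= I t <= 1 by rewrite /I indicE; case: (_ \in _); rewrite ?lexx ?ler01.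
pose F (z : RR) := ut z.2 * (K2 (z.1 - z.2) * I z.1).
have mF : measurable_fun setT F.
  apply: measurable_funM; first exact: (measurableT_comp mu').
  apply: measurable_funM; last exact: (measurableT_comp mI).
  by apply: (measurableT_comp (measurable_rlker2 alpha)); exact: measurable_funB.
have lkr z : L1 (fun y => k' (z - y)) by apply: L1_reflect; exact: L1_rlker.
have luk z : L1 (fun y => ut y * k' (z - y)).
  have := L1_mul (lkr z) mu' hB; apply: eq_integrable => [|y _]; first exact: measurableT.
  by rewrite /= mulrC.
have lin y : y < b -> L1 (fun t => K2 (t - y) * I t) /\
    \int[mu]_t (K2 (t - y) * I t) = alpha^-1 * ((b - y) `^ (- alpha) - (x - y) `^ (- alpha)).
  move=> yb; have Et t : K2 (t - y) * I t = ((fun t => K2 (t - y)) \_ `]b, x[) t.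
    by rewrite patchE /I indicE; case: (t \in _); rewrite ?mulr1 ?mulr0.
  have E : (fun t => K2 (t - y) * I t) = (fun t => K2 (t - y)) \_ `]b, x[ by exact/funext.
  split; last by rewrite E -Rintegral_mkcond rlker2_int.
  apply: (@L1_bounded _ _ b x ((b - y) `^ (- 1 - alpha))).
  - rewrite E; apply/(measurable_restrictT _ (measurable_itv _)); apply: measurable_funTS.
    by apply: (measurableT_comp (measurable_rlker2 alpha)); exact: measurable_funB.
  - move=> t; rewrite Et patchE; case: ifPn => [|_]; last by rewrite normr0 powR_ge0.
    rewrite inE/= in_itv/= => /andP[bt _]; rewrite ger0_norm ?rlker2_ge0//.
    by apply: (rlker2_le a0); [rewrite subr_gt0|rewrite lerD2r ltW].
  - move=> t h; rewrite Et patchE memNset//= in_itv/= => /andP[h1 h2].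
    by apply: h; rewrite !ltW.
have kE y z : a < y -> y < b -> b <= z -> z < b' -> (z - y) `^ (- alpha) = k' (z - y).
  move=> ay yb bz zb'; rewrite rlkerE.
  - by congr (_ `^ _); ring.
  - by rewrite subr_gt0 (lt_le_trans yb).
  - by apply: lt_trans baM'; apply: ltr_leB => //; exact: ltW.
(* The integral over [t] of the absolute value is at most $(b-y)^{-\alpha}/\alpha$ times $|u(y)|$.
   This is integrable, so the singularity at $t=y=b$ is harmless. *)
pose g y := `|ut y * k' (b - y)| * alpha^-1.
have lg : L1 g.
  have := L1Zl (alpha^-1) (L1_abs (luk b)); apply: eq_integrable => [|y _]; first exact: measurableT.
  by rewrite /= mulrC.
have inner y : \int[mu]_t F (t, y) = ut y * (alpha^-1 * (k' (b - y) - k' (x - y))).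
  have [yO|yO] := boolP (y \in O); last first.
    rewrite /F/= /ut patchE (negbTE yO) mul0r (_ : (fun t => _) = cst 0) ?Rintegral_cst ?mul0r//.
    by apply/funext => t; rewrite mul0r.
  have /andP[ay yb] : a < y < b by move: yO; rewrite inE/= in_itv.
  have [l h] := lin y yb; rewrite /F/= RintegralZl// h !kE//; exact: ltW.
have hF y : (\int[mu]_t `|F (t, y)|%:E <= (g y)%:E)%E.
  have [yO|yO] := boolP (y \in O); last first.
    rewrite /F/= /ut /g patchE (negbTE yO) integral0_eq ?lee_fin.
      by apply: mulr_ge0 => //; rewrite invr_ge0 ltW.
    by move=> t _; rewrite mul0r normr0.
  have /andP[ay yb] : a < y < b by move: yO; rewrite inE/= in_itv.
  have [l h] := lin y yb.
  have E : (fun t => `|F (t, y)|) = (fun t => `|ut y| * (K2 (t - y) * I t)).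
    apply/funext => t; rewrite /F/= normrM; congr (_ * _); apply: ger0_norm.
    by apply: mulr_ge0; [exact: rlker2_ge0|have /andP[] := I01 t].
  have lF : L1 (fun t => `|F (t, y)|) by rewrite E; exact: L1Zl.
  rewrite (L1_EFin lF) lee_fin E RintegralZl// h !kE//; last exact: ltW.
  rewrite /g normrM (ger0_norm (rlker_ge0 _ _ _)) -mulrA; apply: ler_wpM2l; first exact: normr_ge0.
  rewrite mulrC; apply: ler_wpM2r; first by rewrite invr_ge0 ltW.
  by rewrite gerBl rlker_ge0.
have iF := integral2_of_bound mF lg hF.
have E1 t : (rl_ext v \_ `]b, x[) t = - (alpha * G) * \int[mu]_y F (t, y).
  have -> : \int[mu]_y F (t, y) = I t * conv ut K2 t.
    have [I1|I0] : I t = 1 \/ I t = 0 by rewrite /I indicE; case: (t \in _); [left|right].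
      by rewrite I1 mul1r; apply: eq_Rintegral => y _; rewrite /F/= I1 mulr1.
    rewrite I0 mul0r (_ : (fun y => F (t, y)) = cst 0) ?Rintegral_cst ?mul0r//.
    by apply/funext => y; rewrite /F/= I0 !mulr0.
  rewrite patchE /I indicE; case: ifPn => [|_]; last by rewrite mul0r mulr0.
  by rewrite inE/= in_itv/= => /andP[bt _]; rewrite mul1r /rl_ext bt mulNr.
have -> : \int[mu]_t (rl_ext v \_ `]b, x[) t = \int[mu]_t (- (alpha * G) * \int[mu]_y F (t, y)).
  by apply: eq_Rintegral => t _; exact: E1.
rewrite RintegralZl//; last exact: (L1_fubini iF).
rewrite (Rfubini iF).
have -> : \int[mu]_y \int[mu]_t F (t, y) = \int[mu]_y (alpha^-1 * (ut y * k' (b - y) - ut y * k' (x - y))).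
  by apply: eq_Rintegral => y _; rewrite inner mulrCA mulrBr.
rewrite RintegralZl//; last by apply: L1B; exact: luk.
rewrite RintegralB//; try exact: luk.
rewrite /conv; move: (Rintegral _ _ _) (Rintegral _ _ _) => X Y.
have : alpha != 0 by rewrite gt_eqF.
have : Gamma (1 - alpha) != 0 by rewrite gt_eqF// Gamma_gt0// gtrBl.
by move: (Gamma _) => r rn an; field; rewrite an.
Qed.

Lemma conv_rlJ_patch_ae v : Lp p (v \_ O) -> {ae mu, forall x, a < x < b ->
  G * conv (J v \_ O) k' x = conv (v \_ O) (rlker 1 M') x}.
Proof.
move=> lv; apply: aeS (conv_rep_ae ab a0 a1 0 (Lp_L1 p1 lv)) => x h xab.
have := h xab; rewrite mulr0 mul0r add0r; have /andP[ax xb] := xab.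
have xM : x - a <= M by apply: le_trans (_ : b - a <= _); [rewrite lerD2r ltW|rewrite ler_peMl ?ler1n// ltW].
have xM' : x - a <= M'.
  by apply: le_trans (ltW baM'); rewrite lerD2r ltW// (lt_trans xb).
rewrite (conv_trunc 1 (patch_le0 v) xM' xM) => <-; congr (_ * _).
rewrite (conv_trunc _ (patch_le0 (J v)) xM' xM).
apply: (@eq_conv_lt _ _ _ _ b); [by move=> t; exact: rlker_le0| |exact: ltW].
move=> y yb; rewrite mul0r add0r; have [ya|ay] := leP y a; last by rewrite patch_in.
by rewrite patch_le0// rlJ_le0.
Qed.

Lemma rlker1_le1 (m t : R) : `|rlker 1 m t| <= 1.
Proof.
by rewrite /rlker; case: ifP => _; rewrite ?normr0// subrr powRr0 normr1.
Qed.

Lemma conv_seq_cvg f g (B : R) (xs : nat -> R) (x : R) : L1 g -> continuous f ->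
  (forall y, `|f y| <= B) -> xs n @[n --> \oo] --> x ->
  conv g f (xs n) @[n --> \oo] --> conv g f x.
Proof.
move=> lg cf fB cx; have mf : measurable_fun setT f by exact: continuous_measurable_fun.
have mg := L1_measurable lg.
have mux z : measurable_fun setT (fun y : R => g y * f (z - y)).
  apply: measurable_funM; first exact: mg.
  by apply: (measurableT_comp mf); exact: measurable_funB.
apply: (@Rdominated_cvg _ _ _ (fun y => B * `|g y|)).
- by move=> n; exact: mux.
- exact: mux.
- apply: aeW => y; apply: cvgMl_tmp; apply: (cvg_comp (fun n => xs n - y)); last exact: cf.
  by apply: cvgB; [exact: cx|exact: cvg_cst].
- by apply: L1Zl; exact: L1_abs.
- by move=> n y; rewrite normrM mulrC; apply: ler_wpM2r.
Qed.

(** The Abel identity at the single point [b], where the almost everywhere version says nothing.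
    Both sides are continuous from the left, the first because [J v b = 0] makes the extension by
    zero continuous. *)
Lemma conv_rlJ_patch_end v : Lp p (v \_ O) -> J v b = 0 ->
  G * conv (J v \_ O) k' b = \int[mu]_y (v \_ O) y.
Proof.
move=> lv Jb; have cu := rlJ_patch_continuous lv Jb.
have mu' := measurable_rlJ_patch lv; have [B B0 hB] := rlJ_patch_bounded lv.
have lv1 := Lp_L1 p1 lv; have mv := L1_measurable lv1.
have mk := measurable_rlker (1 - alpha) M'; have lk := L1_rlker M' a1'.
(* Points increasingly close to [b] taken from the set of full measure where the identity holds. *)
have [xs hxs] : exists xs : nat -> R, forall n, b - (b - a) / n.+1%:R < xs n < b /\
    G * conv (J v \_ O) k' (xs n) = conv (v \_ O) (rlker 1 M') (xs n).
  suff h (n : nat) : exists x, b - (b - a) / n.+1%:R < x < b /\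
      G * conv (J v \_ O) k' x = conv (v \_ O) (rlker 1 M') x.
    by exists (fun n => projT1 (cid (h n))) => n; exact: (projT2 (cid (h n))).
  have d0 : 0 < (b - a) / n.+1%:R by rewrite divr_gt0.
  have bd : b - (b - a) / n.+1%:R < b by rewrite ltrBlDr ltrDl.
  have [x [xb h]] := ae_exists_in bd (conv_rlJ_patch_ae lv); exists x; split=> //; apply: h.
  have /andP[bx ->] := xb; rewrite andbT; apply: le_lt_trans bx.
  by rewrite lerBrDr -lerBrDl ler_pdivrMr ?ltr0n// ler_peMr ?ler1n// ltW.
have xsb n : xs n < b by have [/andP[]] := hxs n.
have cx : xs n @[n --> \oo] --> b.
  apply: (@squeeze_cvgr _ _ _ _ (fun n => b - (b - a) / n.+1%:R) (fun=> b)).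
  - by apply: nearW => n; have [/andP[/ltW -> /ltW ->]] := hxs n.
  - rewrite -[X in _ --> X]subr0; apply: cvgB; first exact: cvg_cst.
    rewrite -(mulr0 (b - a)); apply: cvgMl_tmp; exact: cvg_harmonic.
  - exact: cvg_cst.
have c1 : G * conv (J v \_ O) k' (xs n) @[n --> \oo] --> G * conv (J v \_ O) k' b.
  apply: cvgMl_tmp; rewrite (convC _ mu' mk).
  rewrite (_ : (fun n => _) = fun n => conv k' (J v \_ O) (xs n)); last first.
    by apply/funext => n; rewrite convC.
  exact: (conv_seq_cvg lk cu hB cx).
have c2 : conv (v \_ O) (rlker 1 M') (xs n) @[n --> \oo] --> \int[mu]_y (v \_ O) y.
  apply: (@Rdominated_cvg _ _ _ (fun y => `|(v \_ O) y|)) => //.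
  - move=> n; apply: measurable_funM => //.
    by apply: (measurableT_comp (measurable_rlker _ _)); exact: measurable_funB.
  - apply: aeW => y; have [ya|ay] := leP y a.
      by rewrite (patch_le0 v ya); under eq_fun do rewrite mul0r; exact: cvg_cst.
    have [yb|by'] := ltP y b; last first.
      by rewrite (patch_ge0 v by'); under eq_fun do rewrite mul0r; exact: cvg_cst.
    rewrite -[X in _ --> X]mulr1; apply: cvgMl_tmp; apply: cvg_near_cst.
    have : \forall n \near \oo, y < xs n by apply: (cvgr_gt b cx).
    apply: filterS => n yx; rewrite rlkerE ?subrr ?powRr0// ?subr_gt0//.
    apply: lt_trans baM'; apply: ltr_leB; last exact: ltW.
    exact: lt_trans bb'.
  - exact: L1_abs.
  - by move=> n y; rewrite normrM ler_piMr// rlker1_le1.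
rewrite (_ : (fun n => conv (v \_ O) (rlker 1 M') (xs n)) =
  fun n => G * conv (J v \_ O) k' (xs n)) in c2; last first.
  by apply/funext => n; have [_ ->] := hxs n.
by rewrite -(cvg_lim (@Rhausdorff R) c1) -(cvg_lim (@Rhausdorff R) c2).
Qed.

(** Before [b] the extension is not seen. Beyond [b], the value at [b] from [conv_rlJ_patch_end] and
    the increment from [rl_ext_increment] add up to the primitive of [rl_ext v]. *)
Lemma conv_rl_ext_ae v w : Lp p (v \_ O) -> Lp p (w \_ O) -> refl_rep a b alpha v w ->
  J v b = 0 -> {ae mu, forall x, a < x < b' ->
    G * conv (J v \_ O) k' x = conv (rl_ext v \_ O') (rlker 1 M') x}.
Proof.
move=> lv lw hr Jb; have le := Lp_L1 p1 (Lp_rl_ext lv lw hr).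
apply: aeS2 (conv_rlJ_patch_ae lv) (ae_neq b) => x h /eqP xnb /andP[ax xb'].
move: xnb; rewrite neq_lt => /orP[xb|bx].
  rewrite h ?ax//; apply: (@eq_conv_lt _ _ _ _ b); [by move=> t; exact: rlker_le0| |exact: ltW].
  by move=> y yb; rewrite rl_ext_patch_lt// ltW.
have E : (rl_ext v \_ O') \_ `]b, x[ = rl_ext v \_ `]b, x[.
  apply/funext => y; rewrite !patchE; case: ifPn => // ybx; rewrite mem_set//=.
  by move: ybx; rewrite inE/= !in_itv/= => /andP[h1 h2]; rewrite (lt_trans ab h1) (lt_trans h2 xb').
have lx : L1 (rl_ext v \_ `]b, x[) by rewrite -E; exact: L1_patch.
have -> : G * conv (J v \_ O) k' x = \int[mu]_y ((v \_ O) y + (rl_ext v \_ `]b, x[) y).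
  rewrite RintegralD//; last exact: (Lp_L1 p1).
  by rewrite -rl_ext_increment// -conv_rlJ_patch_end// [RHS]addrC subrK.
rewrite conv_rlker1 [RHS]Rintegral_mkcond; apply: eq_Rintegral => y _; rewrite [RHS]patchE mem_setE in_itv/=.
have xMa : x - M' < a by rewrite ltrBlDl -ltrBlDr; apply: lt_trans baM'; rewrite ltrD2r.
have [yb|by'] := leP y b.
  rewrite rl_ext_patch_lt// [X in _ + X]patchE memNset ?addr0//; last by rewrite /= in_itv/= ltNge yb.
  rewrite (le_lt_trans yb bx) andbT; case: ifPn => //; rewrite -leNgt => yx.
  by rewrite patch_le0// (le_trans yx)// ltW.
rewrite (patch_ge0 _ (ltW by')) add0r patchE mem_setE in_itv/= by'/=.
rewrite (lt_trans xMa (lt_trans ab by'))/=; case: ifPn => // yx.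
by rewrite patchE mem_set//= in_itv/= (lt_trans ab by') (lt_trans yx xb').
Qed.

(** Both functions have the same fractional integral of order $1-\alpha$ on the longer interval, so
    [abel_inj] applies there. *)
Lemma rl_ext_rep v w : Lp p (v \_ O) -> Lp p (w \_ O) -> refl_rep a b alpha v w ->
  J v b = 0 -> {ae mu, forall x, a < x < b' -> (J v \_ O) x = rlJ a b' alpha (rl_ext v) x}.
Proof.
move=> lv lw hr Jb; have le := Lp_L1 p1 (Lp_rl_ext lv lw hr).
have lu : L1 (J v \_ O) by apply: L1_restrict_oo; apply: (L1_rlJ a0); exact: (Lp_L1 p1).
have lJ : L1 (rlJ a b' alpha (rl_ext v)) := L1_rlJ a0 le.
have lk := L1_rlker M' a1'.
have fa y : y <= a -> (J v \_ O) y - rlJ a b' alpha (rl_ext v) y = 0.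
  by move=> ya; rewrite patch_le0// rlJ_le0// subrr.
have h0 : {ae mu, forall x, a < x < b' ->
    conv (fun y => (J v \_ O) y - rlJ a b' alpha (rl_ext v) y) k' x = 0}.
  apply: (aeS2 _ (aeS2 (fun x p q => conj p q) (conv_ae_L1 lu lk) (conv_ae_L1 lJ lk))
    (aeS2 (fun x p q => conj p q) (conv_rl_ext_ae lv lw hr Jb) (conv_rep_ae ab' a0 a1 0 le))).
  move=> x [l1 l2] [h1 h2] xab; have := h2 xab; rewrite mulr0 mul0r add0r -h1// => h3.
  rewrite /conv; under eq_Rintegral do rewrite mulrBl.
  rewrite RintegralB//; apply/eqP; rewrite subr_eq0; apply/eqP.
  apply: (mulfI (lt0r_neq0 G0)); rewrite -[LHS]h3; congr (_ * _).
  by apply: eq_Rintegral => y _; rewrite mul0r add0r.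
apply: aeS (abel_inj a0 a1 ab' baM' (L1B lu lJ) fa h0) => x h xab.
by apply/eqP; rewrite -subr_eq0; apply/eqP; exact: h.
Qed.

End extension.

(** * Mollification of the extended potential *)

Section mollified_extension.
Context {R : realType} (a b alpha p : R).
Hypotheses (ab : a < b) (a0 : 0 < alpha) (a1 : alpha < 1) (p1 : 1 < p) (ap : 1 < alpha * p).
Notation mu := (@lebesgue_measure R).
Local Notation O := (`]a, b[%classic).
Local Notation J := (rlJ a b alpha).
Local Notation M := (2 * (b - a)).
Local Notation b' := (b + (b - a)).
Local Notation O' := (`]a, (b + (b - a))[%classic).
Local Notation M' := (2 * (b + (b - a) - a)).
Local Notation mid := ((a + b) / 2).
Local Notation ext := (rl_ext a b alpha).
Implicit Types (u v w f g : R -> R).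

Let ba : 0 < b - a. Proof. by rewrite subr_gt0. Qed.

Let lin1 (i : R) : 0 < i -> mid - (b - a + 4 * i) / 2 < a - i. Proof. by move=> h; lra. Qed.
Let lin2 (i y z : R) : 4 * i <= b - a -> 0 < i -> b' <= z ->
  y < mid + (b - a + 4 * i) / 2 -> y - z < - i.
Proof. by move=> *; lra. Qed.

Let lin3 (s x : R) : a < x - s -> x < b -> s < b - a. Proof. by move=> *; lra. Qed.
Let lin4 (s x : R) : x < b -> 0 < s -> x - s < b. Proof. by move=> *; lra. Qed.
Let lin5 (s : R) : s < b - a -> s < M /\ 2 * s < M'.
Proof. by move=> *; have := ba; split; lra. Qed.

Lemma measurable_moll f (N lam m : R) : 0 < N -> L1 f -> measurable_fun setT (moll N lam m f).
Proof.
move=> N0 lf; have mA := L1_measurable (L1_conv lf (test_L1 (test_molk N0))).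
have -> : moll N lam m f = (fun x => conv f (molk N) (lam * x + (m - lam * m))).
  by apply/funext => z; rewrite mollE.
exact: (measurableT_comp mA (measurable_affine _ _)).
Qed.

Lemma conv_translate f g (y t : R) : measurable_fun setT f -> measurable_fun setT g ->
  \int[mu]_z (f (z - t) * g (y - z)) = conv f g (y - t).
Proof.
move=> mf mg; rewrite /conv -(@Rintegral_shift _ (fun z => f z * g (y - t - z)) t).
  by apply: eq_Rintegral => z _; congr (_ * g _); ring.
apply: measurable_funM; first exact: mf.
by apply: (measurableT_comp mg); exact: measurable_funB.
Qed.

(** Associativity at every point, in contrast to [convA]: the mollifier is bounded, so [conv_swap]
    applies for each fixed [y]. *)
Lemma conv_conv_molk (V : R -> R) (s M0 N y : R) : 0 < s -> 0 < N -> L1 V ->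
  conv (conv V (rlker s M0)) (molk N) y =
  conv (rlker s M0) (conv V (molk N)) y.
Proof.
move=> s0 N0 lV; have lk := L1_rlker M0 s0; have mV := L1_measurable lV.
have mk := measurable_rlker s M0; have tm := test_molk N0.
have [B hB] := test_bounded tm; have mm := test_measurable tm.
have mmy : measurable_fun setT (fun z : R => molk N (y - z)).
  by apply: (measurableT_comp mm); exact: measurable_funB.
rewrite /conv; under eq_Rintegral => z _ do rewrite -/(conv V (rlker s M0) z) (convC _ mV mk).
rewrite (conv_swap lk lV mmy (fun z => hB (y - z))).
by apply: eq_Rintegral => t _; rewrite conv_translate.
Qed.

(* The dilation by [lam] multiplies the Riemann-Liouville potential by
   [lam ^ alpha]; the support of [V], which begins at [a], keeps out of reach
   of the dilated mollifier. *)
Lemma conv_rlker_moll (V : R -> R) (N lam x : R) : 0 < N -> 0 < lam -> lam <= 2 ->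
  (b - a) * lam = b - a + 4 * N^-1 -> L1 V -> (forall y, ~ (a <= y <= b') -> V y = 0) -> x < b ->
  conv (rlker alpha M') (conv V (molk N)) (mid + lam * (x - mid)) =
  conv ((fun y => lam `^ alpha * moll N lam mid V y) \_ O) (rlker alpha M) x.
Proof.
move=> N0 l0 l2 hl lV V0 xb; set y := mid + lam * (x - mid); set A := conv V (molk N).
have tm := test_molk N0; have lA : L1 A := L1_conv lV (test_L1 tm).
have mA := L1_measurable lA; have mk := measurable_rlker alpha M'.
have i0 : 0 < N^-1 by rewrite invr_gt0.
have mm : measurable_fun setT ((fun y => lam `^ alpha * moll N lam mid V y) \_ O).
  apply/(measurable_restrictT _ (measurable_itv _)); apply: measurable_funTS.
  by apply: measurable_funM; [exact: measurable_cst|exact: measurable_moll].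
rewrite [RHS](convC _ mm (measurable_rlker _ _)).
have ln0 : lam != 0 by rewrite gt_eqF.
have mkA : measurable_fun setT (fun t : R => rlker alpha M' t * A (y - t)).
  apply: measurable_funM; first exact: mk.
  by apply: (measurableT_comp mA); exact: measurable_funB.
have h := Rintegral_affine 0 ln0 mkA; rewrite (gtr0_norm l0) in h.
have -> : conv (rlker alpha M') A y = lam * \int[mu]_t (rlker alpha M' (lam * t + 0) * A (y - (lam * t + 0))).
  by rewrite h mulrA divff// mul1r.
have l1 : L1 (fun t => rlker alpha M' (lam * t + 0) * A (y - (lam * t + 0))).
  apply: (@L1_affine _ (fun t => rlker alpha M' t * A (y - t))) => //.
  have [B hB] := test_bounded tm.
  have AB z : `|A z| <= B * \int[mu]_x `|V x| by exact: conv_bounded lV (test_measurable tm) hB.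
  have mAy : measurable_fun setT (fun t : R => A (y - t)).
    by apply: (measurableT_comp mA); exact: measurable_funB.
  exact: (L1_mul (L1_rlker M' a0) mAy (fun t => AB (y - t))).
rewrite -RintegralZl//; apply: eq_Rintegral => s _; rewrite addr0.
have [s0|s0] := leP s 0.
  by rewrite !rlker_le0 ?mul0r ?mulr0// mulr_ge0_le0// ltW.
have AE : A (y - lam * s) = moll N lam mid V (x - s).
  by rewrite /moll /A; congr (conv _ _ _); rewrite /y; ring.
rewrite AE; have [xa|ax] := leP (x - s) a.
  rewrite (patch_le0 _ _ xa) mulr0.
  suff -> : moll N lam mid V (x - s) = 0 by rewrite !mulr0.
  apply: (conv_molk_supp N0 V0) => /andP[h1 _]; move: h1; apply/negP; rewrite -ltNge.
  have h2 : mid + lam * (x - s - mid) <= mid + lam * (a - mid).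
    by rewrite lerD2l; apply: ler_wpM2l; [exact: ltW|rewrite lerD2r].
  apply: (le_lt_trans h2); have -> : mid + lam * (a - mid) = mid - (b - a) * lam / 2 by field.
  by rewrite hl; exact: lin1.
have sba : s < b - a by exact: lin3 ax xb.
have xsb : x - s < b by exact: lin4.
have [sM sM'] := lin5 sba.
rewrite (patch_in _ ax xsb) rlkerE ?mulr_gt0//; last first.
  by apply: (@le_lt_trans _ _ (2 * s)); [apply: ler_wpM2r => //; exact: ltW|exact: sM'].
rewrite (rlkerE _ s0 sM).
rewrite (powRM _ (ltW l0) (ltW s0)).
have -> : lam `^ alpha = lam * lam `^ (alpha - 1).
  by rewrite -{2}(powRr1 (ltW l0)) -powRD ?ln0 ?implybT// addrC subrK.
by ring.
Qed.

(** The extension is replaced by its potential representation under the mollifier, which then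
    commutes with the fractional integral; the dilation is absorbed by [conv_rlker_moll]. *)
Lemma moll_rep v w (N lam x : R) : Lp p (v \_ O) -> Lp p (w \_ O) -> refl_rep a b alpha v w ->
  J v b = 0 -> 0 < N -> 0 < lam -> lam <= 2 -> (b - a) * lam = b - a + 4 * N^-1 ->
  a < x -> x < b ->
  moll N lam mid (J v \_ O) x = J (fun y => lam `^ alpha * moll N lam mid (ext v \_ O') y) x.
Proof.
move=> lv lw hr Jb N0 l0 l2 hl ax xb; set V := ext v \_ O'.
have i0 : 0 < N^-1 by rewrite invr_gt0.
(* [lam <= 2] forces $4/N\le b-a$: the mollifier, centred before $b+2/N$, does not reach
   [b + (b - a)], where the representation ends. *)
have iba : 4 * N^-1 <= b - a.
  have : (b - a) * lam <= (b - a) * 2 by apply: ler_wpM2l => //; exact: ltW.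
  by rewrite hl; lra.
have lV : L1 V := Lp_L1 p1 (Lp_rl_ext ab a0 a1 p1 ap lv lw hr).
have V0 y : ~ (a <= y <= b') -> V y = 0.
  by move=> h; rewrite /V patchE memNset//= in_itv/= => /andP[h1 h2]; apply: h; rewrite !ltW.
rewrite /rlJ -/(conv _ _ _) -(conv_rlker_moll N0 l0 l2 hl lV V0 xb).
rewrite -(conv_conv_molk _ _ a0 N0 lV) /moll; set y := mid + lam * (x - mid).
have tm := test_molk N0; have mm := test_measurable tm.
have lu : L1 (J v \_ O) by apply: L1_restrict_oo; apply: (L1_rlJ a0); exact: (Lp_L1 p1).
have lJ : L1 (rlJ a b' alpha (ext v)) := L1_rlJ a0 lV.
have mmy : measurable_fun setT (fun z : R => molk N (y - z)).
  by apply: (measurableT_comp mm); exact: measurable_funB.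
transitivity (conv (rlJ a b' alpha (ext v)) (molk N) y); last first.
  have [B hB] := test_bounded tm.
  rewrite /conv -RintegralZl//; last first.
    exact: (L1_mul (L1_conv lV (L1_rlker M' a0)) mmy (fun z => hB (y - z))).
  by apply: eq_Rintegral => z _; rewrite mulrA.
apply: ae_eq_Rintegral.
- by apply: measurable_funM; [exact: L1_measurable lu|exact: mmy].
- by apply: measurable_funM; [exact: L1_measurable lJ|exact: mmy].
apply: aeS (rl_ext_rep ab a0 a1 p1 ap lv lw hr Jb) => z h.
have [za|az] := leP z a; first by rewrite patch_le0// rlJ_le0.
have [zb|bz] := ltP z b'; first by rewrite h// az.
have [_ h1 _] := tm; rewrite (h1 (y - z)) ?mulr0//.
have hy : y < mid + lam * (b - mid).
  by rewrite ltrD2l (ltr_pM2l l0) ltrD2r.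
have hE : mid + lam * (b - mid) = mid + (b - a) * lam / 2 by field.
by apply: (lin2 iba i0 bz); move: hy; rewrite hE hl.
Qed.

End mollified_extension.

(** * The two-sided space *)

Section two_sided.
Context {R : realType} (a b alpha p : R).
Hypotheses (ab : a < b) (a0 : 0 < alpha) (a1 : alpha < 1) (p1 : 1 < p) (ap : 1 < alpha * p).
Notation mu := (@lebesgue_measure R).
Local Notation O := (`]a, b[%classic).
Local Notation J := (rlJ a b alpha).
Local Notation O' := (`]a, (b + (b - a))[%classic).
Local Notation mid := ((a + b) / 2).
Local Notation ext := (rl_ext a b alpha).
Local Notation wpair := (weak_pair a b alpha p).
Local Notation refl := (refl_itv a b).
Local Notation mollO n := (moll n.+1%:R (lamn a b n) mid).
Implicit Types (u v w f g : R -> R).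

Let p0 : 0 < p. Proof. exact: lt_trans p1. Qed.
Let ba : 0 < b - a. Proof. by rewrite subr_gt0. Qed.

(* Vanishing of both traces removes the singular term and leaves a potential. *)
Definition minus_rep u v := [/\ Lp p (u \_ O), Lp p (v \_ O),
  {ae mu, forall x, a < x < b -> u x = J v x} & J v b = 0].

Lemma potential_pair u v : Lp p (u \_ O) -> Lp p (v \_ O) ->
  {ae mu, forall x, a < x < b -> u x = J v x} -> wpair Fminus u v.
Proof.
move=> lu lv h; apply/(weak_pair_minusP ab a0 a1 p1); split=> //; exists 0.
by apply: aeS h => x h /h ->; rewrite mul0r add0r.
Qed.

Lemma minus_rep_pair u v : minus_rep u v -> wpair Fminus u v.
Proof. by move=> [lu lv h _]; exact: potential_pair. Qed.

Lemma patch_supp f x : ~ (a <= x <= b) -> (f \_ O) x = 0.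
Proof.
by move=> h; rewrite patchE memNset//= in_itv/= => /andP[h1 h2]; apply: h; rewrite !ltW.
Qed.

Lemma mollO_test n u : L1 (u \_ O) -> exists c d,
  [/\ a < c, d < b & is_test c d (mollO n (u \_ O))].
Proof. by move=> lu; apply: moll_test_in => // x; exact: patch_supp. Qed.

Lemma lamn_cvg : lamn a b n - 1 @[n --> \oo] --> 0.
Proof.
have -> : (fun n => lamn a b n - 1) = (fun n : nat => 4 / (b - a) * n.+1%:R^-1).
  by apply/funext => n; rewrite /lamn addrAC subrr add0r.
by rewrite -(mulr0 (4 / (b - a))); apply: cvgMl_tmp; exact: cvg_harmonic.
Qed.

Lemma powR_sub1_le (l : R) : 1 <= l -> l <= 2 ->
  [/\ 0 <= l `^ alpha, l `^ alpha <= 2 & `|l `^ alpha - 1| <= l - 1].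
Proof.
move=> l1 l2; have l0 : 0 < l by exact: lt_le_trans l1.
have h1 : 1 <= l `^ alpha.
  by have := ge0_ler_powR (ltW a0) (ler01 : 1 \in Num.nneg) (ltW l0 : l \in Num.nneg) l1; rewrite powR1.
have h2 : l `^ alpha <= l.
  by rewrite -{2}(powRr1 (ltW l0)); apply: ler_powR => //; exact: ltW.
split; [exact: powR_ge0|exact: le_trans l2|].
by rewrite ger0_norm ?subr_ge0// lerD2r.
Qed.

(** From $cf-g=c(f-g)+(c-1)g$. The bound is linear in [t] because $|c-1|^p\le|c-1|$ for $|c-1|\le
    1$. *)
Lemma Np_moll_scaled f g (c t : R) : Lp p f -> Lp p g -> 0 <= c -> c <= 2 -> `|c - 1| <= t -> t <= 1 ->
  Np p (fun x => c * f x - g x) <= 2 `^ p * (2 `^ p * Np p (fun x => f x - g x) + t * Np p g).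
Proof.
move=> lf lg c0 c2 ct t1.
have -> : (fun x => c * f x - g x) = (fun x => c * (f x - g x) + (c - 1) * g x).
  by apply/funext => x; ring.
have lfg : Lp p (fun x => f x - g x) by exact: LpB.
apply: (le_trans (NpD p1 (LpZ _ lfg) (LpZ (c - 1) lg))).
apply: ler_wpM2l; first exact: powR_ge0.
rewrite !NpZ//; apply: lerD; (apply: ler_wpM2r; first exact: Np_ge0).
  by rewrite ger0_norm//; apply: ge0_ler_powR; rewrite ?nnegrE ?(ltW p0).
have [c10|c10] := eqVneq (`|c - 1|) 0.
  by rewrite c10 powR0 ?gt_eqF//; apply: le_trans ct; rewrite c10.
apply: (le_trans (powR_le_id p1 _ (le_trans ct t1))) => //.
by rewrite lt0r c10 normr_ge0.
Qed.

(** Stated for all large [n], not for some [n], so that both sides can be treated with the same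
    mollified function. *)
Lemma moll_half u v w : minus_rep u v -> Lp p (w \_ O) -> refl_rep a b alpha v w ->
  forall e, 0 < e -> exists n0, forall n, (n0 <= n)%N -> exists psi,
    wpair Fminus (mollO n (u \_ O)) psi /\ Np p (fun x => (psi \_ O) x - (v \_ O) x) < e.
Proof.
move=> [lu lv uJ Jb] lw hr e e0; set V := ext v \_ O'.
have lV : Lp p V := Lp_rl_ext ab a0 a1 p1 ap lv lw hr.
have lV1 : L1 V := Lp_L1 p1 lV.
have V0 y : ~ (a <= y <= b + (b - a)) -> V y = 0.
  by move=> h; rewrite /V patchE memNset//= in_itv/= => /andP[h1 h2]; apply: h; rewrite !ltW.
have cV := moll_cvg mid p1 lV V0 (lamnB ab) (lamn_ge ab).
pose D (n : nat) := 2 `^ p * (2 `^ p * Np p (fun x => mollO n V x - V x) + (lamn a b n - 1) * Np p V).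
have cD : D n @[n --> \oo] --> 0.
  rewrite -[X in _ --> X](mulr0 (2 `^ p)); apply: cvgMl_tmp; apply: cvg0D.
    by rewrite -[X in _ --> X](mulr0 (2 `^ p)); apply: cvgMl_tmp.
  by rewrite -[X in _ --> X](mul0r (Np p V)); apply: cvgMr_tmp; exact: lamn_cvg.
have h1 : \forall n \near \oo, D n < e by exact: (cvgr_lt 0 cD).
have h2 : \forall n \near \oo, lamn a b n - 1 < 1 by exact: (cvgr_lt 0 lamn_cvg).
have [n0 _ hn0] := filterI h1 h2.
exists n0 => n n0n; have [Dn ln1] := hn0 n n0n.
have N0 : 0 < n.+1%:R :> R by rewrite ltr0n.
have l1 := lamn_ge1 ab n; have l0 := lamn_gt0 ab n.
have l2 : lamn a b n <= 2 by rewrite ltW// -ltrBlDr.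
have hl : (b - a) * lamn a b n = b - a + 4 * n.+1%:R^-1.
  by rewrite /lamn; field; rewrite !gt_eqF.
have lu1 := Lp_L1 p1 lu.
pose psi y := lamn a b n `^ alpha * mollO n V y.
have lmV : Lp p (mollO n V) by have [] := Lp_Np_moll mid p1 N0 l0 lV1 lV.
have lpsi : Lp p psi by exact: LpZ.
exists psi; split.
  apply: potential_pair.
  - have [c [d [ac db t]]] := mollO_test n lu1.
    by rewrite (test_restrict ac db t); exact: test_Lp t.
  - exact: Lp_patch.
  - apply: aeW => x /andP[ax xb].
    rewrite -(moll_rep ab a0 a1 p1 ap lv lw hr Jb N0 l0 l2 hl ax xb) /moll.
    have mm : measurable_fun setT (fun z : R => molk n.+1%:R (mid + lamn a b n * (x - mid) - z)).
      apply: (measurableT_comp (test_measurable (test_molk N0))); exact: measurable_funB.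
    apply: ae_eq_Rintegral.
    + by apply: measurable_funM; [exact: L1_measurable lu1|exact: mm].
    + by apply: measurable_funM; [exact: (measurable_rlJ_patch a0 p1 lv)|exact: mm].
    apply: aeS uJ => z hz; congr (_ * _); rewrite !patchE; case: ifPn => //.
    by rewrite inE/= in_itv/= => /hz.
have [c0 c2 c1] := powR_sub1_le (ltW l1) l2.
apply: le_lt_trans Dn.
apply: le_trans (Np_moll_scaled lmV lV c0 c2 c1 (ltW ln1)).
have -> : (fun x => (psi \_ O) x - (v \_ O) x) = (fun x => psi x - V x) \_ O.
  apply/funext => x; rewrite [RHS]patchE; case: ifPn => [|xO].
    rewrite inE/= in_itv/= => /andP[ax xb].
    by rewrite /V rl_ext_patch_lt ?ltW// (patch_in psi ax xb).
  by rewrite !patchE (negbTE xO) subrr.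
by apply: Np_patch => //; exact: LpB.
Qed.

(** Multiplied by $(x-a)^{1-\alpha}$, the representation tends to [C] at [a], while the
    representative given by the right trace tends to 0; hence [C = 0]. *)
Lemma minus_rep_of_traces u : Wside0 a b Fminus alpha p u -> has_trace a b Fplus u 0 ->
  exists v, minus_rep u v.
Proof.
move=> /(Wside0_minusP ab a0 a1 p1 ap)[v [C [lu lv uU Ub]]] [z zu [cz za]].
have cJ := rlJ_continuous ab a0 a1 p1 ap lv.
suff C0 : C = 0.
  exists v; split=> //; last by move: Ub; rewrite /rl_rep C0 mul0r add0r.
  by apply: aeS uU => x h /h ->; rewrite /rl_rep C0 mul0r add0r.
have [am mb] := itv_mid ab.
have a1' : 0 < 1 - alpha by rewrite subr_gt0.
pose q (x : R) := (x - a) `^ (1 - alpha).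
have cq : q x @[x --> a^'+] --> 0.
  apply/cvgrPdist_lt => e e0; have /cvgrPdist_lt/(_ _ e0) := powR_cvg0 a1'.
  move=> /nbhs_ballP[r /= r0 hr]; apply/nbhs_ballP; exists r => //= x xr ax.
  apply: hr; last by rewrite subr_gt0.
  by move: xr; rewrite /ball/= sub0r opprB.
have cza : z x @[x --> a^'+] --> 0.
  have mab : mid \in `]a, b[ by rewrite in_itv/= am.
  by have /(continuous_within_itvP _ am)[_ + _] := cz _ mab; rewrite za.
have c1 : C + q x * J v x @[x --> a^'+] --> C.
  rewrite -[X in _ --> X]addr0; apply: cvgD; first exact: cvg_cst.
  rewrite -(mul0r (J v a)); apply: cvgM => //.
  by apply: cvg_at_right_filter; exact: cJ.
have c2 : q x * z x @[x --> a^'+] --> 0.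
  by rewrite -(mulr0 0); exact: cvgM.
apply: (ae_eq_lim_right ab _ c1 c2).
apply: (aeS2 _ uU zu) => x h1 h2 xab; have /andP[ax xb] := xab.
have qE : q x * (x - a) `^ (alpha - 1) = 1.
  have x0 : x - a != 0 by rewrite subr_eq0 gt_eqF.
  rewrite /q -powRD ?x0 ?implybT//.
  by have -> : 1 - alpha + (alpha - 1) = 0 by [ring]; rewrite powRr0.
rewrite (h2 _); last by rewrite /= in_itv.
rewrite (h1 xab) /rl_rep; move: (J v x) ((x - a) `^ (alpha - 1)) (q x) qE => j r s sr.
by rewrite mulrDr mulrCA sr mulr1.
Qed.

Lemma Wsym0P u : Wsym0 a b alpha p u <->
  exists v w, minus_rep u v /\ minus_rep (refl u) w.
Proof.
split=> [[[W1 W2] t1 t2]|[v [w [h1 h2]]]].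
  have [v hv] := minus_rep_of_traces (conj W1 t1) t2.
  have /(Wside0_refl ab a0 a1 p1)h2 : Wside0 a b Fplus alpha p u by [].
  have t3 : has_trace a b Fplus (refl u) 0 by apply/has_trace_refl; rewrite refl_itvK.
  by have [w hw] := minus_rep_of_traces h2 t3; exists v, w.
have key f g : minus_rep f g -> Wside0 a b Fminus alpha p f.
  move=> [lf lg h Jb]; apply/(Wside0_minusP ab a0 a1 p1 ap); exists g, 0; split=> //.
    by apply: aeS h => x h /h ->; rewrite /rl_rep mul0r add0r.
  by rewrite /rl_rep mul0r add0r.
have [W1 t1] := key _ _ h1.
have [W2 t2] := (Wside0_refl ab a0 a1 p1 u).2 (key _ _ h2).
by split.
Qed.

Lemma minus_rep_refl u v w : minus_rep u v -> minus_rep (refl u) w ->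
  refl_rep a b alpha v (refl w).
Proof.
move=> [_ _ h1 _] [_ _ h2 _]; rewrite /refl_rep refl_itvK.
apply: (aeS2 _ (ae_reflect (a + b) h1) h2) => x e1 e2 xab; rewrite -e2//; apply/esym/e1.
by have := refl_itv_in a b x; rewrite !in_itv/= => ->.
Qed.

Lemma minus_rep_refl_pair u w : minus_rep (refl u) w -> wpair Fplus u (refl w).
Proof.
move=> h; apply/(weak_pair_refl ab a0 a1 p1); rewrite refl_itvK; exact: minus_rep_pair.
Qed.

Lemma refl_NpB f g : Lp p (f \_ O) -> Lp p (g \_ O) ->
  Np p (fun x => (refl f \_ O) x - (refl g \_ O) x) = Np p (fun x => (f \_ O) x - (g \_ O) x).
Proof.
move=> [mf _] [mg _]; rewrite !refl_itv_patch.
exact: (@Np_reflect R p (fun x => (f \_ O) x - (g \_ O) x) (a + b) (measurable_funB mf mg)).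
Qed.

(** The mollifier is even and the dilation is centred at the midpoint, so both commute with
    reflection. This is what lets one sequence serve both sides. *)
Lemma mollO_refl n u : L1 (u \_ O) -> refl (mollO n (u \_ O)) = mollO n (refl u \_ O).
Proof.
move=> lu; apply/funext => x; rewrite refl_itv_patch {1}/refl_itv /moll /conv.
have N0 : 0 < n.+1%:R :> R by rewrite ltr0n.
set y := mid + _; set y' := mid + lamn a b n * (x - mid).
have yE : y = a + b - y' by rewrite /y /y'; field.
have mm : measurable_fun setT (fun z : R => (u \_ O) z * molk n.+1%:R (y - z)).
  apply: measurable_funM; first exact: L1_measurable lu.
  by apply: (measurableT_comp (test_measurable (test_molk N0))); exact: measurable_funB.
rewrite -(Rintegral_reflect (a + b) mm); apply: eq_Rintegral => z _; congr (_ * _).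
by rewrite -molkN yE; congr molk; ring.
Qed.

Lemma Wsym0_dense u : Wsym0 a b alpha p u -> exists2 phi : nat -> R -> R,
  (forall n, Cc_smooth a b (phi n)) & WsymNorm a b alpha p (phi n \- u) @[n --> \oo] --> 0%E.
Proof.
move=> /Wsym0P[v [w [h1 h2]]].
have [lu lv _ _] := h1; have [lru lw _ _] := h2; have lrw := refl_Lp lw; have lrv := refl_Lp lv.
have hr := minus_rep_refl h1 h2.
have hr' : refl_rep a b alpha w (refl v).
  by apply: (minus_rep_refl h2); rewrite refl_itvK.
have H (k : nat) : exists phi vv, Cc_smooth a b phi /\ exists ww,
    [/\ wpair Fminus phi vv, wpair Fplus phi ww,
      Np p (fun x => (phi \_ O) x - (u \_ O) x) < k.+1%:R^-1,
      Np p (fun x => (vv \_ O) x - (v \_ O) x) < k.+1%:R^-1 &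
      Np p (fun x => (ww \_ O) x - (refl w \_ O) x) < k.+1%:R^-1].
  have k0 : 0 < k.+1%:R^-1 :> R by rewrite invr_gt0.
  have [n1 H1] := moll_half h1 lrw hr k0.
  have [n2 H2] := moll_half h2 lrv hr' k0.
  have cu := moll_cvg mid p1 lu (@patch_supp u) (lamnB ab) (lamn_ge ab).
  have [n3 H3] := (Np_cvg0P _ _).1 cu _ k0.
  (* One index past all three thresholds: those of the two derivatives and that of the function. *)
  pose n := maxn n1 (maxn n2 n3).
  have [vv [pv nv]] := H1 n (leq_maxl _ _).
  have [|ww [pw nw]] := H2 n; first by rewrite /n !leq_max leqnn !orbT.
  have {}H3 := H3 n; rewrite !leq_max leqnn !orbT in H3; have {}H3 := H3 isT.
  have [c [d [ac db t]]] := mollO_test n (Lp_L1 p1 lu).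
  exists (mollO n (u \_ O)), vv; split; first exact: (test_Cc_smooth ac db t).
  exists (refl ww); split; [exact: pv| | |exact: nv|].
  - by apply/(weak_pair_refl ab a0 a1 p1); rewrite refl_itvK mollO_refl//; exact: (Lp_L1 p1).
  - by rewrite (test_restrict ac db t); exact: H3.
  - have [_ lww _] := pw.
    by rewrite (refl_NpB lww lw); exact: nw.
have [phi [vv h]] := choice_pairs H.
exists phi; first by move=> n; have [] := h n.
have [ww hw] : exists ww : nat -> R -> R, forall k,
    [/\ wpair Fminus (phi k) (vv k), wpair Fplus (phi k) (ww k),
      Np p (fun x => (phi k \_ O) x - (u \_ O) x) < k.+1%:R^-1,
      Np p (fun x => (vv k \_ O) x - (v \_ O) x) < k.+1%:R^-1 &
      Np p (fun x => (ww k \_ O) x - (refl w \_ O) x) < k.+1%:R^-1].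
  have e k := (h k).2.
  by exists (fun k => projT1 (cid (e k))) => k; exact: (projT2 (cid (e k))).
have cvgi (f : nat -> R) : (forall n, 0 <= f n) -> (forall n, f n < n.+1%:R^-1) ->
    f n @[n --> \oo] --> 0.
  move=> f0 fn; apply: (squeeze_cvgr _ (cvg_cst (0 : R)) (@cvg_harmonic R)).
  by apply: nearW => n; rewrite f0/= ltW.
apply: (Wsym_pair_cvg ab a0 a1 p1 (v := vv) (w := ww) (v0 := v) (w0 := refl w)).
- by move=> n; have [] := hw n.
- by move=> n; have [] := hw n.
- exact: minus_rep_pair.
- exact: minus_rep_refl_pair.
- by apply: cvgi => n; [exact: Np_ge0|have [] := hw n].
- by apply: cvgi => n; [exact: Np_ge0|have [] := hw n].
- by apply: cvgi => n; [exact: Np_ge0|have [] := hw n].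
Qed.

(** A test function is the potential of its fractional derivative by [small_potential], of which
    only the representation and the boundedness matter here. The value at [b] follows by
    continuity. *)
Lemma test_minus_rep phi : Cc_smooth a b phi -> exists v, minus_rep phi v.
Proof.
move=> /(Cc_smooth_test ab)[c [d [ac db t]]]; set e := phi \_ O in t.
have [de te'] := test_derive t; have [_ ec ed] := t; have [_ gc gd] := te'.
have [L hL] := test_bounded te'.
(* [c] need not lie before [b], since [is_test] does not order its bounds. *)
pose c1 := Num.min c b; have ac1 : a < c1 by rewrite lt_min ac.
pose c0 := (a + c1) / 2; have [ac0 c01] : a < c0 /\ c0 < c1 by rewrite !midf_lt.
have c0c : c0 < c by apply: lt_le_trans c01 _; rewrite ge_min lexx.
have c0b : c0 < b by apply: lt_le_trans c01 _; rewrite ge_min lexx orbT.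
have L0 : 0 <= L := le_trans (normr_ge0 _) (hL 0).
have [mk ek bk] := small_potential ab a0 a1 ac0 c0b (fun x _ => de x)
  (fun x _ => test_continuous te' (x := x))
  (fun x _ xc => ec x (le_lt_trans xc c0c)) (fun x _ xc => gc x (le_lt_trans xc c0c))
  L0 (fun x _ _ => hL x).
set v := rlK _ _ _ _ in mk ek bk.
have lv : Lp p (v \_ O).
  set B := _ * _ in bk; have B0 : 0 <= B := le_trans (normr_ge0 _) (bk a ab).
  have mv : measurable_fun setT (v \_ O).
    by apply/(measurable_restrictT _ (measurable_itv _)); exact: measurable_funTS.
  by have [] := Np_bounded_itv ab p1 mv B0 (fun x _ xb => bk x xb).
have cJ := rlJ_continuous ab a0 a1 p1 ap lv.
exists v; split=> //.
- by rewrite -/e; exact: test_Lp t.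
- apply: aeS ek => x h xab; rewrite -h// /e; have /andP[ax xb] := xab.
  by rewrite patch_in.
- apply/esym; rewrite -(ed b db).
  apply: (ae_eq_lim_left ab ek); apply: cvg_at_left_filter; last exact: cJ.
  exact: (test_continuous t).
Qed.

Lemma Cc_smooth_sub_Wsym0 : Cc_smooth a b `<=` Wsym0 a b alpha p.
Proof.
move=> phi sphi; apply/Wsym0P; have [v hv] := test_minus_rep sphi.
have [w hw] := test_minus_rep (Cc_smooth_refl ab sphi).
by exists v, w.
Qed.

(** The case of zero coefficients in [rl_rep_limit]; the values of the potentials at [b] converge as
    well. *)
Lemma minus_rep_limit (u v : nat -> R -> R) u0 v0 : (forall n, minus_rep (u n) (v n)) ->
  Lp p (u0 \_ O) -> Lp p (v0 \_ O) ->
  Np p (fun x => (u n \_ O) x - (u0 \_ O) x) @[n --> \oo] --> 0 ->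
  Np p (fun x => (v n \_ O) x - (v0 \_ O) x) @[n --> \oo] --> 0 -> minus_rep u0 v0.
Proof.
move=> h lu0 lv0 cu cv.
have lu n : Lp p (u n \_ O) by have [] := h n.
have lv n : Lp p (v n \_ O) by have [] := h n.
have Jb : J v0 b = 0.
  have c : J (v n) b @[n --> \oo] --> J v0 b by apply: (rlJ_cvg a0 a1 p1 ap lv lv0 cv).
  rewrite (_ : (fun n => J (v n) b) = fun=> 0) in c; last by apply/funext => n; have [] := h n.
  by rewrite -(cvg_lim (@Rhausdorff R) c) lim_cst.
have rep n : {ae mu, forall x, a < x < b -> u n x = rl_rep a b alpha 0 (v n) x}.
  by have [_ _ e _] := h n; apply: aeS e => x e /e ->; rewrite /rl_rep mul0r add0r.
have tr n : rl_rep a b alpha 0 (v n) b = 0.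
  by have [_ _ _ e] := h n; rewrite /rl_rep mul0r add0r.
have [C0 [e0]] := rl_rep_limit ab a0 a1 p1 ap lu lv rep tr lu0 lv0 cu cv.
(* The limit potential vanishes at [b], so the zero value of the representation there forces its
   coefficient to vanish too. *)
rewrite {1}/rl_rep Jb addr0 => /eqP; rewrite mulf_eq0 => /orP[/eqP C00|]; last first.
  by rewrite gt_eqF// powR_gt0.
by split=> //; apply: aeS e0 => x e /e ->; rewrite /rl_rep C00 mul0r add0r.
Qed.

Lemma Wsym0_complete (w : nat -> R -> R) : (forall n, Wsym0 a b alpha p (w n)) ->
  (forall e : R, 0 < e -> exists n0 : nat, forall m n : nat, (n0 <= m)%N -> (n0 <= n)%N ->
    (WsymNorm a b alpha p (w m \- w n)%R < e%:E)%E) ->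
  exists2 u, Wsym0 a b alpha p u & WsymNorm a b alpha p (w n \- u) @[n --> \oo] --> 0%E.
Proof.
move=> hw cw; have [v [z h]] := choice_pairs (fun n => (Wsym0P (w n)).1 (hw n)).
have h1 n : minus_rep (w n) (v n) by have [] := h n.
have h2 n : minus_rep (refl (w n)) (z n) by have [] := h n.
have lw n : Lp p (w n \_ O) by have [] := h1 n.
have lv n : Lp p (v n \_ O) by have [] := h1 n.
have lz n : Lp p (z n \_ O) by have [] := h2 n.
have p1n n := minus_rep_pair (h1 n); have p2n n := minus_rep_refl_pair (h2 n).
have cauchy e : 0 < e -> exists n0, forall m n, (n0 <= m)%N -> (n0 <= n)%N ->
    [/\ Np p (fun x => (w m \_ O) x - (w n \_ O) x) < e,
      Np p (fun x => (v m \_ O) x - (v n \_ O) x) < e &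
      Np p (fun x => (z m \_ O) x - (z n \_ O) x) < e].
  move=> e0; have e0' : 0 < e `^ p^-1 by exact: powR_gt0.
  have [n0 hn] := cw _ e0'; exists n0 => m n n0m n0n.
  have := Wsym_pair_norm_lt p1 (weak_pairB ab a0 a1 p1 (p1n m) (p1n n))
    (weak_pairB ab a0 a1 p1 (p2n m) (p2n n)) e0' (hn _ _ n0m n0n).
  by rewrite !patchB (refl_NpB (lz m) (lz n)) (powR_VK p0 (ltW e0)).
have [u0 lu0 cu] : exists2 u, Lp p (u \_ O) &
    Np p (fun x => (w n \_ O) x - (u \_ O) x) @[n --> \oo] --> 0.
  apply: (Lp_complete_itv p1) => // e /cauchy[n0 hn]; exists n0 => m n l1 l2.
  by have [] := hn m n l1 l2.
have [v0 lv0 cv] : exists2 u, Lp p (u \_ O) &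
    Np p (fun x => (v n \_ O) x - (u \_ O) x) @[n --> \oo] --> 0.
  apply: (Lp_complete_itv p1) => // e /cauchy[n0 hn]; exists n0 => m n l1 l2.
  by have [] := hn m n l1 l2.
have [z0 lz0 cz] : exists2 u, Lp p (u \_ O) &
    Np p (fun x => (z n \_ O) x - (u \_ O) x) @[n --> \oo] --> 0.
  apply: (Lp_complete_itv p1) => // e /cauchy[n0 hn]; exists n0 => m n l1 l2.
  by have [] := hn m n l1 l2.
have refl_cvg (f : nat -> R -> R) f0 : (forall n, Lp p (f n \_ O)) -> Lp p (f0 \_ O) ->
    Np p (fun x => (f n \_ O) x - (f0 \_ O) x) @[n --> \oo] --> 0 ->
    Np p (fun x => (refl (f n) \_ O) x - (refl f0 \_ O) x) @[n --> \oo] --> 0.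
  move=> lf lf0 c.
  have -> : (fun n => Np p (fun x => (refl (f n) \_ O) x - (refl f0 \_ O) x)) =
      (fun n => Np p (fun x => (f n \_ O) x - (f0 \_ O) x)).
    by apply/funext => n; exact: refl_NpB.
  exact: c.
have r1 := minus_rep_limit h1 lu0 lv0 cu cv.
have r2 : minus_rep (refl u0) z0.
  apply: (minus_rep_limit h2 (refl_Lp lu0) lz0 _ cz); exact: refl_cvg.
exists u0; first by apply/Wsym0P; exists v0, z0.
apply: (Wsym_pair_cvg ab a0 a1 p1 p1n p2n (minus_rep_pair r1) (minus_rep_refl_pair r2) cu cv).
exact: refl_cvg.
Qed.

Lemma Wsym0_completion :
  is_completion (WsymNorm a b alpha p) (Cc_smooth a b) (Wsym0 a b alpha p).
Proof.
split; [exact: Cc_smooth_sub_Wsym0|exact: Wsym0_dense|exact: Wsym0_complete].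
Qed.

End two_sided.

(** A one-sided smooth function may be unbounded at the other end, hence the intersection with
    [Wside], which selects the elements of finite norm; compactly supported ones belong to the
    symmetric space by [Cc_smooth_sub_Wsym0]. *)
Theorem theorem5p7 (R : realType) (a b alpha p : R)
    (hab : a < b) (halpha0 : 0 < alpha) (halpha1 : alpha < 1)
    (hp : 1 < p) (halphap : 1 < alpha * p) :
  (forall s : side,
     is_completion (WsideNorm a b s alpha p)
       (Cc_smooth_side a b s `&` Wside a b s alpha p)
       (Wside0 a b s alpha p)) /\
  is_completion (WsymNorm a b alpha p) (Cc_smooth a b) (Wsym0 a b alpha p).
Proof.
split; first by move=> s; exact: Wside0_completion.
exact: Wsym0_completion.
Qed.
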